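(* Let $G$ be a connected finite-dimensional Lie group and let $\widetilde{\Omega G}$ be a central extension of $\Omega G$. If $G$ is semisimple, then there is at most one fusion factorization for $\widetilde{\Omega G}$. If $G$ is additionally simply connected, then a fusion factorization for $\widetilde{\Omega G}$ exists.
   Context: A smooth map is flat at a point if all its derivatives of all orders $\ge1$ vanish there. $S^1=\mathbb{R}/2\pi\mathbb{Z}$; $\Omega G$ is the Fréchet Lie group of smooth loops $\gamma:S^1\to G$ with $\gamma(0)=e$ that are flat at $0$. $P_eG$ is the Fréchet Lie group of smooth paths $\gamma:[0,\pi]\to G$ with $\gamma(0)=e$ that are flat at both endpoints. For $\gamma_1,\gamma_2\in P_eG$ with $\gamma_1(\pi)=\gamma_2(\pi)$, $\gamma_1\cup\gamma_2\in\Omega G$ is the loop equal to $\gamma_1(s)$ for $s\in[0,\pi]$ and $\gamma_2(2\pi-s)$ for $s\in[\pi,2\pi]$. $P_eG^{[2]}=P_eG\times_GP_eG$ (fibre product over evaluation at $\pi$) is regarded as a subgroup of $\Omega G$ via $\cup$. A central extension of a Fréchet Lie group $H$ is a sequence $1\to \mathrm{U}(1)\to\widetilde H\xrightarrow{\pi}H\to 1$ of Lie groups and Lie group homomorphisms, exact as groups, with $\mathrm{U}(1)$ central, such that $\widetilde H$ is a smooth principal $\mathrm{U}(1)$-bundle over $H$. For $K\subset H$, $\widetilde K:=\pi^{-1}(K)$. A fusion factorization for $\widetilde{\Omega G}$ is a Lie group homomorphism $i:P_eG\to\widetilde{P_eG^{[2]}}\subset\widetilde{\Omega G}$ such that $\pi(i(\gamma))=\gamma\cup\gamma$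 for all $\gamma\in P_eG$. *)

(* Defs.v *)
From HB Require Import structures.
From mathcomp Require Import all_boot all_order all_algebra.
From mathcomp Require Import all_classical all_reals all_analysis.
From mathcomp Require Import complex.

Set Implicit Arguments.
Unset Strict Implicit.
Unset Printing Implicit Defensive.

Import Order.TTheory GRing.Theory Num.Theory.
Import numFieldNormedType.Exports.

Local Open Scope ring_scope.
Local Open Scope classical_set_scope.

(* [Ck k U f]: [f] is of class C^k on the open set [U] in the sense of
   Michal-Bastiani and Hamilton: the directional derivative exists and is
   jointly continuous (as a map on [U * E]) and is itself of class C^(k-1). *)
Fixpoint Ck (R : realType) (k : nat) (E F : tvsType R) (U : set E) (f : E -> F)
    : Prop :=
  (forall x, U x -> {for x, continuous f}) /\
  if k is k'.+1 then
    exists df : E * E -> F,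
      (forall x v, U x ->
         h^-1 *: (f (x + h *: v) - f x) @[h --> (0 : R)^'] --> df (x, v)) /\
      @Ck R k' (E * E)%type F (U `*` setT) df
  else True.

Definition Cinfty (R : realType) (E F : tvsType R) (U : set E) (f : E -> F) :=
  forall k, Ck k U f.

(* A [tvsType] is locally convex by definition. *)
Definition frechet_space (R : realType) (E : tvsType R) :=
  [/\ hausdorff_space E,
      countable_uniformity E &
      forall F : set_system E, ProperFilter F -> cauchy F ->
        exists x : E, F --> x].

(* A chart of [M] modelled on [E] is given by its inverse, the local
   parametrisation [chart_par] defined on [chart_cod]; the chart itself is
   [chart_map]. *)
Record chart (R : realType) (E : tvsType R) (M : Type) := Chart {
  chart_cod : set E;
  chart_par : E -> M
}.

Section Manifold.
Context {R : realType}.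

Definition chart_dom (E : tvsType R) M (c : chart E M) : set M :=
  chart_par c @` chart_cod c.

Definition chart_map (E : tvsType R) M (c : chart E M) (x : M) : E :=
  xget 0 [set u | chart_cod c u /\ chart_par c u = x].

Definition atlas (E : tvsType R) (M : Type) := set (chart E M).

Definition manifold_top (E : tvsType R) (M : choiceType) (A : atlas E M)
  : Type := M.

Section ManifoldTopology.
Variables (E : tvsType R) (M : choiceType) (A : atlas E M).

Definition manifold_open (O : set M) :=
  forall c u, A c -> chart_cod c u -> O (chart_par c u) ->
    nbhs u (chart_par c @^-1` O).

Fact manifold_openT : manifold_open setT.
Proof. by move=> c u _ _ _; exact: filterT. Qed.

Fact manifold_openI : setI_closed manifold_open.
Proof.
move=> O P oO oP c u Ac cu [Ou Pu].
by rewrite preimage_setI; apply: filterI; [exact: oO|exact: oP].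
Qed.

Fact manifold_open_bigU (I : Type) (O : I -> set M) :
  (forall i, manifold_open (O i)) -> manifold_open (\bigcup_i O i).
Proof.
move=> oO c u Ac cu [i _ Oiu].
by apply: (filterS _ (oO i c u Ac cu Oiu)) => v Oiv; exists i.
Qed.

HB.instance Definition _ := Choice.copy (manifold_top A) M.
HB.instance Definition _ := isOpenTopological.Build (manifold_top A)
  manifold_openT manifold_openI manifold_open_bigU.

End ManifoldTopology.

Definition smooth_in_charts (E F : tvsType R) M N
    (c : chart E M) (d : chart F N) (f : M -> N) (u : E) :=
  exists W : set E, [/\ open W, W u, W `<=` chart_cod c,
    forall v, W v -> chart_dom d (f (chart_par c v)) &
    Cinfty W (chart_map d \o f \o chart_par c)].

Definition manifold (E : tvsType R) (M : choiceType) (A : atlas E M) :=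
  [/\ forall c, A c ->
        open (chart_cod c) /\ {in chart_cod c &, injective (chart_par c)},
      \bigcup_(c in A) chart_dom c = setT,
      forall c d u, A c -> A d ->
        chart_cod c u -> chart_dom d (chart_par c u) ->
        smooth_in_charts c d id u &
      hausdorff_space (manifold_top A)].

(* [f] is smooth on the open subset [S] of [M]; values outside [S] do not
   matter. *)
Definition smooth_map (E F : tvsType R) M N (A : atlas E M) (B : atlas F N)
    (S : set M) (f : M -> N) :=
  forall x, S x -> exists c d,
    [/\ A c, B d, chart_dom c x & smooth_in_charts c d f (chart_map c x)].

Definition prod_chart (E F : tvsType R) M N (c : chart E M) (d : chart F N)
    : chart (E * F)%type (M * N)%type :=
  Chart (chart_cod c `*` chart_cod d)
    (fun u => (chart_par c u.1, chart_par d u.2)).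

Definition prod_atlas (E F : tvsType R) M N (A : atlas E M) (B : atlas F N)
    : atlas (E * F)%type (M * N)%type :=
  [set e | exists c d, [/\ A c, B d & e = prod_chart c d]].

Definition simply_connected (T : topologicalType) :=
  connected [set: T] /\
  forall f : R -> T, {within `[0, 1], continuous f} -> f 0 = f 1 ->
    exists h : R * R -> T,
      {within `[0, 1] `*` `[0, 1], continuous h} /\
      forall s : R, 0 <= s <= 1 ->
        [/\ h (s, 0) = f s, h (s, 1) = f 0, h (0, s) = f 0 & h (1, s) = f 0].

Definition lie_group (E : tvsType R) (G : groupType) (A : atlas E G) :=
  [/\ manifold A,
      smooth_map (prod_atlas A A) A setT (fun x => x.1 * x.2)%g &
      smooth_map A A setT (fun x => x^-1)%g].

(* The bracket of the Lie algebra of [G], whose underlying vector space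
   [T_1 G] is identified with the model space by a chart at the identity:
   [ad] is the derivative at [1] of the adjoint action [Ad]. *)
Definition Ad n (G : groupType) (c : chart 'rV[R]_n G) (g : G) (Y : 'rV[R]_n)
    : 'rV[R]_n :=
  derive1 (fun t : R =>
    chart_map c (g * chart_par c (chart_map c 1%g + t *: Y)%R * g^-1)%g) 0.

Definition lie_bracket n (G : groupType) (c : chart 'rV[R]_n G)
    (X Y : 'rV[R]_n) : 'rV[R]_n :=
  derive1 (fun s : R => Ad c (chart_par c (chart_map c 1%g + s *: X)) Y) 0.

(* The Lie algebra has no abelian ideal but 0 (Bourbaki's definition);
   a subspace is the row space of a square matrix. *)
Definition semisimple n (G : groupType) (A : atlas 'rV[R]_n G) :=
  forall c, A c -> chart_dom c 1%g -> forall I : 'M[R]_n,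
    (forall X Y : 'rV[R]_n,
       (Y <= I)%MS -> (lie_bracket c X Y <= I)%MS) ->
    (forall X Y : 'rV[R]_n,
       (X <= I)%MS -> (Y <= I)%MS -> lie_bracket c X Y = 0) ->
    I = 0.

End Manifold.

Record circle (R : realType) := Circle {
  circle_val :> R[i];
  _ : `|circle_val| == 1
}.

Section Circle.
Context {R : realType}.

HB.instance Definition _ := [isSub for @circle_val R].
HB.instance Definition _ := [Choice of circle R by <:].

Fact circle1_subproof : `|1 : R[i]| == 1. Proof. by rewrite normr1. Qed.

Fact circleM_subproof (z w : circle R) : `|(z : R[i]) * w| == 1.
Proof. by rewrite normrM (eqP (valP z)) (eqP (valP w)) mulr1. Qed.

Fact circleV_subproof (z : circle R) : `|(z : R[i])^-1| == 1.
Proof. by rewrite normfV (eqP (valP z)) invr1. Qed.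

Definition circle_one : circle R := Circle circle1_subproof.
Definition circle_mul (z w : circle R) : circle R :=
  Circle (circleM_subproof z w).
Definition circle_inv (z : circle R) : circle R := Circle (circleV_subproof z).

Fact circle_neq0 (z : circle R) : (z : R[i]) != 0.
Proof. by rewrite -normr_eq0 (eqP (valP z)) oner_eq0. Qed.

Fact circle_mulA : associative circle_mul.
Proof. by move=> x y z; apply: val_inj; rewrite /= mulrA. Qed.
Fact circle_mul1 : left_id circle_one circle_mul.
Proof. by move=> x; apply: val_inj; rewrite /= mul1r. Qed.
Fact circle_mulr1 : right_id circle_one circle_mul.
Proof. by move=> x; apply: val_inj; rewrite /= mulr1. Qed.
Fact circle_mulV : left_inverse circle_one circle_inv circle_mul.
Proof. by move=> x; apply: val_inj; rewrite /= mulVf ?circle_neq0. Qed.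
Fact circle_mulrV : right_inverse circle_one circle_inv circle_mul.
Proof. by move=> x; apply: val_inj; rewrite /= mulfV ?circle_neq0. Qed.

HB.instance Definition _ := isGroup.Build (circle R)
  circle_mulA circle_mul1 circle_mulr1 circle_mulV circle_mulrV.

Fact expi_subproof (t : R) : `|(cos t +i* sin t)%C| == 1.
Proof. by rewrite normc_def /= cos2Dsin2 sqrtr1. Qed.

Definition expi (t : R) : circle R := Circle (expi_subproof t).

Definition circle_chart (t : R) : chart R^o (circle R) :=
  Chart [set u : R^o | - pi < u < pi] (fun u => expi (t + u)).

Definition circle_atlas : atlas R^o (circle R) := range circle_chart.

End Circle.

(* Loops [S^1 -> X] are represented by 2pi-periodic functions on [R], and
   paths [[0, pi] -> X] by functions on [R] that are constant on
   [-oo, 0] and on [[pi, +oo[. For a path that is flat at both endpoints,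
   smoothness on [[0, pi]] is the same as smoothness of this extension. *)
Variant curve_kind := Loop | Path.

Section Curves.
Context {R : realType}.

Definition wraps (kappa : curve_kind) T (f : R -> T) :=
  match kappa with
  | Loop => forall s, f (s + 2 * pi) = f s
  | Path => forall s, f s = f (Num.max 0 (Num.min s pi))
  end.

Definition flat_at (kappa : curve_kind) : set R :=
  match kappa with
  | Loop => [set 0]
  | Path => [set 0; pi]
  end.

Definition flat_vcurve (kappa : curve_kind) n (f : R -> 'rV[R]_n) :=
  [/\ wraps kappa f, f 0 = 0,
      forall k (s : R), derivable f^`(k) s 1 &
      forall s, flat_at kappa s -> forall k, f^`(k.+1) s = 0].

Definition flat_vcurve_pred kappa n : {pred R -> 'rV[R]_n} :=
  fun f => `[< flat_vcurve kappa f >].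
Arguments flat_vcurve_pred : clear implicits.

Fact derive1nD n (f g : R -> 'rV[R]_n) :
  (forall k (s : R), derivable f^`(k) s 1) ->
  (forall k (s : R), derivable g^`(k) s 1) ->
  forall k, derive1n k (f + g) = derive1n k f + derive1n k g.
Proof.
move=> df dg; elim=> [//|k IHk]; apply/funext => s.
rewrite derive1nS IHk derive1E (deriveD (df k s) (dg k s)) -!derive1E.
by rewrite -!derive1nS.
Qed.

Fact derive1nZ n (a : R) (f : R -> 'rV[R]_n) :
  (forall k (s : R), derivable f^`(k) s 1) ->
  forall k, derive1n k (a *: f) = a *: derive1n k f.
Proof.
move=> df; elim=> [//|k IHk]; apply/funext => s.
rewrite derive1nS IHk derive1E (deriveZ a (df k s)) -!derive1E.
by rewrite -!derive1nS.
Qed.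

Fact derive1n_cst0 n k : derive1n k (0 : R -> 'rV[R]_n) = 0.
Proof.
elim: k => [//|k IHk]; apply/funext => s.
by rewrite derive1nS IHk derive1E derive_cst.
Qed.

Fact flat_vcurve_submod kappa n : subsemimod_closed (flat_vcurve_pred kappa n).
Proof.
split; first split.
- apply/asboolP; split=> //.
  + by case: kappa.
  + by move=> k s; rewrite derive1n_cst0; exact: derivable_cst.
  + by move=> s _ k; rewrite derive1n_cst0.
- move=> f g /asboolP[wf f0 df ff] /asboolP[wg g0 dg fg]; apply/asboolP; split.
  + case: kappa wf wg {ff fg} => wf wg s; rewrite !fctE.
      by rewrite wf wg.
    by rewrite [f s]wf [g s]wg.
  + by rewrite fctE f0 g0 addr0.
  + move=> k s; rewrite (derive1nD df dg).
    exact: (derivableD (df k s) (dg k s)).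
  + by move=> s bs k; rewrite (derive1nD df dg) fctE ff // fg // addr0.
- move=> a f /asboolP[wf f0 df ff]; apply/asboolP; split.
  + case: kappa wf {ff} => wf s; rewrite !fctE.
      by rewrite wf.
    by rewrite [f s]wf.
  + by rewrite fctE f0 scaler0.
  + by move=> k s; rewrite (derive1nZ a df); exact: (derivableZ (df k s)).
  + by move=> s bs k; rewrite (derive1nZ a df) fctE ff // scaler0.
Qed.

HB.instance Definition _ kappa n := GRing.isSubmodClosed.Build R
  (R -> 'rV[R]_n) (flat_vcurve_pred kappa n) (@flat_vcurve_submod kappa n).

End Curves.
Arguments flat_vcurve_pred {R} kappa n _.

Record flat_vect (R : realType) (kappa : curve_kind) (n : nat) := FlatVect {
  flat_fun :> R -> 'rV[R]_n;
  _ : flat_fun \in flat_vcurve_pred kappa n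
}.

Section FlatVect.
Context {R : realType} {kappa : curve_kind} {n : nat}.
Local Notation V := (flat_vect R kappa n).

HB.instance Definition _ := [isSub for @flat_fun R kappa n].
HB.instance Definition _ := [Choice of V by <:].
HB.instance Definition _ := [SubChoice_isSubLmodule of V by <:].

(* The C^k-norm; on flat loops and paths the values outside [[0, 2 * pi]] are
   redundant. *)
Definition Ck_norm (k : nat) (f : V) : R :=
  sup [set `|derive1n j f s| | j in `I_k.+1 & s in `[0, 2 * pi]].

Fact flat_vectP (f : V) : flat_vcurve kappa f.
Proof. by case: f => f /= /asboolP. Qed.

Fact flat_vect_derivable (f : V) k (s : R) : derivable (derive1n k f) s 1.
Proof. by have [_ _] := flat_vectP f. Qed.

Fact Ck_norm_has_sup k (f : V) :
  has_sup [set `|derive1n j f s| | j in `I_k.+1 & s in `[0, 2 * pi]].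
Proof.
split.
  exists `|derive1n 0 f 0|; exists 0%N => //; exists 0 => //=.
  by rewrite in_itv /= lexx mulr_ge0 //; exact: pi_ge0.
have bnd j : exists M, forall s, 0 <= s <= 2 * pi -> `|derive1n j f s| <= M.
  have : {within `[0, 2 * pi], continuous (derive1n j f)}.
    by apply: derivable_within_continuous => s _; exact: flat_vect_derivable.
  move=> cf; have [M [_ Mb]] :=
    compact_bounded (continuous_compact cf (@segment_compact _ _ _)).
  exists (M + 1) => s s2.
  have M1 : M < M + 1 by rewrite ltrDl.
  by apply: (Mb _ M1); exists s => //=; rewrite in_itv.
have [M Mb] := choice bnd.
exists (\sum_(j < k.+1) `|M j|) => _ [j jk [s /= /[!in_itv] /= s2 <-]].
have jk' : (j < k.+1)%N by [].
rewrite (bigD1 (Ordinal jk')) //=.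
apply: (le_trans (Mb j s s2)); apply: (le_trans (ler_norm _)).
by rewrite lerDl sumr_ge0.
Qed.

Fact le_Ck_norm k (f : V) j s : (j <= k)%N -> 0 <= s <= 2 * pi ->
  `|derive1n j f s| <= Ck_norm k f.
Proof.
move=> jk s2; have [_ ub] := Ck_norm_has_sup k f.
by apply: ub_le_sup => //; exists j => //; exists s => //=; rewrite in_itv.
Qed.

Fact Ck_norm_le k (f : V) (C : R) :
  (forall j s, (j <= k)%N -> 0 <= s <= 2 * pi -> `|derive1n j f s| <= C) ->
  Ck_norm k f <= C.
Proof.
move=> fC; have [ne _] := Ck_norm_has_sup k f.
by apply: ge_sup => // _ [j jk [s /= /[!in_itv] /= s2 <-]]; exact: fC.
Qed.

Fact Ck_norm_ge0 k (f : V) : 0 <= Ck_norm k f.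
Proof.
apply: (le_trans _ (@le_Ck_norm k f 0%N 0 _ _)) => //.
by rewrite lexx mulr_ge0 //; exact: pi_ge0.
Qed.

Fact Ck_normD k (f g : V) : Ck_norm k (f + g) <= Ck_norm k f + Ck_norm k g.
Proof.
apply: Ck_norm_le => j s jk s2.
rewrite /= derive1nD; [|exact: flat_vect_derivable..].
by rewrite (le_trans (ler_normD _ _)) // lerD // le_Ck_norm.
Qed.

Fact Ck_normZ k (a : R) (f : V) : Ck_norm k (a *: f) <= `|a| * Ck_norm k f.
Proof.
apply: Ck_norm_le => j s jk s2.
rewrite /= derive1nZ; last exact: flat_vect_derivable.
by rewrite normrZ ler_wpM2l // le_Ck_norm.
Qed.

Fact Ck_norm0 k : Ck_norm k 0 = 0.
Proof.
apply/eqP; rewrite eq_le Ck_norm_ge0 andbT.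
by have := Ck_normZ k 0 0; rewrite scale0r normr0 mul0r.
Qed.

Fact Ck_norm_mono k l (f : V) : (k <= l)%N -> Ck_norm k f <= Ck_norm l f.
Proof.
move=> kl; apply: Ck_norm_le => j s jk s2.
by apply: le_Ck_norm => //; exact: leq_trans kl.
Qed.

(* The C^oo-topology, that is, uniform convergence of all derivatives. *)
Definition flat_ball (f : V) (k : nat) (e : R) : set V :=
  [set g | Ck_norm k (g - f) < e].

Definition flat_open (O : set V) :=
  forall f, O f -> exists k (e : R), 0 < e /\ flat_ball f k e `<=` O.

Fact flat_openT : flat_open setT.
Proof. by move=> f _; exists 0%N, 1. Qed.

Fact flat_openI : setI_closed flat_open.
Proof.
move=> O P oO oP f [/oO[k [e [e0 kO]]] /oP[l [d [d0 lP]]]].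
exists (maxn k l), (Num.min e d); rewrite lt_min e0 d0; split=> // g.
rewrite /flat_ball /= lt_min => /andP[ge gd]; split.
  by apply/kO/(le_lt_trans _ ge)/Ck_norm_mono/leq_maxl.
by apply/lP/(le_lt_trans _ gd)/Ck_norm_mono/leq_maxr.
Qed.

Fact flat_open_bigU (I : Type) (O : I -> set V) :
  (forall i, flat_open (O i)) -> flat_open (\bigcup_i O i).
Proof.
move=> oO f [i _ /oO[k [e [e0 kO]]]].
by exists k, e; split=> // g /kO Og; exists i.
Qed.

HB.instance Definition _ := isOpenTopological.Build V
  flat_openT flat_openI flat_open_bigU.

Fact flat_ball_center (f : V) k e : 0 < e -> flat_ball f k e f.
Proof. by move=> e0; rewrite /flat_ball /= subrr Ck_norm0. Qed.

Fact flat_ball_open (f : V) k e : flat_open (flat_ball f k e).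
Proof.
move=> g; rewrite {1}/flat_ball /= => ge.
have e'0 : 0 < e - Ck_norm k (g - f) by rewrite subr_gt0.
exists k, (e - Ck_norm k (g - f)); split; first exact: e'0.
move=> h; rewrite /flat_ball /= ltrBrDr => he.
have -> : h - f = (h - g) + (g - f) by rewrite addrA subrK.
exact: le_lt_trans (Ck_normD _ _ _) he.
Qed.

Fact nbhs_flatP (f : V) (U : set V) :
  nbhs f U <-> exists k (e : R), 0 < e /\ flat_ball f k e `<=` U.
Proof.
split=> [[P [oP Pf PU]]|[k [e [e0 kU]]]].
  have [k [e [e0 kP]]] := oP f Pf.
  by exists k, e; split=> //; exact: subset_trans PU.
exists (flat_ball f k e); split=> //; first exact: flat_ball_open.
exact: flat_ball_center.
Qed.

Fact nbhs_flat_ball (f : V) k e : 0 < e -> nbhs f (flat_ball f k e).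
Proof. by move=> e0; apply/nbhs_flatP; exists k, e; split. Qed.

Fact flat_add_continuous : continuous (fun x : V * V => x.1 + x.2).
Proof.
move=> [f g] U /= /nbhs_flatP[k [e [e0 kU]]].
exists (flat_ball f k (e / 2), flat_ball g k (e / 2)).
  by split; apply: nbhs_flat_ball; exact: divr_gt0.
move=> [f' g'] [/= ff gg]; apply: kU; rewrite /flat_ball /=.
rewrite opprD addrACA (le_lt_trans (Ck_normD _ _ _)) //.
by rewrite [e]splitr ltrD.
Qed.

Fact flat_scale_continuous : continuous (fun z : R^o * V => z.1 *: z.2).
Proof.
move=> [a f] U /= /nbhs_flatP[k [e [e0 kU]]].
pose C := Ck_norm k f + 1; pose D := `|a| + 1.
have C0 : 0 < C by rewrite ltr_wpDl // Ck_norm_ge0.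
have D0 : 0 < D by rewrite ltr_wpDl.
exists (ball a (Num.min 1 (e / 2 / C)), flat_ball f k (e / 2 / D)).
  split.
    by apply: nbhsx_ballx; rewrite lt_min ltr01 !divr_gt0.
  by apply: nbhs_flat_ball; rewrite !divr_gt0.
move=> [b g] [/=]; rewrite /ball /= lt_min => /andP[ab1 abC] gf.
apply: kU; rewrite /flat_ball /=.
have -> : b *: g - a *: f = b *: (g - f) + (b - a) *: f.
  by rewrite scalerBr scalerBl addrA subrK.
rewrite (le_lt_trans (Ck_normD _ _ _)) // [ltRHS]splitr ltr_leD //.
  rewrite (le_lt_trans (Ck_normZ _ _ _)) //.
  have bD : `|b| <= D.
    rewrite -[b](subrK a) (le_trans (ler_normD _ _)) // addrC lerD2l.
    by rewrite distrC ltW.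
  rewrite (le_lt_trans (ler_wpM2r (Ck_norm_ge0 _ _) bD)) //.
  by rewrite mulrC -ltr_pdivlMr.
rewrite (le_trans (Ck_normZ _ _ _)) // distrC.
rewrite (le_trans (_ : _ <= e / 2 / C * C)) //; last by rewrite divfK // gt_eqF.
by apply: ler_pM => //; [exact: Ck_norm_ge0|exact: ltW|rewrite lerDl].
Qed.

Fact flat_locally_convex :
  exists2 B : set_system V, (forall b, b \in B -> convex_set b) & basis B.
Proof.
exists [set U | exists f k e, U = flat_ball f k e].
  move=> U /set_mem[f [k [e ->]]]; apply/convex_setW => g h.
  move=> /set_mem; rewrite {1}/flat_ball /= => ge.
  move=> /set_mem; rewrite {1}/flat_ball /= => he l l0 l1.
  apply/mem_set; rewrite /flat_ball /=.
  have -> : conv l g h - f =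
      l%:num *: (g - f) + (1 - l%:num) *: (h - f).
    rewrite !scalerBr addrACA -opprD -scalerDl.
    by rewrite [l%:num + _]addrC subrK scale1r.
  rewrite (le_lt_trans (Ck_normD _ _ _)) //.
  have -> : e = l%:num * e + (1 - l%:num) * e.
    by rewrite -mulrDl [l%:num + _]addrC subrK mul1r.
  have lc0 : 0 < 1 - l%:num by rewrite subr_gt0.
  have scale_lt (a : R) (x : V) : 0 < a -> Ck_norm k x < e ->
      Ck_norm k (a *: x) < a * e.
    move=> a0 xe; apply: (le_lt_trans (Ck_normZ _ _ _)).
    by rewrite (gtr0_norm a0) (ltr_pM2l a0).
  exact: ltrD (scale_lt _ _ l0 ge) (scale_lt _ _ lc0 he).
split=> [_ [f [k [e ->]]]|f U /nbhs_flatP[k [e [e0 kU]]]].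
  exact: flat_ball_open.
exists (flat_ball f k e) => //.
by split; [exists f, k, e|exact: flat_ball_center].
Qed.

(* This factory only provides the uniform structure. *)
HB.instance Definition _ := PreTopologicalLmod_isTvs.Build R V
  flat_add_continuous flat_scale_continuous flat_locally_convex.
HB.instance Definition _ :=
  PreTopologicalNmodule_isTopologicalNmodule.Build V flat_add_continuous.
HB.instance Definition _ :=
  TopologicalNmodule_isTopologicalLmodule.Build R V flat_scale_continuous.
HB.instance Definition _ := Uniform_isTvs.Build R V flat_locally_convex.

End FlatVect.

Section FunctionGroup.
Variables (T : Type) (G : groupType).

Fact fct_mulgA : associative (fun (f g : T -> G) t => (f t * g t)%g).
Proof. by move=> f g h; apply/funext => t; rewrite mulgA. Qed.
Fact fct_mul1g : left_id (fun=> 1%g) (fun (f g : T -> G) t => (f t * g t)%g).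
Proof. by move=> f; apply/funext => t; rewrite mul1g. Qed.
Fact fct_mulg1 : right_id (fun=> 1%g) (fun (f g : T -> G) t => (f t * g t)%g).
Proof. by move=> f; apply/funext => t; rewrite mulg1. Qed.
Fact fct_mulVg : left_inverse (fun=> 1%g) (fun (f : T -> G) t => (f t)^-1%g)
  (fun (f g : T -> G) t => (f t * g t)%g).
Proof. by move=> f; apply/funext => t; rewrite mulVg. Qed.
Fact fct_mulgV : right_inverse (fun=> 1%g) (fun (f : T -> G) t => (f t)^-1%g)
  (fun (f g : T -> G) t => (f t * g t)%g).
Proof. by move=> f; apply/funext => t; rewrite mulgV. Qed.

HB.instance Definition _ := isGroup.Build (T -> G)
  fct_mulgA fct_mul1g fct_mulg1 fct_mulVg fct_mulgV.

End FunctionGroup.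

(* The groups of flat loops and flat paths are subgroups of the group of all
   functions [R -> G]; an atlas of such a subgroup is an atlas on [R -> G]
   whose charts cover the subgroup only. *)
Section LoopGroup.
Context {R : realType} {n : nat} {G : groupType}.
Variable A : atlas 'rV[R]_n G.

Definition smooth_curve (g : R -> G) :=
  continuous (g : R -> manifold_top A) /\
  forall c k (s : R), A c -> chart_dom c (g s) ->
    derivable (derive1n k (chart_map c \o g)) s 1.

Definition flat_curves (kappa : curve_kind) : set (R -> G) :=
  [set g | [/\ wraps kappa g, g 0 = 1%g, smooth_curve g &
    forall s, flat_at kappa s -> forall c k, A c -> chart_dom c (g s) ->
      derive1n k.+1 (chart_map c \o g) s = 0]].

Definition OmegaG : set (R -> G) := flat_curves Loop.

Definition PeG : set (R -> G) := flat_curves Path.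

(* The chart around [g] induced by a chart [c] of [G] around the identity:
   it sends [h] near [g] to the curve [g^-1 * h] read in [c] and translated
   so that it starts at 0. *)
Definition flat_chart (kappa : curve_kind) (g : R -> G) (c : chart 'rV[R]_n G)
    : chart (flat_vect R kappa n) (R -> G) :=
  Chart [set eta : flat_vect R kappa n |
          forall s, chart_cod c (chart_map c 1%g + eta s)]
    (fun eta s => (g s * chart_par c (chart_map c 1%g + eta s)%R)%g).

Definition flat_atlas (kappa : curve_kind)
    : atlas (flat_vect R kappa n) (R -> G) :=
  [set d | exists g c,
    [/\ flat_curves kappa g, A c, chart_dom c 1%g & d = flat_chart kappa g c]].

(* [g1] on [[0, pi]], then [g2] run backwards on [[pi, 2 * pi]], extended
   periodically. *)
Definition cup (g1 g2 : R -> G) (s : R) : G :=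
  let t := s - (Num.floor (s / (2 * pi)))%:~R * (2 * pi) in
  if t <= pi then g1 t else g2 (2 * pi - t).

Definition PeG_square : set (R -> G) :=
  [set g | exists g1 g2,
    [/\ PeG g1, PeG g2, g1 pi = g2 pi & g = cup g1 g2]].

End LoopGroup.
Arguments flat_atlas {R n G} A kappa _.

Section CentralExtension.
Context {R : realType}.

(* Lie group homomorphism defined on the Lie group [S], a subgroup of [H]
   with atlas [A]; values outside [S] do not matter. *)
Definition lie_hom (F E : tvsType R) (H K : groupType) (A : atlas F H)
    (B : atlas E K) (S : set H) (f : H -> K) :=
  smooth_map A B S f /\
  forall x y, S x -> S y -> f (x * y)%g = (f x * f y)%g.

(* Equivariant local trivialisation over a neighbourhood of [h]; [z : U(1)]
   acts on [Ht] by multiplication by [iota z]. *)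
Definition trivial_near (F E : tvsType R) (H Ht : groupType) (S : set H)
    (AH : atlas F H) (At : atlas E Ht) (iota : circle R -> Ht) (p : Ht -> H)
    (h : H) :=
  exists (U : set H) (Phi : H * circle R -> Ht) (Psi : Ht -> H * circle R),
  [/\ U h, U `<=` S & open (U : set (manifold_top AH))] /\
  [/\ smooth_map (prod_atlas AH circle_atlas) At (U `*` setT) Phi,
      smooth_map At (prod_atlas AH circle_atlas) (p @^-1` U) Psi,
      forall x z, U x -> Psi (Phi (x, z)) = (x, z) &
      forall y, U (p y) -> U (Psi y).1 /\ Phi (Psi y) = y] /\
  (forall x z, U x -> p (Phi (x, z)) = x) /\
  (forall x z w, U x -> Phi (x, (z * w)%g) = (Phi (x, z) * iota w)%g).

(* [1 -> U(1) -> Ht -> S -> 1] is a central extension of the Frechet Lie group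
   [S], a subgroup of [H] with atlas [AH]. *)
Record central_extension (F E : tvsType R) (H Ht : groupType) (S : set H)
    (AH : atlas F H) (At : atlas E Ht) (iota : circle R -> Ht) (p : Ht -> H)
    : Prop := CentralExtension {
  ext_frechet : frechet_space E;
  ext_lie_group : lie_group At;
  ext_iota_hom : lie_hom circle_atlas At setT iota;
  ext_proj_hom : lie_hom At AH setT p;
  ext_iota_inj : injective iota;
  ext_exact : forall y, p y = 1%g <-> range iota y;
  ext_proj_surj : range p = S;
  ext_central : forall z y, (iota z * y = y * iota z)%g;
  ext_bundle : forall h, S h -> trivial_near S AH At iota p h
}.

Definition fusion_factorization (n : nat) (G : groupType)
    (A : atlas 'rV[R]_n G) (E : tvsType R) (Ht : groupType) (At : atlas E Ht)
    (p : Ht -> (R -> G)) (i : (R -> G) -> Ht) :=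
  [/\ lie_hom (flat_atlas A Path) At (PeG A) i,
      forall g, PeG A g -> PeG_square A (p (i g)) &
      forall g, PeG A g -> p (i g) = cup g g].

End CentralExtension.

(* Main.v *)
Require Import Defs.
From HB Require Import structures.
From mathcomp Require Import all_boot all_order all_algebra.
From mathcomp Require Import all_classical all_reals all_analysis.
From mathcomp Require Import complex ring lra.

Set Implicit Arguments.
Unset Strict Implicit.
Unset Printing Implicit Defensive.

Import Order.TTheory GRing.Theory Num.Theory.
Import numFieldNormedType.Exports.

Local Open Scope ring_scope.
Local Open Scope classical_set_scope.

(* Over small paths the pulled-back extension has a smooth section [s]. Its
   conjugation defect has a second derivative at the identity which is a
   continuous 2-cocycle on the Lie algebra of flat paths. As the Lie algebra of
   [G] is semisimple, the Casimir element together with cutoffs near [0] shows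
   that this cocycle is a coboundary and that brackets are dense. Hence [s] can
   be corrected so that conjugation preserves it to first order. Call a curve
   in the extension horizontal if it is tangent to the translates of [s]; then
   products of horizontal curves are horizontal. Reparametrisation contracts
   the path group to the identity through homomorphisms [S r], and the end point
   of the horizontal lift of [r |-> S r g] defines the fusion factorization.
   Two factorizations differ by a character of the path group, whose
   differential kills all brackets and therefore vanishes; so the character is
   constant along [r |-> S r g]. *)

(** Ordinary differential equations need not be solvable in Fréchet Lie groups, so only scalars are
    ever integrated: near the identity a horizontal lift is [s (Sv r z)] times a central factor
    whose exponent is a primitive of a real function, and general lifts are pointwise products of
    such lifts. Nonzero constants are not flat paths, which start at 0; bracketing with an element
    of the Lie algebra of [G] is therefore an outer derivation of the path algebra. Cutoffs times
    constants approximate it from inside. They blow up in the C^k-norms with k >= 1, but locality of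
    the cocycle and flatness of the other argument at 0 compensate. Once the cocycle is invariant
    under constants, it depends on pairs of functions like the one-form f dg, and one-forms on an
    interval are exact; on a circle the integral of f dg would survive. The adjoint action, the
    bracket and its identities are derived once for an abstract group with a class of smooth maps
    ([local_lie]), and then used both for [G] and for its path group. *)

Lemma subr4 (V : zmodType) (x a b c : V) : x - a - (b - c) = x - b - (a - c).
Proof. by rewrite !opprB addrACA [RHS]addrACA [- a + _]addrC. Qed.

(** * Differential calculus in locally convex spaces *)

Section TvsLimits.
Context {R : realType}.

Lemma tvs_cvgD (F : tvsType R) T (FF : set_system T) {FFF : Filter FF}
    (f g : T -> F) (a b : F) :
  f @ FF --> a -> g @ FF --> b -> (fun t => f t + g t) @ FF --> a + b.
Proof.
move=> fa gb; apply: (@cvg_comp _ _ _ (fun t => (f t, g t))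
  (fun x : F * F => x.1 + x.2) FF (nbhs (a, b))).
  exact: cvg_pair fa gb.
exact: (@add_continuous F (a, b)).
Qed.

Lemma tvs_cvgZ (F : tvsType R) T (FF : set_system T) {FFF : Filter FF}
    (s : T -> R) (g : T -> F) (k : R) (b : F) :
  s @ FF --> k -> g @ FF --> b -> (fun t => s t *: g t) @ FF --> k *: b.
Proof.
move=> sk gb; apply: (@cvg_comp _ _ _ (fun t => (s t : R^o, g t))
  (fun x : R^o * F => x.1 *: x.2) FF (nbhs ((k : R^o), b))).
  exact: cvg_pair sk gb.
exact: (@scale_continuous R F (k, b)).
Qed.

Lemma tvs_cvgB (F : tvsType R) T (FF : set_system T) {FFF : Filter FF}
    (f g : T -> F) (a b : F) :
  f @ FF --> a -> g @ FF --> b -> (fun t => f t - g t) @ FF --> a - b.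
Proof.
move=> fa gb; rewrite -[- b]scaleN1r.
have -> : (fun t => f t - g t) = (fun t => f t + (-1) *: g t).
  by apply/funext => t; rewrite scaleN1r.
apply: tvs_cvgD => //; apply: tvs_cvgZ => //; exact: cvg_cst.
Qed.

Lemma cts_pair (S T U : topologicalType) (f : S -> T) (g : S -> U) x :
  {for x, continuous f} -> {for x, continuous g} ->
  {for x, continuous (fun y => (f y, g y))}.
Proof. by move=> cf cg; exact: cvg_pair cf cg. Qed.

Lemma tvs_cvg_line (F : tvsType R) T (FF : set_system T) {FFF : Filter FF}
    (s : T -> R) (x y : T -> F) (a b : F) :
  s @ FF --> (0 : R) -> x @ FF --> a -> y @ FF --> b ->
  (fun t => x t + s t *: y t) @ FF --> a.
Proof.
move=> s0 xa yb; have := @tvs_cvgD _ _ _ FFF _ _ _ _ xa (@tvs_cvgZ _ _ _ FFF _ _ _ _ s0 yb).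
by rewrite scale0r addr0.
Qed.

Definition cvx_set (F : tvsType R) (U : set F) := forall x y (t : R),
  0 <= t <= 1 -> U x -> U y -> U (t *: x + (1 - t) *: y).

Lemma nbhs_cvx (F : tvsType R) (x : F) (W : set F) : nbhs x W ->
  exists U, [/\ open U, U x, cvx_set U & U `<=` W].
Proof.
move=> xW; have [B Bc [Bo Bb]] := @locally_convex R F.
have [U [BU Ux] UW] := Bb x W xW.
exists U; split=> //; first exact: Bo.
move=> a b t /andP[t0 t1] Ua Ub.
have := Bc U (mem_set BU) a b (Itv01 t0 t1) (mem_set Ua) (mem_set Ub).
by rewrite inE.
Qed.

Definition hasD (E F : tvsType R) (f : E -> F) (x v : E) (d : F) :=
  h^-1 *: (f (x + h *: v) - f x) @[h --> (0 : R)^'] --> d.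

Section ConvexMVT.
Variables (F : tvsType R) (U : set F) (phi dphi : R -> F).
Hypotheses (cU : cvx_set U)
  (dphiE : forall t, 0 <= t <= 1 ->
     h^-1 *: (phi (t + h) - phi t) @[h --> (0 : R)^'] --> dphi t)
  (oU : open U)
  (Udphi : forall t, 0 <= t <= 1 -> U (dphi t)).

Let q a b := (b - a)^-1 *: (phi b - phi a).

(** The quotient over [[a, c]] is the convex combination of those over [[a, b]] and [[b, c]], with
    weights proportional to the lengths. *)
Let q_cat a b c : a < b -> b < c -> U (q a b) -> U (q b c) -> U (q a c).
Proof.
move=> ab bc Uab Ubc.
have ca0 : 0 < c - a by rewrite subr_gt0 (lt_trans ab).
have ba0 : 0 < b - a by rewrite subr_gt0.
have cb0 : 0 < c - b by rewrite subr_gt0.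
pose t := (b - a) / (c - a).
have -> : q a c = t *: q a b + (1 - t) *: q b c.
  have -> : 1 - t = (c - b) / (c - a) by rewrite /t; field; rewrite gt_eqF.
  rewrite /q /t !scalerA.
  have -> : (b - a) / (c - a) * (b - a)^-1 = (c - a)^-1.
    by field; rewrite !gt_eqF.
  have -> : (c - b) / (c - a) * (c - b)^-1 = (c - a)^-1.
    by field; rewrite !gt_eqF.
  by rewrite -scalerDr; congr (_ *: _); rewrite [RHS]addrC addrA subrK.
apply: cU => //; apply/andP; split; first by rewrite divr_ge0 // ltW.
by rewrite ler_pdivrMr // mul1r lerD2r ltW.
Qed.

Let q_local t : 0 <= t <= 1 -> exists2 d, 0 < d &
  forall a b, t - d < a -> a <= t -> t <= b -> b < t + d -> a < b -> U (q a b).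
Proof.
move=> t01; have Ut : nbhs (dphi t) U by apply: open_nbhs_nbhs; split; auto.
have /nbhs_ballP[d /= d0 dU] := dphiE t01 Ut.
have loc h : h != 0 -> `|h| < d -> U (h^-1 *: (phi (t + h) - phi t)).
  move=> h0 hd; apply: (dU h) => //.
  by rewrite -ball_normE /= sub0r normrN.
exists d => // a b da at_ tb bd ab.
have Ul : a < t -> U (q a t).
  move=> alt; have := loc (a - t); rewrite subrKC /q => /(_ _ _) U1.
  rewrite -opprB -[phi t - phi a]opprB invrN scaleNr scalerN opprK.
  apply: U1; first by rewrite subr_eq0 lt_eqF.
  by rewrite ltr0_norm ?subr_lt0 // opprB ltrBlDl -ltrBlDr.
have Ur : t < b -> U (q t b).
  move=> tlb; have := loc (b - t); rewrite subrKC /q; apply.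
    by rewrite subr_eq0 gt_eqF.
  by rewrite gtr0_norm ?subr_gt0 // ltrBlDl.
move: at_ tb; rewrite le_eqVlt => /predU1P[at_|alt].
  by rewrite le_eqVlt => /predU1P[tb|]; [move: ab; rewrite at_ tb ltxx|rewrite at_; exact: Ur].
rewrite le_eqVlt => /predU1P[<-|tlb]; first exact: Ul.
exact: q_cat (Ul alt) (Ur tlb).
Qed.

(** A vector-valued curve need not attain its mean slope as a derivative; what survives is that the
    mean slope stays in any open convex set containing all derivatives. Openness of [U] puts the
    quotients close to each point into [U] ([q_local]), and [q_cat] propagates them by continuous
    induction, without Hahn-Banach. *)
Lemma convex_mvt : U (phi 1 - phi 0).
Proof.
pose S := [set t : R | 0 <= t <= 1 /\ (t = 0 \/ U (q 0 t))].
have S0 : S 0 by split; [rewrite lexx ler01|left].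
have S1 t : S t -> t <= 1 by case=> /andP[].
have hS : has_sup S by split; [exists 0|exists 1 => t /S1].
have s01 : 0 <= sup S <= 1.
  by rewrite ub_le_sup //= ?ge_sup //; [exists 0| case: hS].
have [d d0 qd] := q_local s01.
have [t St ts] := sup_adherent d0 hS.
have tles : t <= sup S by apply: ub_le_sup => //; case: hS.
pose s' := Num.min 1 (sup S + d / 2).
have d20 : 0 < d / 2 by rewrite divr_gt0.
have ss' : sup S <= s' by rewrite le_min; case/andP: s01 => _ ->; rewrite lerDl ltW.
have s'd : s' < sup S + d.
  by rewrite gt_min; apply/orP; right; rewrite ltrD2l ltr_pdivrMr // ltr_pMr // ltr1n.
have Ss' : S s'.
  have [t01 tc] := St.
  have [tlt|] := ltP t s'; last first.
    move=> s't; have -> : s' = t by apply/eqP; rewrite eq_le s't (le_trans tles).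
    by [].
  have Uts' : U (q t s') by apply: qd.
  split; first by rewrite (le_trans _ ss') //= ?ge_min ?lexx //; case/andP: s01.
  right; case: tc => [t0|Ut]; first by rewrite -t0.
  have [t0|t0] := eqVneq t 0; first by rewrite -t0.
  apply: q_cat tlt Ut Uts'; rewrite lt_neqAle eq_sym t0; by case/andP: t01.
have s'1 : s' = 1.
  have : s' <= sup S by apply: ub_le_sup => //; case: hS.
  rewrite /s'; case: (leP 1 (sup S + d/2)) => // _; lra.
move: Ss'; rewrite s'1 => -[_ [/eqP|]]; first by rewrite oner_eq0.
by rewrite /q subr0 invr1 scale1r.
Qed.

End ConvexMVT.

Lemma cvg_tvs_lineR (E : tvsType R) (x v : E) : 
  (fun h : R => x + h *: v) @ (0 : R) --> x.
Proof.
rewrite -{2}[x]addr0 -(scale0r v); apply: tvs_cvgD; first exact: cvg_cst.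
apply: tvs_cvgZ; [exact: cvg_id|exact: cvg_cst].
Qed.

(** Joint continuity of the directional derivative upgrades it to strict differentiability: base
    point, direction and step may all vary with the filter. The segment from [y t] to
    [y t + h t *: w t] stays in a convex neighbourhood of [x], where [df] is close to [df (x, w0)],
    and [convex_mvt] applies. *)
Lemma quot_cvg (E F : tvsType R) (f : E -> F) (df : E * E -> F) (U : set E) x w0 :
  open U -> U x -> (forall y v, U y -> hasD f y v (df (y, v))) ->
  {for (x, w0), continuous df} ->
  forall T (FF : set_system T) {_ : Filter FF} (h : T -> R) (y w : T -> E),
  h @ FF --> (0 : R) -> y @ FF --> x -> w @ FF --> w0 ->
  (\forall t \near FF, h t != 0) ->
  (fun t => (h t)^-1 *: (f (y t + h t *: w t) - f (y t))) @ FF --> df (x, w0).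
Proof.
move=> oU Ux dfE cdf T FF FFF h y w h0 yx ww0 hn0 N /nbhs_cvx[N' [oN' N'd cN' N'N]].
have /cdf : nbhs (df (x, w0)) N' by apply: open_nbhs_nbhs.
move=> [[A B] /= [xA w0B] AB].
have [A' [oA' A'x cA' A'A]] : exists A', [/\ open A', A' x, cvx_set A' & A' `<=` A `&` U].
  by apply: nbhs_cvx; apply: filterI => //; apply: open_nbhs_nbhs.
have nA' : nbhs x A' by apply: open_nbhs_nbhs.
have yhw : (fun t => y t + h t *: w t) @ FF --> x.
  rewrite -[x]addr0 -(scale0r w0); apply: tvs_cvgD => //; exact: tvs_cvgZ.
have n1 := yx _ nA'; have n2 := yhw _ nA'; have n3 := ww0 _ w0B.
change (FF ((fun t => (h t)^-1 *: (f (y t + h t *: w t) - f (y t))) @^-1` N)).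
apply: filterS (filterI (hn0 : FF _) (filterI (n1 : FF _) (filterI (n2 : FF _) (n3 : FF _)))) => t [/= ht0 [A'y [A'yw Bw]]].
apply: N'N.
pose phi s := (h t)^-1 *: f (y t + (s * h t) *: w t).
have -> : (h t)^-1 *: (f (y t + h t *: w t) - f (y t)) = phi 1 - phi 0.
  by rewrite /phi mul1r mul0r scale0r addr0 scalerBr.
have A'seg s : 0 <= s <= 1 -> A' (y t + (s * h t) *: w t).
  move=> s01; have -> : y t + (s * h t) *: w t = s *: (y t + h t *: w t) + (1 - s) *: y t.
    by rewrite scalerDr scalerA scalerBl scale1r [RHS]addrC subrKA.
  exact: cA'.
apply: (@convex_mvt _ N' phi (fun s => df (y t + (s * h t) *: w t, w t))) => //.
  move=> s s01; set z := y t + (s * h t) *: w t.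
  have Uz : U z by have [] := A'A _ (A'seg s s01).
  have := dfE z (w t) Uz => dz.
  have -> : (fun k => k^-1 *: (phi (s + k) - phi s)) =
      (fun k : R => k^-1 *: (f (z + k *: w t) - f z)) \o (fun k => k * h t).
    apply/funext => k /=; rewrite /phi -scalerBr scalerA -invfM mulrDl scalerDl addrA.
    by [].
  apply: cvg_comp dz => M /= /nbhs_ballP[e /= e0 eM].
  apply/nbhs_ballP; exists (e / `|h t|) => /=; first by rewrite divr_gt0 // normr_gt0.
  move=> k; rewrite -ball_normE /= sub0r normrN ltr_pdivlMr ?normr_gt0 // => kh k0.
  by apply: eM; rewrite -?ball_normE /= ?sub0r ?normrN ?normrM // mulf_neq0.
move=> s s01; have [As _] := A'A _ (A'seg s s01).
by apply: (AB (_, _)); split.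
Qed.

(** A choice of derivative as a function of point and direction, so that it can be differentiated
    again. In a Hausdorff target the choice is forced wherever the limit exists. *)
Definition Df (E F : tvsType R) (f : E -> F) (p : E * E) : F :=
  xget 0 [set d | hasD f p.1 p.2 d].

Lemma hasD_Df (E F : tvsType R) (f : E -> F) x v d : hausdorff_space F ->
  hasD f x v d -> Df f (x, v) = d.
Proof.
move=> hF fd; apply: xget_unique => // d' fd'; exact: (cvg_unique hF fd' fd).
Qed.

Lemma hasD_near (E F : tvsType R) (f g : E -> F) (x v : E) d :
  (\forall y \near x, f y = g y) -> hasD f x v d -> hasD g x v d.
Proof.
move=> fg; rewrite /hasD => fd; have fgx : f x = g x by exact: nbhs_singleton fg.
apply: cvg_trans fd; apply: near_eq_cvg.
have nfg : \forall h \near (0 : R), f (x + h *: v) = g (x + h *: v) := @cvg_tvs_lineR _ x v _ fg.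
apply: cvg_within; near=> h; rewrite -fgx.
by congr (_ *: (_ - _)); near: h.
Unshelve. all: by end_near. Qed.


Definition clin (E F : tvsType R) (L : E -> F) :=
  (forall a x y, L (a *: x + y) = a *: L x + L y) /\ continuous L.

Lemma open_setX (S T : topologicalType) (A : set S) (B : set T) :
  open A -> open B -> open (A `*` B).
Proof.
move=> oA oB; rewrite openE => -[a b] [/= Aa Bb].
by exists (A, B) => //; split; apply: open_nbhs_nbhs.
Qed.

Lemma open_setXT (S T : topologicalType) (A : set S) : open A -> open (A `*` [set: T]).
Proof. by move=> oA; apply: open_setX => //; exact: openT. Qed.

Lemma hausdorff_prod (S T : topologicalType) : hausdorff_space S ->
  hausdorff_space T -> hausdorff_space (S * T)%type.
Proof.
move=> hS hT [a b] [c d] cl; congr (_, _).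
  apply: hS => A B nA nB; have [||[x y] [[/= Ax _] [/= Bx _]]] := cl (A `*` setT) (B `*` setT).
  - by exists (A, setT) => //; split=> //; exact: filterT.
  - by exists (B, setT) => //; split=> //; exact: filterT.
  by exists x.
apply: hT => A B nA nB; have [||[x y] [[_ /= Ax] [_ /= Bx]]] := cl (setT `*` A) (setT `*` B).
- by exists (setT, A) => //; split=> //; exact: filterT.
- by exists (setT, B) => //; split=> //; exact: filterT.
by exists y.
Qed.

Section CkCalculus.
Implicit Types (E F K : tvsType R).

Lemma Ck_cont E F k (U : set E) (f : E -> F) x :
  Ck k U f -> U x -> {for x, continuous f}.
Proof. by case: k => [|k] [cf _] Ux; exact: cf. Qed.

Lemma CkSE E F k (U : set E) (f : E -> F) : Ck k.+1 U f <->
  (forall x, U x -> {for x, continuous f}) /\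
  exists df : E * E -> F, (forall x v, U x -> hasD f x v (df (x, v))) /\
    Ck k (U `*` setT) df.
Proof. by []. Qed.

Lemma Ck_sub E F k (U W : set E) (f : E -> F) :
  W `<=` U -> Ck k U f -> Ck k W f.
Proof.
elim: k E F U W f => [|k IH] E F U W f WU [cf df]; split=> //=.
- by move=> x /WU/cf.
- by move=> x /WU/cf.
have [g [gE Cg]] := df; exists g; split; first by move=> x v /WU; exact: gE.
by apply: IH Cg => -[x v] [/= /WU Ux _].
Qed.

Lemma Ck_ext E F k (U : set E) (f g : E -> F) : open U ->
  (forall x, U x -> f x = g x) -> Ck k U f -> Ck k U g.
Proof.
move=> oU fg Cf.
have cg x : U x -> {for x, continuous g}.
  move=> Ux; have cfx := Ck_cont Cf Ux.
  rewrite /prop_for /continuous_at -fg //; apply: cvg_trans cfx; apply: near_eq_cvg.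
  by apply: filterS (open_nbhs_nbhs (conj oU Ux)) => y /fg ->.
case: k Cf => [|k] [cf df]; split=> //; have [d [dE Cd]] := df.
exists d; split=> // x v Ux; apply: hasD_near (dE x v Ux).
exact: filterS (open_nbhs_nbhs (conj oU Ux)).
Qed.

Lemma Ck_pred E F k (U : set E) (f : E -> F) : Ck k.+1 U f -> Ck k U f.
Proof.
elim: k E F U f => [|k IH] E F U f [cf [d [dE Cd]]]; split=> //.
by exists d; split=> //; exact: IH.
Qed.

Lemma dnbhs0_neq : \forall h \near (0 : R)^', h != 0.
Proof. exact: withinT. Qed.

Lemma dnbhs0_eq_cvg F (g g' : R -> F) (d : F) :
  (forall h, h != 0 -> g h = g' h) -> g' @ (0 : R)^' --> d -> g @ (0 : R)^' --> d.
Proof.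
move=> gg'; apply: cvg_trans; apply: near_eq_cvg.
by apply: filterS dnbhs0_neq => h /gg' ->.
Qed.

Lemma clinD E F (L : E -> F) x y : clin L -> L (x + y) = L x + L y.
Proof. by move=> [lL _]; have := lL 1 x y; rewrite !scale1r. Qed.

Lemma clin0 E F (L : E -> F) : clin L -> L 0 = 0.
Proof.
by move=> cL; have := clinD 0 0 cL; rewrite addr0 => L0; apply: (@addrI _ (L 0)); rewrite -L0 addr0.
Qed.

Lemma clinZ E F (L : E -> F) a x : clin L -> L (a *: x) = a *: L x.
Proof. by move=> cL; have [lL _] := cL; have := lL a x 0; rewrite addr0 clin0 // addr0. Qed.

Lemma clinN E F (L : E -> F) x : clin L -> L (- x) = - L x.
Proof. by move=> cL; rewrite -scaleN1r clinZ // scaleN1r. Qed.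

Lemma clinB E F (L : E -> F) x y : clin L -> L (x - y) = L x - L y.
Proof. by move=> cL; rewrite clinD // clinN. Qed.

Lemma clin_cont E F (L : E -> F) x : clin L -> {for x, continuous L}.
Proof. by case=> _; exact. Qed.

Lemma clin_comp E F K (L : E -> F) (M : F -> K) : clin L -> clin M -> clin (M \o L).
Proof.
move=> [lL cL] [lM cM]; split; first by move=> a x y /=; rewrite lL lM.
by move=> x; apply: continuous_comp; [exact: cL|exact: cM].
Qed.

Lemma clin_pair E F K (L : E -> F) (M : E -> K) : clin L -> clin M ->
  clin (fun x => (L x, M x)).
Proof.
move=> [lL cL] [lM cM]; split; first by move=> a x y /=; rewrite lL lM.
by move=> x; apply: cvg_pair; [exact: cL|exact: cM].
Qed.

Lemma clin_fst E F : clin (fun p : E * F => p.1).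
Proof. by split=> // -[x y]; exact: cvg_fst. Qed.

Lemma clin_snd E F : clin (fun p : E * F => p.2).
Proof. by split=> // -[x y]; exact: cvg_snd. Qed.

Lemma clin_id E : clin (fun x : E => x).
Proof. by split=> // x; exact: cvg_id. Qed.

Lemma clin_zero E F : clin (fun _ : E => 0 : F).
Proof. by split; [move=> a x y; rewrite scaler0 addr0|move=> x; exact: cvg_cst]. Qed.

Lemma clin_sum E F (L M : E -> F) : clin L -> clin M -> clin (fun x => L x + M x).
Proof.
move=> [lL cL] [lM cM]; split.
  by move=> a x y; rewrite lL lM scalerDr addrACA.
by move=> x; apply: tvs_cvgD; [exact: cL|exact: cM].
Qed.

Lemma clin_scal E F (L : E -> F) (b : R) : clin L -> clin (fun x => b *: L x).
Proof.
move=> [lL cL]; split.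
  by move=> a x y; rewrite lL scalerDr !scalerA mulrC.
by move=> x; apply: tvs_cvgZ; [exact: cvg_cst|exact: cL].
Qed.

Lemma hasD_lin E F (L : E -> F) x v : clin L -> hasD L x v (L v).
Proof.
move=> cL; apply: (@dnbhs0_eq_cvg _ _ (fun=> L v)); last exact: cvg_cst.
by move=> h h0; rewrite (clinD _ _ cL) (clinZ _ _ cL) addrAC subrr add0r scalerA mulVf // scale1r.
Qed.

Lemma Ck_lin E F k (L : E -> F) : clin L -> Ck k setT L.
Proof.
elim: k E F L => [|k IH] E F L cL; first by split=> // x _; exact: clin_cont.
apply/CkSE; split; first by move=> x _; exact: clin_cont.
exists (L \o snd); split; first by move=> x v _; exact: hasD_lin.
apply: (@Ck_sub _ _ _ setT) => //; apply: IH.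
by apply: clin_comp => //; exact: clin_snd.
Qed.

Lemma Ck_precomp E E' F k (U : set E) (f : E -> F) (L : E' -> E) :
  clin L -> Ck k U f -> Ck k (L @^-1` U) (f \o L).
Proof.
elim: k E E' F U f L => [|k IH] E E' F U f L cL Cf.
  split=> // x Ux; apply: continuous_comp; [exact: clin_cont|exact: Ck_cont Cf Ux].
apply/CkSE; split.
  by move=> x Ux; apply: continuous_comp; [exact: clin_cont|exact: Ck_cont Cf Ux].
have /CkSE[_ [d [dE Cd]]] := Cf.
pose LL (p : E' * E') := (L p.1, L p.2).
have cLL : clin LL.
  by apply: clin_pair; apply: clin_comp => //; [exact: clin_fst|exact: clin_snd].
exists (d \o LL); split; last first.
  by apply: Ck_sub (IH _ _ _ _ _ _ cLL Cd) => -[x v] [/=].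
move=> x v Ux; have := dE (L x) (L v) Ux.
by apply: dnbhs0_eq_cvg => h h0 /=; rewrite (clinD _ _ cL) (clinZ _ _ cL).
Qed.

Lemma hasD_pair E F K (f : E -> F) (g : E -> K) x v d e :
  hasD f x v d -> hasD g x v e -> hasD (fun x => (f x, g x)) x v (d, e).
Proof. by move=> fd ge; exact: cvg_pair fd ge. Qed.

Lemma Ck_pair E F K k (U : set E) (f : E -> F) (g : E -> K) :
  Ck k U f -> Ck k U g -> Ck k U (fun x => (f x, g x)).
Proof.
elim: k E F K U f g => [|k IH] E F K U f g [cf df] [cg dg]; split=> //.
- by move=> x Ux; apply: cvg_pair; [exact: cf|exact: cg].
- by move=> x Ux; apply: cvg_pair; [exact: cf|exact: cg].
have [d [dE Cd]] := df; have [e [eE Ce]] := dg.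
exists (fun p => (d p, e p)); split; last exact: IH.
by move=> x v Ux; apply: hasD_pair; [exact: dE|exact: eE].
Qed.

Lemma cvg_dnbhs_line (E : tvsType R) (x v : E) :
  (fun h : R => x + h *: v) @ (0 : R)^' --> x.
Proof. exact: cvg_within_filter (@cvg_tvs_lineR E x v). Qed.

(* The step [h -> f x + h *: q h] with [q] the difference quotient of [f]
   reduces the chain rule to [quot_cvg]. *)
Lemma hasD_comp_gen E F K (W : set F) (f : E -> F) (g : F -> K) dg x v d :
  open W -> W (f x) -> (forall y v, W y -> hasD g y v (dg (y, v))) ->
  {for (f x, d), continuous dg} -> hasD f x v d ->
  hasD (g \o f) x v (dg (f x, d)).
Proof.
move=> oW Wfx dgE cdg fd.
have := @quot_cvg _ _ g dg W (f x) d oW Wfx dgE cdg _ (0 : R)^' _ (fun h => h)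
  (fun=> f x) (fun h => h^-1 *: (f (x + h *: v) - f x)).
have hid : (fun h : R => h) @ (0 : R)^' --> (0 : R).
  by apply: cvg_within_filter; exact: cvg_id.
move=> /(_ _ hid (cvg_cst _) fd dnbhs0_neq).
apply: dnbhs0_eq_cvg => h h0 /=.
by rewrite scalerA divff // scale1r subrKC.
Qed.

(** By the chain rule the derivative of [g \o f] is again a composite, of [e] with
    [(x, v) |-> (f x, d (x, v))], one order lower and on larger spaces; the induction therefore
    quantifies over all spaces. *)
Lemma Ck_comp E F K k (U : set E) (W : set F) (f : E -> F) (g : F -> K) :
  open U -> open W -> (forall x, U x -> W (f x)) ->
  Ck k U f -> Ck k W g -> Ck k U (g \o f).
Proof.
elim: k E F K U W f g => [|k IH] E F K U W f g oU oW UW Cf Cg.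
  split=> // x Ux; apply: continuous_comp; [exact: Ck_cont Cf Ux|exact: Ck_cont Cg (UW _ Ux)].
apply/CkSE; split.
  by move=> x Ux; apply: continuous_comp; [exact: Ck_cont Cf Ux|exact: Ck_cont Cg (UW _ Ux)].
have Cfk := Ck_pred Cf.
have /CkSE[_ [d [dE Cd]]] := Cf; have /CkSE[_ [e [eE Ce]]] := Cg.
exists (e \o (fun p => (f p.1, d p))); split.
  move=> x v Ux; apply: (@hasD_comp_gen _ _ _ W f g e x v (d (x, v)) oW (UW _ Ux) eE _ (dE x v Ux)).
  by apply: (Ck_cont Ce); split=> //; exact: UW.
apply: (IH _ _ _ _ (W `*` setT)) => //.
- exact: open_setXT.
- exact: open_setXT.
- by move=> [x v] [/= Ux _]; split=> //; exact: UW.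
apply: Ck_pair => //.
apply: Ck_sub (Ck_precomp (@clin_fst E E) Cfk).
by move=> -[x v] [].
Qed.

Lemma Ck_cst E F k (U : set E) (b : F) : Ck k U (fun=> b).
Proof.
elim: k E F U b => [|k IH] E F U b; split=> //; try by move=> x _; exact: cvg_cst.
exists (fun=> 0); split=> // x v _.
apply: (@dnbhs0_eq_cvg _ _ (fun=> 0)); last exact: cvg_cst.
by move=> h _; rewrite subrr scaler0.
Qed.

Lemma Ck_postlin E F K k (U : set E) (f : E -> F) (L : F -> K) :
  open U -> clin L -> Ck k U f -> Ck k U (L \o f).
Proof.
by move=> oU cL Cf; apply: (@Ck_comp _ _ _ _ _ setT) => //; [exact: openT|exact: Ck_lin].
Qed.

Lemma Ck_add E F k (U : set E) (f g : E -> F) : open U ->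
  Ck k U f -> Ck k U g -> Ck k U (fun x => f x + g x).
Proof.
move=> oU Cf Cg.
have cA : clin (fun p : F * F => p.1 + p.2).
  by apply: clin_sum; [exact: clin_fst|exact: clin_snd].
exact: (Ck_postlin oU cA (Ck_pair Cf Cg)).
Qed.

Lemma Ck_scal E F k (U : set E) (f : E -> F) (a : R) : open U ->
  Ck k U f -> Ck k U (fun x => a *: f x).
Proof. by move=> oU Cf; apply: (Ck_postlin oU (clin_scal a (@clin_id F)) Cf). Qed.

Definition cbil E F K (B : E * F -> K) :=
  [/\ continuous B, (forall a x x' y, B (a *: x + x', y) = a *: B (x, y) + B (x', y)) &
    (forall a x y y', B (x, a *: y + y') = a *: B (x, y) + B (x, y'))].

Lemma Ck_bil E F K k (B : E * F -> K) : cbil B -> Ck k setT B.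
Proof.
move=> [cB Bl Br].
have BDl x x' y : B (x + x', y) = B (x, y) + B (x', y).
  by have := Bl 1 x x' y; rewrite !scale1r.
have BDr x y y' : B (x, y + y') = B (x, y) + B (x, y').
  by have := Br 1 x y y'; rewrite !scale1r.
have B0l y : B (0, y) = 0.
  by apply: (@addrI _ (B (0, y))); rewrite -BDl !addr0.
have B0r y : B (y, 0) = 0.
  by apply: (@addrI _ (B (y, 0))); rewrite -BDr !addr0.
have BZl a x y : B (a *: x, y) = a *: B (x, y).
  by have := Bl a x 0 y; rewrite !addr0 B0l addr0.
have BZr a x y : B (x, a *: y) = a *: B (x, y).
  by have := Br a x y 0; rewrite !addr0 B0r addr0.
have dB (x v : E * F) : hasD B x v (B (x.1, v.2) + B (v.1, x.2)).
  case: x v => x y [v w] /=.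
  have c1 : (fun h : R => B (x, w) + B (v, y) + h *: B (v, w)) @ (0 : R)^'
      --> B (x, w) + B (v, y) by exact: cvg_dnbhs_line.
  apply: dnbhs0_eq_cvg c1 => h h0.
  rewrite BDl !BDr BZl BZr !BZl [_ + _ - _]addrC !addrA addNr add0r.
  rewrite BZr !scalerDr !scalerA mulVf // !scale1r mulrA mulVf // mul1r.
  by [].
(* Composites with two linear maps form a class that is closed, up to sums, under directional
   derivatives; bilinear maps alone do not. *)
have gen : forall k (D : tvsType R) (L : D -> E) (M : D -> F), clin L -> clin M ->
    Ck k setT (fun d => B (L d, M d)).
  have cont (D : tvsType R) (L : D -> E) (M : D -> F) : clin L -> clin M ->
      continuous (fun d => B (L d, M d)).
    move=> cL cM x; apply: (@continuous_comp _ _ _ (fun d => (L d, M d)) B); last exact: cB.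
    by apply: cts_pair; apply: clin_cont.
  elim=> [|l IH] D L M cL cM; first by split=> // x _; exact: cont.
  apply/CkSE; split; first by move=> x _; exact: cont.
  exists (fun p => B (L p.1, M p.2) + B (L p.2, M p.1)); split.
    move=> x v _; have := dB (L x, M x) (L v, M v).
    by apply: dnbhs0_eq_cvg => h h0 /=; rewrite (clinD _ _ cL) (clinZ _ _ cL) (clinD _ _ cM) (clinZ _ _ cM).
  apply: (@Ck_sub _ _ _ setT) => //; apply: Ck_add; first exact: openT.
    by apply: (IH _ (L \o fst) (M \o snd)); apply: clin_comp => //; [exact: clin_fst|exact: clin_snd].
  by apply: (IH _ (L \o snd) (M \o fst)); apply: clin_comp => //; [exact: clin_snd|exact: clin_fst].
apply: Ck_ext (gen k _ fst snd (@clin_fst E F) (@clin_snd E F)); first exact: openT.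
by case.
Qed.

Section Derivative.
Variables (E F : tvsType R).
Hypothesis hF : hausdorff_space F.

Lemma Ck_Df k (U : set E) (f : E -> F) : open U -> Ck k.+1 U f ->
  (forall x v, U x -> hasD f x v (Df f (x, v))) /\ Ck k (U `*` setT) (Df f).
Proof.
move=> oU [cf [d [dE Cd]]].
have DE x v : U x -> Df f (x, v) = d (x, v).
  by move=> Ux; apply: hasD_Df => //; exact: dE.
split=> [x v Ux|]; first by rewrite DE //; exact: dE.
by apply: Ck_ext Cd; [exact: open_setXT|case=> x v [/= Ux _]; rewrite DE].
Qed.

Lemma Cinfty_Df (U : set E) (f : E -> F) : open U -> Cinfty U f ->
  Cinfty (U `*` setT) (Df f).
Proof. by move=> oU Cf k; have [] := Ck_Df oU (Cf k.+1). Qed.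

Lemma Ck1_quot (U : set E) (f : E -> F) x w0 : open U -> Ck 1 U f -> U x ->
  forall T (FF : set_system T) {_ : Filter FF} (h : T -> R) (y w : T -> E),
  h @ FF --> (0 : R) -> y @ FF --> x -> w @ FF --> w0 ->
  (\forall t \near FF, h t != 0) ->
  (fun t => (h t)^-1 *: (f (y t + h t *: w t) - f (y t))) @ FF --> Df f (x, w0).
Proof.
move=> oU Cf Ux; have [dE Cd] := Ck_Df oU Cf.
by apply: (quot_cvg oU Ux dE); apply: (Ck_cont Cd).
Qed.

Lemma DfZ (U : set E) (f : E -> F) x a v : open U -> Ck 1 U f -> U x ->
  Df f (x, a *: v) = a *: Df f (x, v).
Proof.
move=> oU Cf Ux; have [dE Cd] := Ck_Df oU Cf.
apply: hasD_Df => //.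
have := @Ck1_quot U f x v oU Cf Ux.
have [->|a0] := eqVneq a 0.
  move=> _; rewrite !scale0r; apply: (@dnbhs0_eq_cvg _ _ (fun=> 0 : F)); last exact: cvg_cst.
  by move=> h _; rewrite scaler0 addr0 subrr scaler0.
have ah0 : (fun h : R => h * a) @ (0 : R)^' --> (0 : R).
  rewrite -[X in _ --> X](mul0r a); apply: cvg_within_filter.
  by apply: cvgMl; exact: cvg_id.
move=> /(_ _ (0 : R)^' _ (fun h => h * a) (fun=> x) (fun=> v) ah0 (cvg_cst _) (cvg_cst _)) H.
have {}H := tvs_cvgZ (cvg_cst a) (H _).
apply: (dnbhs0_eq_cvg _ (H _ _ _)).
  by move=> h h0; rewrite [RHS]scalerA invfM mulrCA divff // mulr1 scalerA.
by apply: filterS dnbhs0_neq => h h0; rewrite mulf_neq0.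
Qed.

(** The quotient along [v + w] is a quotient along [v] at the moving point [x + h *: w] plus one
    along [w] at [x]; strict differentiability handles the former. *)
Lemma DfD (U : set E) (f : E -> F) x v w : open U -> Ck 1 U f -> U x ->
  Df f (x, v + w) = Df f (x, v) + Df f (x, w).
Proof.
move=> oU Cf Ux; have [dE Cd] := Ck_Df oU Cf.
apply: hasD_Df => //.
have hid : (fun h : R => h) @ (0 : R)^' --> (0 : R).
  by apply: cvg_within_filter; exact: cvg_id.
have Hv := @Ck1_quot U f x v oU Cf Ux _ (0 : R)^' _ (fun h => h)
  (fun h => x + h *: w) (fun=> v) hid (@cvg_dnbhs_line E x w) (cvg_cst _) dnbhs0_neq.
apply: dnbhs0_eq_cvg (tvs_cvgD (Hv _ _) (dE x w Ux)) => h h0.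
by rewrite -[RHS]scalerDr; congr (_ *: _); rewrite [RHS]subrKA scalerDr [h *: v + _]addrC addrA.
Qed.

Lemma Df0 (U : set E) (f : E -> F) x : open U -> Ck 1 U f -> U x ->
  Df f (x, 0) = 0.
Proof. by move=> oU Cf Ux; rewrite -(scale0r 0) (DfZ 0 0 oU Cf Ux) scale0r. Qed.

Lemma Df_clin (U : set E) (f : E -> F) x : open U -> Ck 1 U f -> U x ->
  clin (fun v => Df f (x, v)).
Proof.
move=> oU Cf Ux; split=> [a v w|v]; first by rewrite (DfD _ _ oU Cf Ux) (DfZ _ _ oU Cf Ux).
have [_ Cd] := Ck_Df oU Cf.
apply: (@continuous_comp _ _ _ (fun v => (x, v)) (Df f)).
  by apply: cvg_pair; [exact: cvg_cst|exact: cvg_id].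
exact: (Ck_cont Cd).
Qed.

End Derivative.

Lemma hasD_comp E F K (W : set F) (f : E -> F) (g : F -> K) x v d :
  hausdorff_space K -> open W -> Ck 1 W g -> W (f x) -> hasD f x v d ->
  hasD (g \o f) x v (Df g (f x, d)).
Proof.
move=> hK oW Cg Wfx fd; have [dE Cd] := Ck_Df hK oW Cg.
by apply: (hasD_comp_gen oW) => //; exact: (Ck_cont Cd).
Qed.

Lemma Df_comp E F K (U : set E) (W : set F) (f : E -> F) (g : F -> K) x v :
  hausdorff_space F -> hausdorff_space K -> open U -> open W ->
  Ck 1 U f -> Ck 1 W g -> U x -> W (f x) ->
  Df (g \o f) (x, v) = Df g (f x, Df f (x, v)).
Proof.
move=> hF hK oU oW Cf Cg Ux Wfx; apply: hasD_Df => //.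
by apply: (hasD_comp hK oW) => //; have [dE _] := Ck_Df hF oU Cf; exact: dE.
Qed.

(** Near [x] the first-order quotients of [Df f] in the direction [a] are close to the second
    derivative; [convex_mvt] along [v] carries this over to the double difference, with independent
    steps [h] and [k]. *)
Let second_diff E F (U : set E) (f : E -> F) x a v : hausdorff_space F ->
  open U -> Ck 2 U f -> U x ->
  forall N, nbhs (Df (Df f) ((x, v), (a, 0))) N -> exists2 e, 0 < e &
  forall h k : R, h != 0 -> k != 0 -> `|h| < e -> `|k| < e ->
  N (k^-1 *: (h^-1 *: (f (x + h *: a + k *: v) - f (x + h *: a) - (f (x + k *: v) - f x)))).
Proof.
move=> hF oU Cf Ux N /nbhs_cvx[N' [oN' N'd cN' N'N]].
have [dE Cd] := Ck_Df hF oU Cf.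
have oUT : open (U `*` [set: E]) by exact: open_setXT.
pose FF := filter_prod (0 : R)^' (nbhs (0 : R)).
have c1 : (fun p : R * R => p.1) @ FF --> (0 : R).
  by apply: cvg_trans cvg_fst _; exact: cvg_within.
have c2 : (fun p : R * R => p.2) @ FF --> (0 : R) by exact: cvg_snd.
have c3 : (fun p : R * R => (x + p.2 *: v, v)) @ FF --> (x, v).
  apply: cvg_pair; last exact: cvg_cst.
  by apply: tvs_cvg_line => //; exact: cvg_cst.
have c4 : \forall p \near FF, p.1 != 0 :> R.
  by exists ([set h | h != 0], setT); [split; [exact: dnbhs0_neq|exact: filterT]|case=> ? ? []].
have c5 : (fun p : R * R => x + p.2 *: v) @ FF --> x.
  by apply: tvs_cvg_line => //; exact: cvg_cst.
have c6 : (fun p : R * R => x + p.2 *: v + p.1 *: a) @ FF --> x.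
  by apply: tvs_cvg_line => //; exact: cvg_cst.
have nU : nbhs x U by apply: open_nbhs_nbhs.
have hUx : (U `*` [set: E]) (x, v) by [].
have nN' : nbhs (Df (Df f) ((x, v), (a, 0))) N' by apply: open_nbhs_nbhs.
have Q := @Ck1_quot _ _ hF _ (Df f) (x, v) (a, 0) oUT Cd hUx _ FF _ _ _ _ c1 c3 (cvg_cst _) c4 _ nN'.
have [[A B] /= [A0 B0] AB] : FF [set p : R * R | [/\ N' (p.1^-1 *: (Df f ((x + p.2 *: v, v) + p.1 *: (a, 0)) - Df f (x + p.2 *: v, v))),
    U (x + p.2 *: v) & U (x + p.2 *: v + p.1 *: a)]].
  by apply: filterS (filterI (Q _ _ : FF _) (filterI (c5 _ nU : FF _) (c6 _ nU : FF _))) => p [? []].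
move: A0 => /nbhs_ballP[e1 /= e10 e1A]; move: B0 => /nbhs_ballP[e2 /= e20 e2B].
exists (Num.min e1 e2); first by rewrite lt_min e10.
move=> h k h0 k0; rewrite !lt_min => /andP[he1 _] /andP[_ ke2].
have Ah : A h by apply: (e1A h) => //; rewrite -ball_normE /= sub0r normrN.
have main s : 0 <= s <= 1 -> [/\ N' (h^-1 *: (Df f (x + (s * k) *: v + h *: a, v) - Df f (x + (s * k) *: v, v))),
    U (x + (s * k) *: v) & U (x + (s * k) *: v + h *: a)].
  move=> /andP[s0 s1]; have Bk : B (s * k).
    apply: e2B; rewrite -ball_normE /= sub0r normrN normrM (ger0_norm s0).
    by apply: le_lt_trans ke2; rewrite ler_piMl.
  have [/= N1 U1 U2] := AB (h, s * k) (conj Ah Bk); split=> //.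
  have -> : (x + (s * k) *: v + h *: a, v) = (x + (s * k) *: v, v) + h *: (a, 0 : E).
    by congr (_, _) => /=; rewrite scaler0 addr0.
  exact: N1.
apply: N'N.
pose phi s := k^-1 *: (h^-1 *: (f (x + (s * k) *: v + h *: a) - f (x + (s * k) *: v))).
have -> : k^-1 *: (h^-1 *: (f (x + h *: a + k *: v) - f (x + h *: a) - (f (x + k *: v) - f x))) = phi 1 - phi 0.
  rewrite /phi mul1r mul0r scale0r addr0 -!scalerBr; congr (_ *: (_ *: _)).
  by rewrite [x + k *: v + _]addrAC; exact: subr4.
apply: (@convex_mvt _ N' phi (fun s => h^-1 *: (Df f (x + (s * k) *: v + h *: a, v) - Df f (x + (s * k) *: v, v)))) => //; last by move=> s /main[].
move=> s /main[_ U1 U2].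
have d1 := dE _ v U1; have d2 := dE _ v U2.
have kh0 : (fun t : R => t * k) @ (0 : R)^' --> (0 : R)^'.
  move=> M /= /nbhs_ballP[e /= e0 eM].
  apply/nbhs_ballP; exists (e / `|k|) => /=; first by rewrite divr_gt0 // normr_gt0.
  move=> t; rewrite -ball_normE /= sub0r normrN ltr_pdivlMr ?normr_gt0 // => th t0.
  by apply: eM; rewrite -?ball_normE /= ?sub0r ?normrN ?normrM // mulf_neq0.
have := tvs_cvgZ (cvg_cst h^-1) (tvs_cvgB (cvg_comp _ _ kh0 d2) (cvg_comp _ _ kh0 d1)).
move=> /(_ _ _ _); apply: dnbhs0_eq_cvg => t t0 /=.
rewrite /phi mulrDl scalerDl addrA.
rewrite [x + _ + _ + h *: a]addrAC.
rewrite -!scalerBr !scalerA; congr (_ *: _).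
  by rewrite invfM [RHS]mulrC -mulrA.
exact: subr4.
Qed.

(** The double difference is symmetric in its two increments, so with equal small steps it lies in
    given neighbourhoods of both second derivatives; in a Hausdorff space the two then coincide. *)
Lemma Df_sym E F (U : set E) (f : E -> F) x a v : hausdorff_space F ->
  open U -> Ck 2 U f -> U x ->
  Df (Df f) ((x, v), (a, 0)) = Df (Df f) ((x, a), (v, 0)).
Proof.
move=> hF oU Cf Ux; apply: (hF) => A B nA nB.
have [e e0 eA] := second_diff hF oU Cf Ux nA.
have [d d0 dB] := second_diff hF oU Cf Ux nB.
pose h := Num.min e d / 2.
have m0 : 0 < Num.min e d by rewrite lt_min e0.
have h0 : 0 < h by rewrite divr_gt0.
have hm : h < Num.min e d by rewrite ltr_pdivrMr // ltr_pMr // ltr1n.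
move: hm; rewrite -(gtr0_norm h0) lt_min => /andP[he hd].
exists (h^-1 *: (h^-1 *: (f (x + h *: a + h *: v) - f (x + h *: a) - (f (x + h *: v) - f x)))).
split; first by apply: eA => //; rewrite gt_eqF.
have -> : f (x + h *: a + h *: v) - f (x + h *: a) - (f (x + h *: v) - f x) =
  f (x + h *: v + h *: a) - f (x + h *: v) - (f (x + h *: a) - f x).
  by rewrite [x + h *: v + _]addrAC; exact: subr4.
by apply: dB => //; rewrite gt_eqF.
Qed.

(** Since [Df f] is linear in its direction, moving the direction by [b] contributes just
    [Df f (x, b)]. *)
Lemma Df_Df E F (U : set E) (f : E -> F) x a v b : hausdorff_space F ->
  open U -> Ck 2 U f -> U x ->
  Df (Df f) ((x, v), (a, b)) = Df (Df f) ((x, v), (a, 0)) + Df f (x, b).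
Proof.
move=> hF oU Cf Ux; have [_ Cd] := Ck_Df hF oU Cf.
have Cf1 := Ck_pred Cf; have [dE _] := Ck_Df hF oU Cf1.
have oUT := @open_setXT E E _ oU.
have -> : (a, b) = (a, 0) + (0, b) :> E * E by congr (_, _); rewrite /= ?addr0 ?add0r.
rewrite (@DfD _ _ hF _ _ (x, v) (a, 0) (0, b) oUT Cd) //; congr (_ + _).
apply: hasD_Df => //; apply: (@dnbhs0_eq_cvg _ _ (fun=> Df f (x, b))); last exact: cvg_cst.
move=> h h0.
have -> : (x, v) + h *: (0, b) = (x, v + h *: b) :> E * E.
  by congr (_, _); rewrite /= scaler0 addr0.
by rewrite (DfD hF _ _ oU Cf1 Ux) (DfZ hF _ _ oU Cf1 Ux) addrAC subrr add0r scalerA mulVf // scale1r.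
Qed.

Lemma Cinfty_comp E F K (U : set E) (W : set F) (f : E -> F) (g : F -> K) :
  open U -> open W -> (forall x, U x -> W (f x)) ->
  Cinfty U f -> Cinfty W g -> Cinfty U (g \o f).
Proof. by move=> oU oW UW Cf Cg k; exact: (Ck_comp oU oW UW (Cf k) (Cg k)). Qed.

Lemma Cinfty_sub E F (U W : set E) (f : E -> F) : W `<=` U -> Cinfty U f -> Cinfty W f.
Proof. by move=> WU Cf k; exact: Ck_sub (Cf k). Qed.

Lemma Cinfty_ext E F (U : set E) (f g : E -> F) : open U ->
  (forall x, U x -> f x = g x) -> Cinfty U f -> Cinfty U g.
Proof. by move=> oU fg Cf k; exact: Ck_ext (Cf k). Qed.

Lemma Cinfty_pair E F K (U : set E) (f : E -> F) (g : E -> K) :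
  Cinfty U f -> Cinfty U g -> Cinfty U (fun x => (f x, g x)).
Proof. by move=> Cf Cg k; exact: Ck_pair. Qed.

Lemma Cinfty_lin E F (U : set E) (L : E -> F) : clin L -> Cinfty U L.
Proof. by move=> cL k; apply: (@Ck_sub _ _ _ setT) => //; exact: Ck_lin. Qed.

Lemma Cinfty_add E F (U : set E) (f g : E -> F) : open U ->
  Cinfty U f -> Cinfty U g -> Cinfty U (fun x => f x + g x).
Proof. by move=> oU Cf Cg k; exact: Ck_add. Qed.

Lemma Cinfty_scal E F (U : set E) (f : E -> F) (a : R) : open U ->
  Cinfty U f -> Cinfty U (fun x => a *: f x).
Proof. by move=> oU Cf k; exact: Ck_scal. Qed.

Lemma Cinfty_opp E F (U : set E) (f : E -> F) : open U ->
  Cinfty U f -> Cinfty U (fun x => - f x).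
Proof.
move=> oU Cf; apply: Cinfty_ext (Cinfty_scal (-1) oU Cf) => // x _.
by rewrite scaleN1r.
Qed.

Lemma Cinfty_cst E F (U : set E) (b : F) : Cinfty U (fun=> b).
Proof. by move=> k; exact: Ck_cst. Qed.

Lemma Cinfty_bil E F K (U : set (E * F)%type) (B : E * F -> K) : cbil B -> Cinfty U B.
Proof. by move=> cB k; apply: (@Ck_sub _ _ _ setT) => //; exact: Ck_bil. Qed.

Lemma Cinfty_cont E F (U : set E) (f : E -> F) x : Cinfty U f -> U x ->
  {for x, continuous f}.
Proof. by move=> Cf; exact: Ck_cont (Cf 0%N). Qed.

Lemma Cinfty_hasD E F (U : set E) (f : E -> F) x v : hausdorff_space F ->
  open U -> Cinfty U f -> U x -> hasD f x v (Df f (x, v)).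
Proof. by move=> hF oU Cf; have [dE _] := Ck_Df hF oU (Cf 1%N); exact: dE. Qed.

End CkCalculus.

End TvsLimits.

(** * Curves of one real variable *)

Section CurveCalculus.
Context {R : realType}.

Lemma hausdorff_normed (V : normedModType R) : hausdorff_space V.
Proof. exact: norm_hausdorff. Qed.

Section Rows.
Variable X : normedModType R.
Implicit Types (f g : R -> X).

Lemma hasD_derivable f (s : R) (d : X) : hasD (f : R^o -> X) s 1 d ->
  derivable f s 1 /\ derive1 f s = d.
Proof.
move=> fd.
have fd1 : (fun h : R => h^-1 *: (f (h + s) - f s)) @ (0 : R)^' --> d.
  by apply: dnbhs0_eq_cvg fd => h _; rewrite [h *: _]mulr1 [s + h]addrC.
split; last exact: (cvg_lim (@hausdorff_normed _) fd1).
apply/cvg_ex; exists d; apply: dnbhs0_eq_cvg fd => h _ /=.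
by rewrite [_ + s]addrC.
Qed.

Lemma derivable_hasD1 f (s : R) : derivable f s 1 ->
  hasD (f : R^o -> X) s 1 (derive1 f s).
Proof.
move=> df; rewrite derive1E.
by apply: dnbhs0_eq_cvg df => h _ /=; rewrite [s + _]addrC.
Qed.

Lemma derivable_hasD f (s t : R) : derivable f s 1 ->
  hasD (f : R^o -> X) s t (t *: derive1 f s).
Proof.
move=> df; have [->|t0] := eqVneq t 0.
  apply: (@dnbhs0_eq_cvg _ _ _ (fun=> 0 : X)); last by rewrite scale0r; exact: cvg_cst.
  by move=> h _; rewrite scaler0 addr0 subrr scaler0.
have := derivable_hasD1 df.
have kh0 : (fun h : R => h * t) @ (0 : R)^' --> (0 : R)^'.
  move=> M /= /nbhs_ballP[e /= e0 eM].
  apply/nbhs_ballP; exists (e / `|t|) => /=; first by rewrite divr_gt0 // normr_gt0.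
  move=> h; rewrite -ball_normE /= sub0r normrN ltr_pdivlMr ?normr_gt0 // => th h0.
  by apply: eM; rewrite -?ball_normE /= ?sub0r ?normrN ?normrM // mulf_neq0.
move=> /(cvg_comp _ _ kh0) H; have := tvs_cvgZ (cvg_cst t) H.
move=> /(_ _ _); apply: dnbhs0_eq_cvg => h h0 /=.
by rewrite [(h * t) *: _]mulr1 scalerA invfM mulrCA divff // mulr1.
Qed.

Lemma derive1n_near k f g (s : R) : (\forall y \near s, f y = g y) ->
  \forall y \near s, derive1n k f y = derive1n k g y.
Proof.
elim: k => [//|k IH] fg; have /nbhs_ballP[e /= e0 eE] := IH fg.
near=> y; rewrite /= /derive1; congr (lim _).
have ye : nbhs y (ball s e) by near: y; apply: nbhs_interior; exact: nbhsx_ballx.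
have yey := nbhs_singleton ye.
suff E : forall (u v : R -> X), (\forall z \near y, u z = v z) ->
    (h^-1 *: (u (h + y) - u y) @[h --> 0^'] : set_system X) `<=` h^-1 *: (v (h + y) - v y) @[h --> 0^'].
  apply/seteqP; split; apply: E; apply: filterS ye => z /eE //.
move=> u v uv; apply: near_eq_cvg.
have yc : (fun h : R => h + y) @ (0 : R)^' --> y.
  rewrite -[X in _ --> X]add0r; apply: cvg_within_filter.
  by apply: cvgD; [exact: cvg_id|exact: cvg_cst].
have uvy := nbhs_singleton uv.
have uvh : \forall h \near (0 : R)^', u (h + y) = v (h + y) := yc _ uv.
by apply: filterS uvh => h E; rewrite uvy E.
Unshelve. all: by end_near. Qed.

Lemma derive1_Df (W : set R^o) f (s : R) : open W -> Cinfty W (f : R^o -> X) -> W s ->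
  derive1 f s = Df (f : R^o -> X) (s : R^o, 1 : R^o).
Proof.
move=> oW Cf Ws.
by have [] := hasD_derivable (Cinfty_hasD (@hausdorff_normed _) oW Cf Ws).
Qed.

Lemma Cinfty_derive1n (W : set R^o) f k : open W -> Cinfty W (f : R^o -> X) ->
  Cinfty W (derive1n k f : R^o -> X).
Proof.
move=> oW Cf; elim: k => [//|k IH]; rewrite derive1nS.
apply: (@Cinfty_ext _ _ _ _ (fun s : R^o => Df (derive1n k f : R^o -> X) (s, 1 : R^o))) => //.
  by move=> s Ws; rewrite (derive1_Df oW).
apply: (@Cinfty_comp _ _ _ _ _ (W `*` setT) (fun s : R^o => (s, 1 : R^o))) => //.
- exact: open_setXT.
- by apply: Cinfty_pair; [apply: Cinfty_lin; exact: clin_id|exact: Cinfty_cst].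
by apply: Cinfty_Df => //; exact: hausdorff_normed.
Qed.

Lemma Cinfty_derivable (W : set R^o) f k s : open W -> Cinfty W (f : R^o -> X) -> W s ->
  derivable (derive1n k f) s 1.
Proof.
move=> oW Cf Ws; have Ck := Cinfty_derive1n k oW Cf.
by have [] := hasD_derivable (Cinfty_hasD (@hausdorff_normed _) oW Ck Ws).
Qed.

Lemma cbil_scale (V : tvsType R) : cbil (fun p : R^o * V => p.1 *: p.2).
Proof.
split; first exact: scale_continuous.
  by move=> a x x' y /=; rewrite scalerDl scalerA.
by move=> a x y y' /=; rewrite scalerDr !scalerA mulrC.
Qed.

Lemma derivable_Cinfty (W : set R^o) f : open W ->
  (forall k s, W s -> derivable (derive1n k f) s 1) -> Cinfty W (f : R^o -> X).
Proof.
(* All iterated derivatives are treated together, since the directional derivative of the [j]-th one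
   involves the next. *)
move=> oW df l; suff: forall j, Ck l W (derive1n j f : R^o -> X) by move/(_ 0%N).
elim: l => [|l IH] j; first by split=> // s Ws; apply: differentiable_continuous; apply/derivable1_diffP; apply: df.
apply/CkSE; split; first by move=> s Ws; apply: differentiable_continuous; apply/derivable1_diffP; apply: df.
exists (fun p => p.2 *: derive1n j.+1 f p.1); split.
  by move=> s t Ws; rewrite derive1nS; apply: derivable_hasD; exact: df.
apply: (@Ck_comp _ _ _ _ _ _ setT (fun p : R^o * R^o => (p.2 : R^o, derive1n j.+1 f p.1 : X))
  (fun p : R^o * X => p.1 *: p.2)) => //.
- exact: open_setXT.
- exact: openT.
- apply: Ck_pair; first by apply: (@Ck_sub _ _ _ _ setT) => //; apply: Ck_lin; exact: clin_snd.
  by apply: Ck_sub (Ck_precomp (@clin_fst _ R^o R^o) (IH j.+1)) => -[x v] [].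
exact: Ck_bil (@cbil_scale X).
Qed.

End Rows.

(** Compactness of [[a, b]]. Estimates uniform in the curve parameter are obtained from it. *)
Lemma tube_lemma (T : Type) (F : set_system T) (P : T -> R -> Prop) (a b : R) :
  Filter F -> (forall s, a <= s <= b -> \forall s' \near s & t \near F, P t s') ->
  \forall t \near F, forall s, a <= s <= b -> P t s.
Proof.
move=> FF Ps; have /compact_near_coveringP nc := @segment_compact R a b.
have {}nc := nc T F P FF.
apply: filterS (nc _) => [t Pt s sab|s sab]; first by apply: Pt; rewrite /= in_itv.
by apply: Ps; move: sab; rewrite /= in_itv.
Qed.

(** * The space of flat curves and the exponential law *)

Section FlatVectTopology.
Variables (kappa : curve_kind) (n : nat).
Local Notation V := (flat_vect R kappa n).

(** The representative [s'] depends on [s] only, not on the curve or its target, so it serves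
    group-valued and vector-valued curves alike. *)
Lemma wraps_rep (s : R) : exists2 s', 0 <= s' <= 2 * pi &
  forall T (f : R -> T), wraps kappa f -> f s = f s'.
Proof.
have p0 := @pi_gt0 R.
case: kappa => /=.
  have p2 : 0 < 2 * pi :> R by rewrite mulr_gt0.
  exists (s - (Num.floor (s / (2 * pi)))%:~R * (2 * pi)).
    have /andP[] := floor_itv (s / (2 * pi)).
    rewrite ler_pdivlMr // ltr_pdivrMr // => l1 l2; rewrite subr_ge0 l1 /=.
    by move: l2; rewrite intrD mulrDl mul1r => l2; lra.
  move=> T f wf; set m := Num.floor _.
  have wn (k : nat) t : f (t + k%:R * (2 * pi)) = f t.
    elim: k => [|k IH]; first by rewrite mul0r addr0.
    by rewrite -addn1 natrD mulrDl mul1r addrA wf.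
  case: m => k; first by rewrite -[LHS](wn 0%N) -[RHS](wn k) mul0r addr0 subrK.
  by rewrite NegzE mulrNz mulNr opprK wn.
exists (Num.max 0 (Num.min s pi)); last by move=> T f ->.
apply/andP; split; first by rewrite le_max lexx.
rewrite ge_max; apply/andP; split; first by rewrite mulr_ge0 // ltW.
by rewrite ge_min; apply/orP; right; rewrite ler_peMl ?ler1n // ltW.
Qed.

Lemma flat_wraps (f : V) : wraps kappa f.
Proof. by have [] := flat_vectP f. Qed.

Lemma flat_vect_ext (f g : V) : (forall s, 0 <= s <= 2 * pi -> f s = g s) -> f = g.
Proof.
move=> fg; apply: val_inj; apply/funext => s.
have [s' s'2 E] := wraps_rep s.
by rewrite /= (E _ _ (flat_wraps f)) (E _ _ (flat_wraps g)) fg.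
Qed.

Lemma flat_vectB k (f g : V) s : derive1n k (f - g) s = derive1n k f s - derive1n k g s.
Proof.
rewrite -[f - g]/(f + - g) -scaleN1r.
have -> : flat_fun (f + -1 *: g) = (f : R -> _) + (-1 *: (g : R -> _)) by [].
rewrite derive1nD; [|exact: flat_vect_derivable|].
  by rewrite derive1nZ; [rewrite !fctE scaleN1r|exact: flat_vect_derivable].
by move=> j t; rewrite derive1nZ; [apply: derivableZ|]; exact: flat_vect_derivable.
Qed.

Lemma flat_vectZ k a (f : V) s : derive1n k (a *: f) s = a *: derive1n k f s.
Proof.
have -> : flat_fun (a *: f) = a *: (f : R -> _) by [].
by rewrite derive1nZ //; exact: flat_vect_derivable.
Qed.

Lemma flat_vectD k (f g : V) s : derive1n k (f + g) s = derive1n k f s + derive1n k g s.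
Proof.
have -> : flat_fun (f + g) = (f : R -> _) + (g : R -> _) by [].
by rewrite derive1nD //; exact: flat_vect_derivable.
Qed.

Lemma flat_vect_hausdorff : hausdorff_space V.
Proof.
move=> f g cl; suff n0 : Ck_norm 0 (f - g) = 0.
  apply: flat_vect_ext => s s2; apply/eqP; rewrite -subr_eq0 -normr_le0 -n0.
  by rewrite -(@flat_vectB 0%N f g s) le_Ck_norm.
apply/eqP; rewrite eq_le Ck_norm_ge0 andbT; apply/ler_addgt0Pr => e e0.
have e20 : 0 < e / 2 by rewrite divr_gt0.
have [h [/= hf hg]] := cl _ _ (nbhs_flat_ball f 0 e20) (nbhs_flat_ball g 0 e20).
have -> : f - g = (-1) *: (h - f) + (h - g) by rewrite scaleN1r opprB addrA subrK.
rewrite add0r (le_trans (Ck_normD _ _ _)) // [leRHS]splitr lerD //; last exact: ltW.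
by rewrite (le_trans (Ck_normZ _ _ _)) // normrN1 mul1r ltW.
Qed.

Lemma near_leq T (F : set_system T) (P : nat -> T -> Prop) k : Filter F ->
  (forall j, \forall t \near F, P j t) ->
  \forall t \near F, forall j, (j <= k)%N -> P j t.
Proof.
move=> FF FP; elim: k => [|k IH]; first by apply: filterS (FP 0%N) => t Pt j; rewrite leqn0 => /eqP ->.
apply: filterS2 (FP k.+1) IH => t Pk Pt j; rewrite leq_eqVlt => /predU1P[->//|].
by rewrite ltnS; exact: Pt.
Qed.

Lemma cvg_flat T (F : set_system T) (g : T -> V) (l : V) : Filter F ->
  (forall j (e : R), 0 < e -> \forall t \near F, forall s, 0 <= s <= 2 * pi ->
     `|derive1n j (g t) s - derive1n j l s| < e) -> g @ F --> l.
Proof.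
move=> FF gl U /nbhs_flatP[k [e [e0 eU]]].
have e20 : 0 < e / 2 by rewrite divr_gt0.
apply: filterS (near_leq k FF (fun j => gl j _ e20)) => t H; apply: eU.
rewrite /flat_ball /=; apply: le_lt_trans (_ : e / 2 < e); last first.
  by rewrite ltr_pdivrMr // ltr_pMr // ltr1n.
by apply: Ck_norm_le => j s jk s2; rewrite flat_vectB ltW // H.
Qed.

Definition mk_flat (f : R -> 'rV[R]_n) : V := insubd 0 f.

Lemma mk_flatE f : flat_vcurve kappa f -> mk_flat f = f :> (R -> 'rV[R]_n).
Proof. by move=> ff; apply: insubdK; apply/asboolP. Qed.

Lemma flat_vect_Cinfty (f : V) : Cinfty setT (flat_fun f : R^o -> 'rV[R]_n).
Proof. by apply: derivable_Cinfty => [|k s _]; [exact: openT|exact: flat_vect_derivable]. Qed.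

End FlatVectTopology.

Lemma Df_near (E F : tvsType R) (f g : E -> F) (x v : E) :
  (\forall y \near x, f y = g y) -> Df f (x, v) = Df g (x, v).
Proof.
move=> fg; congr (xget 0 _); apply/seteqP; split => d /=; apply: hasD_near => //.
by apply: filterS fg.
Qed.

Lemma wraps_pointwise kappa (D S T : Type) (U : set D) (H : D -> R -> S) (K : R -> T) :
  (forall s s', (forall d, U d -> H d s = H d s') -> K s = K s') ->
  (forall d, U d -> wraps kappa (H d)) -> wraps kappa K.
Proof. by case: kappa => /= HK HW s; apply: HK => d Ud; rewrite HW. Qed.

Section ExponentialLaw.
Variables (kappa : curve_kind) (n : nat).
Local Notation X := 'rV[R]_n.
Local Notation V := (flat_vect R kappa n).
Let hX : hausdorff_space X := @hausdorff_normed X.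

Section OneMap.
Variables (D : tvsType R) (U : set D) (H : D * R^o -> X) (T : D -> V).
Hypotheses (oU : open U) (CH : Cinfty (U `*` setT) H)
  (TH : forall d s, U d -> T d s = H (d, s)).

Let UT : set (D * R^o)%type := U `*` setT.
Let oUT : open UT. Proof. exact: open_setXT. Qed.

(** Successive partial derivatives in the curve parameter, kept as functions of both variables. *)
Fixpoint dsn (j : nat) : D * R^o -> X :=
  if j is j'.+1 then fun p => Df (dsn j') (p, ((0 : D), (1 : R^o))) else H.

Lemma Cinfty_dsn j : Cinfty UT (dsn j).
Proof.
elim: j => [//|j IH] /=.
apply: (@Cinfty_comp _ _ _ _ _ (UT `*` setT) (fun p => (p, ((0 : D), (1 : R^o)))) (Df (dsn j))) => //.
- exact: open_setXT.
- by apply: Cinfty_pair; [apply: Cinfty_lin; exact: clin_id|exact: Cinfty_cst].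
exact: Cinfty_Df.
Qed.

Lemma dsn_slice j d s : U d ->
  hasD (fun t : R^o => dsn j (d, t)) s (1 : R^o) (dsn j.+1 (d, s)).
Proof.
move=> Ud; have := @Cinfty_hasD _ _ _ UT (dsn j) (d, s) ((0 : D), (1 : R^o)) hX oUT (Cinfty_dsn j) (conj Ud I).
by apply: dnbhs0_eq_cvg => h h0; congr (_ *: (dsn j (_, _) - _)); rewrite /= scaler0 addr0.
Qed.

Lemma derive1n_dsn j d : U d -> derive1n j (T d) = (fun s => dsn j (d, s)).
Proof.
move=> Ud; elim: j => [|j IH]; first by apply/funext => s; rewrite /= TH.
by rewrite derive1nS IH; apply/funext => s; have [] := hasD_derivable (@dsn_slice j d s Ud).
Qed.

Lemma exp_law_cont d0 : U d0 -> {for d0, continuous T}.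
Proof.
move=> Ud0; apply: cvg_flat => j e e0.
have nU : nbhs d0 U by apply: open_nbhs_nbhs.
suff H1 : \forall d \near d0, forall s, 0 <= s <= 2 * pi -> `|dsn j (d, s) - dsn j (d0, s)| < e.
  by apply: filterS2 nU H1 => d Ud Hd s s2; rewrite !derive1n_dsn //; exact: Hd.
apply: tube_lemma => s _.
have cj := Cinfty_cont (Cinfty_dsn j) (conj Ud0 I : UT (d0, s)).
have e20 : 0 < e / 2 by rewrite divr_gt0.
move/cvgrPdist_lt: cj => /(_ _ e20)[[A B] /= [nA nB] AB].
exists (B, A) => //= -[s' t] [/= Bs At].
have h1 := AB (t, s') (conj At Bs).
have h2 := AB (d0, s') (conj (nbhs_singleton nA) Bs).
rewrite [e]splitr distrC (le_lt_trans (ler_distD (dsn j (d0, s)) _ _)) // ltrD //.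
by rewrite distrC.
Qed.

(** The partial derivative of [H] along [D] at [p.1.1] in the direction [p.1.2]. It is the uncurried
    form of the expected derivative of [T], which allows the exponential law to be iterated. *)
Definition dK (p : (D * D) * R^o) : X := Df H ((p.1.1, p.2), (p.1.2, (0 : R^o))).

Let L (p : (D * D) * R^o) : (D * R^o) * (D * R^o) := ((p.1.1, p.2), (p.1.2, 0)).
Let cL : clin L.
Proof.
apply: clin_pair; apply: clin_pair.
- by apply: (@clin_comp _ _ _ _ fst fst); exact: clin_fst.
- exact: clin_snd.
- by apply: (@clin_comp _ _ _ _ fst snd); [exact: clin_fst|exact: clin_snd].
- exact: clin_zero.
Qed.

Let U2 : set (D * D)%type := U `*` setT.
Let oU2 : open U2. Proof. exact: open_setXT. Qed.

Lemma Cinfty_DfL (f : D * R^o -> X) : Cinfty UT f -> Cinfty (U2 `*` setT) (Df f \o L).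
Proof.
move=> Cf; apply: (@Cinfty_comp _ _ _ _ _ (UT `*` setT)).
- exact: open_setXT.
- exact: open_setXT.
- by move=> [[d v] s] [[/= Ud _] _].
- exact: Cinfty_lin.
- exact: Cinfty_Df.
Qed.

Lemma Cinfty_dK : Cinfty (U2 `*` setT) dK.
Proof. exact: Cinfty_DfL. Qed.

(** By symmetry of second derivatives, differentiation in [s] commutes with differentiation along
    [D]. *)
Lemma derive1n_dK j d v : U d ->
  derive1n j (fun s => dK ((d, v), s)) = (fun s => Df (dsn j) ((d, s), (v, (0 : R^o)))).
Proof.
move=> Ud; elim: j => [//|j IH].
rewrite derive1nS IH; apply/funext => s.
have oU2T : open (U2 `*` [set: R^o]) by exact: open_setXT.
have UdvS : (U2 `*` [set: R^o]) ((d, v), s) by [].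
have C := @Cinfty_hasD _ _ _ (U2 `*` [set: R^o]) (Df (dsn j) \o L) ((d, v), s) ((0 : D * D), (1 : R^o)) hX oU2T (Cinfty_DfL (Cinfty_dsn j)) UdvS.
have [_ E] : derivable (fun s => Df (dsn j) ((d, s), (v, (0 : R^o)))) s 1 /\
    derive1 (fun s => Df (dsn j) ((d, s), (v, (0 : R^o)))) s = Df (Df (dsn j) \o L) (((d, v), s), ((0 : D * D), (1 : R^o))).
  apply: hasD_derivable; apply: dnbhs0_eq_cvg C => h h0.
  have LE : L (((d, v), s : R^o) + h *: ((0 : D * D), (1 : R^o))) = ((d, s + h *: (1 : R^o)), (v, 0)).
    by rewrite /L /= !scaler0 !addr0.
  by rewrite /comp LE.
rewrite E; have Ck j' : Ck 2 UT (dsn j') by exact: Cinfty_dsn.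
have UTd : UT (d, s) := conj Ud I.
have oUTT : open (UT `*` [set: (D * R^o)%type]) by exact: open_setXT.
have CD := Cinfty_Df hX oUT (Cinfty_dsn j).
rewrite /=.
have -> : Df (Df (dsn j) \o L) (((d, v), s), ((0 : D * D), (1 : R^o))) =
    Df (Df (dsn j)) (L ((d, v), s), L ((0 : D * D), (1 : R^o))).
  have HL : hasD L ((d, v), s : R^o) ((0 : D * D), (1 : R^o)) (L ((0 : D * D), (1 : R^o))) by exact: hasD_lin.
  have HH := @hasD_comp _ _ _ _ (UT `*` setT) L (Df (dsn j)) ((d, v), s : R^o) _ _ hX oUTT (CD 1%N) (conj UTd I) HL.
  exact: (hasD_Df hX HH).
rewrite /L /= (Df_sym _ _ hX oUT (Ck j) UTd).
apply/esym; apply: (hasD_Df hX).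
apply: (@hasD_comp _ _ _ _ (UT `*` setT) (fun p => (p, ((0 : D), (1 : R^o)))) (Df (dsn j)) (d, s) (v, 0 : R^o)
   ((v, 0 : R^o), (0 : D * R^o)) hX oUTT (CD 1%N) (conj UTd I)).
apply: hasD_pair; first by apply: hasD_lin; exact: clin_id.
apply: (@dnbhs0_eq_cvg _ _ _ (fun=> 0 : D * R^o)); last exact: cvg_cst.
by move=> h _; rewrite subrr scaler0.
Qed.

Lemma dsn_near0 (f g : D -> X) d v : U d -> (forall d, U d -> f d = g d) ->
  Df f (d, v) = Df g (d, v).
Proof.
move=> Ud fg; apply: Df_near; apply: filterS (open_nbhs_nbhs (conj oU Ud)) => y.
exact: fg.
Qed.

Lemma Df_slice j d v s : U d ->
  Df (dsn j) ((d, s), (v, (0 : R^o))) = Df (fun d' => dsn j (d', s)) (d, v).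
Proof.
move=> Ud; apply/esym; apply: hasD_Df => //.
have := @Cinfty_hasD _ _ _ UT (dsn j) (d, s) (v, (0 : R^o)) hX oUT (Cinfty_dsn j) (conj Ud I).
by apply: dnbhs0_eq_cvg => h h0; congr (_ *: (dsn j (_, _) - _)); rewrite /= scaler0 addr0.
Qed.

Lemma Df_cst0 (d v : D) : Df (fun _ : D => 0 : X) (d, v) = 0.
Proof.
apply: hasD_Df => //; apply: (@dnbhs0_eq_cvg _ _ _ (fun=> 0 : X)); last exact: cvg_cst.
by move=> h _; rewrite subrr scaler0.
Qed.

(** The conditions on a flat curve are linear and hold for every nearby [T d'], hence they pass to
    the derivative in [d]. *)
Lemma dK_flat d v : U d -> flat_vcurve kappa (fun s => dK ((d, v), s)).
Proof.
move=> Ud.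
have KE s : dK ((d, v), s) = Df (fun d' => H (d', s)) (d, v) by exact: (@Df_slice 0%N d v s).
split.
- apply: (wraps_pointwise (U := U) (H := fun d' s => H (d', s))).
    by move=> s s' E; rewrite !KE; apply: dsn_near0.
  move=> d' Ud'; have -> : (fun s => H (d', s)) = T d' by apply/funext => s; rewrite TH.
  exact: flat_wraps.
- rewrite KE (@dsn_near0 _ (fun=> 0) d v Ud) ?Df_cst0 // => d' Ud'.
  by rewrite -TH //; have [] := flat_vectP (T d').
- move=> k s; apply: (@Cinfty_derivable _ setT) => //; first exact: openT.
  apply: (@Cinfty_comp _ _ _ _ _ (U2 `*` setT) (fun t : R^o => ((d, v), t)) dK) => //.
  + exact: openT.
  + exact: open_setXT.
  + by apply: Cinfty_pair; [exact: Cinfty_cst|apply: Cinfty_lin; exact: clin_id].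
  exact: Cinfty_dK.
move=> s fs k; rewrite derive1n_dK // Df_slice //.
rewrite (@dsn_near0 _ (fun=> 0) d v Ud) ?Df_cst0 // => d' Ud'.
have := derive1n_dsn k.+1 Ud' => /(congr1 (fun f => f s)) <-.
by have [_ _ _] := flat_vectP (T d'); exact.
Qed.

Definition dT (p : D * D) : V := mk_flat kappa (fun s => dK (p, s)).

Lemma dTE p s : U2 p -> dT p s = dK (p, s).
Proof. by case: p => d v [/= Ud _]; rewrite mk_flatE //; exact: dK_flat. Qed.

(** Convergence in [V] means uniform convergence of every [s]-derivative. Strict differentiability
    of [dsn j] gives it locally in [s], and the tube lemma makes it uniform on [[0, 2 * pi]]. *)
Lemma exp_law_hasD d v : U d -> hasD T d v (dT (d, v)).
Proof.
move=> Ud; apply: cvg_flat => j e e0.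
have nU : nbhs d U by apply: open_nbhs_nbhs.
have nUh : \forall h \near (0 : R)^', U (d + h *: v) := @cvg_dnbhs_line _ _ d v _ nU.
suff H1 : \forall h \near (0 : R)^', forall s, 0 <= s <= 2 * pi ->
    `|h^-1 *: (dsn j (d + h *: v, s) - dsn j (d, s)) - Df (dsn j) ((d, s), (v, (0 : R^o)))| < e.
  apply: filterS2 nUh H1 => h Uh Hh s s2.
  rewrite flat_vectZ flat_vectB !derive1n_dsn //.
  have -> : flat_fun (dT (d, v)) = (fun s => dK ((d, v), s)) by apply/funext => t; rewrite dTE.
  by rewrite derive1n_dK //; exact: Hh.
apply: tube_lemma => s _.
pose FF := filter_prod (nbhs s) (0 : R)^'.
have UTd : UT (d, s) := conj Ud I.
have c1 : (fun p : R * R => p.2) @ FF --> (0 : R).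
  by apply: cvg_trans cvg_snd _; exact: cvg_within.
have cs : (fun p : R * R => p.1) @ FF --> s by exact: cvg_fst.
have c2 : (fun p : R * R => (d, p.1 : R^o)) @ FF --> (d, s : R^o).
  by have := cvg_pair (@cvg_cst _ d _ FF _) cs; exact.
have c3 : \forall p \near FF, p.2 != 0 :> R.
  by exists (setT, [set h | h != 0]); [split; [exact: filterT|exact: dnbhs0_neq]|case=> ? ? []].
have Q := @Ck1_quot _ _ _ hX UT (dsn j) (d, s) (v, 0 : R^o) oUT (Cinfty_dsn j 1%N) UTd _ FF _
  (fun p => p.2) (fun p => (d, p.1 : R^o)) _ c1 c2 (cvg_cst _) c3.
have CD := Cinfty_cont (Cinfty_Df hX oUT (Cinfty_dsn j)) (conj UTd I : (UT `*` setT) ((d, s), (v, 0 : R^o))).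
have c4 : (fun p : R * R => Df (dsn j) ((d, p.1 : R^o), (v, 0 : R^o))) @ FF --> Df (dsn j) ((d, s), (v, 0 : R^o)).
  apply: (@cvg_comp _ _ _ (fun p : R * R => ((d, p.1 : R^o), (v, 0 : R^o))) (Df (dsn j)) FF
    (nbhs ((d, s : R^o), (v, 0 : R^o)))) => //.
  by have := cvg_pair c2 (@cvg_cst _ (v, 0 : R^o) _ FF _); exact.
have := tvs_cvgB (Q _ _) c4; rewrite subrr => /(_ _ _ _) /cvgrPdist_lt /(_ _ e0).
apply: filterS => -[t h]; rewrite sub0r normrN /= => E; apply: le_lt_trans E.
have -> : (d, t : R^o) + h *: (v, 0 : R^o) = (d + h *: v, t : R^o).
  by congr (_, _); rewrite /= scaler0 addr0.
by [].
Qed.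

End OneMap.

(** The derivative of [T] is curried from [dK H], to which the same hypotheses apply over the
    tangent directions of [U]; so the order of differentiability grows by induction. *)
Theorem exp_law (D : tvsType R) (U : set D) (H : D * R^o -> X) (T : D -> V) :
  open U -> Cinfty (U `*` setT) H -> (forall d s, U d -> T d s = H (d, s)) ->
  Cinfty U T.
Proof.
move=> oU CH TH k; elim: k D U H T oU CH TH => [|k IH] D U H T oU CH TH.
  by split=> // d Ud; exact: (exp_law_cont oU CH TH Ud).
apply/CkSE; split; first by move=> d Ud; exact: (exp_law_cont oU CH TH Ud).
exists (dT H); split; first by move=> d v; exact: (exp_law_hasD oU CH TH).
apply: (IH _ _ (dK H)).
- exact: open_setXT.
- exact: (Cinfty_dK oU CH).
by move=> p s; exact: (dTE oU CH TH).
Qed.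

End ExponentialLaw.

Section Evaluation.
Variable n : nat.
Local Notation X := 'rV[R]_n.
Local Notation V := (flat_vect R Path n).

Lemma derive1nS_cst (c : X) k (s : R) : derive1n k.+1 (fun=> c) s = 0.
Proof.
rewrite derive1Sn; have -> : derive1 (fun=> c) = (0 : R -> X).
  by apply/funext => t; rewrite derive1_cst.
by rewrite derive1n_cst0.
Qed.

Lemma path_le0 (f : V) s : s <= 0 -> f s = 0.
Proof.
move=> s0; have [wf f0 _ _] := flat_vectP f; rewrite wf.
rewrite [Num.min _ _]min_l; last by rewrite (le_trans s0) // pi_ge0.
by rewrite max_l.
Qed.

Lemma path_gepi (f : V) s : pi <= s -> f s = f pi.
Proof.
move=> ps; have [wf f0 _ _] := flat_vectP f; rewrite wf.
by rewrite [Num.min _ _]min_r // max_r // pi_ge0.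
Qed.

Lemma path_derive_le0 (f : V) k s : s <= 0 -> derive1n k f s = 0.
Proof.
rewrite le_eqVlt => /predU1P[->|s0].
  have [_ f0 _ fl] := flat_vectP f.
  by case: k => [//|k]; apply: fl; left.
have nz : \forall t \near s, f t = (0 : R -> X) t.
  near=> t; rewrite path_le0 //; apply: ltW; near: t.
  exact: lt_nbhsl.
by rewrite (nbhs_singleton (derive1n_near k nz)) derive1n_cst0.
Unshelve. all: by end_near. Qed.

Lemma path_derive_gepi (f : V) k s : pi <= s -> derive1n k.+1 f s = 0.
Proof.
rewrite le_eqVlt => /predU1P[<-|ps].
  have [_ f0 _ fl] := flat_vectP f; apply: fl; by right.
have nz : \forall t \near s, f t = (fun=> f pi) t.
  near=> t; rewrite path_gepi //; apply: ltW; near: t.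
  exact: lt_nbhsr.
by rewrite (nbhs_singleton (derive1n_near k.+1 nz)) derive1nS_cst.
Unshelve. all: by end_near. Qed.

Lemma path_derive_bound (f : V) j s : `|derive1n j f s| <= Ck_norm j f.
Proof.
have [s0|s0] := leP s 0; first by rewrite path_derive_le0 // normr0 Ck_norm_ge0.
have [sp|ps] := leP s pi.
  by apply: le_Ck_norm => //; rewrite ltW //= (le_trans sp) // ler_peMl ?ler1n // pi_ge0.
case: j => [|j]; last by rewrite (path_derive_gepi f j (ltW ps)) normr0 Ck_norm_ge0.
rewrite /= (path_gepi f (ltW ps)); apply: (@le_Ck_norm _ _ _ 0 f 0 pi) => //.
by rewrite pi_ge0 ler_peMl ?ler1n // pi_ge0.
Qed.

Let evn j (p : V * R^o) : X := derive1n j p.1 p.2.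

Let evn_cont j p : {for p, continuous (evn j)}.
Proof.
case: p => f s; apply/cvgrPdist_lt => e e0.
have e20 : 0 < e / 2 by rewrite divr_gt0.
have cf : {for s, continuous (derive1n j f)}.
  by apply: differentiable_continuous; apply/derivable1_diffP; exact: flat_vect_derivable.
move/cvgrPdist_lt: cf => /(_ _ e20) nB.
exists (flat_ball f j (e / 2), [set t : R | `|derive1n j f s - derive1n j f t| < e / 2]).
  by split=> //; exact: nbhs_flat_ball.
move=> [g t] [/= gf ts]; rewrite /evn /= [e]splitr.
rewrite (le_lt_trans (ler_distD (derive1n j f t) _ _)) // ltrD //.
rewrite -normrN opprB -flat_vectB.
exact: le_lt_trans (path_derive_bound _ _ _) gf.
Qed.

Let evn_hasD j f (s : R^o) g (t : R^o) :
  hasD (evn j) (f, s) (g, t) (evn j (g, s) + t *: evn j.+1 (f, s)).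
Proof.
have c1 : (fun h : R => derive1n j g (s + h *: t)) @ (0 : R)^' --> evn j (g, s).
  apply: (@cvg_comp _ _ _ (fun h : R => s + h *: t) (derive1n j g) _ (nbhs s)); first exact: cvg_dnbhs_line.
  by apply: differentiable_continuous; apply/derivable1_diffP; exact: flat_vect_derivable.
have c2 := @derivable_hasD _ _ s t (@flat_vect_derivable _ _ _ f j s).
have := tvs_cvgD c1 c2 => /(_ _ _); apply: dnbhs0_eq_cvg => h h0.
rewrite [evn j (_ + _)](flat_vectD j f (h *: g) (s + h *: t)) flat_vectZ /evn /=.
by rewrite addrAC scalerDr scalerA mulVf // scale1r [LHS]addrC.
Qed.

(** The derivative of the [j]-th derivative of [f] at [s], taken in the direction [(g, t)], involves
    the next derivative of [f], so evaluations of all orders are handled at once. *)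
Lemma ev_Cinfty : Cinfty setT (fun p : V * R^o => flat_fun p.1 p.2).
Proof.
move=> k; suff: forall j, Ck k setT (evn j) by move/(_ 0%N).
elim: k => [|k IH] j; first by split=> // p _; exact: evn_cont.
apply/CkSE; split; first by move=> p _; exact: evn_cont.
exists (fun q => evn j (q.2.1, q.1.2) + q.2.2 *: evn j.+1 q.1); split.
  by move=> [f s] [g t] _; exact: evn_hasD.
have oT : open [set: ((V * R^o) * (V * R^o))%type] by exact: openT.
have c11 := @clin_fst R (V * R^o)%type (V * R^o)%type.
have c12 := @clin_snd R (V * R^o)%type (V * R^o)%type.
apply: (@Ck_sub _ _ _ _ setT) => //; apply: Ck_add => //.
  apply: (@Ck_comp _ _ _ _ _ _ setT (fun q : (V * R^o) * (V * R^o) => (q.2.1, q.1.2)) (evn j)) => //.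
  - exact: openT.
  - apply: Ck_lin; apply: clin_pair.
      exact: (clin_comp c12 (@clin_fst _ V R^o)).
    exact: (clin_comp c11 (@clin_snd _ V R^o)).
apply: (@Ck_comp _ _ _ _ _ _ setT (fun q : (V * R^o) * (V * R^o) => (q.2.2 : R^o, evn j.+1 q.1))
  (fun p : R^o * X => p.1 *: p.2)) => //; first exact: openT.
  apply: Ck_pair; first by apply: Ck_lin; exact: (clin_comp c12 (@clin_snd _ V R^o)).
  exact: (Ck_precomp c11 (IH j.+1)).
exact: Ck_bil (@cbil_scale X).
Qed.

Lemma clin_ev (s : R) : clin (fun f : V => flat_fun f s).
Proof.
split=> // f; apply: (@continuous_comp _ _ _ (fun f : V => (f, s : R^o)) (fun p : V * R^o => flat_fun p.1 p.2)).
  by apply: cts_pair; [exact: cvg_id|exact: cst_continuous].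
exact: (Cinfty_cont ev_Cinfty).
Qed.

End Evaluation.

End CurveCalculus.

(** * Smooth maps into manifolds and flat curves in Lie groups *)

Section SmoothPlots.
Context {R : realType}.

(** Smoothness of a plot on a neighbourhood of [x], tested in every chart around [f x]. Existence of
    a chart is part of the definition, because an atlas such as [flat_atlas] covers only a subset of
    its type. *)
Definition smat (D E : tvsType R) M (A : atlas E M) (f : D -> M) (x : D) :=
  (exists c, A c /\ chart_dom c (f x)) /\
  forall c, A c -> chart_dom c (f x) -> exists W,
    [/\ open W, W x, forall v, W v -> chart_dom c (f v) &
        Cinfty W (chart_map c \o f)].

Definition atlas_inj (E : tvsType R) M (A : atlas E M) :=
  forall c, A c -> {in chart_cod c &, injective (chart_par c)}.

Lemma chart_mapP (E : tvsType R) M (c : chart E M) x : chart_dom c x ->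
  chart_cod c (chart_map c x) /\ chart_par c (chart_map c x) = x.
Proof.
move=> [u cu ux].
exact: (@xgetPex _ 0 [set u | chart_cod c u /\ chart_par c u = x] (ex_intro _ u (conj cu ux))).
Qed.

Lemma chart_map_par (E : tvsType R) M (c : chart E M) u :
  {in chart_cod c &, injective (chart_par c)} -> chart_cod c u ->
  chart_map c (chart_par c u) = u.
Proof.
move=> ci cu; have [cu' E'] := chart_mapP (ex_intro2 _ _ u cu erefl : chart_dom c (chart_par c u)).
by apply: ci => //; apply/mem_set.
Qed.

Lemma chart_map_eq (E : tvsType R) M (c : chart E M) u x :
  {in chart_cod c &, injective (chart_par c)} -> chart_cod c u ->
  chart_par c u = x -> chart_map c x = u.
Proof. by move=> ci cu <-; exact: chart_map_par. Qed.

(** The derivatives found locally need not be restrictions of one function; the canonical [Df] glues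
    them. *)
Lemma Cinfty_local (E F : tvsType R) (U : set E) (f : E -> F) : hausdorff_space F ->
  (forall x, U x -> exists W, [/\ open W, W x & Cinfty W f]) -> Cinfty U f.
Proof.
move=> hF loc k; elim: k E U f loc => [|k IH] E U f loc.
  by split=> // x /loc[W [_ Wx CW]]; exact: Cinfty_cont CW Wx.
apply/CkSE; split; first by move=> x /loc[W [_ Wx CW]]; exact: Cinfty_cont CW Wx.
exists (Df f); split.
  by move=> x v /loc[W [oW Wx CW]]; exact: (@Cinfty_hasD _ _ _ W f x v hF oW CW Wx).
apply: IH => -[x v] [/= /loc[W [oW Wx CW]] _].
by exists (W `*` setT); split=> //; [exact: open_setXT|exact: Cinfty_Df].
Qed.

Lemma preim_open (E F : tvsType R) (W : set E) (O : set F) (f : E -> F) :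
  open W -> open O -> Cinfty W f -> open (W `&` f @^-1` O).
Proof.
move=> oW oO Cf; rewrite openE => x [Wx Ox].
apply: filterI; first by apply: open_nbhs_nbhs.
by apply: (Cinfty_cont Cf Wx); apply: open_nbhs_nbhs.
Qed.

(** [smooth_map] offers some pair of charts only; a transition map brings the target into the
    prescribed chart [d']. Both smoothness and flatness of composites rest on this local form. *)
Lemma smooth_repr (D E F : tvsType R) M N (A : atlas E M) (B : atlas F N)
    (S : set M) (f : D -> M) (g : M -> N) (x : D) d' :
  atlas_inj B ->
  (forall c d u, B c -> B d -> chart_cod c u -> chart_dom d (chart_par c u) ->
        smooth_in_charts c d id u) ->
  smat A f x -> smooth_map A B S g -> S (f x) -> B d' -> chart_dom d' (g (f x)) ->
  exists c W O (G : E -> F), [/\ A c /\ chart_dom c (f x), open W /\ W x, open O,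
    (forall v, W v -> [/\ O (chart_map c (f v)), chart_dom d' (g (f v)) &
       chart_map d' (g (f v)) = G (chart_map c (f v))]) &
    Cinfty W (chart_map c \o f) /\ Cinfty O G].
Proof.
move=> iB tB [_ fs] gs Sfx Bd' d'x.
have [c [d [Ac Bd cfx [W2 [oW2 W2u W2c W2d CW2]]]]] := gs _ Sfx.
have [W1 [oW1 W1x W1c CW1]] := fs c Ac cfx.
have [cu uE] := chart_mapP cfx.
have dgfx : chart_dom d (g (f x)) by rewrite -uE; exact: W2d.
have [du duE] := chart_mapP dgfx.
have d'du : chart_dom d' (chart_par d (chart_map d (g (f x)))) by rewrite duE.
have [W3 [oW3 W3u W3d W3d' CW3]] := tB _ _ _ Bd Bd' du d'du.
pose P := chart_map d \o g \o chart_par c.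
pose O := W2 `&` P @^-1` W3.
have oO : open O by exact: preim_open.
pose W := W1 `&` (chart_map c \o f) @^-1` O.
have oW : open W by exact: preim_open.
have par v : W v -> [/\ W2 (chart_map c (f v)), W3 (chart_map d (g (f v))),
    chart_par c (chart_map c (f v)) = f v & chart_par d (chart_map d (g (f v))) = g (f v)].
  move=> [W1v [W2v W3v]]; have [cv cvE] := chart_mapP (W1c v W1v).
  have dv : chart_dom d (g (f v)) by rewrite -cvE; exact: W2d.
  have [_ dvE] := chart_mapP dv.
  by split=> //; move: W3v; rewrite /P /= cvE.
exists c, W, O, (chart_map d' \o chart_par d \o P); split=> //.
- split=> //; split=> //; split=> //=; rewrite /P /= uE //.
- move=> v Wv; have [W2v W3v cvE dvE] := par v Wv; split.
  + by split=> //; rewrite /P /= cvE.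
  + by rewrite -dvE; exact: W3d'.
  by rewrite /P /= cvE dvE.
split; first by apply: Cinfty_sub CW1 => v [].
apply: (@Cinfty_comp _ _ _ _ O W3 P) => //; first by move=> v [].
by apply: Cinfty_sub CW2 => v [].
Qed.

Lemma smat_comp_gen (D E F : tvsType R) M N (A : atlas E M) (B : atlas F N)
    (S : set M) (f : D -> M) (g : M -> N) (x : D) :
  atlas_inj B ->
  (forall c d u, B c -> B d -> chart_cod c u -> chart_dom d (chart_par c u) ->
        smooth_in_charts c d id u) ->
  smat A f x -> smooth_map A B S g -> S (f x) -> smat B (g \o f) x.
Proof.
move=> iB tB fs gs Sfx; split.
  have [c [d [Ac Bd cfx [W2 [oW2 W2u W2c W2d CW2]]]]] := gs _ Sfx.
  by exists d; split=> //=; have [cu uE] := chart_mapP cfx; rewrite -uE; exact: W2d.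
move=> d' Bd' d'x.
have [c [W [Q [G [[Ac cx] [oW Wx] oO WO [CW CO]]]]]] := smooth_repr iB tB fs gs Sfx Bd' d'x.
exists W; split=> //; first by move=> v /WO[].
apply: (@Cinfty_ext _ _ _ _ (G \o (chart_map c \o f))) => //.
  by move=> v /WO[_ _ /= ->].
by apply: (@Cinfty_comp _ _ _ _ W Q) => // v /WO[].
Qed.

Lemma smat_near (D E : tvsType R) M (A : atlas E M) (f g : D -> M) (x : D) :
  (\forall y \near x, f y = g y) -> smat A f x -> smat A g x.
Proof.
move=> fg [ex all]; have E0 := nbhs_singleton fg.
split=> [|c Ac]; rewrite -E0 // => cx.
have [W [oW Wx Wc CW]] := all c Ac cx.
have [Q [oO Ox OE]] : exists O, [/\ open O, O x & O `<=` [set y | f y = g y]].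
  by move: fg; rewrite /prop_near1 nbhsE => -[Q [oO Ox] OE]; exists Q.
exists (W `&` Q); split=> //; first exact: openI.
  by move=> v [Wv /OE <-]; exact: Wc.
apply: (@Cinfty_ext _ _ _ _ (chart_map c \o f)); first exact: openI.
  by move=> v [_ /OE /= ->].
by apply: Cinfty_sub CW => v [].
Qed.

Lemma smat_precomp (D' D E : tvsType R) M (A : atlas E M) (f : D -> M)
    (U : set D') (h : D' -> D) y : open U -> U y -> Cinfty U h ->
  smat A f (h y) -> smat A (f \o h) y.
Proof.
move=> oU Uy Ch [ex all]; split=> // c Ac cx.
have [W [oW Wx Wc CW]] := all c Ac cx.
exists (U `&` h @^-1` W); split=> //; first exact: preim_open.
  by move=> v [_ /Wc].
apply: (@Cinfty_comp _ _ _ _ _ W h (chart_map c \o f)) => //; first exact: preim_open.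
  by move=> v [].
by apply: Cinfty_sub Ch => v [].
Qed.

Lemma chart_map_prod (E F : tvsType R) M N (c : chart E M) (d : chart F N) x y :
  {in chart_cod c &, injective (chart_par c)} ->
  {in chart_cod d &, injective (chart_par d)} ->
  chart_dom c x -> chart_dom d y ->
  chart_map (prod_chart c d) (x, y) = (chart_map c x, chart_map d y).
Proof.
move=> ci di cx dy; have [cu cE] := chart_mapP cx; have [du dE] := chart_mapP dy.
apply: chart_map_eq => //=; last by rewrite cE dE.
move=> [a b] [a' b'] /set_mem[/= ca db] /set_mem[/= ca' db'] [/= E1 E2].
by congr (_, _); [apply: ci|apply: di] => //; exact/mem_set.
Qed.

Lemma smat_pair (D E F : tvsType R) M N (A : atlas E M) (B : atlas F N)
    (f : D -> M) (g : D -> N) (x : D) : atlas_inj A -> atlas_inj B ->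
  smat A f x -> smat B g x -> smat (prod_atlas A B) (fun y => (f y, g y)) x.
Proof.
move=> iA iB [[c [Ac cx]] fs] [[d [Bd dx]] gs]; split.
  exists (prod_chart c d); split; first by exists c, d.
  by case: cx => u cu uE; case: dx => v dv vE; exists (u, v) => //=; rewrite uE vE.
move=> _ [c' [d' [Ac' Bd' ->]]] [[u v] [/= cu dv] [uE vE]].
have [W1 [oW1 W1x W1c CW1]] := fs c' Ac' (ex_intro2 _ _ u cu uE).
have [W2 [oW2 W2x W2c CW2]] := gs d' Bd' (ex_intro2 _ _ v dv vE).
exists (W1 `&` W2); split=> //; first exact: openI.
  move=> y [/W1c[u' cu' uE'] /W2c[v' dv' vE']].
  by exists (u', v') => //=; rewrite uE' vE'.
apply: (@Cinfty_ext _ _ _ _ (fun y => (chart_map c' (f y), chart_map d' (g y)))).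
- exact: openI.
- by move=> y [/W1c cy /W2c dy]; rewrite /= chart_map_prod //; [exact: iA|exact: iB].
apply: Cinfty_pair; first by apply: Cinfty_sub CW1 => y [].
by apply: Cinfty_sub CW2 => y [].
Qed.

Section OnManifold.
Variables (E : tvsType R) (M : choiceType) (A : atlas E M).
Hypothesis mA : manifold A.

Lemma manifold_inj : atlas_inj A.
Proof. by have [H _ _ _] := mA; move=> c /H[]. Qed.

Lemma manifold_trans c d u : A c -> A d ->
  chart_cod c u -> chart_dom d (chart_par c u) -> smooth_in_charts c d id u.
Proof. by have [_ _ H _] := mA; exact: H. Qed.

Lemma manifold_cov x : exists c, A c /\ chart_dom c x.
Proof.
have [_ H _ _] := mA; have : [set: M] x by [].
by rewrite -H => -[c Ac cx]; exists c.
Qed.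

Lemma smat_comp (D F : tvsType R) N (B : atlas F N)
    (S : set N) (f : D -> N) (g : N -> M) (x : D) :
  smat B f x -> smooth_map B A S g -> S (f x) -> smat A (g \o f) x.
Proof. exact: smat_comp_gen manifold_inj manifold_trans. Qed.

Lemma smat_par (D : tvsType R) c (W : set D) (z : D -> E) x : A c -> open W -> W x ->
  Cinfty W z -> (forall y, W y -> chart_cod c (z y)) ->
  smat A (chart_par c \o z) x.
Proof.
move=> Ac oW Wx Cz Wc; split; first exact: manifold_cov.
have ci := manifold_inj Ac.
move=> c' Ac' c'x; have [W' [oW' W'x W'c W'c' CW']] := manifold_trans Ac Ac' (Wc _ Wx) c'x.
exists (W `&` z @^-1` W'); split=> //; first exact: preim_open.
  by move=> y [_ /W'c'].
apply: (@Cinfty_comp _ _ _ _ _ W' z (chart_map c' \o chart_par c)) => //; first exact: preim_open.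
  by move=> v [].
by apply: Cinfty_sub Cz => v [].
Qed.

Lemma smat_of_chart (D : tvsType R) c (W : set D) (f : D -> M) x : A c -> open W -> W x ->
  (forall y, W y -> chart_dom c (f y)) -> Cinfty W (chart_map c \o f) ->
  smat A f x.
Proof.
move=> Ac oW Wx Wc CW; apply: (@smat_near _ _ _ _ (chart_par c \o (chart_map c \o f))).
  apply: filterS (open_nbhs_nbhs (conj oW Wx)) => y /Wc cy /=.
  by have [] := chart_mapP cy.
by apply: (@smat_par _ c W) => // y Wy; have [] := chart_mapP (Wc y Wy).
Qed.

Lemma smat_cst (D : tvsType R) (m : M) (x : D) : smat A (fun=> m) x.
Proof.
have [c [Ac cm]] := manifold_cov m.
apply: (@smat_of_chart _ c setT) => //; first exact: openT.
exact: Cinfty_cst.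
Qed.

Lemma manifold_openP (Q : set M) :
  open (Q : set (manifold_top A)) <-> manifold_open A Q.
Proof.
split=> [oQ c u Ac cu Qu|oQ].
  have : nbhs (chart_par c u : manifold_top A) Q by apply: open_nbhs_nbhs.
  by move=> [B [oB Bu BQ]]; apply: (filterS _ (oB c u Ac cu Bu)) => v /BQ.
by rewrite openE => p Qp; exists Q; split.
Qed.

Lemma chart_dom_open c : A c -> open (chart_dom c : set (manifold_top A)).
Proof.
move=> Ac; apply/manifold_openP => c' u Ac' cu dc.
have [W [oW Wu _ Wc _]] := manifold_trans Ac' Ac cu dc.
by apply: filterS (open_nbhs_nbhs (conj oW Wu)).
Qed.

Lemma smat_continuous (D : tvsType R) (f : D -> M) x : smat A f x ->
  {for x, continuous (f : D -> manifold_top A)}.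
Proof.
move=> [[c [Ac cx]] fs] O; rewrite nbhsE => -[Q [/manifold_openP oO' O'x] O'O].
have [W [oW Wx Wc CW]] := fs c Ac cx.
have [cu uE] := chart_mapP cx.
have := oO' c _ Ac cu; rewrite uE => /(_ O'x) nO.
have nW := open_nbhs_nbhs (conj oW Wx).
have := Cinfty_cont CW Wx nO => nO2.
change (nbhs x (f @^-1` O)).
apply: filterS2 nW nO2 => y Wy /= O'y; have [_ yE] := chart_mapP (Wc y Wy).
by apply: O'O; rewrite -yE.
Qed.

End OnManifold.

Section OnGroup.
Variables (E : tvsType R) (G : groupType) (A : atlas E G).
Hypothesis lA : lie_group A.

Lemma lie_manifold : manifold A. Proof. by case: lA. Qed.

Lemma smat_mul (D : tvsType R) (f g : D -> G) x : smat A f x -> smat A g x ->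
  smat A (fun y => f y * g y)%g x.
Proof.
move=> fs gs; have [_ sm _] := lA; have iA := manifold_inj lie_manifold.
exact: (smat_comp lie_manifold (smat_pair iA iA fs gs) sm).
Qed.

Lemma smat_inv (D : tvsType R) (f : D -> G) x : smat A f x ->
  smat A (fun y => (f y)^-1)%g x.
Proof. by move=> fs; have [_ _ si] := lA; exact: (smat_comp lie_manifold fs si). Qed.

End OnGroup.

(** * Flatness of curves under smooth maps *)

Section FlatGerms.

(** Iterated derivatives of a curve in any locally convex space. The recursion differentiates the
    curve first, unlike that of [derive1n], to match the induction of [dcn_comp_flat]. *)
Fixpoint dcn (E : tvsType R) (k : nat) (x : R^o -> E) : R^o -> E :=
  if k is k'.+1 then dcn k' (fun s => Df x (s, (1 : R^o))) else x.

Lemma dcn_ext (E : tvsType R) k (W : set R^o) (x y : R^o -> E) : open W ->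
  (forall s, W s -> x s = y s) -> forall s, W s -> dcn k x s = dcn k y s.
Proof.
move=> oW; elim: k x y => [|k IH] x y xy s Ws /=; first exact: xy.
apply: IH => // t Wt; apply: Df_near.
exact: filterS (open_nbhs_nbhs (conj oW Wt)).
Qed.

Lemma Cinfty_deriv (E : tvsType R) (W : set R^o) (x : R^o -> E) :
  hausdorff_space E -> open W -> Cinfty W x ->
  Cinfty W (fun s => Df x (s, (1 : R^o))).
Proof.
move=> hE oW Cx.
apply: (@Cinfty_comp _ _ _ _ _ (W `*` setT) (fun s : R^o => (s, 1 : R^o))) => //.
- exact: open_setXT.
- by apply: Cinfty_pair; [apply: Cinfty_lin; exact: clin_id|exact: Cinfty_cst].
exact: Cinfty_Df.
Qed.

Lemma dcn_pair (E F : tvsType R) k (W : set R^o) (x : R^o -> E) (y : R^o -> F) :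
  hausdorff_space E -> hausdorff_space F ->
  open W -> Cinfty W x -> Cinfty W y -> forall s, W s ->
  dcn k (fun s => (x s, y s)) s = (dcn k x s, dcn k y s).
Proof.
move=> hE hF oW; elim: k x y => [//|k IH] x y Cx Cy s Ws /=.
rewrite -IH //; try exact: Cinfty_deriv.
apply: (@dcn_ext _ k W) => // t Wt.
apply: hasD_Df; first exact: hausdorff_prod.
by apply: hasD_pair; [exact: (@Cinfty_hasD _ _ _ W x t _ hE oW Cx Wt)|exact: (@Cinfty_hasD _ _ _ W y t _ hF oW Cy Wt)].
Qed.

(** No formula for higher derivatives of composites is needed: the derivative of [f \o x] is [Df f]
    along the curve [(x, x')], which is flat at [s] whenever [x] is, so the order drops by one. *)
Lemma dcn_comp_flat (E F : tvsType R) (W : set R^o) (Q : set E) (x : R^o -> E)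
    (f : E -> F) s k : hausdorff_space E -> hausdorff_space F ->
  open W -> open Q -> Cinfty W x -> Cinfty Q f -> W s ->
  (forall t, W t -> Q (x t)) -> (forall k, dcn k.+1 x s = 0) ->
  dcn k.+1 (f \o x) s = 0.
Proof.
move=> hE hF oW; elim: k E hE Q x f => [|k IH] E hE Q x f oQ Cx Cf Ws WQ x0.
  rewrite /= (@Df_comp _ _ _ _ W Q _ _ _ _ hE hF oW oQ (Cx 1%N) (Cf 1%N) Ws (WQ _ Ws)).
  by have /= -> := x0 0%N; rewrite (@Df0 _ _ _ hF Q _ _ oQ (Cf 1%N) (WQ _ Ws)).
pose x' t := Df x (t, (1 : R^o)).
have Cx' : Cinfty W x' by exact: Cinfty_deriv.
have -> : dcn k.+2 (f \o x) s = dcn k.+1 (Df f \o (fun t => (x t, x' t))) s.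
  apply: (@dcn_ext _ k.+1 W) => // t Wt.
  by rewrite /= (@Df_comp _ _ _ _ W Q _ _ _ _ hE hF oW oQ (Cx 1%N) (Cf 1%N) Wt (WQ _ Wt)).
apply: (IH _ _ (Q `*` setT)) => //.
- exact: hausdorff_prod.
- exact: open_setXT.
- exact: Cinfty_pair.
- exact: Cinfty_Df.
- by move=> t Wt; split=> //; exact: WQ.
move=> j; rewrite (@dcn_pair _ _ _ W) // x0.
by have /= -> := x0 j.+1.
Qed.

Lemma derive1n_dcn n k (W : set R^o) (x : R^o -> 'rV[R]_n) : open W -> Cinfty W x ->
  forall s, W s -> derive1n k x s = dcn k x s.
Proof.
move=> oW; elim: k x => [//|k IH] x Cx s Ws; rewrite derive1Sn /=.
rewrite -(IH _ (Cinfty_deriv (@hausdorff_normed _ _) oW Cx) s Ws).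
apply: (nbhs_singleton (derive1n_near k _)).
apply: filterS (open_nbhs_nbhs (conj oW Ws)) => t Wt.
exact: (derive1_Df oW Cx Wt).
Qed.

(** Along [F] the curve is locally constant, so its derivatives vanish there; by continuity they
    vanish at [s]. *)
Lemma derive1n_side n k (W : set R^o) (x : R^o -> 'rV[R]_n) (c : 'rV[R]_n) (s : R)
    (F : set_system R) : ProperFilter F ->
  open W -> Cinfty W x -> W s -> F --> s ->
  (\forall t \near F, \forall u \near t, x u = c) -> derive1n k.+1 x s = 0.
Proof.
move=> PF oW Cx Ws Fs xc.
have c1 : derive1n k.+1 x t @[t --> F] --> derive1n k.+1 x s.
  by apply: cvg_comp Fs _; exact: (Cinfty_cont (Cinfty_derive1n k.+1 oW Cx) Ws).
have c2 : derive1n k.+1 x t @[t --> F] --> (0 : 'rV[R]_n).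
  apply: (@cvg_trans _ ((fun=> 0 : 'rV[R]_n) @ F)); last exact: cvg_cst.
  apply: near_eq_cvg.
  apply: filterS xc => t nz; have := nbhs_singleton (derive1n_near k.+1 (nz : \forall u \near t, x u = (fun=> c) u)).
  by rewrite derive1nS_cst.
exact: (cvg_unique (@hausdorff_normed _ _) c1 c2).
Qed.

Lemma derive1n_left n k (W : set R^o) (x : R^o -> 'rV[R]_n) (c : 'rV[R]_n) (s : R) :
  open W -> Cinfty W x -> W s -> (forall t, t < s -> W t -> x t = c) ->
  derive1n k.+1 x s = 0.
Proof.
move=> oW Cx Ws xc; apply: (@derive1n_side n k W x c s s^'-) => //.
  exact: cvg_within.
near=> t; have ts : t < s by near: t; exact: nbhs_left_lt.
have Wt : W t by near: t; apply: cvg_within; exact: open_nbhs_nbhs.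
near=> u; apply: xc; near: u; first exact: lt_nbhsl.
exact: open_nbhs_nbhs.
Unshelve. all: by end_near. Qed.

Lemma derive1n_right n k (W : set R^o) (x : R^o -> 'rV[R]_n) (c : 'rV[R]_n) (s : R) :
  open W -> Cinfty W x -> W s -> (forall t, s < t -> W t -> x t = c) ->
  derive1n k.+1 x s = 0.
Proof.
move=> oW Cx Ws xc; apply: (@derive1n_side n k W x c s s^'+) => //.
  exact: cvg_within.
near=> t; have ts : s < t by near: t; exact: nbhs_right_gt.
have Wt : W t by near: t; apply: cvg_within; exact: open_nbhs_nbhs.
near=> u; apply: xc; near: u; first exact: lt_nbhsr.
exact: open_nbhs_nbhs.
Unshelve. all: by end_near. Qed.

End FlatGerms.

Definition dflat (E : tvsType R) M (A : atlas E M) (g : R^o -> M) (s : R^o) :=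
  forall c, A c -> chart_dom c (g s) -> forall k, dcn k.+1 (chart_map c \o g) s = 0.

Lemma dflat_comp (E F : tvsType R) M N (A : atlas E M) (B : atlas F N)
    (S : set M) (g : R^o -> M) (f : M -> N) s :
  hausdorff_space E -> hausdorff_space F -> atlas_inj B ->
  (forall c d u, B c -> B d -> chart_cod c u -> chart_dom d (chart_par c u) ->
        smooth_in_charts c d id u) ->
  smat A g s -> smooth_map A B S f -> S (g s) -> dflat A g s -> dflat B (f \o g) s.
Proof.
move=> hE hF iB tB gs fs Sgs gf d Bd ds k.
have [c [W [Q [H [[Ac cx] [oW Ws] oQ WQ [CW CH]]]]]] := smooth_repr iB tB gs fs Sgs Bd ds.
rewrite (@dcn_ext _ k.+1 W _ (H \o (chart_map c \o g)) oW _ _ Ws); last first.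
  by move=> t /WQ[_ _ /= ->].
apply: (@dcn_comp_flat _ _ W Q) => //; first by move=> t /WQ[].
exact: gf.
Qed.

Lemma dflat_pair (E F : tvsType R) M N (A : atlas E M) (B : atlas F N)
    (f : R^o -> M) (g : R^o -> N) s : hausdorff_space E -> hausdorff_space F ->
  atlas_inj A -> atlas_inj B -> smat A f s -> smat B g s ->
  dflat A f s -> dflat B g s -> dflat (prod_atlas A B) (fun t => (f t, g t)) s.
Proof.
move=> hE hF iA iB [_ fs] [_ gs] ff gf _ [c [d [Ac Bd ->]]] [[u v] [/= cu dv] [uE vE]] k.
have cf : chart_dom c (f s) by exists u.
have dg : chart_dom d (g s) by exists v.
have [W1 [oW1 W1x W1c CW1]] := fs c Ac cf.
have [W2 [oW2 W2x W2c CW2]] := gs d Bd dg.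
have oW := openI oW1 oW2; have Ws : (W1 `&` W2) s by [].
transitivity (dcn k.+1 (fun t => (chart_map c (f t), chart_map d (g t))) s).
  apply: (@dcn_ext _ k.+1 (W1 `&` W2)) => // t [/W1c ct /W2c dt].
  by rewrite /= chart_map_prod //; [exact: iA|exact: iB].
rewrite (@dcn_pair _ _ k.+1 (W1 `&` W2)) //; first by rewrite ff // gf.
  by apply: Cinfty_sub CW1 => t [].
by apply: Cinfty_sub CW2 => t [].
Qed.

Section FlatCurves.
Variables (n : nat) (G : groupType) (A : atlas 'rV[R]_n G).
Hypothesis lA : lie_group A.
Let mA := lie_manifold lA.
Let iA := manifold_inj mA.
Let hX : hausdorff_space 'rV[R]_n := @hausdorff_normed R _.

Lemma smooth_curveP (g : R -> G) :
  smooth_curve A g <-> forall s, smat A (g : R^o -> G) s.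
Proof.
split=> [[cg dg] s|gs].
  have [c [Ac cx]] := manifold_cov mA (g s).
  pose W : set R^o := g @^-1` chart_dom c.
  have oW : open W.
    rewrite openE => t Wt; have := cg t (chart_dom c); apply.
    by apply: open_nbhs_nbhs; split=> //; exact: chart_dom_open.
  apply: (@smat_of_chart _ _ _ mA _ c W) => //.
  by apply: derivable_Cinfty => // k t Wt; apply: dg.
split=> [s|c k s Ac cs]; first exact: (smat_continuous (gs s)).
have [_ /(_ c Ac cs)[W [oW Ws Wc CW]]] := gs s.
exact: (@Cinfty_derivable R _ W (chart_map c \o g) k s).
Qed.

Lemma flat_curvesP kappa (g : R -> G) : flat_curves A kappa g <->
  [/\ wraps kappa g, g 0 = 1%g, forall s, smat A (g : R^o -> G) s &
      forall s, flat_at kappa s -> dflat A (g : R^o -> G) s].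
Proof.
have E s c k : (forall s, smat A (g : R^o -> G) s) -> A c -> chart_dom c (g s) ->
    derive1n k.+1 (chart_map c \o g) s = dcn k.+1 (chart_map c \o g) s.
  move=> gs Ac cs; have [_ /(_ c Ac cs)[W [oW Ws Wc CW]]] := gs s.
  exact: (derive1n_dcn _ oW CW Ws).
split=> [[w g0 /smooth_curveP gs fl]|[w g0 gs fl]]; split=> //.
- by move=> s /fl sf c Ac cs k; rewrite -E // sf.
- exact/smooth_curveP.
by move=> s /fl sf c k Ac cs; rewrite E // sf.
Qed.

Lemma wraps_fun2 kappa (T S K : Type) (f : R -> T) (g : R -> S) (h : T -> S -> K) :
  wraps kappa f -> wraps kappa g -> wraps kappa (fun t => h (f t) (g t)).
Proof. by case: kappa => /= wf wg s; rewrite wf wg. Qed.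

Lemma dflat_mul (g h : R^o -> G) s : smat A g s -> smat A h s -> dflat A g s ->
  dflat A h s -> dflat A (fun t => g t * h t)%g s.
Proof.
move=> gs hs gf hf; have [_ sm _] := lA.
apply: (@dflat_comp _ _ _ _ (prod_atlas A A) A setT (fun t => (g t, h t)) (fun x => x.1 * x.2)%g) => //.
- exact: manifold_trans.
- exact: smat_pair.
by apply: dflat_pair.
Qed.

Lemma dflat_near (f g : R^o -> G) (s : R^o) : (\forall t \near s, f t = g t) ->
  dflat A f s -> dflat A g s.
Proof.
move=> fg ff c Ac cs k; have E := nbhs_singleton fg.
move: fg; rewrite /prop_near1 nbhsE => -[W [oW Ws] WE].
rewrite -(@dcn_ext _ k.+1 W (chart_map c \o f)) //; last by move=> t /WE /= ->.
by apply: ff => //; rewrite E.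
Qed.

Lemma flat_curves_mul kappa (g h : R -> G) : flat_curves A kappa g ->
  flat_curves A kappa h -> flat_curves A kappa (fun t => g t * h t)%g.
Proof.
move=> /flat_curvesP[wg g0 gs gf] /flat_curvesP[wh h0 hs hf]; apply/flat_curvesP; split.
- exact: (wraps_fun2 (fun a b => a * b)%g wg wh).
- by rewrite g0 h0 mulg1.
- by move=> s; apply: smat_mul.
by move=> s fs; apply: dflat_mul => //; [exact: gf|exact: hf].
Qed.

Lemma flat_curves_inv kappa (g : R -> G) : flat_curves A kappa g ->
  flat_curves A kappa (fun t => (g t)^-1)%g.
Proof.
move=> /flat_curvesP[wg g0 gs gf]; apply/flat_curvesP; split.
- exact: (wraps_fun2 (fun a b => a^-1)%g wg wg).
- by rewrite g0 invg1.
- by move=> s; apply: smat_inv.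
move=> s fs; have [_ _ si] := lA.
apply: (@dflat_comp _ _ _ _ A A setT g (fun x => x^-1)%g) => //; last exact: gf.
exact: manifold_trans.
Qed.

Lemma dflat_left (g : R^o -> G) s (a : G) : smat A g s -> (forall t, t < s -> g t = a) ->
  dflat A g s.
Proof.
move=> [_ gs] ga c Ac cs k; have [W [oW Ws Wc CW]] := gs c Ac cs.
rewrite -(derive1n_dcn _ oW CW Ws).
by apply: (@derive1n_left _ _ W _ (chart_map c a)) => // t ts _; rewrite /= ga.
Qed.

Lemma dflat_right (g : R^o -> G) s (a : G) : smat A g s -> (forall t, s < t -> g t = a) ->
  dflat A g s.
Proof.
move=> [_ gs] ga c Ac cs k; have [W [oW Ws Wc CW]] := gs c Ac cs.
rewrite -(derive1n_dcn _ oW CW Ws).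
by apply: (@derive1n_right _ _ W _ (chart_map c a)) => // t ts _; rewrite /= ga.
Qed.

Lemma wraps_path_le0 T (g : R -> T) t : wraps Path g -> t <= 0 -> g t = g 0.
Proof.
by move=> w t0; rewrite w [Num.min _ _]min_l ?max_l // (le_trans t0) // pi_ge0.
Qed.

Lemma wraps_path_gepi T (g : R -> T) t : wraps Path g -> pi <= t -> g t = g pi.
Proof. by move=> w pt; rewrite w [Num.min _ _]min_r // max_r // pi_ge0. Qed.

(* A path is constant on either side of [[0, pi]], so that flatness at the
   endpoints follows from smoothness. *)
Lemma PeGP (g : R -> G) : PeG A g <->
  [/\ wraps Path g, g 0 = 1%g & forall s, smat A (g : R^o -> G) s].
Proof.
rewrite /PeG; split=> [/flat_curvesP[]//|[w g0 gs]]; apply/flat_curvesP; split=> //.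
move=> s [->|->].
  by apply: (@dflat_left _ _ (g 0)) => // t t0; apply: wraps_path_le0 => //; exact: ltW.
by apply: (@dflat_right _ _ (g pi)) => // t t0; apply: wraps_path_gepi => //; exact: ltW.
Qed.

Lemma derive1n_subc k (x : R -> 'rV[R]_n) (c : 'rV[R]_n) s :
  derive1n k.+1 (fun t => x t - c) s = derive1n k.+1 x s.
Proof.
rewrite !derive1Sn; congr (derive1n k _ s); apply/funext => t.
rewrite /derive1; have -> // : (fun h => h^-1 *: (x (h + t) - c - (x t - c))) = (fun h => h^-1 *: (x (h + t) - x t)).
by apply/funext => h; rewrite opprB addrA subrK.
Qed.

Lemma flat_chart_inj kappa : atlas_inj (flat_atlas A kappa).
Proof.
move=> _ [g [c [_ Ac _ ->]]] eta eta' /set_mem ce /set_mem ce' /= E.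
apply: val_inj; apply/funext => s /=; have /(congr1 (fun f => f s)) /mulgI E' := E.
by apply: (@addrI _ (chart_map c 1%g)); apply: (iA Ac) => //; apply/mem_set; [exact: ce|exact: ce'].
Qed.

Section ExpLawGroup.
Variables (kappa : curve_kind) (D : tvsType R) (U : set D) (H : D -> R -> G).
Hypotheses (oU : open U) (Hf : forall d, U d -> flat_curves A kappa (H d))
  (Hs : forall d s, U d -> smat A (fun p : D * R^o => H p.1 p.2) (d, s)).

Lemma smat_slice (d : D) (s : R^o) (K : D * R^o -> G) : smat A K (d, s) ->
  smat A (fun t : R^o => K (d, t)) s.
Proof.
move=> Ks; apply: (@smat_precomp _ _ _ _ _ K setT (fun t : R^o => (d, t))) => //.
  exact: openT.
by apply: Cinfty_pair; [exact: Cinfty_cst|apply: Cinfty_lin; exact: clin_id].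
Qed.

Lemma smat_snd_curve (g : R -> G) (d : D) (s : R^o) : smat A (g : R^o -> G) s ->
  smat A (fun p : D * R^o => g p.2) (d, s).
Proof.
move=> gs; apply: (@smat_precomp _ _ _ _ _ (g : R^o -> G) setT (fun p : D * R^o => p.2)) => //.
  exact: openT.
by apply: Cinfty_lin; exact: clin_snd.
Qed.

Lemma tube_wraps (P : G -> Prop) (K : D -> R -> G) d0 :
  (forall d, U d -> wraps kappa (K d)) -> U d0 ->
  (forall s : R, \forall p \near (d0, s : R^o), P (K p.1 p.2)) ->
  \forall d \near d0, forall s, P (K d s).
Proof.
move=> Kw Ud0 KP.
have H1 : \forall d \near d0, forall s, 0 <= s <= 2 * pi -> P (K d s).
  apply: tube_lemma => s _; have [[B C] /= [nB nC] BC] := KP s.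
  by exists (C, B) => // -[t d] [/= Ct Bd]; exact: (BC (d, t)).
apply: filterS2 (open_nbhs_nbhs (conj oU Ud0)) H1 => d Ud Hd s.
have [s' s'2 E] := wraps_rep kappa s.
by rewrite (E _ _ (Kw d Ud)); exact: Hd.
Qed.

(** The exponential law for group-valued curves. After division by the centre [g] of the chart, the
    curves stay in one chart of [G] at the identity for all [d] near [d0] ([tube_wraps]), and there
    [exp_law] applies. *)
Theorem smat_flat d0 : U d0 -> smat (flat_atlas A kappa) H d0.
Proof.
move=> Ud0; split.
  have [c [Ac c1]] := manifold_cov mA 1%g.
  exists (flat_chart kappa (H d0) c); split; first by exists (H d0), c; split=> //; exact: Hf.
  have [cu cE] := chart_mapP c1.
  exists 0; first by move=> s /=; rewrite addr0.
  by apply/funext => s /=; rewrite addr0 cE mulg1.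
move=> _ [g [c [gf Ac c1 ->]]] [eta ce etaE].
have [_ _ gs _] := (flat_curvesP _ _).1 gf.
pose K d s := ((g s)^-1 * H d s)%g.
have Kf d : U d -> flat_curves A kappa (K d).
  by move=> Ud; apply: flat_curves_mul; [exact: flat_curves_inv|exact: Hf].
have Ks d s : U d -> smat A (fun p : D * R^o => K p.1 p.2) (d, s).
  move=> Ud; apply: (smat_mul lA); last exact: Hs.
  by apply: (smat_inv lA); apply: smat_snd_curve.
have Kw d : U d -> wraps kappa (K d) by move=> /Kf/flat_curvesP[].
have Kc0 s : chart_dom c (K d0 s).
  by exists (chart_map c 1%g + eta s); [exact: ce|rewrite /K -etaE /= mulKg].
have nW : \forall d \near d0, forall s, chart_dom c (K d s).
  apply: tube_wraps => // s; have [_ /(_ c Ac (Kc0 s))[W [oW Ws Wc _]]] := Ks d0 s Ud0.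
  by apply: filterS (open_nbhs_nbhs (conj oW Ws)) => p /Wc.
have nWU : nbhs d0 ((fun d => forall s, chart_dom c (K d s)) `&` U).
  by apply: filterI => //; exact: open_nbhs_nbhs.
move: nWU; rewrite nbhsE => -[W [oW Wd0] WP].
have Wc d s : W d -> chart_dom c (K d s) by move=> /WP[].
have WU d : W d -> U d by move=> /WP[].
pose e := chart_map c 1%g.
pose h (p : D * R^o) : 'rV[R]_n := chart_map c (K p.1 p.2) - e.
have Ch : Cinfty (W `*` setT) h.
  apply: Cinfty_add; first exact: open_setXT.
    apply: Cinfty_local => // -[d s] [/= Wd _].
    have [_ /(_ c Ac (Wc d s Wd))[Q [oQ Qs Qc CQ]]] := Ks d s (WU _ Wd).
    by exists Q.
  exact: Cinfty_cst.
have hf d : W d -> flat_vcurve kappa (fun s => h (d, s)).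
  move=> Wd; have [w K0 Ksm Kfl] := Kf d (WU d Wd); split.
  - exact: (wraps_fun2 (fun a b => chart_map c a - e) w w).
  - by rewrite /h /= K0 subrr.
  - move=> k s; apply: (@Cinfty_derivable R _ setT) => //; first exact: openT.
    apply: (@Cinfty_comp _ _ _ _ _ (W `*` setT) (fun t : R^o => (d, t)) h) => //.
    + exact: openT.
    + exact: open_setXT.
    by apply: Cinfty_pair; [exact: Cinfty_cst|apply: Cinfty_lin; exact: clin_id].
  move=> s fs k; transitivity (derive1n k.+1 (fun t => chart_map c (K d t)) s).
    exact: derive1n_subc.
  exact: (Kfl s fs c k Ac (Wc d s Wd)).
pose T d := mk_flat kappa (fun s => h (d, s)).
have TE d s : W d -> T d s = h (d, s) by move=> Wd; rewrite /T mk_flatE //; exact: hf.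
have CT : Cinfty W T by exact: exp_law Ch TE.
have TH d : W d -> chart_cod (flat_chart kappa g c) (T d) /\
    chart_par (flat_chart kappa g c) (T d) = H d.
  move=> Wd; have KE s := chart_mapP (Wc d s Wd); split=> [s|].
    by rewrite TE // /h addrCA subrr addr0; have [] := KE s.
  by apply/funext => s /=; rewrite TE // /h addrCA subrr addr0 (KE s).2 /K mulgA mulgV mul1g.
exists W; split=> //; first by move=> d /TH[cT TE']; exists (T d).
apply: (Cinfty_ext oW _ CT) => d /TH[cT TE'].
apply/esym; apply: chart_map_eq => //.
by apply: (@flat_chart_inj kappa); exists g, c.
Qed.

End ExpLawGroup.

Section Cup.
Implicit Types (h : R -> G).

Lemma cup_shift (T : groupType) (g1 g2 : R -> T) s (k : int) :
  cup g1 g2 (s + k%:~R * (2 * pi)) = cup g1 g2 s.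
Proof.
have p2 : (2 * pi : R) != 0 by rewrite gt_eqF // mulr_gt0 // pi_gt0.
have F : Num.floor ((s + k%:~R * (2 * pi)) / (2 * pi)) = Num.floor (s / (2 * pi)) + k.
  have /andP[l1 l2] := floor_itv (s / (2 * pi)).
  have -> : (s + k%:~R * (2 * pi)) / (2 * pi) = s / (2 * pi) + k%:~R.
    by rewrite [LHS](mulrDl s (k%:~R * (2 * pi))) mulfK.
  apply: floor_def; rewrite addrAC ![(_ + k)%:~R]intrD lerD2r l1 /=.
  by rewrite ltrD2r.
rewrite /cup F; set m := Num.floor _.
by have -> : s + k%:~R * (2 * pi) - (m + k)%:~R * (2 * pi) = s - m%:~R * (2 * pi) by rewrite intrD; ring.
Qed.

(** On either side of 0 one of the factors is [1]. The product formula shows smoothness across the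
    seam, which the definition by cases hides. *)
Lemma cup_near0 h s : wraps Path h -> h 0 = 1%g -> - pi <= s <= pi ->
  cup h h s = (h s * h (- s))%g.
Proof.
move=> w h0 /andP[ps sp]; have p0 := @pi_gt0 R.
have p2 : (0 : R) < 2 * pi by rewrite mulr_gt0.
have [s0|s0] := leP 0 s.
  have -> : cup h h s = h s.
    rewrite /cup (_ : Num.floor _ = 0) ?mul0r ?subr0 ?sp //.
    apply: floor_def; rewrite divr_ge0 ?(ltW p2) // add0r ltr_pdivrMr // mul1r.
    by rewrite /=; lra.
  by rewrite (wraps_path_le0 w (_ : - s <= 0)) ?oppr_le0 // h0 mulg1.
rewrite (wraps_path_le0 w (ltW s0)) h0 mul1g /cup.
rewrite (_ : Num.floor _ = -1).
  rewrite mulN1r opprK; have [l|l] := leP (s + 2 * pi) pi; last by congr (h _); lra.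
  by congr (h _); lra.
apply: floor_def; rewrite ler_pdivlMr // ltr_pdivrMr // addNr mul0r s0 andbT.
by rewrite mulN1r; lra.
Qed.

(** On either side of [pi] one of the outer factors equals [h pi] and cancels the inverse. *)
Lemma cup_nearpi h s : wraps Path h -> 0 <= s -> s < 2 * pi ->
  cup h h s = (h s * (h pi)^-1 * h (2 * pi - s))%g.
Proof.
move=> w s0 s2; have p0 := @pi_gt0 R.
have p2 : (0 : R) < 2 * pi by rewrite mulr_gt0.
rewrite /cup (_ : Num.floor _ = 0) ?mul0r ?subr0.
  have [sp|ps] := leP s pi.
    have l : pi <= 2 * pi - s by lra.
    by rewrite (wraps_path_gepi w l) -mulgA mulVg mulg1.
  by rewrite (wraps_path_gepi w (ltW ps)) mulgV mul1g.
by apply: floor_def; rewrite divr_ge0 ?(ltW p2) // add0r ltr_pdivrMr // mul1r.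
Qed.

Lemma smat_affine (D : tvsType R) (U : set D) (F : D -> R -> G) (a b : R) d (s : R^o) :
  (forall d s, U d -> smat A (fun p : D * R^o => F p.1 p.2) (d, s)) -> U d ->
  smat A (fun p : D * R^o => F p.1 (a * p.2 + b)) (d, s).
Proof.
move=> Fs Ud.
apply: (@smat_precomp _ _ _ _ _ (fun p : D * R^o => F p.1 p.2) setT
  (fun p : D * R^o => (p.1, (a * p.2 + b : R^o)))) => //; first exact: openT.
  apply: Cinfty_pair; first by apply: Cinfty_lin; exact: clin_fst.
  apply: Cinfty_add; [exact: openT| |exact: Cinfty_cst].
  by apply: Cinfty_lin; apply: (@clin_scal _ _ _ (fun p : D * R^o => p.2)); exact: clin_snd.
exact: Fs.
Qed.

Variables (D : tvsType R) (U : set D) (H : D -> R -> G).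
Hypotheses (oU : open U) (HP : forall d, U d -> PeG A (H d))
  (Hs : forall d s, U d -> smat A (fun p : D * R^o => H p.1 p.2) (d, s)).

(** A shift by a multiple of the period brings the parameter into [[0, 2 * pi[]; there each point
    has a neighbourhood on which one of the two product formulas holds for all [d] in [U]. *)
Lemma smat_cup d (s : R^o) : U d ->
  smat A (fun p : D * R^o => cup (H p.1) (H p.1) p.2) (d, s).
Proof.
move=> Ud; have p0 := @pi_gt0 R.
have p2 : (0 : R) < 2 * pi by rewrite mulr_gt0.
have HP' d' : U d' -> wraps Path (H d') /\ H d' 0 = 1%g by move=> /HP/PeGP[].
pose k := Num.floor (s / (2 * pi)); pose b := - (k%:~R * (2 * pi)) : R.
have cE d' t : cup (H d') (H d') t = cup (H d') (H d') (t + b).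
  by rewrite /b -mulNr -mulrNz cup_shift.
have nU : \forall p \near (d, s), U p.1.
  by exists (U, setT) => [|[? ?] [/=]] //; split; [exact: open_nbhs_nbhs|exact: filterT].
have ct : (fun p : D * R^o => p.2 + b) @ (d, s) --> s + b.
  by apply: (@cvgD _ R^o); [exact: cvg_snd|exact: cvg_cst].
have nst (a c : R) : a < s + b -> s + b < c -> \forall p \near (d, s), a < p.2 + b < c.
  move=> l1 l2; have nI : nbhs (s + b) `]a, c[%classic.
    by apply: open_nbhs_nbhs; split; [exact: interval_open|rewrite /= in_itv /= l1].
  have nn : nbhs (d, s) ((fun p : D * R^o => p.2 + b) @^-1` `]a, c[%classic) := ct _ nI.
  by apply: filterS nn => p; rewrite /= in_itv.
have /andP[l1 l2] := floor_itv (s / (2 * pi)).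
have sb0 : 0 <= s + b by rewrite /b subr_ge0 -ler_pdivlMr.
have sb2 : s + b < 2 * pi.
  by move: l2; rewrite ltr_pdivrMr // intrD mulrDl mul1r /b -/k => ?; lra.
have aff a c := @smat_affine D U H a c d s Hs Ud.
have [sb1|sb1] := leP (s + b) 0.
  apply: (@smat_near _ _ _ _ (fun p : D * R^o => H p.1 (1 * p.2 + b) * H p.1 ((-1) * p.2 - b))%g).
    have l3 : - pi < s + b by lra.
    have l4 : s + b < pi by lra.
    apply: filterS2 nU (nst _ _ l3 l4) => -[d' t] /= Ud' /andP[t1 t2].
    have [w h0] := HP' d' Ud'.
    by rewrite cE cup_near0 // ?(ltW t1) ?(ltW t2) // mul1r mulN1r -opprD.
  exact: (smat_mul lA).
apply: (@smat_near _ _ _ _ (fun p : D * R^o => H p.1 (1 * p.2 + b) * (H p.1 (0 * p.2 + pi))^-1 *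
    H p.1 ((-1) * p.2 + (2 * pi - b)))%g).
  apply: filterS2 nU (nst _ _ sb1 sb2) => -[d' t] /= Ud' /andP[t1 t2].
  have [w h0] := HP' d' Ud'.
  by rewrite cE cup_nearpi // ?(ltW t1) // mul1r mulN1r mul0r add0r opprD addrCA.
apply: (smat_mul lA) => //; apply: (smat_mul lA) => //.
exact: (smat_inv lA).
Qed.

Lemma cup_OmegaG d : U d -> OmegaG A (cup (H d) (H d)).
Proof.
move=> Ud; have [w h0 hs] := (PeGP _).1 (HP Ud).
have cs s : smat A (cup (H d) (H d) : R^o -> G) s.
  by apply: (@smat_slice D d s (fun p : D * R^o => cup (H p.1) (H p.1) p.2)); exact: smat_cup.
apply/flat_curvesP; split=> //.
- by move=> s /=; rewrite -[2 * pi]mul1r -[1]/(1%:~R) cup_shift.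
- by rewrite cup_near0 ?oppr0 ?h0 ?mulg1 // oppr_le0 pi_ge0.
move=> _ ->.
have hN : smat A (fun t : R^o => H d (- t)) 0.
  apply: (@smat_precomp _ _ _ _ _ (H d : R^o -> G) setT (fun t : R^o => - t)) => //.
    exact: openT.
  by apply: Cinfty_opp; [exact: openT|apply: Cinfty_lin; exact: clin_id].
(* [H d t] is constant for [t < 0] and [H d (- t)] for [t > 0], so both factors are flat at 0. *)
apply: (@dflat_near (fun t => H d t * H d (- t))%g); last first.
  apply: dflat_mul => //.
    by apply: (@dflat_left _ _ (H d 0)) => // t t0; apply: wraps_path_le0 => //; exact: ltW.
  by apply: (@dflat_right _ _ (H d 0)) => // t t0; apply: wraps_path_le0 => //; rewrite oppr_le0 ltW.
have nI : nbhs (0 : R) `]- pi, pi[%classic.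
  apply: open_nbhs_nbhs; split; first exact: interval_open.
  by rewrite /= in_itv /= oppr_lt0 pi_gt0.
apply: filterS nI => t; rewrite /= in_itv /= => /andP[t1 t2].
by rewrite cup_near0 // (ltW t1) (ltW t2).
Qed.

Lemma smat_cup_loop d : U d -> smat (flat_atlas A Loop) (fun d => cup (H d) (H d)) d.
Proof. by move=> Ud; apply: smat_flat Ud => //; [exact: cup_OmegaG|exact: smat_cup]. Qed.

End Cup.

End FlatCurves.

End SmoothPlots.
From mathcomp Require Import spectral.

(** * The Killing form and the Casimir element *)

Section ConjugatePart.
Variables (C : numClosedFieldType) (m : nat).
Local Notation N := m.+1.

Lemma coprimep_prodr (I : eqType) (s : seq I) (p : {poly C}) (P : I -> {poly C}) :
  (forall i, i \in s -> coprimep p (P i)) -> coprimep p (\prod_(i <- s) P i).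
Proof.
elim: s => [|i s IH] Ps; first by rewrite big_nil coprimep1.
rewrite big_cons coprimepMr Ps ?mem_head // IH // => j js.
by rewrite Ps // inE js orbT.
Qed.

Lemma dvdp_prod_coprime (I : eqType) (s : seq I) (r : {poly C}) (P : I -> {poly C}) :
  uniq s -> {in s &, forall i j, i != j -> coprimep (P i) (P j)} ->
  (forall i, i \in s -> P i %| r) -> \prod_(i <- s) P i %| r.
Proof.
elim: s => [|i s IH] us cs Pr; first by rewrite big_nil dvd1p.
move: us => /= /andP[nis us]; rewrite big_cons Gauss_dvdp.
  rewrite Pr ?mem_head // IH // => [j k js ks|j js]; first by apply: cs; rewrite inE ?js ?ks orbT.
  by rewrite Pr // inE js orbT.
apply: coprimep_prodr => j js; apply: cs; rewrite ?mem_head // ?inE ?js ?orbT //.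
by apply: contraNneq nis => ->.
Qed.

(** The Chinese remainder theorem. Evaluated at a matrix, the [e i] become the projections to its
    generalised eigenspaces. *)
Lemma crt_poly (I : eqType) (s : seq I) (P : I -> {poly C}) :
  uniq s -> {in s &, forall i j, i != j -> coprimep (P i) (P j)} ->
  exists e : I -> {poly C}, forall i, i \in s ->
    P i %| e i - 1 /\ forall j, j \in s -> j != i -> P j %| e i.
Proof.
move=> us cs.
have /choice[e He] : forall i, exists p : {poly C}, i \in s ->
    P i %| p - 1 /\ forall j, j \in s -> j != i -> P j %| p.
  move=> i; have [is_|nis] := boolP (i \in s); last by exists 0.
  pose Q := \prod_(j <- s | j != i) P j.
  have : coprimep (P i) Q.
    rewrite /Q -big_filter; apply: coprimep_prodr => j; rewrite mem_filter => /andP[ji js].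
    by apply: cs => //; rewrite eq_sym.
  move=> /Bezout_eq1_coprimepP[[u v] /= uv]; exists (v * Q) => _; split.
    by rewrite -uv opprD addrCA subrr addr0 dvdpNr dvdp_mull.
  move=> j js ji; apply: dvdp_mull; rewrite /Q (big_rem j) //= ji.
  exact: dvdp_mulr.
by exists e.
Qed.

Lemma trig_mul n (S T : 'M[C]_n) : (forall i j : 'I_n, (i < j)%N -> S i j = 0) ->
  (forall i j : 'I_n, (i < j)%N -> T i j = 0) ->
  (forall i j : 'I_n, (i < j)%N -> (S *m T) i j = 0) /\
  forall i, (S *m T) i i = S i i * T i i.
Proof.
move=> S0 T0; split=> [i j ij|i]; rewrite mxE.
  apply: big1 => k _; have [ik|ki] := ltnP i k; first by rewrite S0 // mul0r.
  by rewrite T0 ?mulr0 // (leq_ltn_trans ki).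
rewrite (bigD1 i) //= big1 ?addr0 // => k ki.
move: ki; rewrite neq_ltn => /orP[ki|ik]; first by rewrite T0 // mulr0.
by rewrite S0 // mul0r.
Qed.

Lemma trig_horner (T : 'M[C]_N) (p : {poly C}) :
  (forall i j : 'I_N, (i < j)%N -> T i j = 0) ->
  (forall i j : 'I_N, (i < j)%N -> horner_mx T p i j = 0) /\
  forall i, horner_mx T p i i = p.[T i i].
Proof.
move=> T0; elim/poly_ind: p => [|p c [IH1 IH2]].
  by rewrite rmorph0; split=> [i j _|i]; rewrite !mxE ?horner0.
rewrite rmorphD rmorphM /= horner_mx_X horner_mx_C.
have [M1 M2] := trig_mul IH1 T0.
split=> [i j ij|i]; rewrite mxE.
  have -> : (horner_mx T p * T) i j = 0 := M1 i j ij; rewrite !mxE.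
  by rewrite -val_eqE /= ltn_eqF // addr0.
have -> : (horner_mx T p * T) i i = _ := M2 i.
by rewrite mxE eqxx mulr1n IH2 hornerMXaddC.
Qed.

Variable A : 'M[C]_N.

Local Notation shiftmx l := (A - l%:M).

Lemma horner_shift (l : C) k : horner_mx A (('X - l%:P) ^+ k) = shiftmx l ^+ k.
Proof. by rewrite rmorphXn rmorphB /= horner_mx_X horner_mx_C. Qed.

Lemma horner_mulmx (p q : {poly C}) :
  horner_mx A (p * q) = horner_mx A p *m horner_mx A q.
Proof. exact: rmorphM. Qed.

Lemma horner_dvd0 (p q : {poly C}) k (v : 'M[C]_(k, N)) :
  p %| q -> v *m horner_mx A p = 0 -> v *m horner_mx A q = 0.
Proof.
by move=> /dvdpP[r ->] vp; rewrite mulrC horner_mulmx mulmxA vp mul0mx.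
Qed.

(* [q] interpolates complex conjugation on the spectrum, so that [q(A)] is the
   conjugate of the semisimple part of [A]. *)
Theorem conjugate_part : exists (rs : seq C) (e : C -> {poly C}) (q : {poly C}),
  [/\ forall (v : 'rV[C]_N), v = \sum_(l <- rs) v *m horner_mx A (e l),
      forall (v : 'rV[C]_N) l, l \in rs -> v *m horner_mx A (e l) *m shiftmx l ^+ N = 0,
      forall nu k (v : 'rV[C]_N), v *m shiftmx nu ^+ k = 0 ->
        v *m horner_mx A q = nu^* *: v &
      \tr (A *m horner_mx A q) = 0 -> A ^+ N = 0].
Proof.
have [P Pu PA] := @Schur C N A isT.
have Pinv : P \in unitmx by exact: unitarymx_unit.
pose T := conjmx P A.
have TrT : is_trig_mx T by [].
have T0 : forall i j : 'I_N, (i < j)%N -> T i j = 0 by exact/is_trig_mxP.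
have hTA p : horner_mx T p = conjmx P (horner_mx A p).
  by apply: horner_mx_conj; rewrite ?row_free_unit ?stablemx_unit.
have cj B : conjmx P B = P *m B *m invmx P by rewrite conjumx.
have cj0 B : conjmx P B = 0 -> B = 0.
  rewrite cj => /(congr1 (fun M => invmx P *m M *m P)).
  by rewrite !mulmxA mulVmx // mul1mx mulmxKV // mulmx0 mul0mx.
pose chi := \prod_(i < N) ('X - (T i i)%:P).
have chiA : horner_mx A chi = 0.
  by apply: cj0; rewrite -hTA /chi -char_poly_trig // Cayley_Hamilton.
pose rs := undup [seq T i i | i : 'I_N].
have rsT i : T i i \in rs by rewrite mem_undup; apply: map_f; rewrite mem_enum.
(* The exponent [N] is at least every multiplicity, so that [chi] divides the product of the
   [Q l]. *)
pose Q (l : C) := ('X - l%:P) ^+ N.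
have chiQ : chi %| \prod_(l <- rs) Q l.
  rewrite prodrXl /chi -[X in _ ^+ X]card_ord -prodr_const.
  elim/big_ind2: _ => [|p1 p2 q1 q2|i _]; [by rewrite dvd1p|exact: dvdp_mul|].
  by rewrite (big_rem (T i i)) ?rsT //= dvdp_mulr.
have copQ : {in rs &, forall i j, i != j -> coprimep (Q i) (Q j)}.
  move=> i j _ _ ij; apply: coprimep_expl; apply: coprimep_expr.
  by rewrite coprimep_XsubC root_XsubC eq_sym.
have urs : uniq rs := undup_uniq _.
have [e He] := crt_poly urs copQ.
have kill p : (forall l, l \in rs -> Q l %| p) -> horner_mx A p = 0.
  move=> Qp; have := @horner_dvd0 chi p _ 1%:M; rewrite !mul1mx; apply=> //.
  exact: dvdp_trans chiQ (dvdp_prod_coprime urs copQ Qp).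
have dec (v : 'rV[C]_N) : v = \sum_(l <- rs) v *m horner_mx A (e l).
  rewrite -mulmx_sumr -[in LHS](mulmx1 v); congr (_ *m _).
  apply/eqP; rewrite eq_sym -subr_eq0; apply/eqP.
  have -> : \sum_(l <- rs) horner_mx A (e l) - 1%:M = horner_mx A (\sum_(l <- rs) e l - 1).
    by rewrite rmorphB rmorph_sum /= [X in _ = _ - X](rmorph1 (horner_mx A)).
  apply: kill => l lrs; rewrite (big_rem l) //= addrAC.
  apply: dvdp_add; first by have [] := He l lrs.
  rewrite big_seq; elim/big_ind: _ => [|p1 p2 d1 d2|k]; [exact: dvdp0|exact: dvdp_add|].
  rewrite mem_rem_uniq // inE => /andP[kl krs].
  by have [_] := He k krs; apply; rewrite // eq_sym.
have killQ (v : 'rV[C]_N) l : l \in rs -> v *m horner_mx A (e l) *m shiftmx l ^+ N = 0.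
  move=> lrs; rewrite -horner_shift -mulmxA -horner_mulmx kill ?mulmx0 // => k krs.
  have [->|kl] := eqVneq k l; first exact: dvdp_mull.
  by apply: dvdp_mulr; have [_] := He l lrs; apply.
pose q := \sum_(l <- rs) (l^*)%:P * e l.
have qv (v : 'rV[C]_N) : v *m horner_mx A q = \sum_(l <- rs) l^* *: (v *m horner_mx A (e l)).
  rewrite rmorph_sum mulmx_sumr; apply: eq_bigr => l _.
  by rewrite /= horner_mulmx horner_mx_C mul_scalar_mx scalemxAr.
exists rs, e, q; split=> //.
- move=> nu k v vk.
  have off l : l \in rs -> l != nu -> v *m horner_mx A (e l) = 0.
    move=> lrs lnu; pose w := v *m horner_mx A (e l).
    have w1 : w *m horner_mx A (Q l) = 0 by rewrite horner_shift; exact: killQ.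
    have w2 : w *m horner_mx A (('X - nu%:P) ^+ k) = 0.
      by rewrite /w -mulmxA -horner_mulmx mulrC horner_mulmx mulmxA horner_shift vk mul0mx.
    have : coprimep (Q l) (('X - nu%:P) ^+ k).
      by apply: coprimep_expl; apply: coprimep_expr; rewrite coprimep_XsubC root_XsubC eq_sym.
    move=> /Bezout_eq1_coprimepP[[a b] /= ab].
    rewrite -/w -[w]mulmx1 -[1%:M](rmorph1 (horner_mx A)) -ab rmorphD mulmxDr.
    by rewrite (horner_dvd0 _ w1) ?(horner_dvd0 _ w2) ?addr0 // dvdp_mull.
  rewrite qv {2}[v]dec scaler_sumr big_seq [RHS]big_seq; apply: eq_bigr => l lrs.
  by have [->//|lnu] := eqVneq l nu; rewrite off // !scaler0.
have qe l : l \in rs -> q.[l] = l^*.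
  move=> lrs; rewrite /q horner_sum (big_rem l) //= hornerM hornerC.
  have ev p c : Q c %| p -> p.[c] = 0.
    by move=> /dvdpP[r ->]; rewrite hornerM horner_exp !hornerE subrr expr0n /= mulr0.
  have -> : (e l).[l] = 1.
    by have [/ev + _] := He l lrs; rewrite hornerD hornerN hornerC => /eqP; rewrite subr_eq0 => /eqP.
  rewrite mulr1 big_seq big1 ?addr0 // => k; rewrite mem_rem_uniq // inE => /andP[kl krs].
  by rewrite hornerM (ev (e k)) ?mulr0 //; have [_] := He k krs; apply; rewrite // eq_sym.
move=> tr0.
(* In triangular form [A *m horner_mx A q] has the squared moduli of the eigenvalues on its
   diagonal; if their sum is 0, all eigenvalues vanish. *)
have T00 i : T i i = 0.
  have [H1 H2] := trig_horner q T0.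
  have [_ M2] := trig_mul T0 H1.
  have : \sum_(i < N) `|T i i| ^+ 2 = 0.
    rewrite -[RHS]tr0.
    have -> : \tr (A *m horner_mx A q) = \tr (T *m horner_mx T q).
      rewrite hTA /T !cj !mulmxA mulmxKV // -!(mulmxA P).
      by rewrite [RHS]mxtrace_mulC mulmxKV.
    by apply: eq_bigr => j _; rewrite M2 H2 qe // normCK.
  move=> /eqP; rewrite psumr_eq0 => [/allP/(_ i (mem_index_enum _))|j _]; last exact: exprn_ge0.
  by rewrite expf_eq0 /= normr_eq0 => /eqP.
have : horner_mx A chi = A ^+ N.
  rewrite /chi (eq_bigr (fun=> 'X)) => [|i _]; last by rewrite T00 subr0.
  by rewrite prodr_const card_ord rmorphXn /= horner_mx_X.
by rewrite chiA.
Qed.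

End ConjugatePart.

(** * Engel's theorem, Cartan's criterion and the Casimir element *)

Section KillingForm.
Variables (R : rcfType) (m : nat).
Local Notation n := m.+1.
Variable br : 'rV[R]_n -> 'rV[R]_n -> 'rV[R]_n.
Hypothesis brDl : forall x y z, br (x + y) z = br x z + br y z.
Hypothesis brZl : forall a x z, br (a *: x) z = a *: br x z.
Hypothesis brC : forall x y, br x y = - br y x.
Hypothesis jacobi : forall x y z, br x (br y z) = br (br x y) z + br y (br x z).

Let e i : 'rV[R]_n := delta_mx 0 i.
Let brDr x y z : br x (y + z) = br x y + br x z.
Proof. by rewrite brC brDl opprD -!brC. Qed.
Let brZr a x y : br x (a *: y) = a *: br x y.
Proof. by rewrite brC brZl -scalerN -brC. Qed.

Definition adm x : 'M[R]_n := \matrix_i br x (e i).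

Lemma admE x y : y *m adm x = br x y.
Proof.
have br0 : br x 0 = 0 by rewrite -[0 in LHS](scale0r (0 : 'rV[R]_n)) brZr scale0r.
rewrite {2}[y]row_sum_delta (big_morph (br x) (brDr x) br0) mulmx_sum_row.
by apply: eq_bigr => i _; rewrite rowK brZr.
Qed.

Lemma adm_inj_rows k (M P : 'M[R]_(n, k)) : (forall v : 'rV_n, v *m M = v *m P) -> M = P.
Proof. by move=> H; apply/row_matrixP => i; rewrite !rowE H. Qed.

Lemma admD x y : adm (x + y) = adm x + adm y.
Proof. by apply: adm_inj_rows => v; rewrite mulmxDr !admE brDl. Qed.
Lemma admZ a x : adm (a *: x) = a *: adm x.
Proof. by apply: adm_inj_rows => v; rewrite -scalemxAr !admE brZl. Qed.
Lemma adm0 : adm 0 = 0.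
Proof. by rewrite -[0 in LHS](scale0r (0 : 'rV[R]_n)) admZ scale0r. Qed.
Lemma adm_sum (I : Type) (r : seq I) (P : pred I) F :
  adm (\sum_(i <- r | P i) F i) = \sum_(i <- r | P i) adm (F i).
Proof. exact: (big_morph adm admD adm0). Qed.
(** Row vectors are acted on from the right, which reverses the order in the commutator. *)
Lemma adm_br x y : adm (br x y) = adm y *m adm x - adm x *m adm y.
Proof.
apply: adm_inj_rows => v; rewrite mulmxBr !mulmxA !admE jacobi addrK //.
Qed.

Definition killing x y := \tr (adm x *m adm y).

Lemma killingC x y : killing x y = killing y x.
Proof. exact: mxtrace_mulC. Qed.
Lemma killingDl x y z : killing (x + y) z = killing x z + killing y z.
Proof. by rewrite /killing admD mulmxDl mxtraceD. Qed.
Lemma killingZl a x z : killing (a *: x) z = a * killing x z.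
Proof. by rewrite /killing admZ -scalemxAl mxtraceZ. Qed.
Lemma killingDr x y z : killing x (y + z) = killing x y + killing x z.
Proof. by rewrite killingC killingDl !(killingC x). Qed.
Lemma killingZr a x z : killing x (a *: z) = a * killing x z.
Proof. by rewrite killingC killingZl killingC. Qed.
Lemma killing_sumr x (I : Type) (r : seq I) (P : pred I) F :
  killing x (\sum_(i <- r | P i) F i) = \sum_(i <- r | P i) killing x (F i).
Proof.
apply: (big_morph (killing x) (killingDr x)).
by rewrite -[X in killing x X](scale0r (0 : 'rV[R]_n)) killingZr mul0r.
Qed.
Lemma killing_suml x (I : Type) (r : seq I) (P : pred I) F :
  killing (\sum_(i <- r | P i) F i) x = \sum_(i <- r | P i) killing (F i) x.
Proof. by rewrite killingC killing_sumr; apply: eq_bigr => i _; exact: killingC. Qed.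

Lemma killing_inv x y z : killing (br x y) z = killing x (br y z).
Proof.
rewrite /killing !adm_br mulmxBl mulmxBr !mxtraceD !raddfN /= !mulmxA.
by rewrite -(mulmxA (adm y)) (mxtrace_mulC (adm y)).
Qed.

Definition gram : 'M[R]_n := \matrix_(i, j) killing (e i) (e j).

Lemma gramE x i : (x *m gram) 0 i = killing x (e i).
Proof.
rewrite {2}[x]row_sum_delta killing_suml mxE; apply: eq_bigr => j _.
by rewrite killingZl mxE.
Qed.

Lemma sub_rad x : (x <= kermx gram)%MS <-> forall y, killing x y = 0.
Proof.
split=> [/sub_kermxP xg y|xy]; last first.
  by apply/sub_kermxP/rowP => i; rewrite gramE xy mxE.
rewrite [y]row_sum_delta killing_sumr big1 // => i _.
by rewrite killingZr -gramE xg mxE mulr0.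
Qed.

Definition mx_lideal (J : 'M[R]_n) := forall x y, (y <= J)%MS -> (br x y <= J)%MS.

Definition brmx (J : 'M[R]_n) : 'M[R]_n :=
  (\sum_(p : 'I_n * 'I_n) <<br (row p.1 J) (row p.2 J)>>)%MS.

Lemma sub_brmx J x y : (x <= J)%MS -> (y <= J)%MS -> (br x y <= brmx J)%MS.
Proof.
move=> /submxP[a ->] /submxP[b ->].
rewrite -admE (mulmx_sum_row b) mulmx_suml; apply: summx_sub => j _.
rewrite -scalemxAl scalemx_sub // (mulmx_sum_row a) adm_sum mulmx_sumr.
apply: summx_sub => i _; rewrite admZ -scalemxAr scalemx_sub // admE.
by apply: (sumsmx_sup (i, j)) => //=; rewrite genmxE.
Qed.

Lemma brmx_ind J (P : 'rV[R]_n -> Prop) : P 0 -> (forall a x y, P x -> P y -> P (a *: x + y)) ->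
  (forall x y, (x <= J)%MS -> (y <= J)%MS -> P (br x y)) ->
  forall x, (x <= brmx J)%MS -> P x.
Proof.
move=> P0 PD Pbr x /sub_sumsmxP[u ->].
elim/big_ind: _ => [//|y z Py Pz|p _]; first by rewrite -[y]scale1r; exact: PD.
have : (u p *m <<br (row p.1 J) (row p.2 J)>> <= br (row p.1 J) (row p.2 J))%MS.
  by rewrite (submx_trans (submxMl _ _)) // genmxE.
move=> /sub_rVP[a ->]; rewrite -[_ *: _]addr0; apply: PD => //.
by apply: Pbr; exact: row_sub.
Qed.

Section Engel.
Variable J : 'M[R]_n.
Hypothesis nilJ : forall x, (x <= J)%MS -> adm x ^+ n = 0.

(** Engel's theorem for [L] acting on [W] modulo [U], stated without forming a quotient. Induction
    on the rank of [L]: a maximal proper subalgebra [L0] annihilates some [y] of [L] modulo [L0],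
    hence [L] is spanned by [L0] and [y]. It also annihilates some [w] of [W] modulo [U], and the
    powers of [ad y] do the rest. *)
Lemma engel (L U W : 'M[R]_n) : (L <= J)%MS ->
  (forall x y, (x <= L)%MS -> (y <= L)%MS -> (br x y <= L)%MS) ->
  (forall x y, (x <= L)%MS -> (y <= U)%MS -> (br x y <= U)%MS) ->
  (forall x y, (x <= L)%MS -> (y <= W)%MS -> (br x y <= W)%MS) ->
  ~~ (W <= U)%MS ->
  exists w, [/\ (w <= W)%MS, ~~ (w <= U)%MS & forall x, (x <= L)%MS -> (br x w <= U)%MS].
Proof.
move: {2}(\rank L) (leqnn (\rank L)) => r.
elim: r L U W => [|r IH] L U W rL LJ Lsub LU LW WU.
  have L0 : L = 0 by apply/eqP; rewrite -mxrank_eq0 -leqn0.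
  have /row_subPn[i iU] := WU.
  exists (row i W); split=> //; first exact: row_sub.
  move=> x; rewrite L0 submx0 => /eqP ->.
  by rewrite -admE adm0 mulmx0 sub0mx.
have [->|Ln0] := eqVneq L 0.
  have /row_subPn[i iU] := WU.
  exists (row i W); split=> //; first exact: row_sub.
  move=> x; rewrite submx0 => /eqP ->.
  by rewrite -admE adm0 mulmx0 sub0mx.
pose S (L0 : 'M[R]_n) := [/\ (L0 <= L)%MS, (\rank L0 < \rank L)%N &
  forall x y, (x <= L0)%MS -> (y <= L0)%MS -> (br x y <= L0)%MS].
pose Q k := `[< exists L0, S L0 /\ \rank L0 = k >].
have exQ : exists k, Q k.
  exists 0%N; apply/asboolP; exists 0; split; last exact: mxrank0.
  split; [exact: sub0mx|by rewrite mxrank0 lt0n mxrank_eq0|].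
  move=> x y; rewrite !submx0 => /eqP -> _.
  by rewrite -admE adm0 mulmx0.
have bQ k : Q k -> (k <= \rank L)%N by move=> /asboolP[L0 [[_ /ltnW lr _] <-]].
have [k /asboolP[L0 [[L0L rL0 L0sub] L0k]] kmax] := ex_maxnP exQ bQ.
have rL0r : (\rank L0 <= r)%N by rewrite -ltnS (leq_trans rL0).
have L0J := submx_trans L0L LJ.
have LL0 : ~~ (L <= L0)%MS.
  by apply/negP => /mxrankS; rewrite leqNgt rL0.
have [||y [yL yL0 L0y]] := IH L0 L0 L rL0r L0J L0sub _ _ LL0.
- by [].
- by move=> x z xL0 zL; apply: Lsub => //; exact: submx_trans L0L.
pose L1 := (L0 + <<y>>)%MS.
have L1L : (L1 <= L)%MS by rewrite addsmx_sub L0L genmxE.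
have L1P x : (x <= L1)%MS -> exists l t, (l <= L0)%MS /\ x = l + t *: y.
  move=> /sub_addsmxP[[u v] /= ->]; exists (u *m L0).
  have /sub_rVP[t ->] : (v *m <<y>> <= y)%MS by rewrite (submx_trans (submxMl _ _)) // genmxE.
  by exists t; rewrite submxMl.
have L1E : (L <= L1)%MS.
  apply/negPn/negP => LL1.
  have rL1 : (\rank L1 < \rank L)%N.
    rewrite ltn_neqAle mxrankS // andbT; apply: contraNneq LL1 => rE.
    by have := mxrank_leqif_sup L1L; rewrite rE => -[_ /esym]; rewrite eqxx.
  have /kmax : Q (\rank L1).
    apply/asboolP; exists L1; split=> //; split=> // x z /L1P[l [t [lL0 ->]]] /L1P[l' [t' [l'L0 ->]]].
    have yy : br y y = 0.
      have /eqP := brC y y; rewrite -addr_eq0 -mulr2n -scaler_nat scaler_eq0 pnatr_eq0 /=.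
      by move=> /eqP.
    rewrite brDl !brDr !brZl !brZr yy !scaler0 addr0.
    apply: (submx_trans _ (addsmxSl L0 _)).
    have yl : (br y l' <= L0)%MS by rewrite brC eqmx_opp L0y.
    apply: addmx_sub; last exact: scalemx_sub.
    by apply: addmx_sub; [exact: L0sub|apply: scalemx_sub; exact: L0y].
  rewrite -L0k leqNgt => /negP; apply.
  rewrite ltn_neqAle mxrankS ?addsmxSl // andbT.
  apply: contraNneq yL0 => rE.
  have : (L1 <= L0)%MS.
    by have := mxrank_leqif_sup (addsmxSl L0 <<y>>%MS); rewrite -/L1 rE => -[_ /esym]; rewrite eqxx.
  by apply: submx_trans; rewrite (submx_trans _ (addsmxSr _ _)) // genmxE.
have L0U x z : (x <= L0)%MS -> (z <= U)%MS -> (br x z <= U)%MS.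
  by move=> xL; apply: LU; exact: submx_trans L0L.
have L0W x z : (x <= L0)%MS -> (z <= W)%MS -> (br x z <= W)%MS.
  by move=> xL; apply: LW; exact: submx_trans L0L.
have [w [wW wU L0w]] := IH L0 U W rL0r L0J L0sub L0U L0W WU.
(* All [v k'] are annihilated by [L0] modulo [U]; the last one outside [U] is annihilated by [y] as
   well. *)
pose v k' := w *m adm y ^+ k'.
have vS k' : v k'.+1 = br y (v k') by rewrite /v exprSr -mulmxE mulmxA admE.
have vP k' : (v k' <= W)%MS /\ forall x, (x <= L0)%MS -> (br x (v k') <= U)%MS.
  elim: k' => [|k' [IH1 IH2]]; first by rewrite /v expr0 mulmx1.
  rewrite vS; split=> [|x xL0]; first exact: LW.
  rewrite jacobi addmx_sub ?IH2 ?L0y //.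
  by apply: LU => //; exact: IH2.
have exv : exists k', (v k' <= U)%MS.
  by exists n; rewrite /v nilJ ?mulmx0 ?sub0mx // (submx_trans yL).
have [[|k'] vkU kmin] := ex_minnP exv.
  by move: vkU; rewrite /v expr0 mulmx1 (negbTE wU).
exists (v k'); have [vW L0v] := vP k'; split=> //.
  by apply/negP => /kmin; rewrite ltnn.
move=> x /submx_trans/(_ L1E)/L1P[l [t [lL0 ->]]].
by rewrite brDl brZl addmx_sub ?L0v // scalemx_sub // -vS.
Qed.

End Engel.

Local Notation C := (R[i]).
Local Notation toC := (@real_complex R).
Local Notation mC := (map_mx toC).

(** The complex-linear extension of [adm], needed because the generalised eigenspaces of [adm x]
    live over the complex numbers. *)
Let admC (w : 'rV[C]_n) : 'M[C]_n := \sum_i w 0 i *: mC (adm (e i)).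
Let brCx (u v : 'rV[C]_n) : 'rV[C]_n := v *m admC u.

Let admC_map x : admC (mC x) = mC (adm x).
Proof.
rewrite {2}[x]row_sum_delta adm_sum raddf_sum; apply: eq_bigr => i _.
by rewrite /= admZ map_mxZ mxE.
Qed.
Let admCD u v : admC (u + v) = admC u + admC v.
Proof. by rewrite -big_split; apply: eq_bigr => i _; rewrite mxE scalerDl. Qed.
Let admCZ a u : admC (a *: u) = a *: admC u.
Proof. by rewrite scaler_sumr; apply: eq_bigr => i _; rewrite mxE scalerA. Qed.
Let admC0 : admC 0 = 0.
Proof. by rewrite -[0 in LHS](scale0r (0 : 'rV[C]_n)) admCZ scale0r. Qed.

Let span_ind (P : 'rV[C]_n -> Prop) : P 0 -> (forall a x y, P x -> P y -> P (a *: x + y)) ->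
  (forall i, P (mC (e i))) -> forall x, P x.
Proof.
move=> P0 PD Pe x; rewrite [x]row_sum_delta; elim/big_ind: _ => [//|y z Py Pz|i _].
  by rewrite -[y]scale1r; exact: PD.
by rewrite -[_ *: _]addr0; apply: PD => //; have := Pe i; rewrite /e map_delta_mx.
Qed.

Let admC_br u v : admC (brCx u v) = admC v *m admC u - admC u *m admC v.
Proof.
rewrite /brCx; move: v; elim/span_ind: u => [v|a x y IHx IHy v|i].
- by rewrite admC0 !mulmx0 mul0mx subrr admC0.
- rewrite admCD admCZ !mulmxDr !mulmxDl -!scalemxAr -!scalemxAl admCD admCZ IHx IHy.
  by rewrite scalerBr opprD addrACA.
elim/span_ind => [|a x y IHx IHy|j].
- by rewrite mul0mx admC0 mulmx0 mul0mx subrr.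
- rewrite !admCD !admCZ !mulmxDr !mulmxDl -!scalemxAr -!scalemxAl admCD admCZ IHx IHy.
  by rewrite scalerBr opprD addrACA.
by rewrite !admC_map -map_mxM admC_map admE adm_br map_mxB !map_mxM.
Qed.

Section Nilpotent.
Variables (J : 'M[R]_n) (x : 'rV[R]_n).
Hypothesis Jrad : forall z, (z <= J)%MS -> forall y, killing z y = 0.
Hypothesis xJ : (x <= brmx J)%MS.

Let A := admC (mC x).

Let A_der u v : brCx u v *m A = brCx (u *m A) v + brCx u (v *m A).
Proof.
rewrite {2}/brCx -[u *m A]/(brCx (mC x) u) admC_br -/A mulmxBr !mulmxA /brCx.
by rewrite subrK.
Qed.

(** [A] is a derivation, so subtracting [nu + mu] from it on a bracket amounts to subtracting [nu]
    on one entry and [mu] on the other; a double induction on the exponents follows. *)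
Let gen_eigen_br (nu mu : C) i j u v :
  u *m (A - nu%:M) ^+ i = 0 -> v *m (A - mu%:M) ^+ j = 0 ->
  brCx u v *m (A - (nu + mu)%:M) ^+ (i + j) = 0.
Proof.
have mxS k (M : 'M[C]_n) (w : 'rV_n) : w *m M ^+ k.+1 = w *m M *m M ^+ k.
  by rewrite exprS -mulmxA.
elim: i j u v => [|i IHi] j u v.
  by rewrite expr0 mulmx1 => -> _; rewrite /brCx admC0 mulmx0 mul0mx.
elim: j u v => [|j IHj] u v.
  by rewrite expr0 mulmx1 => _ ->; rewrite /brCx !mul0mx.
move=> ui vj; rewrite addSn mxS.
have -> : brCx u v *m (A - (nu + mu)%:M) = brCx (u *m (A - nu%:M)) v + brCx u (v *m (A - mu%:M)).
  rewrite !mulmxBr A_der !mul_mx_scalar -!scaleNr /brCx admCD admCZ.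
  by rewrite !mulmxDr mulmxDl -!scalemxAr -scalemxAl opprD scalerDl addrACA.
rewrite mulmxDl IHi // -?mxS // add0r -addSnnS.
by apply: IHj => //; rewrite -mxS.
Qed.

(** Cartan's criterion. Eigenvalues add under brackets and conjugation is additive, so the conjugate
    [D] of the semisimple part of [ad x] is a derivation. The trace of [ad x] times [D] then reduces
    to values of the Killing form on [J], hence is 0, and [conjugate_part] makes [ad x]
    nilpotent. *)
Lemma adm_nilpotent : adm x ^+ n = 0.
Proof.
have [rs [p [q [dec pA qA trq]]]] := conjugate_part A.
set D := horner_mx A q in qA trq.
have D_der u v : brCx u v *m D = brCx (u *m D) v + brCx u (v *m D).
  have brDlx a b c : brCx (a + b) c = brCx a c + brCx b c by rewrite /brCx admCD mulmxDr.
  have br0x c : brCx 0 c = 0 by rewrite /brCx admC0 mulmx0.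
  rewrite [u](dec u) [v](dec v).
  have suml (F : C -> 'rV[C]_n) c : brCx (\sum_(l <- rs) F l) c = \sum_(l <- rs) brCx (F l) c.
    by apply: (big_morph (fun a => brCx a c)) => // a b; exact: brDlx.
  have sumr (F : C -> 'rV[C]_n) a : brCx a (\sum_(l <- rs) F l) = \sum_(l <- rs) brCx a (F l).
    exact: mulmx_suml.
  rewrite suml !mulmx_suml suml suml -big_split big_seq [RHS]big_seq; apply: eq_bigr => l lrs.
  rewrite sumr !mulmx_suml !sumr -big_split big_seq [RHS]big_seq; apply: eq_bigr => k krs /=.
  have gl := pA u l lrs; have gk := pA v k krs.
  rewrite (qA _ _ _ gl) (qA _ _ _ gk) (qA _ _ _ (gen_eigen_br gl gk)).
  by rewrite rmorphD scalerDl /brCx admCZ -scalemxAr -scalemxAl.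
have D_comm u : admC u *m D = admC (u *m D) + D *m admC u.
  apply/row_matrixP => i; rewrite !rowE mulmxDr !mulmxA.
  exact: D_der.
(* For a bracket of [y1] and [y2], cyclicity of the trace and the derivation property leave minus
   the trace of [ad y1] times [ad (D y2)]. Here [D y2] is complex, but the Killing form with [y1]
   vanishes on a real basis. *)
have tr0 y : (y <= brmx J)%MS -> \tr (admC (mC y) *m D) = 0.
  elim/brmx_ind => [|a y1 y2 IH1 IH2|y1 y2 y1J y2J].
  - by rewrite map_mx0 admC0 mul0mx mxtrace0.
  - by rewrite map_mxD map_mxZ admCD admCZ mulmxDl mxtraceD -scalemxAl mxtraceZ IH1 IH2 mulr0 addr0.
  rewrite admC_map adm_br map_mxB !map_mxM -!admC_map mulmxBl raddfB /=.
  rewrite -mulmxA mxtrace_mulC -mulmxA -raddfB /= -[in X in _ - X]mulmxA -mulmxBr.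
  rewrite D_comm opprD addrCA subrr addr0 mulmxN raddfN /=.
  apply/eqP; rewrite oppr_eq0; apply/eqP.
  elim/span_ind: (mC y2 *m D) => [|a z1 z2 IH1 IH2|i].
  - by rewrite admC0 mulmx0 mxtrace0.
  - by rewrite admCD admCZ mulmxDr mxtraceD -scalemxAr mxtraceZ IH1 IH2 mulr0 addr0.
  rewrite !admC_map -map_mxM -[LHS]/(\tr (map_mx toC _)).
  have -> M : \tr (mC M) = toC (\tr M) by rewrite /mxtrace rmorph_sum; apply: eq_bigr => ? _; rewrite mxE.
  by have := Jrad y1J (e i); rewrite /killing => ->; rewrite rmorph0.
have := trq (tr0 _ xJ); rewrite /A admC_map -rmorphXn /= => /eqP.
by rewrite map_mx_eq0 => /eqP.
Qed.

End Nilpotent.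

Hypothesis semisimple_br : forall J, mx_lideal J ->
  (forall x y, (x <= J)%MS -> (y <= J)%MS -> br x y = 0) -> J = 0.

(** If [[J, J]] is smaller than [J], it vanishes by induction and [J] is abelian. If [[J, J] = J],
    every [ad x] with [x] in [J] is nilpotent; by Engel a nonzero [J] would have a nonzero centre,
    which is an abelian ideal. *)
Lemma rad_ideal0 J : mx_lideal J -> (forall z, (z <= J)%MS -> forall y, killing z y = 0) -> J = 0.
Proof.
move: {2}(\rank J) (leqnn (\rank J)) => r.
elim: r J => [|r IH] J rJ Ji Jrad.
  by apply/eqP; rewrite -mxrank_eq0 -leqn0.
have brJ : (brmx J <= J)%MS.
  apply/sumsmx_subP => p _; rewrite genmxE; apply: Ji; exact: row_sub.
have bri : mx_lideal (brmx J).
  move=> x y; elim/brmx_ind => [|a y1 y2 IH1 IH2|y1 y2 y1J y2J].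
  - by rewrite -admE mul0mx sub0mx.
  - by rewrite brDr brZr addmx_sub // scalemx_sub.
  rewrite jacobi addmx_sub // sub_brmx //; exact: Ji.
have [rlt|] := ltnP (\rank (brmx J)) (\rank J).
  apply: semisimple_br => // x y xJ yJ.
  have br0 : brmx J = 0.
    apply: IH => //; first by rewrite -ltnS (leq_trans rlt).
    by move=> z zbr; apply: Jrad; exact: submx_trans brJ.
  by apply/eqP; rewrite -submx0 -br0; exact: sub_brmx.
move=> rge.
have Jbr : (J <= brmx J)%MS.
  have := mxrank_leqif_sup brJ => -[_ <-].
  by rewrite eqn_leq mxrankS.
have nilJ x : (x <= J)%MS -> adm x ^+ n = 0.
  by move=> xJ; apply: (adm_nilpotent Jrad); exact: submx_trans Jbr.
apply/eqP/negPn/negP => J0.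
pose Z := (J :&: \bigcap_(i < n) kermx (adm (row i J)))%MS.
have ZP z : (z <= Z)%MS <-> (z <= J)%MS /\ forall x, (x <= J)%MS -> br x z = 0.
  rewrite sub_capmx; split=> [/andP[zJ /sub_bigcapmxP zk]|[zJ zk]].
    split=> // x /submxP[a ->]; rewrite -admE (mulmx_sum_row a) adm_sum mulmx_sumr.
    rewrite big1 // => i _; rewrite admZ -scalemxAr.
    by have /sub_kermxP -> := zk i isT; rewrite scaler0.
  rewrite zJ; apply/sub_bigcapmxP => i _; apply/sub_kermxP.
  by rewrite admE zk // row_sub.
have Z0 : Z = 0.
  apply: semisimple_br => [u z /ZP[zJ zk]|x y /ZP[xJ _] /ZP[_ yk]]; last exact: yk.
  apply/ZP; split=> [|x xJ]; first exact: Ji.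
  have xu : (br x u <= J)%MS by rewrite brC eqmx_opp Ji.
  by rewrite jacobi (zk _ xu) (zk x xJ) -admE mul0mx addr0.
have J0' : ~~ (J <= (0 : 'M[R]_n))%MS by rewrite submx0.
have [|||w [wJ w0 Jw]] := @engel J nilJ J 0 J (submx_refl _) _ _ _ J0'.
- by move=> x y _; exact: Ji.
- by move=> x y _; rewrite !submx0 => /eqP ->; rewrite -admE mul0mx.
- by move=> x y _; exact: Ji.
move: w0; rewrite -Z0 => /negP; apply; apply/ZP; split=> // x xJ.
by apply/eqP; rewrite -submx0; exact: Jw.
Qed.

Lemma gram_unit : gram \in unitmx.
Proof.
rewrite -row_free_unit -kermx_eq0; apply/eqP; apply: rad_ideal0.
  move=> x y /sub_rad yr; apply/sub_rad => z.
  by rewrite brC -scaleN1r killingZl killing_inv yr mulr0.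
by move=> z /sub_rad.
Qed.

(** [f] is the basis dual to the standard one for the Killing form. The first part is the invariance
    of the tensor formed by the two bases, tested on all bilinear forms. For the second, pairing the
    left side with [z] gives the trace of [ad z] times [ad y], that is, the Killing form of [y] and
    [z]. *)
Lemma casimirS : exists f : 'I_n -> 'rV[R]_n,
  (forall (B : 'rV[R]_n -> 'rV[R]_n -> R) x,
     (forall a y1 y2 z, B (a *: y1 + y2) z = a * B y1 z + B y2 z) ->
     (forall a y1 y2 z, B z (a *: y1 + y2) = a * B z y1 + B z y2) ->
     \sum_i (B (br x (delta_mx 0 i)) (f i) + B (delta_mx 0 i) (br x (f i))) = 0) /\
  forall y, \sum_i br (delta_mx 0 i) (br (f i) y) = y.
Proof.
pose f i := row i (invmx gram); exists f; rewrite -/e.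
have fe i j : killing (f i) (e j) = (i == j)%:R.
  by rewrite -gramE -row_mul mulVmx ?gram_unit // !mxE.
have nondeg y z : (forall i, killing y (e i) = killing z (e i)) -> y = z.
  move=> yz; apply: (can_inj (mulmxK gram_unit)); apply/rowP => i.
  by rewrite !gramE yz.
have coef (y : 'rV[R]_n) i : y 0 i = killing (f i) y.
  rewrite {2}[y]row_sum_delta killing_sumr (bigD1 i) //= killingZr -/(e _) fe eqxx mulr1.
  by rewrite big1 ?addr0 // => j ji; rewrite killingZr -/(e _) fe eq_sym (negbTE ji) mulr0.
have expe y : y = \sum_i killing (f i) y *: e i.
  by rewrite {1}[y]row_sum_delta; apply: eq_bigr => i _; rewrite coef.
have expf y : y = \sum_i killing (e i) y *: f i.
  apply: nondeg => j; rewrite killing_suml (bigD1 j) //= killingZl fe eqxx mulr1 killingC.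
  by rewrite big1 ?addr0 // => k kj; rewrite killingZl fe (negbTE kj) mulr0.
split=> [B x Bl Br|y].
  have B0l z : B 0 z = 0.
    by have := Bl (-1) 0 0 z; rewrite scaler0 addr0 mulN1r addNr.
  have B0r z : B z 0 = 0.
    by have := Br (-1) 0 0 z; rewrite scaler0 addr0 mulN1r addNr.
  have BZl a u z : B (a *: u) z = a * B u z by rewrite -[_ *: _]addr0 Bl B0l addr0.
  have BZr a u z : B z (a *: u) = a * B z u by rewrite -[_ *: _]addr0 Br B0r addr0.
  have sl z F : B (\sum_(i < n) F i) z = \sum_(i < n) B (F i) z.
    by apply: (big_morph (B^~ z)) => // u v; have := Bl 1 u v z; rewrite scale1r mul1r.
  have sr z F : B z (\sum_(i < n) F i) = \sum_(i < n) B z (F i).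
    by apply: (big_morph (B z)) => // u v; have := Br 1 u v z; rewrite scale1r mul1r.
  rewrite big_split /=.
  under eq_bigr do rewrite [br x (e _)]expe sl.
  under [X in _ + X]eq_bigr do rewrite [br x (f _)]expf sr.
  rewrite [X in _ + X]exchange_big -big_split big1 //= => i _.
  rewrite -big_split big1 //= => j _; rewrite BZl BZr -mulrDl.
  by rewrite -killing_inv (brC (f j)) -scaleN1r killingZl (killingC (e i)) mulN1r addNr mul0r.
apply: nondeg => z; rewrite killing_suml.
transitivity (\sum_i (adm (e z) *m adm y) i i); last by rewrite killingC.
apply: eq_bigr => i _.
rewrite brC -scaleN1r killingZl killing_inv killing_inv mulN1r.
rewrite -[RHS](_ : (e i *m (adm (e z) *m adm y)) 0 i = _); last by rewrite -rowE mxE.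
rewrite coef mulmxA !admE (brC (delta_mx 0 i)) -mulN1r -killingZr -brZr.
by rewrite scaleN1r opprK.
Qed.

End KillingForm.

Theorem casimir (R : rcfType) n (br : 'rV[R]_n -> 'rV[R]_n -> 'rV[R]_n) :
  (forall x y z, br (x + y) z = br x z + br y z) ->
  (forall a x z, br (a *: x) z = a *: br x z) ->
  (forall x y, br x y = - br y x) ->
  (forall x y z, br x (br y z) = br (br x y) z + br y (br x z)) ->
  (forall J : 'M[R]_n, (forall x y : 'rV[R]_n, (y <= J)%MS -> (br x y <= J)%MS) ->
    (forall x y : 'rV[R]_n, (x <= J)%MS -> (y <= J)%MS -> br x y = 0) -> J = 0) ->
  exists f : 'I_n -> 'rV[R]_n,
  (forall (B : 'rV[R]_n -> 'rV[R]_n -> R) x,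
     (forall a y1 y2 z, B (a *: y1 + y2) z = a * B y1 z + B y2 z) ->
     (forall a y1 y2 z, B z (a *: y1 + y2) = a * B z y1 + B z y2) ->
     \sum_i (B (br x (delta_mx 0 i)) (f i) + B (delta_mx 0 i) (br x (f i))) = 0) /\
  forall y, \sum_i br (delta_mx 0 i) (br (f i) y) = y.
Proof.
case: n br => [|m] br brDl brZl brC jacobi ss; last exact: casimirS.
by exists (fun=> 0); split=> [B x _ _|y]; [rewrite big_ord0|rewrite [RHS]thinmx0 thinmx0].
Qed.

(** * Cutoff functions and density of polynomials *)

Section SmoothScalars.
Context {R : realType}.
Implicit Types (f g : R -> R).

Definition smf f := Cinfty setT (f : R^o -> R^o).

Lemma is_derive_hasD (X : normedModType R) (f : R -> X) (s v : R) d :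
  is_derive s 1 f d -> hasD (f : R^o -> X) s v (v *: d).
Proof.
move=> [df <-]; rewrite -derive1E; exact: derivable_hasD.
Qed.

Lemma smf_scale (X : tvsType R) f (g : R^o -> X) : smf f -> Cinfty setT g ->
  Cinfty setT (fun t : R^o => f t *: g t).
Proof.
move=> sf sg.
apply: (@Cinfty_comp _ _ _ _ setT setT (fun t : R^o => (f t : R^o, g t)) (fun p : R^o * X => p.1 *: p.2)) => //.
- exact: openT.
- exact: openT.
- exact: Cinfty_pair.
- exact: Cinfty_bil (cbil_scale X).
Qed.

Lemma smfM f g : smf f -> smf g -> smf (fun t => f t * g t).
Proof. exact: smf_scale. Qed.

Lemma smf_comp f g : smf f -> smf g -> smf (f \o g).
Proof. by move=> sf sg; apply: (@Cinfty_comp _ _ _ _ setT setT) => //; exact: openT. Qed.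

Lemma smf_cst c : smf (fun=> c).
Proof. exact: Cinfty_cst. Qed.

Lemma smf_id : smf id.
Proof. by apply: Cinfty_lin; exact: clin_id. Qed.

Lemma smfD f g : smf f -> smf g -> smf (fun t => f t + g t).
Proof. by apply: Cinfty_add; exact: openT. Qed.

Lemma smfZ f c : smf f -> smf (fun t => c * f t).
Proof. by apply: Cinfty_scal; exact: openT. Qed.

Lemma smfN f : smf f -> smf (fun t => - f t).
Proof. by apply: Cinfty_opp; exact: openT. Qed.

Lemma smf_affine a b : smf (fun t => a * t + b).
Proof. by apply: smfD; [apply: smfZ; exact: smf_id|exact: smf_cst]. Qed.

Lemma open_neq0 : open [set x : R^o | x != 0].
Proof.
rewrite (_ : [set _ | _] = ~` [set (0 : R^o)]); last by apply/seteqP; split=> x /= /eqP.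
by apply: closed_openC; exact: accessible_closed_set1 (hausdorff_accessible (@hausdorff_normed R R^o)) 0.
Qed.

Lemma Cinfty_inv : Cinfty [set x : R^o | x != 0] (fun x : R^o => (x^-1 : R^o)).
Proof.
have o0 := open_neq0.
elim=> [|k IH].
  by split=> // x x0; apply: cvgV => //; exact: cvg_id.
apply/CkSE; split; first by move=> x x0; apply: cvgV => //; exact: cvg_id.
exists (fun p : R^o * R^o => p.2 *: (- (p.1^-1 *: (p.1^-1 : R^o)))); split.
  move=> x v x0.
  have D : is_derive (x : R) 1 (fun y : R => y^-1) (- (x^-1 * x^-1)).
    have := @is_deriveV R id x 1 1 x0 (is_derive_id _ _).
    by rewrite expr2 invfM scaleNr [_ *: 1]mulr1.
  rewrite (_ : _ *: _ = v *: (- (x^-1 * x^-1) : R^o)) //.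
  exact: (@is_derive_hasD R^o _ x v _ D).
have C1 : Ck k ([set x : R^o | x != 0] `*` setT) (fun p : R^o * R^o => p.1^-1 : R^o).
  by apply: Ck_sub (Ck_precomp (@clin_fst _ R^o R^o) IH) => -[x v] [].
have oU : open ([set x : R^o | x != 0] `*` [set: R^o]) by exact: open_setXT.
have mul (u w : R^o * R^o -> R^o) : Ck k ([set x : R^o | x != 0] `*` setT) u ->
    Ck k ([set x : R^o | x != 0] `*` setT) w ->
    Ck k ([set x : R^o | x != 0] `*` setT) (fun p => u p *: w p).
  move=> Cu Cw; apply: (@Ck_comp _ _ _ _ _ _ setT (fun p => (u p, w p)) (fun p : R^o * R^o => p.1 *: p.2)) => //.
  - exact: openT.
  - exact: Ck_pair.
  - exact: Ck_bil (cbil_scale R^o).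
apply: (mul); first by apply: (@Ck_sub _ _ _ _ setT) => //; apply: Ck_lin; exact: clin_snd.
apply: (@Ck_ext _ _ _ _ _ (fun p : R^o * R^o => (-1) *: (p.1^-1 *: (p.1^-1 : R^o)))) => //.
  by move=> p _; rewrite scaleN1r.
by apply: (@Ck_scal _ _ _ _ _ (fun p : R^o * R^o => p.1^-1 *: (p.1^-1 : R^o)) (-1)) => //; apply: (mul).
Qed.

Lemma smf_inv f : smf f -> (forall t, f t != 0) -> smf (fun t => (f t)^-1).
Proof.
move=> sf f0; apply: (@Cinfty_comp _ _ _ _ setT [set x : R^o | x != 0] (f : R^o -> R^o) (fun x : R^o => x^-1 : R^o)).
- exact: openT.
- exact: open_neq0.
- by move=> t _; exact: f0.
- exact: sf.
- exact: Cinfty_inv.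
Qed.

(** A family closed under differentiation up to linear combinations: the derivative of the [n]-th
    member is the [n.+2]-nd minus [n] times the [n.+1]-st. *)
Definition flatexp n t : R := if 0 < t then t^-1 ^+ n * expR (- t^-1) else 0.

(** The term of degree [n.+2] of the exponential series at [t^-1]. Being quadratic in [t], the bound
    gives derivative 0 at 0 for every [n]. *)
Lemma flatexp_bound n t : `|flatexp n t| <= (n.+2)`!%:R * t ^+ 2.
Proof.
rewrite /flatexp; case: ifPn => [t0|_]; last by rewrite normr0 mulr_ge0 // sqr_ge0.
have u0 : 0 < t^-1 by rewrite invr_gt0.
rewrite ger0_norm ?mulr_ge0 ?expR_ge0 ?exprn_ge0 ?(ltW u0) // expRN.
have t2 : t ^+ 2 = (t^-1 ^+ 2)^-1 by rewrite exprVn invrK.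
rewrite ler_pdivrMr ?expR_gt0 // t2 mulrAC ler_pdivlMr ?exprn_gt0 //.
rewrite -exprD addn2 -ler_pdivrMl ?ltr0n ?fact_gt0 // mulrC.
have := @expR_ge1Dxn R t^-1 n.+1 (ltW u0).
by apply: le_trans; rewrite lerDr.
Qed.

Lemma flatexp_hasD n (t v : R^o) : hasD (flatexp n : R^o -> R^o) t v
  (v *: (flatexp n.+2 t - n%:R * flatexp n.+1 t : R^o)).
Proof.
have [t0|] := ltP 0 t.
  have D : is_derive (t : R) 1 (fun s : R => s^-1 ^+ n * expR (- s^-1))
      (flatexp n.+2 t - n%:R * flatexp n.+1 t).
    have dV : is_derive (t : R) 1 (fun y : R => y^-1) (- (t^-1 * t^-1)).
      have := @is_deriveV R id t 1 1 (lt0r_neq0 t0) (is_derive_id _ _).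
      by rewrite expr2 invfM scaleNr [_ *: 1]mulr1.
    have dE : is_derive (t : R) 1 (expR \o (fun y : R => - y^-1)) (expR (- t^-1) * (t^-1 * t^-1)).
      by rewrite -[t^-1 * t^-1]opprK; apply: is_derive1_comp; exact: is_deriveN.
    have dX := is_deriveX n dV.
    have := is_deriveM dX dE; rewrite /flatexp t0 exprfctE.
    set d := (X in is_derive _ _ _ X -> _) => H.
    suff -> : t^-1 ^+ n.+2 * expR (- t^-1) - n%:R * (t^-1 ^+ n.+1 * expR (- t^-1)) = d by exact: H.
    rewrite /d /GRing.scale /=.
    case: (n) => [|m]; first by rewrite expr2 !mul0r mulr0 subr0 addr0; ring.
    by rewrite -pred_Sn !exprS; ring.
  apply: (@hasD_near R _ _ (fun s : R^o => s^-1 ^+ n * expR (- s^-1) : R^o)).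
    near=> y; rewrite /flatexp ifT //; near: y; exact: lt_nbhsr.
  exact: is_derive_hasD.
rewrite le_eqVlt => /orP[/eqP ->|t0]; last first.
  have E m : flatexp m t = 0 by rewrite /flatexp ltNge ltW.
  rewrite !E mulr0 subr0 scaler0.
  apply: (@hasD_near R _ _ (fun=> 0 : R^o)).
    near=> y; rewrite /flatexp ltNge ifF //; apply/negbF/ltW; near: y; exact: lt_nbhsl.
  by apply: (@dnbhs0_eq_cvg _ _ _ (fun=> 0)); [move=> h _; rewrite subrr scaler0|exact: cvg_cst].
have E m : flatexp m 0 = 0 by rewrite /flatexp ltxx.
rewrite !E mulr0 subr0 scaler0.
set C : R := n.+2`!%:R.
have D0 : 0 < C * `|v| ^+ 2 + 1 by rewrite ltr_wpDl // mulr_ge0 // exprn_ge0.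
apply/cvgrPdist_le => e e0; near=> h.
rewrite E subr0 sub0r normrN add0r normrM normfV.
have [->|h0] := eqVneq h 0; first by rewrite normr0 invr0 mul0r ltW.
rewrite mulrC ler_pdivrMr ?normr_gt0 // (le_trans (flatexp_bound _ _)) //.
rewrite -real_normK ?num_real // expr2 normrM -/C.
have hC : `|h| * (C * `|v| ^+ 2) <= e.
  apply: (@le_trans _ _ (`|h| * (C * `|v| ^+ 2 + 1))); first by rewrite ler_wpM2l // lerDl.
  rewrite -ler_pdivlMr //; near: h; exact: (dnbhs0_le (divr_gt0 e0 D0)).
have -> : C * (`|h| * `|v| * (`|h| * `|v|)) = `|h| * (`|h| * (C * `|v| ^+ 2)) by rewrite expr2; ring.
by rewrite mulrC ler_pM2r ?normr_gt0.
Unshelve. all: by end_near. Qed.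

Lemma smf_flatexp n : smf (flatexp n).
Proof.
move=> k; elim: k n => [|k IH] n.
  split=> // x _; have [D _] := hasD_derivable (X := R^o) (@flatexp_hasD n x 1).
  by apply: differentiable_continuous; apply/derivable1_diffP.
apply/CkSE; split.
  move=> x _; have [D _] := hasD_derivable (X := R^o) (@flatexp_hasD n x 1).
  by apply: differentiable_continuous; apply/derivable1_diffP.
exists (fun p => p.2 *: (flatexp n.+2 p.1 - n%:R * flatexp n.+1 p.1)); split.
  by move=> x v _; exact: flatexp_hasD.
apply: (@Ck_comp _ _ _ _ _ _ setT (fun p : R^o * R^o => (p.2 : R^o, flatexp n.+2 p.1 - n%:R * flatexp n.+1 p.1 : R^o))
  (fun p : R^o * R^o => p.1 *: p.2)) => //.
- exact: open_setXT openT.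
- exact: openT.
- apply: Ck_pair; first by apply: (@Ck_sub _ _ _ _ setT) => //; apply: Ck_lin; exact: clin_snd.
  have CC m : Ck k (setT `*` setT) (fun p : R^o * R^o => flatexp m p.1 : R^o).
    by apply: Ck_sub (Ck_precomp (@clin_fst _ R^o R^o) (IH m)).
  apply: (@Ck_ext _ _ _ _ _ (fun p : R^o * R^o => (flatexp n.+2 p.1 : R^o) + (- n%:R) *: (flatexp n.+1 p.1 : R^o))).
  + exact: open_setXT openT.
  + by move=> p _; rewrite scaleNr.
  apply: Ck_add => //; first exact: open_setXT openT.
  by apply: Ck_scal => //; exact: open_setXT openT.
exact: Ck_bil (cbil_scale R^o).
Qed.

Lemma flatexp0_gt0 t : 0 < t -> 0 < flatexp 0 t.
Proof. by move=> t0; rewrite /flatexp t0 mul1r expR_gt0. Qed.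
Lemma flatexp0_ge0 t : 0 <= flatexp 0 t.
Proof. by rewrite /flatexp; case: ifP => // _; rewrite mul1r expR_ge0. Qed.
Lemma flatexp_le0 n t : t <= 0 -> flatexp n t = 0.
Proof. by rewrite /flatexp ltNge => ->. Qed.

(** Positive, since [2^-1 < 1] leaves no [t] at which both terms vanish. The quotient [step1] is 0
    up to [2^-1] and 1 from 1 on. *)
Definition stepden t := flatexp 0 (t - 2^-1) + flatexp 0 (1 - t).
Definition step1 t := flatexp 0 (t - 2^-1) / stepden t.

Lemma stepden_gt0 t : 0 < stepden t.
Proof.
rewrite /stepden; have [t1|t1] := ltP t 1.
  by rewrite ltr_wpDl ?flatexp0_ge0 // flatexp0_gt0 // subr_gt0.
rewrite ltr_wpDr ?flatexp0_ge0 // flatexp0_gt0 // subr_gt0 (lt_le_trans _ t1) //.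
by rewrite invf_lt1 // ltr1n.
Qed.

Lemma smf_step1 : smf step1.
Proof.
have s1 a b : smf (fun t => flatexp 0 (a * t + b)).
  exact: (smf_comp (smf_flatexp 0) (smf_affine a b)).
have sA : smf (fun t => flatexp 0 (t - 2^-1)).
  by have := s1 1 (- 2^-1); under eq_fun do rewrite mul1r.
have sB : smf (fun t => flatexp 0 (1 - t)).
  by have := s1 (-1) 1; under eq_fun do rewrite mulN1r addrC.
apply: smfM => //; apply: smf_inv => [|t]; first exact: smfD.
by rewrite gt_eqF // stepden_gt0.
Qed.

Lemma step1_le0 t : t <= 2^-1 -> step1 t = 0.
Proof. by move=> t0; rewrite /step1 flatexp_le0 ?mul0r // subr_le0. Qed.
Lemma step1_ge1 t : 1 <= t -> step1 t = 1.
Proof.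
move=> t0; have := stepden_gt0 t; rewrite /step1 /stepden.
by rewrite (flatexp_le0 _ (t := 1 - t)) ?subr_le0 // addr0 => /lt0r_neq0; exact: divff.
Qed.
Lemma step1_ge0 t : 0 <= step1 t.
Proof. by rewrite divr_ge0 ?flatexp0_ge0 // ltW // stepden_gt0. Qed.
Lemma step1_le1 t : step1 t <= 1.
Proof. by rewrite ler_pdivrMr ?stepden_gt0 // mul1r lerDl flatexp0_ge0. Qed.

End SmoothScalars.

(** * Cutoffs of flat paths and their norms *)

Section PathVectors.
Context {R : realType} {n : nat}.
Local Notation X := 'rV[R]_n.
Local Notation V := (flat_vect R Path n).
Implicit Types (f : R -> R) (Y : V).

Lemma wraps_pathI T (g : R -> T) : (forall t, t <= 0 -> g t = g 0) ->
  (forall t, pi <= t -> g t = g pi) -> wraps Path g.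
Proof.
move=> g0 gpi s; have [s0|s0] := lerP s 0.
  by rewrite min_l ?(le_trans s0) ?pi_ge0 // max_l // g0.
have [sp|sp] := lerP s pi; first by rewrite max_r // ltW.
by rewrite max_r ?pi_ge0 // gpi // ltW.
Qed.

Lemma path_flat (g : R -> X) : wraps Path g -> g 0 = 0 -> Cinfty setT (g : R^o -> X) ->
  flat_vcurve Path g.
Proof.
move=> wg g0 Cg; split=> // [k s|s].
  by apply: (@Cinfty_derivable _ _ setT) => //; exact: openT.
case=> -> k.
  apply: (@derive1n_left _ _ _ setT _ 0) => // [|t t0 _]; first exact: openT.
  by rewrite (wraps_path_le0 wg) ?ltW.
apply: (@derive1n_right _ _ _ setT _ (g pi)) => // [|t t0 _]; first exact: openT.
by rewrite (wraps_path_gepi wg) ?ltW.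
Qed.

Lemma mk_pathE (g : R -> X) : wraps Path g -> g 0 = 0 -> Cinfty setT (g : R^o -> X) ->
  mk_flat Path g = g :> (R -> X).
Proof. by move=> *; apply: mk_flatE; exact: path_flat. Qed.

Definition cutoff f := wraps Path f /\ smf f.

(* Sealed, so that unification does not unfold them. *)
Fact smul_subproof f Y : {Z : V | cutoff f -> forall t, Z t = f t *: Y t}.
Proof.
exists (mk_flat Path (fun t => f t *: Y t)) => -[wf sf] t; rewrite mk_pathE //.
- by move=> s; rewrite [f s in LHS]wf; congr (_ *: _); exact: (flat_wraps Y s).
- by rewrite path_le0 // scaler0.
- by apply: smf_scale => //; exact: flat_vect_Cinfty.
Qed.

Fact ten_subproof f (x : X) : {Z : V | cutoff f -> f 0 = 0 -> forall t, Z t = f t *: x}.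
Proof.
exists (mk_flat Path (fun t => f t *: x)) => -[wf sf] f0 t; rewrite mk_pathE //.
- by move=> s; rewrite [f s in LHS]wf.
- by rewrite f0 scale0r.
- by apply: smf_scale => //; exact: Cinfty_cst.
Qed.

Definition smul f Y : V := sval (smul_subproof f Y).
Definition ten f (x : X) : V := sval (ten_subproof f x).

Lemma smulE f Y t : cutoff f -> smul f Y t = f t *: Y t.
Proof. by move=> cf; exact: (svalP (smul_subproof f Y)). Qed.

Lemma tenE f x t : cutoff f -> f 0 = 0 -> ten f x t = f t *: x.
Proof. by move=> cf f0; exact: (svalP (ten_subproof f x)). Qed.

Lemma flat_ext (f g : V) : (forall t, f t = g t) -> f = g.
Proof. by move=> fg; apply: flat_vect_ext => s _. Qed.

(** Linearity is checked pointwise; continuity comes with smoothness from the exponential law. *)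
Lemma clin_exp (D : tvsType R) (T : D -> V) (H : D * R^o -> X) :
  Cinfty setT H -> (forall d s, T d s = H (d, s)) ->
  (forall s a x y, H (a *: x + y, s) = a *: H (x, s) + H (y, s)) -> clin T.
Proof.
move=> CH TH lH; split=> [a x y|x]; first by apply: flat_ext => s; rewrite TH lH -!TH.
have CT : Cinfty setT T.
  apply: (@exp_law _ _ _ _ _ H); [exact: openT|by apply: Cinfty_sub CH|by move=> d s _].
exact: (Cinfty_cont CT).
Qed.

Lemma Cinfty_ev (D : tvsType R) (a : D -> V) (b : D -> R^o) : Cinfty setT a -> Cinfty setT b ->
  Cinfty setT (fun d => flat_fun (a d) (b d)).
Proof.
move=> Ca Cb; apply: (@Cinfty_comp _ _ _ _ setT setT (fun d => (a d, b d)) (fun p : V * R^o => flat_fun p.1 p.2)) => //.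
- exact: openT.
- exact: openT.
- exact: Cinfty_pair.
- exact: ev_Cinfty.
Qed.

Lemma Cinfty_scale (D W : tvsType R) (a : D -> R^o) (b : D -> W) : Cinfty setT a -> Cinfty setT b ->
  Cinfty setT (fun d => a d *: b d).
Proof.
move=> Ca Cb; apply: (@Cinfty_comp _ _ _ _ setT setT (fun d => (a d, b d)) (fun p : R^o * W => p.1 *: p.2)) => //.
- exact: openT.
- exact: openT.
- exact: Cinfty_pair.
- exact: Cinfty_bil (cbil_scale W).
Qed.

Lemma Cinfty_snd (D : tvsType R) f : smf f -> Cinfty setT (fun p : D * R^o => f p.2 : R^o).
Proof.
move=> sf; apply: (@Cinfty_comp _ _ _ _ setT setT snd (f : R^o -> R^o)) => //.
- exact: openT.
- exact: openT.
- by apply: Cinfty_lin; exact: clin_snd.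
Qed.

Lemma clin_ten f : cutoff f -> f 0 = 0 -> clin (ten f).
Proof.
move=> cf f0; apply: (@clin_exp _ _ (fun p : X * R^o => f p.2 *: p.1)).
- apply: Cinfty_scale; first by apply: Cinfty_snd; exact: cf.2.
  by apply: Cinfty_lin; exact: clin_fst.
- by move=> d s; rewrite tenE.
- by move=> s a x y /=; rewrite scalerDr !scalerA mulrC.
Qed.

Lemma derive1_scale f (g : R -> X) s : smf f -> Cinfty setT (g : R^o -> X) ->
  derive1 (fun t => f t *: g t) s = derive1 f s *: g s + f s *: derive1 g s.
Proof.
move=> sf sg.
have Df1 := derivable_hasD1 (@Cinfty_derivable R R^o setT f 0 s openT sf I).
have Dg1 := derivable_hasD1 (@Cinfty_derivable R X setT g 0 s openT sg I).
suff : hasD (fun t : R^o => f t *: g t) s (1 : R^o) (derive1 f s *: g s + f s *: derive1 g s).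
  by move=> /hasD_derivable[].
have gc : (fun h : R => g (s + h *: (1 : R^o))) @ (0 : R)^' --> g s.
  apply: cvg_comp (@cvg_dnbhs_line R R^o s 1) _; exact: (Cinfty_cont sg).
have := tvs_cvgD (tvs_cvgZ Df1 gc) (tvs_cvgZ (cvg_cst (f s)) Dg1).
move=> /(_ _ _ _ _); apply: dnbhs0_eq_cvg => h h0.
rewrite [X in _ = X + _](_ : _ = h^-1 *: ((f (s + h *: (1 : R^o)) - f s) *: g (s + h *: (1 : R^o)))); last by rewrite scalerA.
rewrite [f s *: (_ *: _)]scalerA [f s * _]mulrC -scalerA -scalerDr; congr (_ *: _).
by rewrite scalerBl scalerBr addrA subrK.
Qed.

Lemma smf_derive f k : smf f -> smf (derive1n k f).
Proof. by move=> sf; apply: Cinfty_derive1n => //; exact: openT. Qed.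

(** Each differentiation splits a product in two, whence the factor [2 ^+ k]. *)
Lemma leibniz_bound k f (g : R -> X) s A B : smf f -> Cinfty setT (g : R^o -> X) ->
  (forall i, (i <= k)%N -> `|derive1n i f s| <= A) ->
  (forall i, (i <= k)%N -> `|derive1n i g s| <= B) ->
  `|derive1n k (fun t => f t *: g t) s| <= 2 ^+ k * (A * B).
Proof.
elim: k f g => [|k IH] f g sf sg fA gB.
  rewrite expr0 mul1r /= normrZ; apply: ler_pM => //; [exact: (fA 0%N)|exact: (gB 0%N)].
rewrite derive1Sn.
have -> : derive1 (fun t => f t *: g t) = (fun t => derive1n 1 f t *: g t) + (fun t => f t *: derive1n 1 g t).
  by apply/funext => t; rewrite derive1_scale.
have sf1 := smf_derive 1 sf.
have sg1 := Cinfty_derive1n (W := setT) 1 openT sg.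
rewrite derive1nD; last 2 first.
- by move=> j t; apply: (@Cinfty_derivable _ _ setT) => //; [exact: openT|exact: smf_scale].
- by move=> j t; apply: (@Cinfty_derivable _ _ setT) => //; [exact: openT|exact: smf_scale].
rewrite (le_trans (ler_normD _ _)) // exprS -mulrA mulr_natl mulr2n lerD //.
  apply: IH => // i ik; [|exact: gB (leqW ik)].
  by have := fA i.+1 ik; rewrite derive1Sn.
apply: IH => // i ik; [exact: fA (leqW ik)|].
by have := gB i.+1 ik; rewrite derive1Sn.
Qed.

Lemma derive1n_dilate f (a s : R) k : smf f ->
  derive1n k (fun t => f (a * t)) s = a ^+ k * derive1n k f (a * s).
Proof.
move=> sf; elim: k s => [|k IH] s; first by rewrite mul1r.
rewrite !derive1nS (_ : derive1n k _ = fun t => a ^+ k * derive1n k f (a * t)); last exact/funext.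
rewrite derive1E exprSr -mulrA.
have dk : is_derive (a * s) 1 (derive1n k f) (derive1 (derive1n k f) (a * s)).
  by split; [apply: (@Cinfty_derivable R R^o setT) => //; exact: openT|rewrite derive1E].
have da : is_derive s 1 ( *%R a) a.
  have := @is_deriveZ R R^o R^o id a s 1 1 (is_derive_id _ _).
  by rewrite [_ *: 1]mulr1.
have := is_derive1_comp dk da => dc.
have [_ ->] := @is_deriveZ R R^o R^o _ (a ^+ k) s 1 _ dc.
by rewrite /= [X in _ = _ * X]mulrC.
Qed.

Lemma derive1nS_cstR k (c s : R) : derive1n k.+1 (fun=> c) s = 0.
Proof.
have E j : derive1n j.+1 (fun=> c) = (fun=> 0 : R).
  elim: j => [|j IH]; apply/funext => t; first by rewrite /= derive1_cst.
  by rewrite derive1nS IH derive1_cst.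
by rewrite E.
Qed.

Lemma bounded_derivs f b k : smf f -> (forall t, t <= 0 -> f t = f 0) ->
  (forall t, b <= t -> f t = f b) ->
  exists C, 0 <= C /\ forall i s, (i <= k)%N -> `|derive1n i f s| <= C.
Proof.
move=> sf f0 f1.
have bnd j : exists M, 0 <= M /\ forall s, `|derive1n j f s| <= M.
  have cj : {within `[0, b], continuous (derive1n j f)}.
    apply: derivable_within_continuous => s _.
    by apply: (@Cinfty_derivable R R^o setT) => //; exact: openT.
  have [M [_ Mb]] := compact_bounded (continuous_compact cj (@segment_compact _ _ _)).
  have M1 : M < `|M| + 1 by rewrite (le_lt_trans (ler_norm _)) // ltrDl.
  exists (`|M| + 1 + `|f 0| + `|f b|); split; first by rewrite !addr_ge0.
  move=> s; have cstb c : `|derive1n j (fun=> c : R) s| <= `|c|.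
    by case: j {cj Mb} => [//|j]; rewrite derive1nS_cstR normr0.
  have [s0|s0] := ltP s 0.
    rewrite (nbhs_singleton (derive1n_near (X := R^o) (g := fun=> f 0) j _)).
      by rewrite (le_trans (cstb _)) // -addrA addrCA lerDl addr_ge0.
    by near=> y; rewrite f0 // ltW //; near: y; exact: lt_nbhsl.
  have [s1|s1] := ltP b s.
    rewrite (nbhs_singleton (derive1n_near (X := R^o) (g := fun=> f b) j _)).
      by rewrite (le_trans (cstb _)) // lerDr !addr_ge0.
    by near=> y; rewrite f1 // ltW //; near: y; exact: lt_nbhsr.
  rewrite -addrA ler_wpDr ?addr_ge0 //.
  by apply: (Mb _ M1); exists s => //=; rewrite in_itv /= s0 s1.
have [M Mb] := choice bnd.
exists (\sum_(j < k.+1) M j); split; first by apply: sumr_ge0 => j _; have [] := Mb j.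
move=> i s ik; rewrite (bigD1 (Ordinal (ik : (i < k.+1)%N))) //=.
have [_ /(_ s) Mi] := Mb i; rewrite (le_trans Mi) // lerDl sumr_ge0 // => j _.
by have [] := Mb j.
Unshelve. all: by end_near. Qed.

Lemma flat_incr Y i s c : 0 <= s -> (forall u, 0 <= u <= s -> `|derive1n i.+1 Y u| <= c) ->
  `|derive1n i Y s| <= s * c.
Proof.
move=> s0 Yc; apply/ler_addgt0Pr => e e0.
(* [convex_mvt] needs an open set, hence the slack [e]. *)
pose U : set X := [set x | `|x| < s * c + e].
have c0 : 0 <= c by apply: le_trans (Yc 0 _); rewrite ?lexx.
suff : U (derive1n i Y (s * 1) - derive1n i Y (s * 0)).
  by rewrite /U /= mulr1 mulr0 (path_derive_le0 _ _ (lexx 0)) subr0 => /ltW.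
apply: (@convex_mvt _ _ U (fun t => derive1n i Y (s * t)) (fun t => s *: derive1n i.+1 Y (s * t))).
- move=> x y t /andP[t0 t1] Ux Uy; rewrite /U /= (le_lt_trans (ler_normD _ _)) // !normrZ.
  rewrite (ger0_norm t0) (@ger0_norm _ (1 - t)) ?subr_ge0 //.
  have [->|t0'] := eqVneq t 0; first by rewrite mul0r add0r subr0 mul1r.
  have -> : s * c + e = t * (s * c + e) + (1 - t) * (s * c + e) by ring.
  apply: ltr_leD; first by rewrite ltr_pM2l // lt_neqAle eq_sym t0'.
  by rewrite ler_wpM2l ?subr_ge0 // ltW.
- move=> t _; have := @derivable_hasD R _ (derive1n i Y) (s * t) s (@flat_vect_derivable R Path n Y i (s * t)).
  apply: dnbhs0_eq_cvg => h h0; rewrite mulrDr [h *: s]mulrC.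
  by [].
- rewrite /U; have : continuous (fun x : X => `|x|) by move=> x; exact: norm_continuous.
  by move=> /continuousP /(_ _ (@open_lt _ (s * c + e))).
- move=> t /andP[t0 t1]; rewrite /U /= normrZ ger0_norm //.
  apply: (@le_lt_trans _ _ (s * c)); last by rewrite ltrDl.
  by rewrite ler_wpM2l // Yc // mulr_ge0 //= ler_piMr.
Qed.

(** All derivatives vanish at 0, so every further derivative buys a factor [s]. *)
Lemma flat_taylor Y M i s : 0 <= s -> `|derive1n i Y s| <= s ^+ M * Ck_norm (i + M) Y.
Proof.
elim: M i s => [|M IH] i s s0; first by rewrite mul1r addn0; exact: path_derive_bound.
rewrite exprS -mulrA; apply: flat_incr => // u /andP[u0 us].
rewrite (le_trans (IH _ _ u0)) // addSnnS ler_wpM2r ?Ck_norm_ge0 //.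
by rewrite lerXn2r.
Qed.

Definition step (r t : R) : R := step1 (r^-1 * t).

Lemma step_le r t : 0 < r -> t <= r / 2 -> step r t = 0.
Proof. by move=> r0 tr; rewrite /step step1_le0 // mulrC ler_pdivrMr // mulrC. Qed.
Lemma step_ge r t : 0 < r -> r <= t -> step r t = 1.
Proof. by move=> r0 tr; rewrite /step step1_ge1 // mulrC ler_pdivlMr // mul1r. Qed.
Lemma step0 r : 0 < r -> step r 0 = 0.
Proof. by move=> r0; rewrite step_le // divr_ge0 // ltW. Qed.
Lemma smf_step r : smf (step r).
Proof. by apply: smf_comp (smf_step1) _; apply: smfZ; exact: smf_id. Qed.
Lemma cutoff_step r : 0 < r -> r <= pi -> cutoff (step r).
Proof.
move=> r0 rp; split; last exact: smf_step.
apply: wraps_pathI => t t0.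
  by rewrite step0 // step_le // (le_trans t0) // divr_ge0 // ltW.
by rewrite !step_ge // (le_trans rp).
Qed.

(** Derivatives of the cutoff cost at most a factor [r ^- k], while on [[0, r]] flatness of [Y]
    gains [r ^+ (k + M)] at the price of [k + M] more derivatives. *)
Lemma cut_bound k M : exists C, 0 <= C /\ forall r Y, 0 < r -> r <= 1 ->
  Ck_norm k (Y - smul (step r) Y) <= C * (r ^+ M * Ck_norm (k + (k + M)) Y).
Proof.
pose phi t : R := 1 - step1 t.
have sphi : smf phi by apply: smfD; [exact: smf_cst|apply: smfN; exact: smf_step1].
have [||C [C0 Cb]] := @bounded_derivs phi 1 k sphi.
- by move=> t t0; rewrite /phi !step1_le0 // (le_trans t0).
- by move=> t t0; rewrite /phi !step1_ge1.
exists (2 ^+ k * C); split; first by rewrite mulr_ge0 // exprn_ge0.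
move=> r Y r0 r1; have rp : r <= pi by rewrite (le_trans r1) // (le_trans _ (pi_ge2 R)) // ler1n.
have E : Y - smul (step r) Y = (fun t => phi (r^-1 * t) *: Y t) :> (R -> X).
  apply/funext => t; rewrite -[LHS]/(Y t - smul (step r) Y t) smulE; last exact: cutoff_step.
  by rewrite scalerBl scale1r.
have sphir : smf (fun t => phi (r^-1 * t)).
  by apply: smf_comp sphi _; apply: smfZ; exact: smf_id.
have N0 := Ck_norm_ge0 (k + (k + M)) Y.
apply: Ck_norm_le => j s jk /andP[s0 _]; rewrite E.
have [sr|rs] := lerP s r.
  have -> : 2 ^+ k * C * (r ^+ M * Ck_norm (k + (k + M)) Y) =
      2 ^+ k * ((C / r ^+ k) * (r ^+ (k + M) * Ck_norm (k + (k + M)) Y)).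
    rewrite exprD -!mulrA; congr (_ * (_ * _)).
    by rewrite mulKf // expf_neq0 // gt_eqF.
  apply: (@le_trans _ _ (2 ^+ j * ((C / r ^+ k) * (r ^+ (k + M) * Ck_norm (k + (k + M)) Y)))).
    apply: leibniz_bound => //; first exact: flat_vect_Cinfty.
      move=> i ij; rewrite derive1n_dilate // normrM mulrC.
      apply: ler_pM => //; first by apply: Cb; exact: leq_trans jk.
      rewrite ger0_norm ?exprn_ge0 ?invr_ge0 ?(ltW r0) // -exprVn.
      by apply: ler_weXn2l; [rewrite invf_ge1|exact: leq_trans jk].
    move=> i ij; rewrite (le_trans (flat_taylor Y (k + M) i s0)) //.
    apply: ler_pM; rewrite ?exprn_ge0 ?Ck_norm_ge0 //; first by rewrite lerXn2r // nnegrE // ltW.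
    by apply: Ck_norm_mono; rewrite leq_add2r (leq_trans ij).
  rewrite ler_wpM2r ?mulr_ge0 ?invr_ge0 ?exprn_ge0 ?(ltW r0) //.
  by apply: ler_weXn2l => //; rewrite ler1n.
rewrite (nbhs_singleton (derive1n_near (g := fun=> 0) j _)).
  rewrite [X in `|X|](_ : _ = 0) ?normr0 ?mulr_ge0 ?exprn_ge0 // ?(ltW r0) //.
  by case: (j) => // i; rewrite derive1nS_cst.
near=> y; rewrite /phi step1_ge1 ?subrr ?scale0r // mulrC ler_pdivlMr // mul1r ltW //.
by near: y; exact: lt_nbhsr.
Unshelve. all: by end_near. Qed.

(** Constants are not flat at 0, so here the cost [r ^- k] of the cutoff is not compensated;
    [cut_bound] with [M] equal to [k.+1] will outweigh it. *)
Lemma ten_bound k : exists C, 0 <= C /\ forall r (x : X), 0 < r -> r <= 1 ->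
  Ck_norm k (ten (step r) x - ten (step (r / 2)) x) <= C / r ^+ k * `|x|.
Proof.
pose phi t : R := step1 t - step1 (2 * t).
have sphi : smf phi.
  apply: smfD; first exact: smf_step1.
  by apply: smfN; apply: smf_comp smf_step1 _; apply: smfZ; exact: smf_id.
have [||C [C0 Cb]] := @bounded_derivs phi 1 k sphi.
- by move=> t t0; rewrite /phi !step1_le0 ?mulr0 // (le_trans (y := 0)) // pmulr_rle0.
- by move=> t t0; rewrite /phi !step1_ge1 //; lra.
exists (2 ^+ k * C); split; first by rewrite mulr_ge0 // exprn_ge0.
move=> r x r0 r1; have rp : r <= pi by rewrite (le_trans r1) // (le_trans _ (pi_ge2 R)) // ler1n.
have r20 : 0 < r / 2 by rewrite divr_gt0.
have r2p : r / 2 <= pi by rewrite (le_trans _ rp) // ler_pdivrMr // ler_peMr ?ler1n // ltW.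
have E : ten (step r) x - ten (step (r / 2)) x = (fun t => phi (r^-1 * t) *: x) :> (R -> X).
  apply/funext => t; rewrite -[LHS]/(ten (step r) x t - ten (step (r / 2)) x t).
  have T1 := tenE x t (cutoff_step r0 rp) (step0 r0).
  have T2 := tenE x t (cutoff_step r20 r2p) (step0 r20).
  transitivity (step r t *: x - step (r / 2) t *: x); first exact: (congr2 (fun a b => a - b) T1 T2).
  by rewrite -scalerBl /step /phi invfM invrK [_^-1 * 2]mulrC mulrA.
have sphir : smf (fun t => phi (r^-1 * t)).
  by apply: smf_comp sphi _; apply: smfZ; exact: smf_id.
apply: Ck_norm_le => j s jk /andP[s0 _]; rewrite E.
apply: (@le_trans _ _ (2 ^+ j * ((C / r ^+ k) * `|x|))).
  apply: leibniz_bound => //; first exact: Cinfty_cst.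
    move=> i ij; rewrite derive1n_dilate // normrM mulrC.
    apply: ler_pM => //; first by apply: Cb; exact: leq_trans jk.
    rewrite ger0_norm ?exprn_ge0 ?invr_ge0 ?(ltW r0) // -exprVn.
    by apply: ler_weXn2l; [rewrite invf_ge1|exact: leq_trans jk].
  by case=> [//|i] _; rewrite derive1nS_cst normr0.
rewrite !mulrA ler_wpM2r // ler_wpM2r ?invr_ge0 ?exprn_ge0 ?(ltW r0) // ler_wpM2r //.
by apply: ler_weXn2l => //; rewrite ler1n.
Qed.

Lemma step_cvg (r : nat -> R) Y : (forall j, 0 < r j <= 1) -> r @ \oo --> (0 : R) ->
  (fun j => smul (step (r j)) Y) @ \oo --> Y.
Proof.
move=> r01 r0; apply: cvg_flat => k e e0.
have [C [C0 Cb]] := cut_bound k 1.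
pose N := C * Ck_norm (k + (k + 1)) Y + 1.
have N0 : 0 < N by rewrite ltr_wpDl // mulr_ge0 // Ck_norm_ge0.
have /cvgrPdist_lt /(_ _ (divr_gt0 e0 N0)) rN := r0.
near=> j; move=> s s02; have /andP[rj0 rj1] := r01 j.
rewrite -flat_vectB (le_lt_trans (le_Ck_norm (k := k) _ _ s02)) // -opprB.
have -> : Ck_norm k (- (Y - smul (step (r j)) Y)) = Ck_norm k (Y - smul (step (r j)) Y).
  apply/le_anti/andP; split.
    by have := Ck_normZ k (-1) (Y - smul (step (r j)) Y); rewrite scaleN1r normrN normr1 mul1r.
  by have := Ck_normZ k (-1) (- (Y - smul (step (r j)) Y)); rewrite scaleN1r opprK normrN normr1 mul1r.
rewrite (le_lt_trans (Cb _ _ rj0 rj1)) // expr1.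
apply: (@le_lt_trans _ _ (r j * (C * Ck_norm (k + (k + 1)) Y))); first by rewrite mulrCA.
apply: (@lt_trans _ _ (r j * N)); first by rewrite ltr_pM2l // ltrDl.
rewrite -ltr_pdivlMr //.
have rje : `|0 - r j| < e / N by near: j; exact: rN.
by move: rje; rewrite sub0r normrN ger0_norm // ltW.
Unshelve. all: by end_near. Qed.

End PathVectors.

(** * Approximation of path functions by polynomials *)

Section PolynomialApproximation.
Context {R : realType}.
Implicit Types (f g F : R -> R) (p q : {poly R}).

(** De Casteljau's recursion for the Bernstein polynomial of degree [N] with coefficients [g i]; it
    spares all binomial sums. *)
Fixpoint bernstein N (g : nat -> R) : {poly R} :=
  if N is N'.+1 then 'X * bernstein N' (g \o succn) + (1 - 'X) * bernstein N' g
  else (g 0%N)%:P.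

Lemma bernsteinS N (g : nat -> R) x : (bernstein N.+1 g).[x] =
  x * (bernstein N (g \o succn)).[x] + (1 - x) * (bernstein N g).[x].
Proof. by rewrite /= !hornerE. Qed.

Lemma bernstein_le N (g h : nat -> R) x : 0 <= x <= 1 -> (forall i, g i <= h i) ->
  (bernstein N g).[x] <= (bernstein N h).[x].
Proof.
move=> /andP[x0 x1]; elim: N g h => [|N IH] g h gh; first by rewrite !hornerC.
rewrite !bernsteinS lerD // ler_wpM2l ?subr_ge0 // IH // => i; exact: gh.
Qed.

Lemma bernstein_affine N (g : nat -> R) a b x :
  (bernstein N (fun i => a * g i + b)).[x] = a * (bernstein N g).[x] + b.
Proof.
elim: N g => [|N IH] g; first by rewrite !hornerC.
by rewrite !bernsteinS (IH (g \o succn)) IH; ring.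
Qed.

(** Mean and variance of the binomial distribution in one formula; the shift [c] makes the induction
    close. *)
Lemma bernstein_moment N c x :
  (bernstein N (fun i => (i%:R + c) ^+ 2)).[x] = N%:R * (x * (1 - x)) + (N%:R * x + c) ^+ 2.
Proof.
elim: N c => [|N IH] c; first by rewrite hornerC !mul0r !add0r.
rewrite bernsteinS IH.
have -> : (fun i : nat => (i%:R + c) ^+ 2) \o succn = (fun i => (i%:R + (c + 1)) ^+ 2).
  by apply/funext => i /=; rewrite -natr1 addrAC addrA.
by rewrite IH -[N.+1%:R]natr1; ring.
Qed.

Lemma bernstein_approx g L e : 0 <= L -> 0 < e ->
  (forall x y, `|g x - g y| <= L * `|x - y|) ->
  exists p, forall x, 0 <= x <= 1 -> `|g x - p.[x]| <= e.
Proof.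
move=> L0 e0 Lg.
pose d := e / 2 / (L + 1).
have L1 : 0 < L + 1 by rewrite ltr_wpDl.
have d0 : 0 < d by rewrite !divr_gt0.
pose N := (Num.truncn (d ^- 2)).+1.
have Nd : d ^- 2 < N%:R by rewrite truncnS_gt.
have N0 : 0 < N%:R :> R by rewrite ltr0n.
exists (bernstein N (fun i => g (i%:R / N%:R))) => x x01.
have key s : `|g x - g s| <= L * (d + (s - x) ^+ 2 / d).
  rewrite (le_trans (Lg _ _)) // ler_wpM2l // distrC.
  have [sd|sd] := lerP `|s - x| d; first by rewrite ler_wpDr // divr_ge0 ?sqr_ge0 // ltW.
  rewrite ler_wpDl ?(ltW d0) // ler_pdivlMr // -real_normK ?num_real // expr2.
  by rewrite ler_wpM2l // ltW.
have mom : (bernstein N (fun i => L / d * (i%:R / N%:R - x) ^+ 2 + L * d)).[x] <= e.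
  have -> : (fun i : nat => L / d * (i%:R / N%:R - x) ^+ 2 + L * d) =
      (fun i => (L / d / N%:R ^+ 2) * (i%:R + (- (N%:R * x))) ^+ 2 + L * d).
    apply/funext => i; congr (_ + _); rewrite -!mulrA; congr (_ * (_ * _)).
    by rewrite -exprVn -exprMn; congr (_ ^+ 2); field; rewrite gt_eqF.
  rewrite bernstein_affine bernstein_moment subrr expr0n /= addr0.
  have -> : L / d / N%:R ^+ 2 * (N%:R * (x * (1 - x))) = L * (x * (1 - x) / (d * N%:R)).
    by field; rewrite !gt_eqF.
  rewrite -mulrDr.
  have xx : x * (1 - x) <= 1.
    by move: x01 => /andP[x0 x1]; rewrite mulr_ile1 ?subr_ge0 // gerDl oppr_le0.
  have b1 : x * (1 - x) / (d * N%:R) <= d.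
    have dN : 0 < d * N%:R by rewrite mulr_gt0.
    rewrite ler_pdivrMr //; apply: (le_trans xx).
    rewrite mulrA -expr2.
    by rewrite -ler_pdivrMl ?exprn_gt0 // mulr1 ltW.
  apply: (@le_trans _ _ (L * (d + d))); first by rewrite ler_wpM2l // lerD2r.
  have -> : L * (d + d) = e * (L / (L + 1)) by rewrite /d; field; rewrite gt_eqF.
  by rewrite ler_piMr ?(ltW e0) // ler_pdivrMr // mul1r lerDl.
have key' i : L * (d + (i%:R / N%:R - x) ^+ 2 / d) = L / d * (i%:R / N%:R - x) ^+ 2 + L * d by ring.
rewrite distrC ler_norml; apply/andP; split.
  rewrite lerNl opprB.
  apply: le_trans mom; rewrite -[leLHS]addrC -[X in X + _]mulN1r -bernstein_affine.
  apply: bernstein_le => // i; rewrite -key' (le_trans _ (key _)) //.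
  by rewrite mulN1r addrC ler_norm.
apply: le_trans mom; rewrite -[X in X - _]mul1r -bernstein_affine.
apply: bernstein_le => // i; rewrite -key' (le_trans _ (key _)) //.
by rewrite mul1r distrC ler_norm.
Qed.

Definition antideriv p : {poly R} := \poly_(i < (size p).+1) (p`_i.-1 / i%:R).

Lemma antiderivK p : deriv (antideriv p) = p.
Proof.
apply/polyP => i; rewrite coef_deriv coef_poly ltnS.
case: ltnP => ip; first by rewrite -[LHS]mulr_natr divfK // pnatr_eq0.
by rewrite mul0rn nth_default.
Qed.

Lemma antideriv0 p : (antideriv p).[0] = 0.
Proof. by rewrite horner_coef0 coef_poly /= invr0 mulr0. Qed.

Lemma smf_horner p : smf (horner p).
Proof.
have -> : horner p = (fun t => \sum_(i < size p) p`_i * t ^+ i) by apply/funext => t; rewrite horner_coef.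
have sX i : smf (fun t : R => t ^+ i).
  elim: i => [|i IH]; first by under eq_fun do rewrite expr0; exact: smf_cst.
  by under eq_fun do rewrite exprS; apply: smfM => //; exact: smf_id.
elim: (size p) => [|m IH]; first by under eq_fun do rewrite big_ord0; exact: smf_cst.
under eq_fun do rewrite big_ord_recr /=.
by apply: smfD => //; apply: smfZ.
Qed.

Definition pathfn f := cutoff f /\ f 0 = 0.

Lemma derive1_leP f s c : smf f -> f 0 = 0 -> 0 <= s -> (forall u, 0 <= u <= s -> `|derive1 f u| <= c) ->
  `|f s| <= s * c.
Proof.
move=> sf f0; rewrite le_eqVlt => /orP[/eqP <- _|s0 fc]; first by rewrite f0 normr0 mul0r.
have df (x : R) : derivable f x 1.
  by apply: (@Cinfty_derivable R R^o setT f 0 x openT sf I).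
have [||x] := @MVT R f (derive1 f) 0 s s0.
- by move=> x _; rewrite derive1E; split.
- by apply: derivable_within_continuous => x _.
rewrite in_itv /= f0 !subr0 => /andP[x0 xs] ->.
rewrite normrM (gtr0_norm s0) mulrC ler_wpM2l ?(ltW s0) // fc // !ltW //.
Qed.

(** A path function is constant outside [[0, pi]], so its derivative vanishes there and, by
    continuity, at the endpoints. *)
Lemma pathfn_derive f : pathfn f -> pathfn (derive1 f).
Proof.
move=> [[wf sf] f0].
have near0 (t : R) : t < 0 -> derive1 f t = 0.
  move=> t0; rewrite -[derive1 f]/(derive1n 1 f) (nbhs_singleton (derive1n_near (X := R^o) (g := fun=> 0) 1 _)).
    exact: derive1_cst.
  near=> y; rewrite -f0 (wraps_path_le0 wf) // ltW //; near: y; exact: lt_nbhsl.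
have nearpi (t : R) : pi < t -> derive1 f t = 0.
  move=> t0; rewrite -[derive1 f]/(derive1n 1 f) (nbhs_singleton (derive1n_near (X := R^o) (g := fun=> f pi) 1 _)).
    exact: derive1_cst.
  near=> y; rewrite (wraps_path_gepi wf) // ltW //; near: y; exact: lt_nbhsr.
have cf (t : R) : {for t, continuous (derive1 f : R^o -> R^o)}.
  exact: (Cinfty_cont (smf_derive 1 sf)).
have z0 : derive1 f 0 = 0.
  have h0 : (derive1 f : R^o -> R^o) t @[t --> (0 : R)^'-] --> (0 : R).
    apply: cvg_near_cst; near=> t; exact: near0.
  apply: (cvg_unique (@hausdorff_normed R R^o) _ h0).
  by apply: cvg_within_filter; exact: cf.
have zpi : derive1 f pi = 0.
  have h0 : (derive1 f : R^o -> R^o) t @[t --> (pi : R)^'+] --> (0 : R).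
    apply: cvg_near_cst; near=> t; exact: nearpi.
  apply: (cvg_unique (@hausdorff_normed R R^o) _ h0).
  by apply: cvg_within_filter; exact: cf.
split=> //; split; last exact: smf_derive 1 sf.
apply: wraps_pathI => t; rewrite ?z0 ?zpi le_eqVlt => /orP[/eqP|]; [by move=> ->|exact: near0|by move=> <-|exact: nearpi].
Unshelve. all: by end_near. Qed.

(** Approximate the derivative and integrate: this controls one more order of differentiation and
    keeps the value 0 at 0. *)
Lemma pathfn_approx k f e : pathfn f -> 0 < e -> exists p, p.[0] = 0 /\
  forall j t, (j <= k)%N -> 0 <= t <= pi -> `|derive1n j (fun t => f t - p.[t]) t| <= e.
Proof.
elim: k f e => [|k IH] f e pf e0; have [[wf sf] f0] := pf.
  have [||C [C0 Cb]] := @bounded_derivs _ f pi 1 sf.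
  - by move=> t t0; rewrite (wraps_path_le0 wf).
  - by move=> t t0; rewrite (wraps_path_gepi wf).
  have df (x : R) : derivable f x 1.
    by apply: (@Cinfty_derivable R R^o setT f 0 x openT sf I).
  have lip x y : `|f x - f y| <= C * `|x - y|.
    wlog xy : x y / y < x => [H|].
      have [|xy|->] := ltgtP y x; [exact: H|by rewrite distrC [`|x - y|]distrC H|].
      by rewrite !subrr normr0 mulr0.
    have [||z] := @MVT R f (derive1 f) y x xy.
    - by move=> z _; rewrite derive1E; split.
    - by apply: derivable_within_continuous => z _.
    by move=> _ ->; rewrite normrM ler_wpM2r // (Cb 1%N).
  have e20 : 0 < e / 2 by rewrite divr_gt0.
  have [||p pf'] := @bernstein_approx (fun t => f (pi * t)) (C * pi) (e / 2) _ e20.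
  - by rewrite mulr_ge0 // pi_ge0.
  - move=> x y; rewrite (le_trans (lip _ _)) // -mulrBr normrM (ger0_norm (pi_ge0 R)).
    by rewrite mulrA.
  pose q := p \Po (pi^-1 *: 'X).
  have qE t : q.[t] = p.[pi^-1 * t] by rewrite horner_comp !hornerE.
  have qb t : 0 <= t <= pi -> `|f t - q.[t]| <= e / 2.
    move=> /andP[t0 tp]; rewrite qE -[t in f t](mulVKf (x := pi)) ?gt_eqF ?pi_gt0 //.
    apply: pf'; rewrite mulr_ge0 ?invr_ge0 ?pi_ge0 //= mulrC ler_pdivrMr ?pi_gt0 //.
    by rewrite mul1r.
  exists (q - q.[0]%:P); split; first by rewrite hornerD hornerN hornerC subrr.
  move=> [|//] t _ tp; rewrite /= hornerD hornerN hornerC opprD opprK addrA.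
  rewrite (le_trans (ler_normD _ _)) // [e]splitr lerD ?qb //.
  by have := qb 0; rewrite f0 sub0r normrN lexx pi_ge0; exact.
(* Integration over [[0, pi]] enlarges the error by a factor of at most [pi], and [pi <= 4]. *)
have e40 : 0 < e / 4 by rewrite divr_gt0.
have [q [q0 qb]] := IH _ _ (pathfn_derive pf) e40.
exists (antideriv q); split; first exact: antideriv0.
pose g t := f t - (antideriv q).[t].
have sg : smf g by apply: smfD => //; apply: smfN; exact: smf_horner.
have gE : derive1 g = (fun t => derive1 f t - q.[t]).
  apply/funext => t; rewrite derive1E.
  have D1 : is_derive t 1 f (derive1 f t).
    split; last by rewrite derive1E.
    by apply: (@Cinfty_derivable R R^o setT f 0 t openT sf I).
  have D2 := is_derive_poly (antideriv q) t; rewrite antiderivK in D2.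
  by have [_] := is_deriveB D1 D2.
have e4 : e / 4 <= e by rewrite ler_pdivrMr // ler_peMr ?ler1n // ltW.
case=> [|j] t jk tp; last by rewrite derive1Sn gE (le_trans (qb _ _ jk tp)).
have /andP[t0 tpi] := tp.
apply: (@le_trans _ _ (t * (e / 4))).
  apply: (derive1_leP (f := g)) => //; first by rewrite /g f0 antideriv0 subr0.
  move=> u /andP[u0 ut]; rewrite gE; apply: (qb 0%N) => //.
  by rewrite u0 (le_trans ut).
apply: (@le_trans _ _ (4 * (e / 4))); last by rewrite mulrC divfK.
rewrite ler_wpM2r ?(ltW e40) //; apply: (le_trans tpi).
by have /andP[_] := (pihalf_02_cos_pihalf R).1; rewrite ler_pdivrMr // -natrM.
Qed.

End PolynomialApproximation.

Lemma clin_cvg (R : realType) (E F : tvsType R) (L : E -> F) T (FF : set_system T) (u : T -> E) l :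
  clin L -> u @ FF --> l -> (fun t => L (u t)) @ FF --> L l.
Proof.
move=> cL ul; have c : {for l, continuous L} by exact: clin_cont.
by apply: cvg_comp ul _; exact: c.
Qed.

(** * Density of functions constant near the endpoints *)

Section PathDensity.
Context {R : realType} {n : nat}.
Local Notation X := 'rV[R]_n.
Local Notation V := (flat_vect R Path n).
Implicit Types (f g : R -> R) (Y : V).

Lemma pathfnM f g : pathfn f -> pathfn g -> pathfn (fun t => f t * g t).
Proof.
move=> [[wf sf] f0] [[wg sg] g0]; split; last by rewrite f0 mul0r.
by split; [move=> s; rewrite [f s]wf [g s]wg|exact: smfM].
Qed.

Lemma pathfn_step r : 0 < r -> r <= pi -> pathfn (@step R r).
Proof. by move=> r0 rp; split; [exact: cutoff_step|exact: step0]. Qed.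

Lemma ten_smul f g (x : X) : cutoff f -> pathfn g -> smul f (ten g x) = ten (fun t => f t * g t) x.
Proof.
move=> cf [cg g0]; apply: flat_ext => t.
have cfg : cutoff (fun t => f t * g t).
  split; last exact: smfM cf.2 cg.2.
  by move=> s; rewrite [f s]cf.1 [g s]cg.1.
have fg0 : f 0 * g 0 = 0 by rewrite g0 mulr0.
by rewrite (smulE _ t cf) (tenE x t cg g0) (tenE x t cfg fg0) scalerA.
Qed.

Definition nicefn f := pathfn f /\ exists a : R,
  [/\ 0 < a, forall t, t <= a -> f t = 0 & forall t, pi - a <= t -> f t = f pi].

Definition coordfn Y (i : 'I_n) (t : R) : R := Y t 0 i.

Lemma clin_coord (i : 'I_n) : clin (fun x : X => x 0 i : R^o).
Proof.
split=> [a x y|]; first by rewrite !mxE.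
exact: coord_continuous.
Qed.

Lemma pathfn_coord Y i : pathfn (coordfn Y i).
Proof.
split; last by rewrite /coordfn path_le0 ?mxE.
split; first by move=> s; rewrite /coordfn; congr (fun_of_matrix _ 0 i); exact: (flat_wraps Y s).
apply: (@Cinfty_comp _ _ _ _ setT setT (flat_fun Y : R^o -> X) (fun x : X => x 0 i : R^o)) => //.
- exact: openT.
- exact: openT.
- exact: flat_vect_Cinfty.
- by apply: Cinfty_lin; exact: clin_coord.
Qed.

Lemma coord_ten Y : Y = \sum_i ten (coordfn Y i) (delta_mx 0 i).
Proof.
apply: flat_ext => t.
have E (s : seq 'I_n) : flat_fun (\sum_(i <- s) ten (coordfn Y i) (delta_mx 0 i)) t =
    \sum_(i <- s) ten (coordfn Y i) (delta_mx 0 i) t.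
  by elim: s => [|i s IH]; rewrite ?big_nil // !big_cons -IH.
rewrite E {1}[Y t]row_sum_delta; apply: eq_bigr => i _.
by have [ci c0] := pathfn_coord Y i; rewrite tenE.
Qed.

(** Reversal of time, corrected to start at 0. It exchanges the two endpoints, so that cutoffs at 0
    also serve at [pi]. *)
Fact reflect_path_subproof Y : {Z : V | forall t, Z t = Y pi - Y (pi - t)}.
Proof.
exists (mk_flat Path (fun t => Y pi - Y (pi - t))) => t; rewrite mk_pathE //.
- apply: wraps_pathI => s s0.
    by rewrite subr0 subrr path_gepi ?subrr // lerDl oppr_ge0.
  by rewrite subrr (path_le0 Y (s := pi - s)) ?subr_le0 // (path_le0 Y (s := 0)).
- by rewrite subr0 subrr.
apply: Cinfty_add; first exact: openT.
  exact: Cinfty_cst.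
apply: Cinfty_opp; first exact: openT.
apply: (@Cinfty_comp _ _ _ _ setT setT (fun t : R^o => pi - t : R^o) (flat_fun Y : R^o -> X)) => //.
- exact: openT.
- exact: openT.
- by apply: smfD; [exact: smf_cst|apply: smfN; exact: smf_id].
- exact: flat_vect_Cinfty.
Qed.

Definition reflect_path Y : V := sval (reflect_path_subproof Y).

Lemma reflect_pathE Y t : reflect_path Y t = Y pi - Y (pi - t).
Proof. exact: (svalP (reflect_path_subproof Y)). Qed.

Lemma clin_reflect : clin reflect_path.
Proof.
apply: (@clin_exp _ _ _ _ (fun p : V * R^o => flat_fun p.1 (pi : R^o) - flat_fun p.1 (pi - p.2 : R^o))).
- apply: Cinfty_add; first exact: openT.
    apply: Cinfty_ev; last exact: Cinfty_cst.
    by apply: Cinfty_lin; exact: clin_fst.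
  apply: Cinfty_opp; first exact: openT.
  apply: Cinfty_ev; first by apply: Cinfty_lin; exact: clin_fst.
  apply: (@Cinfty_snd R V (fun t => pi - t)).
  by apply: smfD; [exact: smf_cst|apply: smfN; exact: smf_id].
- by move=> d s; rewrite reflect_pathE.
move=> s a x y; rewrite -[LHS]/((a *: flat_fun x pi + flat_fun y pi) - (a *: flat_fun x (pi - s) + flat_fun y (pi - s))).
by rewrite scalerBr opprD addrACA.
Qed.

Lemma reflectK : involutive reflect_path.
Proof.
move=> Y; apply: flat_ext => t; rewrite !reflect_pathE subKr subrr.
by rewrite (path_le0 Y (s := 0)) // subr0 opprB addrCA subrr addr0.
Qed.

Definition reflectfn f (t : R) : R := f pi - f (pi - t).

Lemma pathfn_reflect f : pathfn f -> pathfn (reflectfn f).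
Proof.
move=> [[wf sf] f0]; split; last by rewrite /reflectfn subr0 subrr.
split.
  apply: wraps_pathI => s s0; rewrite /reflectfn.
    by rewrite subr0 subrr (wraps_path_gepi (t := pi - s) wf) ?subrr // lerDl oppr_ge0.
  by rewrite subrr f0 (wraps_path_le0 (t := pi - s) wf) ?subr_le0 // f0.
apply: smfD; first exact: smf_cst.
apply: smfN; apply: smf_comp sf _.
by apply: smfD; [exact: smf_cst|apply: smfN; exact: smf_id].
Qed.

Lemma ten_reflect f (x : X) : pathfn f -> reflect_path (ten f x) = ten (reflectfn f) x.
Proof.
move=> pf; have [cf f0] := pf; have [cr r0] := pathfn_reflect pf.
apply: flat_ext => t; rewrite reflect_pathE (tenE x pi cf f0) (tenE x (pi - t) cf f0).
by rewrite (tenE x t cr r0) -scalerBl.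
Qed.

Let rad (j : nat) : R := 2^-1 ^+ j.

Let rad01 j : 0 < rad j <= 1.
Proof. by rewrite exprn_gt0 ?invr_gt0 //= exprn_ile1 ?invr_ge0 // invf_le1 // ler1n. Qed.

Let rad0 : rad @ \oo --> (0 : R).
Proof. by apply: cvg_expr; rewrite ger0_norm ?invr_ge0 // invf_lt1 // ltr1n. Qed.

Let radpi j : rad j <= pi.
Proof. by have /andP[_ r1] := rad01 j; rewrite (le_trans r1) // (le_trans _ (pi_ge2 R)) // ler1n. Qed.

Let clin_lim0 (L : V -> R^o) (y : nat -> V) Y : clin L -> y @ \oo --> Y ->
  (forall j, L (y j) = 0) -> L Y = 0.
Proof.
move=> cL yY L0.
have h0 : (fun j => L (y j)) @ \oo --> (0 : R^o).
  by under eq_fun do rewrite L0; exact: cvg_cst.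
apply: (cvg_unique (@hausdorff_normed R R^o) _ h0).
exact: (clin_cvg cL yY).
Qed.

(** Coordinates reduce the claim to functions times constants. By [step_cvg] these are limits of
    functions vanishing near 0 and, after reflection, of functions constant near [pi]; continuity of
    [L] passes to the limit. *)
Lemma nice_dense (L : V -> R^o) : clin L -> (forall f (x : X), nicefn f -> L (ten f x) = 0) ->
  forall Y, L Y = 0.
Proof.
move=> cL L0.
have Lnear0 f (x : X) (a : R) : pathfn f -> 0 < a -> (forall t, t <= a -> f t = 0) -> L (ten f x) = 0.
  move=> pf a0 fa.
  pose g j := reflectfn (fun t => step (Num.min a (rad j)) t * reflectfn f t).
  have m0 j : 0 < Num.min a (rad j) by rewrite lt_min a0; have /andP[] := rad01 j.
  have mp j : Num.min a (rad j) <= pi by rewrite ge_min radpi orbT.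
  have m1 j : Num.min a (rad j) <= 1 by rewrite ge_min; have /andP[_ ->] := rad01 j; rewrite orbT.
  have pg j : pathfn (fun t => step (Num.min a (rad j)) t * reflectfn f t).
    by apply: pathfnM; [exact: pathfn_step|exact: pathfn_reflect].
  apply: (clin_lim0 (y := fun j => ten (g j) x) cL) => [|j].
    have E j : ten (g j) x = reflect_path (smul (step (Num.min a (rad j))) (reflect_path (ten f x))).
      rewrite (ten_reflect x pf) (ten_smul x (cutoff_step (m0 j) (mp j)) (pathfn_reflect pf)).
      by rewrite (ten_reflect x (pg j)).
    under eq_fun do rewrite E.
    suff : (fun j => reflect_path (smul (step (Num.min a (rad j))) (reflect_path (ten f x)))) @ \oo -->
      reflect_path (reflect_path (ten f x)) by rewrite reflectK.
    apply: (clin_cvg clin_reflect); apply: step_cvg.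
      by move=> j; rewrite m0 m1.
    apply: (squeeze_cvgr _ (cvg_cst 0) rad0); apply: nearW => j.
    by rewrite (ltW (m0 j)) ge_min lexx orbT.
  apply: L0; split; first exact: pathfn_reflect.
  have s0 (t : R) : t <= Num.min a (rad j) / 2 -> step (Num.min a (rad j)) t * reflectfn f t = 0.
    by move=> tr; rewrite step_le ?mul0r.
  have fp : f 0 = 0 by rewrite fa // ltW.
  have h2 : Num.min a (rad j) / 2 <= Num.min a (rad j) by rewrite ler_pdivrMr // ler_peMr ?ler1n // ltW.
  have hpi : Num.min a (rad j) / 2 <= pi - Num.min a (rad j) / 2.
    by rewrite lerBrDr -splitr.
  exists (Num.min a (rad j) / 2); split=> [|t ta|t ta].
  - by rewrite divr_gt0.
  - rewrite /g /reflectfn.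
    have E1 : step (Num.min a (rad j)) pi = 1 by rewrite step_ge.
    have [wf sf] := pf.1.
    have tp : pi - Num.min a (rad j) / 2 <= pi - t by rewrite lerD2l lerN2.
    have [rt|rt] := lerP (Num.min a (rad j)) (pi - t).
      rewrite E1 (step_ge _ rt) // !mul1r subKr subrr fp.
      rewrite (fa t) ?subr0 ?subrr // (le_trans ta) // (le_trans h2) // ge_min lexx //.
    have : pi <= Num.min a (rad j) * (3 / 2) by lra.
    have := m1 j; have := pi_ge2 R; lra.
  - rewrite /g /reflectfn.
    have t2 : pi - t <= Num.min a (rad j) / 2 by rewrite lerBlDr -lerBlDl.
    have p2 : pi - pi <= Num.min a (rad j) / 2 by rewrite subrr divr_ge0 // ltW.
    by congr (_ - _); exact: etrans (s0 _ t2) (esym (s0 _ p2)).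
have Lpath f (x : X) : pathfn f -> L (ten f x) = 0.
  move=> pf; apply: (clin_lim0 (y := fun j => smul (step (rad j)) (ten f x)) cL).
    by apply: step_cvg => // j; exact: rad01.
  move=> j; have /andP[r0 _] := rad01 j; rewrite (ten_smul x (cutoff_step r0 (radpi j)) pf).
  apply: (Lnear0 _ _ (rad j / 2)); first by apply: pathfnM => //; exact: pathfn_step.
    by rewrite divr_gt0.
  by move=> t tr; rewrite step_le // mul0r.
move=> Y; rewrite [Y]coord_ten.
have -> : L (\sum_i ten (coordfn Y i) (delta_mx 0 i)) = \sum_i L (ten (coordfn Y i) (delta_mx 0 i)).
  by apply: (big_morph L); [move=> u v; exact: clinD|exact: clin0].
by apply: big1 => i _; apply: Lpath; exact: pathfn_coord.
Qed.

(** The point is that [D] depends on [tau], [k] and [C] only. It will be applied to the difference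
    of a function and a polynomial, which is small only on the range of [tau]. *)
Lemma comp_bound (tau : R -> R) k : pathfn tau -> forall C, 0 <= C -> exists D, 0 <= D /\
  forall (f : R -> R) (g : R -> X) e, smf f -> Cinfty setT (g : R^o -> X) -> 0 <= e ->
  (forall i s, (i <= k)%N -> `|derive1n i g s| <= C) ->
  (forall i s, (i <= k)%N -> `|derive1n i f (tau s)| <= e) ->
  forall i s, (i <= k)%N -> `|derive1n i (fun t => f (tau t) *: g t) s| <= D * e.
Proof.
move=> [[wt st] t0]; elim: k => [|k IH] C C0.
  exists C; split=> // f g e _ _ e0 gC fe [|//] s _.
  by rewrite /= normrZ mulrC ler_pM //; [exact: gC 0%N s _|exact: fe 0%N s _].
have [||T [T0 Tb]] := @bounded_derivs _ tau pi k.+1 st.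
- by move=> t tt; rewrite (wraps_path_le0 wt).
- by move=> t tt; rewrite (wraps_path_gepi wt).
have TC0 : 0 <= 2 ^+ k * (T * C) by rewrite !mulr_ge0 // exprn_ge0.
have [D1 [D10 H1]] := IH _ TC0.
have [D2 [D20 H2]] := IH _ C0.
exists (C + D1 + D2); split; first by rewrite !addr_ge0.
move=> f g e sf sg e0 gC fe [|i] s ik.
  rewrite /= normrZ mulrC.
  apply: (@le_trans _ _ (C * e)); first by apply: ler_pM => //; [exact: gC 0%N s _|exact: fe 0%N s _].
  by rewrite ler_wpM2r // -addrA lerDl addr_ge0.
have sft : smf (f \o tau) by exact: smf_comp.
have sT1 := smf_derive 1 st; have sf1 := smf_derive 1 sf.
have sg1 := Cinfty_derive1n (W := setT) 1 openT sg.
have sTg : Cinfty setT (fun t : R^o => derive1n 1 tau t *: g t : X) by exact: smf_scale.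
have sa : Cinfty setT (fun t : R^o => derive1n 1 f (tau t) *: (derive1n 1 tau t *: g t) : X).
  by apply: smf_scale => //; exact: smf_comp sf1 st.
have sb : Cinfty setT (fun t : R^o => f (tau t) *: derive1n 1 g t : X) by exact: smf_scale.
rewrite derive1Sn.
have -> : derive1 (fun t => f (tau t) *: g t) =
    (fun t => derive1n 1 f (tau t) *: (derive1n 1 tau t *: g t)) + (fun t => f (tau t) *: derive1n 1 g t).
  apply/funext => t; rewrite (derive1_scale t sft sg).
  rewrite -[RHS]/(derive1n 1 f (tau t) *: (derive1n 1 tau t *: g t) + f (tau t) *: derive1n 1 g t) scalerA; congr (_ *: _ + _).
  rewrite derive1_comp //.
    by apply: (@Cinfty_derivable R R^o setT tau 0 t openT st I).
  by apply: (@Cinfty_derivable R R^o setT f 0 (tau t) openT sf I).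
rewrite derive1nD; last 2 first.
- by move=> j t; apply: (@Cinfty_derivable _ _ setT) => //; exact: openT.
- by move=> j t; apply: (@Cinfty_derivable _ _ setT) => //; exact: openT.
rewrite (le_trans (ler_normD _ _)) // -addrA mulrDl ler_wpDl ?mulr_ge0 // mulrDl lerD //.
  apply: (H1 (derive1n 1 f)) => // j u jk.
    apply: le_trans (_ : 2 ^+ j * (T * C) <= _).
      apply: leibniz_bound => // l lj; last by apply: gC; rewrite (leq_trans lj) // leqW.
      by rewrite -derive1Sn; apply: Tb; rewrite ltnS (leq_trans lj).
    by rewrite ler_wpM2r ?mulr_ge0 //; apply: ler_weXn2l => //; rewrite ler1n.
  by rewrite -derive1Sn; exact: fe.
apply: (H2 f (derive1n 1 g)) => // j u jk; last by apply: fe; rewrite leqW.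
by rewrite -derive1Sn; exact: gC.
Qed.

(** Equal to [t] on [[r, pi - r]] and constant, with value 0 or [pi], near the ends. A polynomial
    without constant term is not a path function, but its composite with [clampfn r] is one, and all
    these composites are polynomials in a single function. *)
Definition clampfn (r t : R) : R := step r t * (t + (1 - step r (pi - t)) * (pi - t)).

Section Clamp.
Variable r : R.
Hypotheses (r0 : 0 < r) (r1 : r <= 1).

Let rp : r <= pi - r.
Proof. by have := pi_ge2 R; move: r1; lra. Qed.
Let step01 (s t : R) : 0 <= step s t <= 1.
Proof. by rewrite /step step1_ge0 step1_le1. Qed.

Lemma clampfn_pathfn : pathfn (clampfn r).
Proof.
have c0 (t : R) : t <= 0 -> clampfn r t = 0.
  by move=> t0; rewrite /clampfn step_le ?mul0r // (le_trans t0) // divr_ge0 // ltW.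
have cpi (t : R) : pi <= t -> clampfn r t = pi.
  move=> t0; rewrite /clampfn step_ge //; last by have := pi_ge2 R; move: r1; lra.
  rewrite step_le ?subr0 ?mul1r ?mul1r //; first by rewrite addrCA subrr addr0.
  by rewrite (@le_trans _ _ 0) ?subr_le0 // divr_ge0 // ltW.
split; last exact: c0.
split; first by apply: wraps_pathI => t tt; [rewrite (c0 t tt) (c0 0)|rewrite (cpi t tt) (cpi pi)].
have s1 : smf (fun t : R => pi - t) by apply: smfD; [exact: smf_cst|apply: smfN; exact: smf_id].
apply: smfM; first exact: smf_step.
apply: smfD; first exact: smf_id.
apply: smfM => //; apply: smfD; first exact: smf_cst.
by apply: smfN; apply: smf_comp s1; exact: smf_step.
Qed.

Lemma clampfn_range t : 0 <= clampfn r t <= pi.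
Proof.
have [[wc _] c0] := clampfn_pathfn.
suff H u : 0 <= u <= pi -> 0 <= clampfn r u <= pi.
  rewrite wc; apply: H; have p0 := pi_ge0 R.
  by rewrite le_max lexx /= ge_max p0 ge_min lexx orbT.
move=> /andP[u0 up].
have /andP[a0 a1] := step01 r u; have /andP[b0 b1] := step01 r (pi - u).
rewrite /clampfn; set a := step r u in a0 a1 *; set b := step r (pi - u) in b0 b1 *.
have h0 : 0 <= u + (1 - b) * (pi - u) by rewrite addr_ge0 // mulr_ge0 // subr_ge0.
have h1 : u + (1 - b) * (pi - u) <= pi.
  by rewrite -lerBrDl ler_piMl ?subr_ge0 // gerDl oppr_le0.
by rewrite mulr_ge0 //= (le_trans _ h1) // ler_piMl.
Qed.

Lemma clampfnK f t : pathfn f -> (forall t, t <= r -> f t = 0) -> (forall t, pi - r <= t -> f t = f pi) ->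
  f (clampfn r t) = f t.
Proof.
move=> [[wf sf] f0] fr fp.
have [tr|tr] := lerP t r.
  rewrite (fr t) // fr // /clampfn.
  have [t0|t0] := lerP t 0; first by rewrite step_le ?mul0r ?(ltW r0) // (le_trans t0) // divr_ge0 // ltW.
  rewrite (step_ge (r := r) (t := pi - t)) //; last by rewrite (le_trans rp) // lerD2l lerN2.
  rewrite subrr mul0r addr0 (le_trans _ tr) // ler_piMl ?(ltW t0) //.
  by have /andP[] := step01 r t.
have [tp|tp] := lerP t (pi - r).
  rewrite /clampfn step_ge ?(ltW tr) // step_ge // ?subrr ?mul0r ?addr0 ?mul1r //.
  by rewrite lerBrDr -lerBrDl.
have tE : f t = f pi by rewrite fp // ltW.
rewrite tE.
have [tpi|tpi] := lerP t pi; last first.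
  congr f; rewrite /clampfn step_ge ?(ltW tr) // mul1r step_le ?subr0 ?mul1r //; first by rewrite addrCA subrr addr0.
  by rewrite (@le_trans _ _ 0) ?subr_le0 ?(ltW tpi) // divr_ge0 // ltW.
apply: fp; rewrite /clampfn step_ge ?(ltW tr) // mul1r (le_trans (ltW tp)) // lerDl.
by rewrite mulr_ge0 ?subr_ge0 //; have /andP[] := step01 r (pi - t).
Qed.

(** [f] does not notice the clamping ([clampfnK]), so a polynomial close to [f] on [[0, pi]] stays
    close to it after composition with [clampfn r]. *)
Lemma clamp_approx f (x : X) k e : pathfn f -> (forall t, t <= r -> f t = 0) ->
  (forall t, pi - r <= t -> f t = f pi) -> 0 < e ->
  exists p : {poly R}, p.[0] = 0 /\ Ck_norm k (ten f x - ten (fun t => p.[clampfn r t]) x) <= e.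
Proof.
move=> pf fr fp e0.
have pc := clampfn_pathfn.
have [D [D0 Db]] := comp_bound k pc (normr_ge0 x).
have D1 : 0 < D + 1 by rewrite ltr_wpDl.
have [p [p0 pb]] := pathfn_approx k pf (divr_gt0 e0 D1).
exists p; split=> //.
have pathp : pathfn (fun t => p.[clampfn r t]).
  split; last by rewrite pc.2.
  split; first by move=> s; congr (p.[_]); exact: pc.1.1.
  exact: smf_comp (smf_horner p) pc.1.2.
have E : ten f x - ten (fun t => p.[clampfn r t]) x =
    (fun t => (fun y => f y - p.[y]) (clampfn r t) *: x) :> (R -> X).
  apply/funext => t; have T1 := tenE x t pf.1 pf.2; have T2 := tenE x t pathp.1 pathp.2.
  transitivity (f t *: x - p.[clampfn r t] *: x); first exact: (congr2 (fun a b => a - b) T1 T2).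
  by rewrite -scalerBl (clampfnK t pf fr fp).
apply: Ck_norm_le => j s jk _; rewrite E.
apply: (@le_trans _ _ (D * (e / (D + 1)))); last first.
  by rewrite mulrC -mulrA ler_piMr ?(ltW e0) // mulrC ler_pdivrMr // mul1r lerDl.
apply: (Db (fun y => f y - p.[y]) (fun=> x)) => //.
- by apply: smfD; [exact: pf.1.2|apply: smfN; exact: smf_horner].
- exact: Cinfty_cst.
- by rewrite divr_ge0 // ltW.
- by case=> [//|i] u _; rewrite derive1nS_cst normr0.
by move=> i u ik; apply: pb => //; exact: clampfn_range.
Qed.

End Clamp.
End PathDensity.
From mathcomp Require Import zify.

(** * Second cohomology of the path algebra *)

Section BilinearMaps.
Context {R : realType}.

Lemma cbil_clinl (E F K : tvsType R) (B : E * F -> K) y : cbil B -> clin (fun x => B (x, y)).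
Proof.
move=> [cB Bl Br]; split=> [a x x'|x]; first exact: Bl.
have c : {for x, continuous (fun z : E => (z, y))}.
  by apply: cts_pair; [exact: cvg_id|exact: cvg_cst].
by apply: cvg_comp c _; exact: cB.
Qed.

Lemma cbil_clinr (E F K : tvsType R) (B : E * F -> K) x : cbil B -> clin (fun y => B (x, y)).
Proof.
move=> [cB Bl Br]; split=> [a y y'|y]; first exact: Br.
have c : {for y, continuous (fun z : F => (x, z))}.
  by apply: cts_pair; [exact: cvg_cst|exact: cvg_id].
by apply: cvg_comp c _; exact: cB.
Qed.

Lemma clin_bsum (E F : tvsType R) (L : E -> F) I (r : seq I) (u : I -> E) : clin L ->
  L (\sum_(i <- r) u i) = \sum_(i <- r) L (u i).
Proof. by move=> cL; apply: (big_morph L); [move=> a b; exact: clinD|exact: clin0]. Qed.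

Lemma clin_sums (E F : tvsType R) I (r : seq I) (L : I -> E -> F) : (forall i, clin (L i)) ->
  clin (fun x => \sum_(i <- r) L i x).
Proof.
move=> cL; elim: r => [|i r IH].
  by under eq_fun do rewrite big_nil; exact: clin_zero.
by under eq_fun do rewrite big_cons; exact: clin_sum.
Qed.

Lemma geometric_cvg (u : nat -> R) M : 0 <= M -> (forall j, `|u j.+1 - u j| <= M * 2^-1 ^+ j) ->
  exists L : R, u @ \oo --> L /\ `|L - u 0%N| <= 2 * M.
Proof.
move=> M0 uM.
have h1 : `|2^-1 : R| < 1 by rewrite ger0_norm ?invr_ge0 // invf_lt1 // ltr1n.
have cs : cvgn (series (telescope u)).
  apply: normed_cvg; apply: (@series_le_cvg R _ (geometric M 2^-1)) => [j|j|j|].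
  - exact: normr_ge0.
  - by rewrite /= mulr_ge0 // exprn_ge0 // invr_ge0.
  - exact: uM.
  - exact: is_cvg_geometric_series.
exists (u 0%N + limn (series (telescope u))).
have cu : u @ \oo --> u 0%N + limn (series (telescope u)).
  rewrite [X in X @ _](_ : _ = fun j => u 0%N + series (telescope u) j); last first.
    by apply/funext => j; rewrite -eq_sum_telescope.
  by apply: cvgD; [exact: cvg_cst|exact: cs].
split=> //.
have un j : `|u j - u 0%N| <= 2 * M.
  have -> : u j - u 0%N = series (telescope u) j by rewrite telescopeK.
  rewrite (le_trans (ler_norm_sum _ _ _)) //.
  apply: (@le_trans _ _ (series (geometric M 2^-1) j)).
    by rewrite /series /= ler_sum // => i _; exact: uM.
  rewrite (le_trans (geometric_le_lim _ _ _ h1)) ?invr_gt0 //.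
  by rewrite (_ : 1 - 2^-1 = 2^-1) ?invrK 1?mulrC //; field.
have cn : (fun j => `|u j - u 0%N|) @ \oo --> `|u 0%N + limn (series (telescope u)) - u 0%N|.
  by apply: cvg_norm; apply: cvgB => //; exact: cvg_cst.
by apply: (ler_cvg_to cn (cvg_cst (2 * M))); apply: nearW.
Qed.

Section PathNorms.
Variable n : nat.
Local Notation V := (flat_vect R Path n).

Lemma clin_bounded (L : V -> R^o) l C : (forall a x y, L (a *: x + y) = a *: L x + L y) ->
  (forall Y, `|L Y| <= C * Ck_norm l Y) -> clin L.
Proof.
move=> lL LC; split=> // Y.
have LB Z : L Z - L Y = L (Z - Y).
  by have := lL (-1) Y Z; rewrite !scaleN1r addrC => ->; rewrite addrC.
have C1 : 0 < `|C| + 1 by rewrite ltr_wpDl.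
move=> M /nbhs_ballP[e /= e0 eM].
have := nbhs_flat_ball Y l (divr_gt0 e0 C1).
apply: filterS => Z; rewrite /flat_ball /= => ZY.
apply: eM; rewrite -ball_normE /= distrC LB (le_lt_trans (LC _)) //.
apply: (@le_lt_trans _ _ ((`|C| + 1) * Ck_norm l (Z - Y))).
  by rewrite ler_wpM2r ?Ck_norm_ge0 // (le_trans (ler_norm _)) // lerDl.
by rewrite mulrC -ltr_pdivlMr.
Qed.

(** Continuity at the origin and scaling. One index [k] serves both arguments because the norms
    increase with [k]. *)
Lemma cbil_bound (B : V * V -> R^o) : cbil B -> exists k C, 0 <= C /\
  forall X Y, `|B (X, Y)| <= C * Ck_norm k X * Ck_norm k Y.
Proof.
move=> bB; have [cB _ _] := bB.
have B00 : B (0, 0) = 0 := clin0 (cbil_clinl 0 bB).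
have /cvgrPdist_lt /(_ 1 ltr01) : B x @[x --> (0, 0)] --> B (0, 0) := cB (0, 0).
case=> -[U W] /= [/nbhs_flatP[k1 [e1 [e10 U1]]] /nbhs_flatP[k2 [e2 [e20 W2]]]] UW.
pose k := maxn k1 k2; pose e := Num.min e1 e2.
have e0 : 0 < e by rewrite lt_min e10.
have small X Y : Ck_norm k X < e -> Ck_norm k Y < e -> `|B (X, Y)| < 1.
  move=> Xe Ye; have : `|B (0, 0) - B (X, Y)| < 1.
    apply: (UW (X, Y)); split=> /=; [apply: U1|apply: W2]; rewrite /flat_ball /= subr0.
      rewrite (le_lt_trans _ (lt_le_trans Xe _)) ?Ck_norm_mono ?leq_maxl //.
      by rewrite ge_min lexx.
    rewrite (le_lt_trans _ (lt_le_trans Ye _)) ?Ck_norm_mono ?leq_maxr //.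
    by rewrite ge_min lexx orbT.
  by rewrite B00 sub0r normrN.
have BZ a b X Y : B (a *: X, b *: Y) = a * (b * B (X, Y)).
  by rewrite (clinZ a X (cbil_clinl _ bB)) (clinZ b Y (cbil_clinr _ bB)).
(* Bounds strictly above the norms avoid division by a norm that may be 0; at the end they are
   lowered to the norms. *)
have strict X Y a b : Ck_norm k X < a -> Ck_norm k Y < b -> `|B (X, Y)| <= e ^- 2 * a * b.
  move=> Xa Yb.
  have a0 := le_lt_trans (Ck_norm_ge0 _ _) Xa; have b0 := le_lt_trans (Ck_norm_ge0 _ _) Yb.
  have sc (Z : V) c : 0 < c -> Ck_norm k Z < c -> Ck_norm k ((e / c) *: Z) < e.
    move=> c0 Zc; rewrite (le_lt_trans (Ck_normZ _ _ _)) // ger0_norm ?divr_ge0 ?(ltW e0) ?(ltW c0) //.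
    by rewrite mulrAC ltr_pdivrMr // ltr_pM2l.
  have := small _ _ (sc _ _ a0 Xa) (sc _ _ b0 Yb).
  rewrite BZ => H.
  have ea := ger0_norm (divr_ge0 (ltW e0) (ltW a0)); have eb := ger0_norm (divr_ge0 (ltW e0) (ltW b0)).
  have {}H : e / a * (e / b * `|B (X, Y) : R|) < 1 by rewrite -{1}ea -{1}eb -!normrM; exact: H.
  have -> : `|B (X, Y)| = e ^- 2 * a * b * (e / a * (e / b * `|B (X, Y) : R|)).
    by field; rewrite !gt_eqF.
  by rewrite ler_piMr ?(ltW H) // !mulr_ge0 ?invr_ge0 ?exprn_ge0 // ltW.
exists k, (e ^- 2); split=> [|X Y]; first by rewrite invr_ge0 exprn_ge0 // ltW.
set C := e ^- 2; set a := Ck_norm k X; set b := Ck_norm k Y.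
have C0 : 0 <= C by rewrite invr_ge0 exprn_ge0 // ltW.
have a0 : 0 <= a by exact: Ck_norm_ge0.
have b0 : 0 <= b by exact: Ck_norm_ge0.
have D0 : 0 < C * (a + b + 1) + 1 by rewrite ltr_wpDl // mulr_ge0 // !addr_ge0.
apply/ler_addgt0Pr => d d0.
pose h := Num.min 1 (d / (C * (a + b + 1) + 1)).
have h0 : 0 < h by rewrite lt_min ltr01 divr_gt0.
have h1 : h <= 1 by rewrite ge_min lexx.
have := @strict X Y (a + h) (b + h); rewrite !ltrDl => /(_ h0 h0) /le_trans; apply.
have -> : C * (a + h) * (b + h) = C * a * b + h * (C * (a + b + h)) by ring.
rewrite lerD2l (@le_trans _ _ (h * (C * (a + b + 1) + 1))) //.
  by rewrite ler_wpM2l ?(ltW h0) // ler_wpDr // ler_wpM2l // lerD2l.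
by rewrite -ler_pdivlMr // ge_min lexx orbT.
Qed.

End PathNorms.
End BilinearMaps.

Section SecondCohomology.
Context {R : realType} {n : nat}.
Local Notation X := 'rV[R]_n.
Local Notation V := (flat_vect R Path n).
Variable br : X -> X -> X.
Hypothesis bbr : cbil (fun p : X * X => br p.1 p.2).
Hypothesis brC : forall x y, br x y = - br y x.
Hypothesis jacobi : forall x y z, br x (br y z) = br (br x y) z + br y (br x z).
Variable f : 'I_n -> X.
Local Notation e i := (delta_mx 0 i : X).
Hypothesis casimir_inv : forall (B : X -> X -> R) x,
  (forall a y1 y2 z, B (a *: y1 + y2) z = a * B y1 z + B y2 z) ->
  (forall a y1 y2 z, B z (a *: y1 + y2) = a * B z y1 + B z y2) ->
  \sum_i (B (br x (e i)) (f i) + B (e i) (br x (f i))) = 0.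
Hypothesis casimirE : forall y, \sum_i br (e i) (br (f i) y) = y.

Let brZl a x y : br (a *: x) y = a *: br x y := clinZ a x (cbil_clinl y bbr).
Let brZr a x y : br x (a *: y) = a *: br x y := clinZ a y (cbil_clinr x bbr).
Let br0l y : br 0 y = 0 := clin0 (cbil_clinl y bbr).
Let br0r x : br x 0 = 0 := clin0 (cbil_clinr x bbr).

Lemma Cinfty_br (D : tvsType R) (a b : D -> X) : Cinfty setT a -> Cinfty setT b ->
  Cinfty setT (fun d => br (a d) (b d)).
Proof.
move=> Ca Cb; apply: (@Cinfty_comp _ _ _ _ setT setT (fun d => (a d, b d)) (fun p : X * X => br p.1 p.2)) => //.
- exact: openT.
- exact: openT.
- exact: Cinfty_pair.
- exact: Cinfty_bil bbr.
Qed.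

Fact vbr_subproof (Y Z : V) : {W : V | forall t, W t = br (Y t) (Z t)}.
Proof.
exists (mk_flat Path (fun t => br (Y t) (Z t))) => t; rewrite mk_pathE //.
- by move=> s; rewrite -(flat_wraps Y s) -(flat_wraps Z s).
- by rewrite path_le0.
- by apply: Cinfty_br; exact: flat_vect_Cinfty.
Qed.
Definition vbr Y Z : V := sval (vbr_subproof Y Z).
Lemma vbrE Y Z t : vbr Y Z t = br (Y t) (Z t).
Proof. exact: (svalP (vbr_subproof Y Z)). Qed.

(** Bracket with a constant. It acts on the path algebra although nonzero constants are not elements
    of it. *)
Fact adv_subproof (x : X) (Y : V) : {W : V | forall t, W t = br x (Y t)}.
Proof.
exists (mk_flat Path (fun t => br x (Y t))) => t; rewrite mk_pathE //.
- by move=> s; rewrite -(flat_wraps Y s).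
- by rewrite path_le0.
- by apply: Cinfty_br; [exact: Cinfty_cst|exact: flat_vect_Cinfty].
Qed.
Definition adv x Y : V := sval (adv_subproof x Y).
Lemma advE x Y t : adv x Y t = br x (Y t).
Proof. exact: (svalP (adv_subproof x Y)). Qed.

Lemma flat_lin a (Y Z : V) t : (a *: Y + Z) t = a *: Y t + Z t.
Proof. by []. Qed.

Lemma cbil_vbr : cbil (fun p : V * V => vbr p.1 p.2).
Proof.
have Cvbr : Cinfty setT (fun p : V * V => vbr p.1 p.2).
  apply: (@exp_law _ _ _ _ _ (fun q : (V * V) * R^o => br (flat_fun q.1.1 q.2) (flat_fun q.1.2 q.2))) => //.
  - exact: openT.
  - apply: (@Cinfty_sub _ _ _ setT) => //; apply: Cinfty_br; apply: Cinfty_ev.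
    + by apply: Cinfty_lin; exact: clin_comp (@clin_fst _ _ _) (@clin_fst _ _ _).
    + by apply: Cinfty_lin; exact: clin_snd.
    + by apply: Cinfty_lin; exact: clin_comp (@clin_fst _ _ _) (@clin_snd _ _ _).
    + by apply: Cinfty_lin; exact: clin_snd.
  - by move=> d s _; rewrite vbrE.
have [_ Bl Br] := bbr.
split=> [p|a x x' y|a x y y'] /=; first exact: (Cinfty_cont Cvbr).
  by apply: flat_ext => t; rewrite flat_lin !vbrE flat_lin; exact: Bl.
by apply: flat_ext => t; rewrite flat_lin !vbrE flat_lin; exact: Br.
Qed.

Lemma cbil_adv : cbil (fun p : X * V => adv p.1 p.2).
Proof.
have Cadv : Cinfty setT (fun p : X * V => adv p.1 p.2).
  apply: (@exp_law _ _ _ _ _ (fun q : (X * V) * R^o => br q.1.1 (flat_fun q.1.2 q.2))) => //.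
  - exact: openT.
  - apply: (@Cinfty_sub _ _ _ setT) => //; apply: Cinfty_br.
      by apply: Cinfty_lin; exact: clin_comp (@clin_fst _ _ _) (@clin_fst _ _ _).
    apply: Cinfty_ev; apply: Cinfty_lin; last exact: clin_snd.
    exact: clin_comp (@clin_fst _ _ _) (@clin_snd _ _ _).
  - by move=> d s _; rewrite advE.
have [_ Bl Br] := bbr.
split=> [p|a x x' y|a x y y'] /=; first exact: (Cinfty_cont Cadv).
  by apply: flat_ext => t; rewrite flat_lin !advE; exact: Bl.
by apply: flat_ext => t; rewrite flat_lin !advE flat_lin; exact: Br.
Qed.

Lemma vbrC Y Z : vbr Y Z = - vbr Z Y.
Proof. by apply: flat_ext => t; rewrite -[RHS]/(- flat_fun (vbr Z Y) t) !vbrE -brC. Qed.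

Lemma flat_sum I (r : seq I) (u : I -> V) t : (\sum_(i <- r) u i) t = \sum_(i <- r) u i t.
Proof. by elim: r => [|i s IH]; rewrite ?big_nil // !big_cons -IH. Qed.

Lemma vbr_tenl g x Y : pathfn g -> vbr (ten g x) Y = smul g (adv x Y).
Proof.
move=> [cg g0]; apply: flat_ext => t.
by rewrite vbrE (tenE x t cg g0) (smulE _ t cg) advE brZl.
Qed.

Lemma adv_ten g x y : pathfn g -> adv x (ten g y) = ten g (br x y).
Proof. by move=> [cg g0]; apply: flat_ext => t; rewrite advE !(tenE _ t cg g0) brZr. Qed.

Lemma vbr_ten g h x y : pathfn g -> pathfn h -> vbr (ten g x) (ten h y) = ten (fun t => g t * h t) (br x y).
Proof. by move=> pg ph; rewrite vbr_tenl // (adv_ten _ _ ph) (ten_smul _ pg.1 ph). Qed.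

(** The Casimir identity at each parameter, with [g] moved into the first entry, which turns the
    constants [e i] into paths. *)
Lemma casimir_vbr g Y : pathfn g -> smul g Y = \sum_i vbr (ten g (e i)) (adv (f i) Y).
Proof.
move=> [cg g0]; apply: flat_ext => t; rewrite flat_sum (smulE _ t cg) -[Y t in LHS]casimirE scaler_sumr.
by apply: eq_bigr => i _; rewrite vbrE (tenE _ t cg g0) advE brZl.
Qed.

(** A nice path is reproduced by a cutoff of small radius, hence is a sum of brackets by
    [casimir_vbr]. *)
Lemma brackets_dense (L : V -> R^o) : clin L -> (forall Y Z, L (vbr Y Z) = 0) -> forall Y, L Y = 0.
Proof.
move=> cL L0; apply: nice_dense => // g x [pg [a [a0 ga _]]].
pose b := Num.min a 1.
have b0 : 0 < b by rewrite lt_min a0 ltr01.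
have b1 : b <= pi.
  by apply: (@le_trans _ _ 1); [rewrite ge_min lexx orbT|rewrite (le_trans _ (pi_ge2 R)) // ler1n].
have -> : ten g x = smul (step b) (ten g x).
  rewrite (ten_smul _ (cutoff_step b0 b1) pg); congr ten; apply/funext => t.
  have [ta|ta] := lerP t a; first by rewrite ga // mulr0.
  by rewrite step_ge ?mul1r // (le_trans _ (ltW ta)) // ge_min lexx.
rewrite (casimir_vbr _ (pathfn_step b0 b1)) clin_bsum //.
by apply: big1 => i _; exact: L0.
Qed.

Section Cocycle.
Variable w : V * V -> R^o.
Hypothesis bw : cbil w.
Hypothesis wC : forall Y Z, w (Y, Z) = - w (Z, Y).
Hypothesis cocycle : forall Y Z W, w (vbr Y Z, W) + w (vbr Z W, Y) + w (vbr W Y, Z) = 0.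

Lemma cocycle_der Y U W : w (Y, vbr U W) = w (vbr Y U, W) + w (U, vbr Y W).
Proof.
rewrite (wC Y) (wC U) (vbrC Y W) (clinN _ (cbil_clinl _ bw)) opprK.
by have := cocycle Y U W; rewrite -[w (vbr U W, Y)]opprK -wC; lra.
Qed.

(* [Y] is a sum of brackets of elements supported where [g <> 0]. *)
Lemma cocycle_local g Y T : pathfn g -> smul g Y = Y -> smul g T = 0 -> w (T, Y) = 0.
Proof.
move=> pg gY gT; have [cg g0] := pg.
rewrite -gY (casimir_vbr _ pg) (clin_bsum _ _ (cbil_clinr T bw)) big1 // => i _.
rewrite cocycle_der.
have gt t : g t *: T t = 0 by rewrite -(smulE _ t cg) gT.
have -> : vbr T (ten g (e i)) = 0.
  by apply: flat_ext => t; rewrite vbrE (tenE _ t cg g0) brZr -brZl gt br0l.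
have -> : vbr T (adv (f i) Y) = 0.
  by apply: flat_ext => t; rewrite vbrE advE -gY (smulE _ t cg) !brZr -brZl gt br0l.
by rewrite (clin0 (cbil_clinl _ bw)) (clin0 (cbil_clinr _ bw)) addr0.
Qed.

(** The offset in the exponent ensures [4 * rad j <= 1], as cutoffs of radius [4 * rad j] occur
    below. *)
Let rad (j : nat) : R := 2^-1 ^+ j.+2.
Let rad0 j : 0 < rad j. Proof. by rewrite exprn_gt0 // invr_gt0. Qed.
Let rad1 j : 4 * rad j <= 1.
Proof.
rewrite /rad 2!exprS !mulrA (_ : 4 * 2^-1 * 2^-1 = 1); last by field.
by rewrite mul1r exprn_ile1 ?invr_ge0 // invf_le1 // ler1n.
Qed.
Let radS j : rad j.+1 = rad j / 2. Proof. by rewrite /rad exprSr. Qed.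
Let pi1 : 1 <= pi :> R. Proof. by rewrite (le_trans _ (pi_ge2 R)) // ler1n. Qed.
Let radle1 j : rad j <= 1.
Proof. by have := rad1 j; have := rad0 j; lra. Qed.
Let radpi j : rad j <= pi. Proof. exact: le_trans (radle1 j) pi1. Qed.
Let rad_cvg : rad @ \oo --> (0 : R).
Proof.
have := @cvg_expr R (2^-1); rewrite ger0_norm ?invr_ge0 // invf_lt1 // ltr1n => /(_ isT).
by move=> /(cvg_comp (addn 2) _ (cvg_addnl 2)).
Qed.
Let pstep j := pathfn_step (rad0 j) (radpi j).

(** Approximates the value of the cocycle on [Y] and the constant [x], which is not a path. *)
Definition approxnu (x : X) Y (j : nat) : R := w (ten (step (rad j)) x, Y).

(** The increment [T] vanishes for [t >= r]. By [cocycle_local], with a cutoff of radius [2 * r], it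
    does not see [Y] further out, so [Y] may be replaced by what the cutoff of radius [4 * r]
    removes. That remainder is of order [r ^+ k.+1] while [T] is of order [r ^- k], which leaves one
    factor [r], summable along [rad]. *)
Lemma approxnu_incr : exists C l, 0 <= C /\
  forall x Y j, `|approxnu x Y j.+1 - approxnu x Y j| <= C * `|x| * Ck_norm l Y * 2^-1 ^+ j.
Proof.
have [k [K [K0 wK]]] := cbil_bound bw.
have [C1 [C10 H1]] := @ten_bound R n k.
have [C2 [C20 H2]] := @cut_bound R n k k.+1.
exists (K * C1 * C2 * 4 ^+ k.+1), (k + (k + k.+1))%N; split; first by rewrite !mulr_ge0 // exprn_ge0.
move=> x Y j; rewrite /approxnu radS.
set r := rad j; set T := ten (step r) x - ten (step (r / 2)) x.
have r0 : 0 < r := rad0 j; have r41 : 4 * r <= 1 := rad1 j.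
have r40 : 0 < 4 * r by rewrite mulr_gt0.
have r4pi : 4 * r <= pi := le_trans r41 pi1.
have r20 : 0 < 2 * r by rewrite mulr_gt0.
have r2pi : 2 * r <= pi by rewrite (le_trans _ r4pi) // ler_pM2r // ler_nat.
have rh0 : 0 < r / 2 by rewrite divr_gt0.
have rhpi : r / 2 <= pi by rewrite -radS; exact: radpi.
have E : w (ten (step (r / 2)) x, Y) - w (ten (step r) x, Y) = - w (T, Y - smul (step (4 * r)) Y).
  rewrite (clinB _ _ (cbil_clinr T bw)) [w (T, smul _ _)](@cocycle_local (step (2 * r))).
  - by rewrite subr0 (clinB _ _ (cbil_clinl Y bw)) opprB.
  - exact: pathfn_step.
  - apply: flat_ext => t; rewrite (smulE _ t (cutoff_step r20 r2pi)) !(smulE _ t (cutoff_step r40 r4pi)).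
    have [t2|t2] := lerP t (2 * r); last by rewrite (step_ge r20 (ltW t2)) scale1r.
    by rewrite (@step_le _ (4 * r)) ?scale0r ?scaler0 //; move: t2; lra.
  - apply: flat_ext => t; rewrite (smulE _ t (cutoff_step r20 r2pi)).
    have T1 := tenE x t (cutoff_step r0 (radpi j)) (step0 r0).
    have T2 := tenE x t (cutoff_step rh0 rhpi) (step0 rh0).
    have -> : T t = step r t *: x - step (r / 2) t *: x by exact: (congr2 (fun a b => a - b) T1 T2).
    have [tr|tr] := lerP t r; first by rewrite (@step_le _ (2 * r)) ?scale0r // mulrC mulKf.
    rewrite (step_ge r0 (ltW tr)) (step_ge rh0) ?subrr ?scaler0 //.
    by rewrite (le_trans _ (ltW tr)) // ler_pdivrMr // ler_peMr ?ler1n // ltW.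
rewrite E normrN (le_trans (wK _ _)) //.
have bT := H1 r x r0 (radle1 j); have bY := H2 (4 * r) Y r40 r41.
have N0 := Ck_norm_ge0 (k + (k + k.+1)) Y.
apply: (@le_trans _ _ (K * (C1 / r ^+ k * `|x|) * (C2 * ((4 * r) ^+ k.+1 * Ck_norm (k + (k + k.+1)) Y)))).
  apply: ler_pM => //; rewrite ?mulr_ge0 ?Ck_norm_ge0 //.
  by rewrite ler_wpM2l.
have -> : K * (C1 / r ^+ k * `|x|) * (C2 * ((4 * r) ^+ k.+1 * Ck_norm (k + (k + k.+1)) Y)) =
    K * C1 * C2 * 4 ^+ k.+1 * `|x| * Ck_norm (k + (k + k.+1)) Y * r.
  have -> : (4 * r) ^+ k.+1 = 4 ^+ k.+1 * (r * r ^+ k) by rewrite exprMn -exprS.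
  by field; rewrite expf_neq0 // gt_eqF.
apply: ler_wpM2l; first by rewrite !mulr_ge0 // exprn_ge0.
by rewrite /r /rad 2!exprS !mulrA ler_piMl ?exprn_ge0 ?invr_ge0 //; lra.
Qed.

Lemma nu_exists : exists nu : X -> V -> R,
  (forall x Y, approxnu x Y @ \oo --> (nu x Y : R)) /\ forall x, clin (nu x : V -> R^o).
Proof.
have [C [l [C0 incr]]] := approxnu_incr.
have geo x Y : exists L : R, approxnu x Y @ \oo --> L /\
    `|L - approxnu x Y 0| <= 2 * (C * `|x| * Ck_norm l Y).
  by apply: geometric_cvg => [|j]; [rewrite !mulr_ge0 // Ck_norm_ge0|exact: incr].
have /choice[nu' nuP'] : forall p : X * V, exists L : R, approxnu p.1 p.2 @ \oo --> L /\
    `|L - approxnu p.1 p.2 0| <= 2 * (C * `|p.1| * Ck_norm l p.2) by move=> p; exact: geo.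
pose nu x Y := nu' (x, Y); have nuP x Y := nuP' (x, Y).
exists nu; split=> [x Y|x]; first by have [] := nuP x Y.
have [k [K [K0 wK]]] := cbil_bound bw.
pose D := K * Ck_norm k (ten (step (rad 0)) x) + 2 * (C * `|x|).
apply: (@clin_bounded _ _ _ (maxn k l) D) => [a Y Z|Y].
  have [cY _] := nuP x Y; have [cZ _] := nuP x Z; have [cYZ _] := nuP x (a *: Y + Z).
  apply: (cvg_unique (@hausdorff_normed R R^o) cYZ).
  have -> : approxnu x (a *: Y + Z) = (fun j => a * approxnu x Y j + approxnu x Z j).
    by apply/funext => j; have [H _] := cbil_clinr (ten (step (rad j)) x) bw; exact: H.
  by apply: cvgD => //; apply: cvgM => //; exact: cvg_cst.
have [_ bY] := nuP x Y.
rewrite -[nu x Y](subrK (approxnu x Y 0)) (le_trans (ler_normD _ _)) // addrC mulrDl lerD //.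
  rewrite (le_trans (wK _ _)) // ler_wpM2l ?mulr_ge0 ?Ck_norm_ge0 //.
  by rewrite Ck_norm_mono // leq_maxl.
rewrite (le_trans bY) // -!mulrA !ler_wpM2l //.
by rewrite Ck_norm_mono // leq_maxr.
Qed.

Lemma step_radM i j : (i < j)%N -> (fun t => step (rad j) t * step (rad i) t) = step (rad i).
Proof.
move=> ij; apply/funext => t.
have [ti|ti] := lerP t (rad i / 2); first by rewrite (step_le (rad0 i) ti) mulr0.
rewrite (@step_ge _ (rad j)) ?mul1r // (le_trans _ (ltW ti)) // -radS.
by rewrite /rad ler_wiXn2l ?invr_ge0 // ?invf_le1 ?ler1n // !ltnS.
Qed.

(** [nu x] plays the role of the cocycle with first argument the constant [x]. By [nuB] it is a
    1-cocycle of the Lie algebra of [G] with values in functionals on paths, and the Casimir element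
    makes it a coboundary, as in Whitehead's first lemma. By [nuA] the functional found accounts for
    the failure of invariance of [w]. *)
Lemma second_cohomology_inv : exists mu : V -> R^o, clin mu /\
  forall x Y Z, w (adv x Y, Z) + w (Y, adv x Z) = mu (vbr (adv x Y) Z + vbr Y (adv x Z)).
Proof.
have [nu [nu_cvg nu_clin]] := nu_exists.
have hR := @hausdorff_normed R R^o.
have nul a x y Y : nu (a *: x + y) Y = a * nu x Y + nu y Y.
  apply: (cvg_unique hR (nu_cvg _ Y)).
  have -> : approxnu (a *: x + y) Y = (fun j => a * approxnu x Y j + approxnu y Y j).
    apply/funext => j; have [H _] := cbil_clinl Y bw; rewrite /approxnu.
    have [-> _] := clin_ten (n := n) (pstep j).1 (pstep j).2; exact: H.
  by apply: cvgD; [apply: cvgM; [exact: cvg_cst|exact: nu_cvg]|exact: nu_cvg].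
have scvg (Y : V) : (fun j => smul (step (rad j)) Y) @ \oo --> Y.
  by apply: step_cvg => // j; rewrite rad0 radle1.
have nuA x Y Z : w (adv x Y, Z) + w (Y, adv x Z) = nu x (vbr Y Z).
  apply: (cvg_unique hR _ (nu_cvg x (vbr Y Z))).
  have -> : approxnu x (vbr Y Z) = (fun j => w (smul (step (rad j)) (adv x Y), Z) + w (Y, smul (step (rad j)) (adv x Z))).
    by apply/funext => j; rewrite /approxnu cocycle_der !vbr_tenl.
  have H1 := clin_cvg (cbil_clinl Z bw) (scvg (adv x Y)).
  have H2 := clin_cvg (cbil_clinr Y bw) (scvg (adv x Z)).
  exact: (tvs_cvgD H1 H2).
have nuB x y Y : nu (br x y) Y = nu x (adv y Y) - nu y (adv x Y).
  (* Two limits are involved; the one in [j] is taken first with [i] fixed, because for [j > i] the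
     product of the two cutoffs is the one of index [i]. *)
  have step1 i : w (ten (step (rad i)) (br x y), Y) =
      nu x (smul (step (rad i)) (adv y Y)) - w (ten (step (rad i)) y, adv x Y).
    have cst : (fun j : nat => w (ten (step (rad i)) (br x y), Y) : R) @ \oo --> (w (ten (step (rad i)) (br x y), Y) : R) by exact: cvg_cst.
    apply: (cvg_unique hR cst).
    have H : (fun j => w (ten (step (rad j)) x, smul (step (rad i)) (adv y Y))
        - w (ten (step (rad i)) y, smul (step (rad j)) (adv x Y))) @ \oo -->
        (nu x (smul (step (rad i)) (adv y Y)) - w (ten (step (rad i)) y, adv x Y) : R).
      have H1 := nu_cvg x (smul (step (rad i)) (adv y Y)).
      have H2 := clin_cvg (cbil_clinr (ten (step (rad i)) y) bw) (scvg (adv x Y)).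
      exact: (tvs_cvgB (F := R^o) H1 H2).
    apply: cvg_trans H; apply: near_eq_cvg; exists i.+1 => // j /= ij.
    have -> : ten (step (rad i)) (br x y) = vbr (ten (step (rad j)) x) (ten (step (rad i)) y).
      by rewrite (vbr_ten _ _ (pstep j) (pstep i)) step_radM.
    have := cocycle_der (ten (step (rad j)) x) (ten (step (rad i)) y) Y.
    by rewrite !vbr_tenl // => ->; rewrite addrK.
  apply: (cvg_unique hR (nu_cvg _ Y)).
  have -> : approxnu (br x y) Y = (fun i => nu x (smul (step (rad i)) (adv y Y)) - w (ten (step (rad i)) y, adv x Y)).
    by apply/funext => i; exact: step1.
  have H1 := clin_cvg (nu_clin x) (scvg (adv y Y)).
  exact: (tvs_cvgB (F := R^o) H1 (nu_cvg y (adv x Y))).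
have advr x Y Z : adv x (vbr Y Z) = vbr (adv x Y) Z + vbr Y (adv x Z).
  apply: flat_ext => t; rewrite -[RHS]/(flat_fun (vbr (adv x Y) Z) t + flat_fun (vbr Y (adv x Z)) t).
  by rewrite !(vbrE, advE) jacobi.
have advadv x y Y : adv x (adv y Y) = adv (br x y) Y + adv y (adv x Y).
  apply: flat_ext => t; rewrite -[RHS]/(flat_fun (adv (br x y) Y) t + flat_fun (adv y (adv x Y)) t).
  by rewrite !advE jacobi.
(* The contracting homotopy given by the Casimir element; [nuC] follows from the invariance of its
   tensor and from [casimirE]. *)
pose mu Y : R^o := \sum_i nu (e i) (adv (f i) Y).
exists mu; split.
  by apply: clin_sums => i; exact: clin_comp (cbil_clinr (f i) cbil_adv) (nu_clin (e i)).
suff nuC x Y : nu x Y = mu (adv x Y) by move=> x Y Z; rewrite nuA nuC advr.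
have casadv : \sum_i adv (e i) (adv (f i) Y) = Y.
  apply: flat_ext => t; rewrite flat_sum -[RHS]casimirE; apply: eq_bigr => i _.
  by rewrite !advE.
have advD a x1 x2 Z : adv (a *: x1 + x2) Z = a *: adv x1 Z + adv x2 Z.
  by have [_ H _] := cbil_adv; exact: H.
have nuN a Z : nu (- a) Z = - nu a Z.
  have := nul (-1) a 0 Z; rewrite scaleN1r addr0 mulN1r => ->.
  by have := nul 1 0 0 Z; rewrite scale1r addr0 mul1r => /eqP; rewrite -subr_eq0 opprD addNKr oppr_eq0 => /eqP ->; rewrite addr0.
have H := casimir_inv (B := fun a b => nu a (adv b Y)) x _ _.
have {}H : \sum_i (nu (br x (e i)) (adv (f i) Y) + nu (e i) (adv (br x (f i)) Y)) = 0.
  apply: H => [a y1 y2 z|a y1 y2 z]; first exact: nul.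
  by rewrite advD; have [-> _] := nu_clin z.
rewrite -[Y in LHS]casadv (clin_bsum _ _ (nu_clin x)) /mu.
apply/eqP; rewrite -subr_eq0 -sumrB; apply/eqP; rewrite -[RHS]H.
apply: eq_bigr => i _.
rewrite nuB.
have -> : adv (br x (f i)) Y = adv x (adv (f i) Y) - adv (f i) (adv x Y) by rewrite advadv addrK.
rewrite (clinB _ _ (nu_clin (e i))).
by rewrite addrA subrK.
Qed.

(** Invariance makes [w] symmetric in the Lie algebra factors, hence antisymmetric in the functions;
    with the cocycle identity the functions behave like one-forms g dh modulo exact ones. Among
    polynomials in a single function every such form is exact, so [w] vanishes there, and continuity
    and density extend this to all paths. *)
Lemma invariant_cocycle0 : (forall x Y Z, w (adv x Y, Z) + w (Y, adv x Z) = 0) ->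
  forall Y Z, w (Y, Z) = 0.
Proof.
move=> inv.
pose b g h x y : R := w (ten g x, ten h y).
have bl g h z : pathfn g -> clin (fun x => b g h x z : R^o).
  by move=> [cg g0]; exact: clin_comp (clin_ten cg g0) (cbil_clinl (ten h z) bw).
have brr g h z : pathfn h -> clin (fun x => b g h z x : R^o).
  by move=> [ch h0]; exact: clin_comp (clin_ten ch h0) (cbil_clinr (ten g z) bw).
have bNr g h x y : pathfn h -> b g h x (- y) = - b g h x y.
  by move=> ph; exact: (clinN y (brr g h x ph)).
have bNl g h x y : pathfn g -> b g h (- x) y = - b g h x y.
  by move=> pg; exact: (clinN x (bl g h y pg)).
have binv g h x y z : pathfn g -> pathfn h -> b g h (br x y) z = - b g h y (br x z).
  move=> pg ph; apply/eqP; rewrite -addr_eq0; apply/eqP.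
  by have := inv x (ten g y) (ten h z); rewrite (adv_ten _ _ pg) (adv_ten _ _ ph).
(* An invariant form is symmetric against brackets, and every element is a sum of brackets by
   [casimirE]. *)
have bsym_br g h u v z : pathfn g -> pathfn h -> b g h (br u v) z = b g h z (br u v).
  move=> pg ph; rewrite binv // (brC u z) bNr // -binv // (brC z v) bNl // binv //.
  by rewrite (brC v u) bNr // !opprK.
have bsym g h x z : pathfn g -> pathfn h -> b g h x z = b g h z x.
  move=> pg ph; rewrite -[x]casimirE (clin_bsum _ _ (bl g h z pg)) (clin_bsum _ _ (brr g h z ph)).
  by apply: eq_bigr => i _; exact: bsym_br.
have banti g h x y : pathfn g -> pathfn h -> b g h x y = - b h g x y.
  by move=> pg ph; rewrite bsym // /b wC.
have bcyc k g h x z : pathfn k -> pathfn g -> pathfn h ->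
    b (fun t => k t * g t) h x z + b (fun t => g t * h t) k x z + b (fun t => h t * k t) g x z = 0.
  move=> pk pg ph.
  have pkg := pathfnM pk pg; have pgh := pathfnM pg ph; have phk := pathfnM ph pk.
  suff H u v : b (fun t => k t * g t) h (br u v) z + b (fun t => g t * h t) k (br u v) z
      + b (fun t => h t * k t) g (br u v) z = 0.
    rewrite -[x]casimirE (clin_bsum _ _ (bl _ h z pkg)) (clin_bsum _ _ (bl _ k z pgh)).
    rewrite (clin_bsum _ _ (bl _ g z phk)) -!big_split /=.
    by apply: big1 => i _; exact: H.
  have cyc k' g' u' v' z' : pathfn k' -> pathfn g' -> b k' g' (br u' v') z' = b k' g' (br v' z') u'.
    by move=> pk' pg'; rewrite (binv k' g' v') // (brC v' u') bNr // opprK bsym_br.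
  have := cocycle (ten k u) (ten g v) (ten h z).
  rewrite (vbr_ten _ _ pk pg) (vbr_ten _ _ pg ph) (vbr_ten _ _ ph pk).
  by rewrite -!/(b _ _ _ _) (cyc _ k u) // (cyc _ g u) // (cyc _ g v).
pose tp (tau : R -> R) i t := tau t ^+ i.
have ptp tau i : pathfn tau -> pathfn (tp tau i.+1).
  move=> ptau; elim: i => [|i IH]; first by rewrite (_ : tp tau 1 = tau).
  have -> : tp tau i.+2 = (fun t => tau t * tp tau i.+1 t) by apply/funext => t; rewrite /tp exprS.
  exact: pathfnM.
have tpM tau i j : (fun t => tp tau i t * tp tau j t) = tp tau (i + j)%N.
  by apply/funext => t; rewrite /tp exprD.
(* With the total degree [N] fixed, the cyclic relation makes [psi] additive, so [psi a] is [a]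
   times [psi 1]. Antisymmetry gives [psi (N - 1) = - psi 1], hence [N] times [psi 1] is 0. *)
have bpow tau i j x z : pathfn tau -> b (tp tau i.+1) (tp tau j.+1) x z = 0.
  move=> ptau; pose N := (i.+1 + j.+1)%N.
  pose psi a : R := b (tp tau a) (tp tau (N - a)%N) x z.
  have pt a : (0 < a)%N -> pathfn (tp tau a) by case: a => // a _; exact: ptp.
  have add a c : (0 < a)%N -> (0 < c)%N -> (a + c < N)%N -> psi (a + c)%N = psi a + psi c.
    move=> a0 c0 acN; have d0 : (0 < N - (a + c))%N by rewrite subn_gt0.
    have := bcyc _ _ _ x z (pt a a0) (pt c c0) (pt _ d0); rewrite !tpM.
    have -> : (c + (N - (a + c)) = N - a)%N by lia.
    have -> : (N - (a + c) + a = N - c)%N by lia.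
    have aN : (0 < N - a)%N by lia.
    have cN : (0 < N - c)%N by lia.
    have e1 := banti (tp tau (N - a)%N) (tp tau a) x z (pt _ aN) (pt _ a0).
    have e2 := banti (tp tau (N - c)%N) (tp tau c) x z (pt _ cN) (pt _ c0).
    by rewrite e1 e2 /psi => H; lra.
  have lin a : (0 < a)%N -> (a < N)%N -> psi a = a%:R * psi 1%N.
    elim: a => [//|[|a] IH] _ aN; first by rewrite mul1r.
    have := add a.+1 1%N isT isT; rewrite addn1 => /(_ aN) ->.
    by rewrite IH ?(ltnW aN) // -[a.+2%:R]natr1 mulrDl mul1r.
  have psi1 : psi 1%N = 0.
    have NN : (0 < N - 1)%N by lia.
    have H : psi (N - 1)%N = - psi 1%N.
      rewrite /psi (_ : N - (N - 1) = 1)%N; last by lia.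
      by apply: banti; exact: pt.
    rewrite lin ?lia // in H; last by rewrite /N; lia.
    have : (N - 1)%N.+1%:R * psi 1%N = 0 by rewrite -natr1 mulrDl mul1r H addNr.
    by move=> /eqP; rewrite mulf_eq0 pnatr_eq0 => /eqP.
  have -> : b (tp tau i.+1) (tp tau j.+1) x z = psi i.+1 by rewrite /psi /N addKn.
  by rewrite lin ?psi1 ?mulr0 // /N; lia.
have tpoly tau (p : {poly R}) (x : X) : pathfn tau -> p.[0] = 0 ->
    ten (fun t => p.[tau t]) x = \sum_(i < size p) p`_i *: ten (tp tau i) x.
  move=> ptau p0; apply: flat_ext => t.
  have cp : cutoff (fun t => p.[tau t]).
    split; first by move=> s; congr (p.[_]); exact: ptau.1.1.
    exact: smf_comp (smf_horner p) ptau.1.2.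
  have c0 : p.[tau 0] = 0 by rewrite ptau.2.
  rewrite (tenE x t cp c0) flat_sum horner_coef scaler_suml; apply: eq_bigr => i _.
  rewrite -[RHS]/(p`_i *: flat_fun (ten (tp tau i) x) t).
  case: (i : nat) => [|j]; first by rewrite -horner_coef0 p0 mul0r !scale0r.
  by have [cj j0] := ptp tau j ptau; rewrite (tenE x t cj j0) scalerA.
have bpoly tau (p q : {poly R}) (x z : X) : pathfn tau -> p.[0] = 0 -> q.[0] = 0 ->
    w (ten (fun t => p.[tau t]) x, ten (fun t => q.[tau t]) z) = 0.
  move=> ptau p0 q0; rewrite (tpoly _ p x ptau p0) (tpoly _ q z ptau q0).
  rewrite (clin_bsum _ _ (cbil_clinl _ bw)) big1 // => i _.
  rewrite (clin_bsum _ _ (cbil_clinr _ bw)) big1 // => j _.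
  rewrite (clinZ _ _ (cbil_clinl _ bw)) (clinZ _ _ (cbil_clinr _ bw)).
  case: (i : nat) => [|i']; first by rewrite -horner_coef0 p0 scale0r.
  case: (j : nat) => [|j']; first by rewrite -horner_coef0 q0 scale0r scaler0.
  by have -> : w (ten (tp tau i'.+1) x, ten (tp tau j'.+1) z) = 0 := bpow tau i' j' x z ptau; rewrite !scaler0.
have [k [K [K0 wK]]] := cbil_bound bw.
have small (A M : R) : 0 <= M -> (forall d, 0 < d -> `|A| <= M * d) -> A = 0.
  move=> M0 H; apply/eqP; rewrite -normr_eq0 eq_le normr_ge0 andbT.
  apply/ler_addgt0Pr => d d0; rewrite add0r.
  have M1 : 0 < M + 1 by rewrite ltr_wpDl.
  rewrite (le_trans (H _ (divr_gt0 d0 M1))) // mulrC -mulrA ler_piMr ?(ltW d0) //.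
  by rewrite mulrC ler_pdivrMr // mul1r lerDl.
(* Both functions are approximated by polynomials in the same [clampfn r], one argument at a
   time. *)
have bnice g h (x z : X) : nicefn g -> nicefn h -> w (ten g x, ten h z) = 0.
  move=> [pg [a [a0 ga ga']]] [ph [c [c0 hc hc']]].
  pose r := Num.min (Num.min a c) 1.
  have r0 : 0 < r by rewrite !lt_min a0 c0 ltr01.
  have r1 : r <= 1 by rewrite ge_min lexx orbT.
  have ra : r <= a by rewrite !ge_min lexx.
  have rc : r <= c by rewrite !ge_min lexx orbT.
  have pt := clampfn_pathfn r0 r1.
  have gr t : t <= r -> g t = 0 by move=> tr; rewrite ga // (le_trans tr).
  have hr t : t <= r -> h t = 0 by move=> tr; rewrite hc // (le_trans tr).
  have gr' t : pi - r <= t -> g t = g pi by move=> tr; rewrite ga' // (le_trans _ tr) // lerD2l lerN2.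
  have hr' t : pi - r <= t -> h t = h pi by move=> tr; rewrite hc' // (le_trans _ tr) // lerD2l lerN2.
  have step1 (q : {poly R}) : q.[0] = 0 -> w (ten g x, ten (fun t => q.[clampfn r t]) z) = 0.
    move=> q0; set Z : V := ten (fun t => q.[clampfn r t]) z.
    apply: (small _ (K * Ck_norm k Z)); first by rewrite mulr_ge0 // Ck_norm_ge0.
    move=> d d0; have [p [p0 pd]] := clamp_approx r0 r1 x k pg gr gr' d0.
    rewrite -[w _]subr0 -(bpoly _ p q x z pt p0 q0) -/Z -(clinB _ _ (cbil_clinl Z bw)).
    by rewrite (le_trans (wK _ _)) // -mulrA [X in _ * X]mulrC mulrA ler_wpM2l // mulr_ge0 // Ck_norm_ge0.
  apply: (small _ (K * Ck_norm k (ten g x))); first by rewrite mulr_ge0 // Ck_norm_ge0.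
  move=> d d0; have [p [p0 pd]] := clamp_approx r0 r1 z k ph hr hr' d0.
  rewrite -[w _]subr0 -(step1 p p0) -(clinB _ _ (cbil_clinr (ten g x) bw)).
  by rewrite (le_trans (wK _ _)) // ler_wpM2l // mulr_ge0 // Ck_norm_ge0.
move=> Y Z; apply: (nice_dense (cbil_clinl Z bw)) => g x ng.
by apply: (nice_dense (cbil_clinr (ten g x) bw)) => h z nh; exact: bnice.
Qed.

End Cocycle.

(** Subtracting the coboundary supplied by [second_cohomology_inv] leaves a cocycle invariant under
    constants. *)
Theorem second_cohomology (w : V * V -> R^o) : cbil w ->
  (forall Y Z, w (Y, Z) = - w (Z, Y)) ->
  (forall Y Z W, w (vbr Y Z, W) + w (vbr Z W, Y) + w (vbr W Y, Z) = 0) ->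
  exists mu : V -> R^o, clin mu /\ forall Y Z, w (Y, Z) = mu (vbr Y Z).
Proof.
move=> bw wC cocycle; have [mu [cmu muE]] := second_cohomology_inv bw wC cocycle.
exists mu; split=> // Y Z.
pose w' (p : V * V) : R^o := w p - mu (vbr p.1 p.2).
apply/eqP; rewrite -subr_eq0; apply/eqP; rewrite -[LHS]/(w' (Y, Z)).
have vl := cbil_clinl _ cbil_vbr; have vr := cbil_clinr _ cbil_vbr.
apply: invariant_cocycle0.
- split.
  + move=> p; apply: tvs_cvgB; first by have [H _ _] := bw; exact: H.
    have [H _ _] := cbil_vbr; exact: (clin_cvg cmu (H p)).
  + move=> a x x' y; have [_ H _] := bw; have [_ H' _] := cbil_vbr; have [H'' _] := cmu.
    by rewrite /w' H [vbr _ _](H' a x x' y) H'' scalerBr opprD addrACA.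
  + move=> a x x' y; have [_ _ H] := bw; have [_ _ H'] := cbil_vbr; have [H'' _] := cmu.
    by rewrite /w' H [vbr _ _](H' a x x' y) H'' scalerBr opprD addrACA.
- by move=> Y1 Z1; rewrite /w' /= wC (vbrC Y1) (clinN _ cmu) opprB opprK addrC.
- move=> Y1 Z1 W1; rewrite /w' /=.
  have J : vbr (vbr Y1 Z1) W1 + vbr (vbr Z1 W1) Y1 + vbr (vbr W1 Y1) Z1 = 0.
    apply: flat_ext => t; rewrite -[LHS]/(flat_fun (vbr (vbr Y1 Z1) W1) t + flat_fun (vbr (vbr Z1 W1) Y1) t + flat_fun (vbr (vbr W1 Y1) Z1) t).
    rewrite !vbrE (brC (br (Z1 t) _)) (brC (br (W1 t) _)) (brC (W1 t)).
    rewrite (clinN _ (cbil_clinr (Z1 t) bbr)) opprK jacobi.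
    by rewrite opprD addrA subrr add0r addNr.
  have := cocycle Y1 Z1 W1.
  have := congr1 mu J; rewrite !(clinD _ _ cmu) (clin0 cmu) => E1 E2.
  lra.
- move=> x Y1 Z1; rewrite /w' /=; have := muE x Y1 Z1; rewrite (clinD _ _ cmu) => E1.
  by rewrite addrACA E1 -opprD subrr.
Qed.

End SecondCohomology.

(** * Adjoint action and bracket of a local Lie group *)

Section MixedDerivative.
Context {R : realType}.
Implicit Types E F K Z : tvsType R.

(* The derivative at [0] in the direction [x] of [u |-> Df f ((u, 0), (0, y))]. *)
Definition mix E F K (f : E * F -> K) (x : E) (y : F) : K :=
  Df (Df f) (((0, 0), (0, y)), ((x, 0), (0, 0))).

Lemma Cinfty_slice E F K (f : E * F -> K) (W : set (E * F)%type) : hausdorff_space K -> open W -> Cinfty W f ->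
  forall y, Cinfty [set u | W (u, 0)] (fun u => Df f ((u, 0), (0, y))).
Proof.
move=> hK oW Cf y.
have oW' : open [set u : E | W (u, 0)].
  have : open ([set: E] `&` (fun u : E => (u, 0 : F)) @^-1` W).
    apply: preim_open => //; first exact: openT.
    by apply: Cinfty_lin; apply: clin_pair; [exact: clin_id|exact: clin_zero].
  by rewrite setTI.
apply: (@Cinfty_comp _ _ _ _ _ (W `*` setT) (fun u : E => ((u, 0 : F), (0 : E, y))) (Df f)) => //.
- exact: open_setXT.
- apply: Cinfty_pair; last exact: Cinfty_cst.
  by apply: Cinfty_lin; apply: clin_pair; [exact: clin_id|exact: clin_zero].
- exact: Cinfty_Df.
Qed.

Lemma mixE E F K (f : E * F -> K) (W : set (E * F)%type) x y : hausdorff_space E -> hausdorff_space F ->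
  hausdorff_space K -> open W -> W (0, 0) -> Cinfty W f ->
  mix f x y = Df (fun u => Df f ((u, 0), (0, y))) (0, x).
Proof.
move=> hE hF hK oW W0 Cf.
have Cj : Cinfty setT (fun u : E => ((u, 0 : F), (0 : E, y))).
  apply: Cinfty_pair; last exact: Cinfty_cst.
  by apply: Cinfty_lin; apply: clin_pair; [exact: clin_id|exact: clin_zero].
have hEF := hausdorff_prod hE hF.
have := @Df_comp R _ _ _ setT (W `*` setT) (fun u : E => ((u, 0 : F), (0 : E, y))) (Df f) 0 x
  (hausdorff_prod hEF hEF) hK openT (open_setXT oW) (Cj 1) (Cinfty_Df hK oW Cf 1) I (conj W0 I).
rewrite /mix => ->; congr (Df _ (_, _)).
apply/esym; apply: hasD_Df; first exact: hausdorff_prod.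
apply: hasD_pair; last first.
  by apply: (@dnbhs0_eq_cvg _ _ _ (fun=> 0)) => [h _|]; [rewrite subrr scaler0|exact: cvg_cst].
by have := @hasD_lin R _ _ (fun u : E => (u, 0 : F)) 0 x (clin_pair (clin_id _) (clin_zero _ _)).
Qed.

Lemma mix_sym E F K (f : E * F -> K) (W : set (E * F)%type) x y : hausdorff_space K ->
  open W -> W (0, 0) -> Cinfty W f ->
  mix f x y = Df (Df f) (((0, 0), (x, 0)), ((0, y), (0, 0))).
Proof. by move=> hK oW W0 Cf; exact: (Df_sym _ _ hK oW (Cf 2) W0). Qed.

Lemma cbil_mix E F K (f : E * F -> K) (W : set (E * F)%type) : hausdorff_space K ->
  open W -> W (0, 0) -> Cinfty W f -> cbil (fun p => mix f p.1 p.2).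
Proof.
move=> hK oW W0 Cf.
have C1 := Cinfty_Df hK oW Cf; have oW1 : open (W `*` [set: E * F]) by exact: open_setXT.
have C2 := Cinfty_Df hK oW1 C1.
split=> [p|a x x' y|a x y y'].
- have Cj : Cinfty setT (fun p : E * F => (((0 : E, 0 : F), (0 : E, p.2)), ((p.1, 0 : F), (0 : E, 0 : F)))).
    apply: Cinfty_lin; apply: clin_pair.
      apply: clin_pair; first by apply: clin_pair; exact: clin_zero.
      by apply: clin_pair; [exact: clin_zero|exact: clin_snd].
    apply: clin_pair; last by apply: clin_pair; exact: clin_zero.
    by apply: clin_pair; [exact: clin_fst|exact: clin_zero].
  have : Cinfty setT (fun p : E * F => mix f p.1 p.2).
    apply: (Cinfty_comp _ _ _ Cj C2); [exact: openT|exact: open_setXT|by []].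
  by move=> C; exact: (Cinfty_cont C).
- have [L _] := Df_clin (x := ((0, 0), (0, y))) hK oW1 (C1 1) (conj W0 I).
  rewrite /mix /= -L; congr (Df _ (_, _)).
  by rewrite -[RHS]/((a *: x + x', a *: 0 + 0), (a *: 0 + 0, a *: 0 + 0)) !scaler0 !addr0.
- have [L _] := Df_clin (x := ((0, 0), (x, 0))) hK oW1 (C1 1) (conj W0 I).
  rewrite /= !(mix_sym _ _ hK oW W0 Cf) -L; congr (Df _ (_, _)).
  by rewrite -[RHS]/((a *: 0 + 0, a *: y + y'), (a *: 0 + 0, a *: 0 + 0)) !scaler0 !addr0.
Qed.

Lemma mix_near E F K (f g : E * F -> K) (W W' : set (E * F)%type) x y : hausdorff_space E -> hausdorff_space F ->
  hausdorff_space K -> open W -> W (0, 0) -> Cinfty W f -> open W' -> W' (0, 0) -> Cinfty W' g ->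
  (\forall p \near (0, 0), f p = g p) -> mix f x y = mix g x y.
Proof.
move=> hE hF hK oW W0 Cf oW' W'0 Cg fg.
rewrite (mixE _ _ hE hF hK oW W0 Cf) (mixE _ _ hE hF hK oW' W'0 Cg); apply: Df_near.
have fg' : \forall p \near ((0, 0) : E * F), \forall q \near p, f q = g q by exact: nbhs_interior fg.
have cj : {for (0 : E), continuous (fun u : E => (u, 0 : F))}.
  by apply: cts_pair; [exact: cvg_id|exact: cvg_cst].
have : \forall u \near (0 : E), \forall q \near (u, 0 : F), f q = g q := cj _ fg'.
by apply: filterS => u; exact: Df_near.
Qed.

(** Obtained by differentiating the first-order chain rule along the slice [u |-> (u, 0)]; of the
    second derivatives of [q] only the mixed one enters. *)
Lemma mix_comp E F Z K (F0 : Z -> K) (q : E * F -> Z) (W : set (E * F)%type) (Q : set Z) x y :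
  hausdorff_space E -> hausdorff_space F -> hausdorff_space Z -> hausdorff_space K ->
  open W -> W (0, 0) -> Cinfty W q -> open Q -> Q (q (0, 0)) -> Cinfty Q F0 ->
  mix (F0 \o q) x y =
  Df (Df F0) ((q (0, 0), Df q ((0, 0), (0, y))), (Df q ((0, 0), (x, 0)), 0)) + Df F0 (q (0, 0), mix q x y).
Proof.
move=> hE hF hZ hK oW W0 Cq oQ Q0 CF.
pose W1 := W `&` q @^-1` Q.
have oW1 : open W1 by exact: preim_open.
have Cq1 : Cinfty W1 q by apply: Cinfty_sub Cq => p [].
have W10 : W1 (0, 0) by [].
have CFq : Cinfty W1 (F0 \o q) by apply: (Cinfty_comp oW1 oQ _ Cq1 CF) => p [].
rewrite (mixE _ _ hE hF hK oW1 W10 CFq).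
have oU : open [set u : E | W1 (u, 0)].
  have : open ([set: E] `&` (fun u : E => (u, 0 : F)) @^-1` W1).
    apply: preim_open => //; first exact: openT.
    by apply: Cinfty_lin; apply: clin_pair; [exact: clin_id|exact: clin_zero].
  by rewrite setTI.
have -> : Df (fun u => Df (F0 \o q) ((u, 0), (0, y))) (0, x) =
    Df (fun u => Df F0 (q (u, 0), Df q ((u, 0), (0, y)))) (0, x).
  apply: Df_near; apply: (filterS _ (open_nbhs_nbhs (conj oU W10))) => u Wu.
  by rewrite (Df_comp _ hZ hK oW1 oQ (Cq1 1) (CF 1) Wu) //; case: Wu.
have Cs := Cinfty_slice hZ oW1 Cq1 y.
have C0 : Cinfty [set u : E | W1 (u, 0)] (fun u => q (u, 0)).
  apply: (@Cinfty_comp _ _ _ _ _ W1 (fun u : E => (u, 0 : F)) q) => //.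
  by apply: Cinfty_lin; apply: clin_pair; [exact: clin_id|exact: clin_zero].
have Cp := Cinfty_pair C0 Cs.
have CDF := Cinfty_Df hK oQ CF.
have inQ u : [set u : E | W1 (u, 0)] u -> (Q `*` setT) (q (u, 0), Df q ((u, 0), (0, y))) by case.
rewrite (@Df_comp R _ _ _ _ (Q `*` setT) (fun u => (q (u, 0), Df q ((u, 0), (0, y)))) (Df F0) 0 x
  (hausdorff_prod hZ hZ) hK oU (open_setXT oQ) (Cp 1) (CDF 1) W10 (inQ 0 W10)).
have -> : Df (fun u => (q (u, 0), Df q ((u, 0), (0, y)))) (0, x) = (Df q ((0, 0), (x, 0)), mix q x y).
  apply: hasD_Df; first exact: hausdorff_prod.
  apply: hasD_pair.
    have := hasD_comp hZ oW1 (Cq1 1) (W10 : W1 ((fun u : E => (u, 0 : F)) 0))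
      (@hasD_lin R _ _ (fun u : E => (u, 0 : F)) 0 x (clin_pair (clin_id _) (clin_zero _ _))).
    exact.
  rewrite (mixE _ _ hE hF hZ oW1 W10 Cq1).
  exact: (Cinfty_hasD hZ oU Cs).
exact: (Df_Df _ _ _ hK oQ (CF 2)).
Qed.

End MixedDerivative.

Section DerivativeRules.
Context {R : realType}.
Implicit Types E F K Z : tvsType R.

Lemma Df_lin E F (L : E -> F) x v : hausdorff_space F -> clin L -> Df L (x, v) = L v.
Proof. by move=> hF cL; apply: hasD_Df => //; exact: hasD_lin. Qed.

Lemma hasD_cst E F (b : F) (x v : E) : hasD (fun=> b) x v 0.
Proof. by apply: (@dnbhs0_eq_cvg _ _ _ (fun=> 0)) => [h _|]; [rewrite subrr scaler0|exact: cvg_cst]. Qed.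

Lemma Df_pair E F K (W : set E) (f : E -> F) (g : E -> K) x v : hausdorff_space F -> hausdorff_space K ->
  open W -> W x -> Cinfty W f -> Cinfty W g -> Df (fun y => (f y, g y)) (x, v) = (Df f (x, v), Df g (x, v)).
Proof.
move=> hF hK oW Wx Cf Cg; apply: hasD_Df; first exact: hausdorff_prod.
by apply: hasD_pair; [exact: (Cinfty_hasD hF oW Cf)|exact: (Cinfty_hasD hK oW Cg)].
Qed.

Lemma hasD_bil E F K (D : tvsType R) (B : E * F -> K) (f : D -> E) (g : D -> F) x v a b : hausdorff_space K -> cbil B ->
  hasD f x v a -> hasD g x v b -> hasD (fun y => B (f y, g y)) x v (B (a, g x) + B (f x, b)).
Proof.
move=> hK bB fa gb.
have CB : Cinfty setT B by exact: Cinfty_bil.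
have := hasD_comp hK openT (CB 1%N) (I : setT ((fun y => (f y, g y)) x)) (hasD_pair fa gb).
suff -> : Df B ((f x, g x), (a, b)) = B (a, g x) + B (f x, b) by [].
apply: hasD_Df => //; have [cB Bl Br] := bB.
have B0l y : B (0, y) = 0 by have := Bl (-1) 0 0 y; rewrite scaler0 addr0 scaleN1r addNr.
have B0r y : B (y, 0) = 0 by have := Br (-1) y 0 0; rewrite scaler0 addr0 scaleN1r addNr.
have lim : (fun h : R => (B (a, g x) + B (f x, b)) + h *: B (a, b)) @ (0 : R)^' --> B (a, g x) + B (f x, b).
  exact: cvg_dnbhs_line.
apply: dnbhs0_eq_cvg lim => h h0.
rewrite -[(f x, g x) + h *: (a, b)]/(f x + h *: a, g x + h *: b).
rewrite (addrC (f x)) (addrC (g x)) !Bl !Br.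
by rewrite addrA addrK -scalerDr scalerA mulVf // scale1r -addrA addrC.
Qed.

Lemma mix_lin E F K (L : E * F -> K) x y : hausdorff_space E -> hausdorff_space F -> hausdorff_space K ->
  clin L -> mix L x y = 0.
Proof.
move=> hE hF hK cL.
rewrite (mixE x y hE hF hK openT I (Cinfty_lin setT cL)).
rewrite (_ : (fun u : E => _) = fun=> L (0, y)); last by apply/funext => u; exact: Df_lin.
by apply: hasD_Df => //; exact: hasD_cst.
Qed.

Lemma mix_postlin E F Z K (L : Z -> K) (q : E * F -> Z) (W : set (E * F)%type) x y :
  hausdorff_space E -> hausdorff_space F -> hausdorff_space Z -> hausdorff_space K ->
  open W -> W (0, 0) -> Cinfty W q -> clin L -> mix (L \o q) x y = L (mix q x y).
Proof.
move=> hE hF hZ hK oW W0 Cq cL.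
rewrite (mix_comp x y hE hF hZ hK oW W0 Cq openT I (Cinfty_lin setT cL)) (Df_lin _ _ hK cL).
have -> : Df L = L \o snd by apply/funext => -[z v]; exact: Df_lin.
rewrite (Df_lin _ _ hK) /= ?(clin0 cL) ?add0r //.
exact: clin_comp (@clin_snd _ _ _) cL.
Qed.

Lemma mix_pair E F K K' (f : E * F -> K) (g : E * F -> K') (W : set (E * F)%type) x y :
  hausdorff_space E -> hausdorff_space F -> hausdorff_space K -> hausdorff_space K' ->
  open W -> W (0, 0) -> Cinfty W f -> Cinfty W g ->
  mix (fun p => (f p, g p)) x y = (mix f x y, mix g x y).
Proof.
move=> hE hF hK hK' oW W0 Cf Cg.
have Cp := Cinfty_pair Cf Cg; have hKK := hausdorff_prod hK hK'.
have e1 : mix f x y = _ := mix_postlin x y hE hF hKK hK oW W0 Cp (@clin_fst _ _ _).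
have e2 : mix g x y = _ := mix_postlin x y hE hF hKK hK' oW W0 Cp (@clin_snd _ _ _).
by rewrite e1 e2; case: (mix _ _ _).
Qed.

End DerivativeRules.

Section LocalLie.
Context {R : realType}.
Variables (E : tvsType R) (H : groupType).
Variable Sm : forall D : tvsType R, (D -> H) -> D -> Prop.
Variables (U0 : set E) (par : E -> H) (lg : H -> E).

(* [Sm f x] is a notion of smoothness at [x] for maps into [H]; [par], with
   local inverse [lg], is a chart of [H] at [1]. *)
Record local_lie : Prop := LocalLieGroup {
  ll_hausdorff : hausdorff_space E;
  ll_mul : forall (D : tvsType R) (f g : D -> H) x, Sm f x -> Sm g x -> Sm (fun y => f y * g y)%g x;
  ll_inv : forall (D : tvsType R) (f : D -> H) x, Sm f x -> Sm (fun y => (f y)^-1)%g x;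
  ll_comp : forall (D D' : tvsType R) (f : D -> H) (U : set D') (h : D' -> D) y,
    open U -> U y -> Cinfty U h -> Sm f (h y) -> Sm (f \o h) y;
  ll_open : open U0;
  ll_zero : U0 0;
  ll_par0 : par 0 = 1%g;
  ll_par : forall z, U0 z -> Sm par z;
  ll_lg : forall (D : tvsType R) (f : D -> H) x, Sm f x -> f x = 1%g -> exists W,
    [/\ open W, W x, Cinfty W (lg \o f) & forall y, W y -> U0 (lg (f y)) /\ par (lg (f y)) = f y];
  ll_lgK : forall z, U0 z -> lg (par z) = z
}.

Hypothesis LL : local_lie.
Let hE := ll_hausdorff LL.

Lemma lg1 : lg 1%g = 0.
Proof. by rewrite -(ll_par0 LL) (ll_lgK LL) //; exact: ll_zero. Qed.

Lemma Sm_cst (D D' : tvsType R) a (x : D) (y : D') : Sm (fun _ : D => a) x -> Sm (fun _ : D' => a) y.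
Proof.
move=> sa; apply: (@ll_comp LL _ _ (fun _ : D => a) setT (fun=> x) y) => //; first exact: openT.
exact: Cinfty_cst.
Qed.

Lemma Sm_lin (D : tvsType R) (L : D -> E) x : clin L -> U0 (L x) -> Sm (fun y => par (L y)) x.
Proof.
move=> cL UL; apply: (@ll_comp LL _ _ par setT L x) => //; first exact: openT.
  exact: Cinfty_lin.
exact: ll_par.
Qed.

Definition local_mul (p : E * E) : E := lg (par p.1 * par p.2)%g.
Definition local_conj (p : E * E) : E := lg (par p.1 * par p.2 * (par p.1)^-1)%g.
Definition local_act a (z : E) : E := lg (a * par z * a^-1)%g.
Definition local_Ad a (X : E) : E := Df (local_act a) (0, X).
(** The derivative of conjugation in its second variable is [Ad], so this mixed derivative is the
    derivative of [Ad] at the identity. *)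
Definition local_brk (X Y : E) : E := mix local_conj X Y.

Lemma lmul_near : exists W, [/\ open W, W (0, 0), Cinfty W local_mul &
  forall p, W p -> U0 (local_mul p) /\ par (local_mul p) = (par p.1 * par p.2)%g].
Proof.
apply: (ll_lg LL); last by rewrite /= (ll_par0 LL) mul1g.
have U00 := ll_zero LL.
by apply: (ll_mul LL); apply: Sm_lin => //; [exact: clin_fst|exact: clin_snd].
Qed.

Lemma lconj_near : exists W, [/\ open W, W (0, 0), Cinfty W local_conj &
  forall p, W p -> U0 (local_conj p) /\ par (local_conj p) = (par p.1 * par p.2 * (par p.1)^-1)%g].
Proof.
apply: (ll_lg LL); last by rewrite /= (ll_par0 LL) mul1g invg1 mulg1.
have U00 := ll_zero LL.
apply: (ll_mul LL); last by apply: (ll_inv LL); apply: Sm_lin => //; exact: clin_fst.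
by apply: (ll_mul LL); apply: Sm_lin => //; [exact: clin_fst|exact: clin_snd].
Qed.

(** In the path instance [H] is the type of all functions from [R] to [G]; this condition then
    singles out the members of [PeG] ([adm_PeG]). *)
Definition admissible a := Sm (fun _ : E => a) 0.

Lemma lact_near a : admissible a -> exists W, [/\ open W, W 0, Cinfty W (local_act a) &
  forall z, W z -> U0 (local_act a z) /\ par (local_act a z) = (a * par z * a^-1)%g].
Proof.
move=> sa; apply: (ll_lg LL); last by rewrite (ll_par0 LL) mulg1 mulgV.
apply: (ll_mul LL); last exact: (ll_inv LL).
by apply: (ll_mul LL) => //; apply: (ll_par LL); exact: (ll_zero LL).
Qed.

Lemma lact0 a : local_act a 0 = 0.
Proof. by rewrite /local_act (ll_par0 LL) mulg1 mulgV lg1. Qed.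

Lemma clin_AdG a : admissible a -> clin (local_Ad a).
Proof.
move=> /lact_near[W [oW W0 CW _]].
exact: (Df_clin hE oW (CW 1%N) W0).
Qed.

Lemma AdG_mul a b X : admissible a -> admissible b -> local_Ad (a * b)%g X = local_Ad a (local_Ad b X).
Proof.
move=> sa sb; have [Wa [oWa Wa0 CWa Ha]] := lact_near sa; have [Wb [oWb Wb0 CWb Hb]] := lact_near sb.
rewrite /local_Ad.
pose W := Wb `&` local_act b @^-1` Wa.
have oW : open W by exact: preim_open.
have W0 : W 0 by split=> //; rewrite /preimage /= lact0.
have E1 : Df (local_act (a * b)) (0, X) = Df (local_act a \o local_act b) (0, X).
  apply: Df_near; apply: (filterS _ (open_nbhs_nbhs (conj oW W0))) => z [Wbz _].
  by rewrite /= /local_act (Hb z Wbz).2 invgM !mulgA.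
rewrite E1 (@Df_comp R _ _ _ W Wa (local_act b) (local_act a)) ?lact0 //.
  by apply: Cinfty_sub CWb _ => ? [].
Qed.

Lemma AdG_par_near : \forall z \near (0 : E), forall Y, local_Ad (par z) Y = Df local_conj ((z, 0), (0, Y)).
Proof.
have [W [oW W0 CW _]] := lconj_near.
have cj : {for (0 : E), continuous (fun u : E => (u, 0 : E))}.
  by apply: cts_pair; [exact: cvg_id|exact: cvg_cst].
have : \forall z \near (0 : E), W (z, 0) := cj _ (open_nbhs_nbhs (conj oW W0)).
apply: filterS => z Wz Y; rewrite /local_Ad.
have dz : hasD (fun u : E => (z, u)) 0 Y (0, Y).
  by apply: hasD_pair; [exact: hasD_cst|exact: hasD_lin (@clin_id R E)].
exact: hasD_Df (hasD_comp hE oW (CW 1%N) (Wz : W ((fun u : E => (z, u)) 0)) dz).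
Qed.

(** Near the identity [local_Ad] is a partial derivative of [local_conj]; differentiating once more
    gives the mixed derivative, that is, the bracket. *)
Lemma hasD_AdG (D : tvsType R) (f : D -> H) x v Y : Sm f x -> f x = 1%g ->
  hasD (fun d => local_Ad (f d) Y) x v (local_brk (Df (lg \o f) (x, v)) Y).
Proof.
move=> sf fx; have [W [oW Wx CW HW]] := ll_lg LL sf fx.
have [Q [oQ Q0 CQ _]] := lconj_near.
have l0 : lg (f x) = 0 by rewrite fx lg1.
have CD := Cinfty_Df hE oQ CQ.
have dl : hasD (fun d => ((lg (f d), 0 : E), (0 : E, Y))) x v ((Df (lg \o f) (x, v), 0), (0, 0)).
  apply: hasD_pair; last exact: hasD_cst.
  by apply: hasD_pair; [exact: (Cinfty_hasD hE oW CW)|exact: hasD_cst].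
have QQ : (Q `*` setT) ((fun d => ((lg (f d), 0 : E), (0 : E, Y))) x) by rewrite /= l0.
have := hasD_comp hE (open_setXT oQ) (CD 1%N) QQ dl; rewrite l0.
apply: hasD_near.
have cl : {for x, continuous (lg \o f)} by exact: (Cinfty_cont CW).
have : \forall d \near x, forall Y, local_Ad (par (lg (f d))) Y = Df local_conj ((lg (f d), 0), (0, Y)).
  have nb : nbhs ((lg \o f) x) [set z | forall Y, local_Ad (par z) Y = Df local_conj ((z, 0), (0, Y))].
    by rewrite /= l0; exact: AdG_par_near.
  exact: (cl _ nb).
move=> near1; near=> d.
have Wd : W d by near: d; exact: (open_nbhs_nbhs (conj oW Wx)).
have E1 : forall Y, local_Ad (par (lg (f d))) Y = Df local_conj ((lg (f d), 0), (0, Y)) by near: d; exact: near1.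
by rewrite /= -E1 (HW d Wd).2.
Unshelve. all: by end_near.
Qed.

Lemma Df_lg_par X : Df (lg \o par) (0, X) = X.
Proof.
rewrite (@Df_near _ _ _ _ id); first by exact: (Df_lin _ _ hE (@clin_id R E)).
apply: (filterS _ (open_nbhs_nbhs (conj (ll_open LL) (ll_zero LL)))) => z; exact: (ll_lgK LL).
Qed.

Lemma admissible_par z : U0 z -> admissible (par z).
Proof.
move=> Uz; apply: (@ll_comp LL _ _ par setT (fun=> z) 0) => //; first exact: openT.
  exact: Cinfty_cst.
exact: ll_par.
Qed.

(** Differentiate at [z = 0] the equality of [Ad a] after [Ad (par z)] with [Ad] of the conjugate of
    [par z] by [a], after [Ad a]. *)
Lemma AdG_brk a X Y : admissible a -> local_Ad a (local_brk X Y) = local_brk (local_Ad a X) (local_Ad a Y).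
Proof.
move=> sa; have cA := clin_AdG sa.
have sp := ll_par LL (ll_zero LL).
have d1 := @hasD_AdG _ par 0 X Y sp (ll_par0 LL).
rewrite Df_lg_par in d1.
have d2 := hasD_comp hE openT (@Cinfty_lin R _ _ setT _ cA 1%N) (I : setT ((fun u => local_Ad (par u) Y) 0)) d1.
rewrite (Df_lin _ _ hE cA) in d2.
have sf : Sm (fun u => a * par u * a^-1)%g 0.
  apply: (ll_mul LL); last exact: (ll_inv LL).
  exact: (ll_mul LL).
have d3 := @hasD_AdG _ _ 0 X (local_Ad a Y) sf _.
have {}d3 : hasD (fun d => local_Ad (a * par d * a^-1)%g (local_Ad a Y)) 0 X (local_brk (local_Ad a X) (local_Ad a Y)).
  by apply: d3; rewrite (ll_par0 LL) mulg1 mulgV.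
apply: esym; rewrite -(hasD_Df hE d3) -(hasD_Df hE d2); apply: Df_near.
have sV := ll_inv LL sa.
apply: (filterS _ (open_nbhs_nbhs (conj (ll_open LL) (ll_zero LL)))) => z Uz /=.
have sz := admissible_par Uz.
by rewrite -AdG_mul ?mulgVK -?mulgA ?mulVg ?mulg1 ?AdG_mul //; apply: (ll_mul LL) => //; exact: (ll_mul LL).
Qed.

Lemma cbil_brk : cbil (fun p => local_brk p.1 p.2).
Proof. by have [W [oW W0 CW _]] := lconj_near; exact: (cbil_mix hE oW W0 CW). Qed.

(** The derivative of [AdG_brk] in the group variable, taken at the identity. *)
Lemma brk_jacobi X Y Z : local_brk X (local_brk Y Z) = local_brk (local_brk X Y) Z + local_brk Y (local_brk X Z).
Proof.
have sp := ll_par LL (ll_zero LL).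
have d W := @hasD_AdG _ par 0 X W sp (ll_par0 LL).
have d1 := d (local_brk Y Z); have dB := hasD_bil hE cbil_brk (d Y) (d Z).
rewrite !Df_lg_par in d1 dB.
have A1 W : local_Ad (par 0) W = W.
  rewrite (ll_par0 LL) /local_Ad (@Df_near _ _ _ _ id); first exact: (Df_lin _ _ hE (@clin_id R E)).
  apply: (filterS _ (open_nbhs_nbhs (conj (ll_open LL) (ll_zero LL)))) => z Uz.
  by rewrite /local_act mul1g invg1 mulg1 (ll_lgK LL).
rewrite !A1 in dB; rewrite -(hasD_Df hE d1) -(hasD_Df hE dB); apply: Df_near.
apply: (filterS _ (open_nbhs_nbhs (conj (ll_open LL) (ll_zero LL)))) => z Uz /=.
by rewrite AdG_brk //; exact: admissible_par.
Qed.

Lemma lmul0r x : U0 x -> local_mul (x, 0) = x.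
Proof. by move=> Ux; rewrite /local_mul /= (ll_par0 LL) mulg1 (ll_lgK LL). Qed.
Lemma lconj0r x : local_conj (x, 0) = 0.
Proof. by rewrite /local_conj /= (ll_par0 LL) mulg1 mulgV lg1. Qed.
Lemma lconj0l x : U0 x -> local_conj (0, x) = x.
Proof. by move=> Ux; rewrite /local_conj /= (ll_par0 LL) mul1g invg1 mulg1 (ll_lgK LL). Qed.

Lemma Df_lconjr Y : Df local_conj ((0, 0), (0, Y)) = Y.
Proof.
have [W [oW W0 CW _]] := lconj_near.
have dz : hasD (fun u : E => (0 : E, u)) 0 Y (0, Y).
  by apply: hasD_pair; [exact: hasD_cst|exact: hasD_lin (@clin_id R E)].
have <- := hasD_Df hE (hasD_comp hE oW (CW 1%N) (W0 : W ((fun u : E => (0, u)) 0)) dz).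
rewrite (@Df_near _ _ _ _ id); first exact: (Df_lin _ _ hE (@clin_id R E)).
apply: (filterS _ (open_nbhs_nbhs (conj (ll_open LL) (ll_zero LL)))) => z Uz.
exact: lconj0l.
Qed.

Lemma Df_lconjl X : Df local_conj ((0, 0), (X, 0)) = 0.
Proof.
have [W [oW W0 CW _]] := lconj_near.
have dz : hasD (fun u : E => (u, 0 : E)) 0 X (X, 0).
  by apply: hasD_pair; [exact: hasD_lin (@clin_id R E)|exact: hasD_cst].
have <- := hasD_Df hE (hasD_comp hE oW (CW 1%N) (W0 : W ((fun u : E => (u, 0)) 0)) dz).
rewrite (_ : _ \o _ = fun=> 0); first by apply: (hasD_Df hE); exact: hasD_cst.
by apply/funext => u; exact: lconj0r.
Qed.

(** At the origin the substitution [p |-> (local_conj p, p.1)] has the flip as its first derivative,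
    and only its first component has a mixed derivative, the bracket. *)
Lemma mix_conj_swap (K : tvsType R) (f : E * E -> K) (W : set (E * E)%type) X Y : hausdorff_space K ->
  open W -> W (0, 0) -> Cinfty W f ->
  mix (fun p => f (local_conj p, p.1)) X Y = mix f Y X + Df f ((0, 0), (local_brk X Y, 0)).
Proof.
move=> hK oW W0 Cf; have [Q [oQ Q0 CQ _]] := lconj_near.
have Cfst : Cinfty Q (fun p : E * E => p.1) by apply: Cinfty_lin; exact: clin_fst.
have Cq := Cinfty_pair CQ Cfst.
have hEE := hausdorff_prod hE hE.
have q0 : (local_conj (0, 0), (0 : E)) = (0, 0) by rewrite lconj0r.
have Wq : W ((fun p : E * E => (local_conj p, p.1)) (0, 0)) by rewrite /= lconj0r.
rewrite (mix_comp X Y hE hE hEE hK oQ Q0 Cq oW Wq Cf) (mix_pair X Y hE hE hE hE oQ Q0 CQ Cfst).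
rewrite !(Df_pair _ hE hE oQ Q0 CQ Cfst) /= !(Df_lin _ _ hE (@clin_fst R E E)) /= Df_lconjr Df_lconjl lconj0r.
rewrite (mix_lin X Y hE hE hE (@clin_fst R E E)); congr (_ + _).
by rewrite (mix_sym Y X hK oW W0 Cf).
Qed.

(** A product x y equals (x y x^-1) x. By [mix_conj_swap] the mixed derivative m of the product
    therefore satisfies m(X, Y) = m(Y, X) + [X, Y]; exchanging [X] and [Y] and comparing gives the
    claim. *)
Lemma brkC X Y : local_brk X Y = - local_brk Y X.
Proof.
have [W [oW W0 CW HW]] := lmul_near; have [Q [oQ Q0 CQ HQ]] := lconj_near.
have D1 v : Df local_mul ((0, 0), (v, 0)) = v.
  have dz : hasD (fun u : E => (u, 0 : E)) 0 v (v, 0).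
    by apply: hasD_pair; [exact: hasD_lin (@clin_id R E)|exact: hasD_cst].
  have <- := hasD_Df hE (hasD_comp hE oW (CW 1%N) (W0 : W ((fun u : E => (u, 0)) 0)) dz).
  rewrite (@Df_near _ _ _ _ id); first exact: (Df_lin _ _ hE (@clin_id R E)).
  apply: (filterS _ (open_nbhs_nbhs (conj (ll_open LL) (ll_zero LL)))) => z Uz.
  exact: lmul0r.
have sw A B : mix local_mul A B = mix local_mul B A + local_brk A B.
  rewrite -[X in _ = _ + X]D1 -(mix_conj_swap A B hE oW W0 CW).
  have Cq : Cinfty Q (fun p => (local_conj p, p.1)).
    by apply: Cinfty_pair => //; apply: Cinfty_lin; exact: clin_fst.
  have oP : open (Q `&` (fun p => (local_conj p, p.1)) @^-1` W) by exact: preim_open.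
  have P0 : (Q `&` (fun p => (local_conj p, p.1)) @^-1` W) (0, 0) by split=> //; rewrite /preimage /= lconj0r.
  have Cc : Cinfty (Q `&` (fun p => (local_conj p, p.1)) @^-1` W) (fun p => local_mul (local_conj p, p.1)).
    apply: (@Cinfty_comp _ _ _ _ _ W (fun p => (local_conj p, p.1)) local_mul) => //.
      by move=> p [].
    by apply: Cinfty_sub Cq => p [].
  apply: (mix_near A B hE hE hE oW W0 CW oP P0 Cc).
  apply: (filterS _ (open_nbhs_nbhs (conj oP P0))) => p [Qp _].
  by rewrite {2}/local_mul /= (HQ p Qp).2 mulgVK.
have := sw X Y; rewrite {1}(sw Y X) -addrA -[LHS]addr0 => /addrI.
by move=> /esym/eqP; rewrite addrC addr_eq0 => /eqP.
Qed.

End LocalLie.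

(** * The group and its path group as local Lie groups *)

Section PathGroup.
Context {R : realType} {n : nat} {G : groupType}.
Variable A : atlas 'rV[R]_n G.
Hypothesis lA : lie_group A.
Variable c : chart 'rV[R]_n G.
Hypotheses (Ac : A c) (c1 : chart_dom c 1%g).
Local Notation X := 'rV[R]_n.
Local Notation V := (flat_vect R Path n).
Let mA := lie_manifold lA.
Let hX : hausdorff_space X := @hausdorff_normed R _.
Let hV : hausdorff_space V := @flat_vect_hausdorff R Path n.
Let e0 := chart_map c 1%g.

Definition gcod : set X := [set x | chart_cod c (e0 + x)].
Definition gpar (x : X) : G := chart_par c (e0 + x).
Definition glg (g : G) : X := chart_map c g - e0.
Definition gsm (D : tvsType R) (f : D -> G) (x : D) : Prop := smat A f x.

Let ci : {in chart_cod c &, injective (chart_par c)}.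
Proof. by have [H _ _ _] := mA; have [] := H c Ac. Qed.
Let oc : open (chart_cod c).
Proof. by have [H _ _ _] := mA; have [] := H c Ac. Qed.

Lemma open_shift (D : tvsType R) (a : D -> X) : Cinfty setT a -> open [set d | chart_cod c (e0 + a d)].
Proof.
move=> Ca; have : open ([set: D] `&` (fun d => e0 + a d) @^-1` chart_cod c).
  apply: preim_open => //; first exact: openT.
  by apply: Cinfty_add => //; [exact: openT|exact: Cinfty_cst].
by rewrite setTI.
Qed.

Lemma local_lie_G : local_lie gsm gcod gpar glg.
Proof.
split=> //.
- by move=> D f g x; exact: smat_mul.
- by move=> D f x; exact: smat_inv.
- by move=> D D' f U h y; exact: smat_precomp.
- by apply: (@open_shift X id); apply: Cinfty_lin; exact: clin_id.
- by rewrite /gcod /= addr0; have [] := chart_mapP c1.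
- by rewrite /gpar addr0; have [] := chart_mapP c1.
- move=> z Uz; apply: (smat_par mA (z := fun x => e0 + x) Ac (W := gcod)) => //.
    by apply: (@open_shift X id); apply: Cinfty_lin; exact: clin_id.
  apply: (@Cinfty_sub _ _ _ setT) => //; apply: Cinfty_add; first exact: openT.
    exact: Cinfty_cst.
  by apply: Cinfty_lin; exact: clin_id.
- move=> D f x sf fx; have [_ H] := sf.
  have [|W [oW Wx Wc CW]] := H c Ac; first by rewrite fx.
  exists W; split=> // [|y Wy].
    by apply: Cinfty_add => //; exact: Cinfty_cst.
  by rewrite /gcod /gpar /glg /= addrC subrK; have [] := chart_mapP (Wc y Wy).
- by move=> z Uz; rewrite /glg /gpar chart_map_par // addrAC subrr add0r.
Qed.

(** Smoothness of a family of paths is taken in uncurried form, which makes products and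
    reparametrisations easy; [smat_flat] converts it to smoothness for [flat_atlas]. *)
Definition psm (D : tvsType R) (f : D -> R -> G) (x : D) : Prop := exists U : set D,
  [/\ open U, U x, forall d, U d -> PeG A (f d) &
    forall d (s : R^o), U d -> smat A (fun p : D * R^o => f p.1 p.2) (d, s)].

Let pc := flat_chart (R := R) Path (1%g : R -> G) c.
Definition pcod : set V := chart_cod pc.
Definition ppar (z : V) : R -> G := chart_par pc z.
Definition plg (h : R -> G) : V := chart_map pc h.

Lemma pparE z s : ppar z s = gpar (z s).
Proof. exact: mul1g. Qed.

Lemma PeG1 : PeG A (1%g : R -> G).
Proof. by apply/(PeGP lA); split=> // s; exact: smat_cst. Qed.

Let Apc : flat_atlas A Path pc.
Proof. by exists 1%g, c; split=> //; exact: PeG1. Qed.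

Lemma open_pcod : open pcod.
Proof.
rewrite openE => z Uz.
have H1 : \forall z' \near z, forall s, 0 <= s <= pi -> chart_cod c (e0 + flat_fun z' s).
  apply: (@tube_lemma R _ (nbhs z) (fun z' s => chart_cod c (e0 + flat_fun z' s)) 0 pi _ _) => s _.
  have oQ := open_shift (@ev_Cinfty R n).
  have [[B C] /= [nB nC] BC] := open_nbhs_nbhs (conj oQ (Uz s : [set p : V * R^o | chart_cod c (e0 + flat_fun p.1 p.2)] (z, s : R^o))).
  by exists (C, B) => // -[t d] [/= Ct Bd]; exact: (BC (d, t)).
apply: filterS H1 => z' Hz s; rewrite (flat_wraps z' s); apply: Hz.
have p0 := pi_ge0 R.
by rewrite le_max lexx /= ge_max p0 ge_min lexx orbT.
Qed.

Lemma PeG_ppar z : pcod z -> PeG A (ppar z).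
Proof.
move=> Uz; apply/(PeGP lA); split.
- by move=> s; rewrite !pparE -(flat_wraps z s).
- by rewrite pparE path_le0 // (ll_par0 local_lie_G).
move=> s; rewrite (_ : ppar z = chart_par c \o (fun t => e0 + z t)); last by apply/funext => t; rewrite pparE.
apply: (smat_par mA Ac (W := [set t : R^o | chart_cod c (e0 + flat_fun z t)])) => //.
- exact: open_shift (@flat_vect_Cinfty R Path n z).
- exact: (Uz s).
- apply: (@Cinfty_sub _ _ _ setT) => //; apply: Cinfty_add; first exact: openT.
    exact: Cinfty_cst.
  exact: flat_vect_Cinfty.
Qed.

Lemma local_lie_P : local_lie psm pcod ppar plg.
Proof.
split=> //.
- move=> D f g x [U [oU Ux fP fs]] [W [oW Wx gP gs]]; exists (U `&` W); split=> //.
  + exact: openI.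
  + by move=> d [Ud Wd]; apply: flat_curves_mul => //; [exact: fP|exact: gP].
  + by move=> d s [Ud Wd]; apply: (smat_mul lA); [exact: fs|exact: gs].
- move=> D f x [U [oU Ux fP fs]]; exists U; split=> //.
  + by move=> d Ud; apply: flat_curves_inv => //; exact: fP.
  + by move=> d s Ud; apply: (smat_inv lA); exact: fs.
- move=> D D' f U h y oU Uy Ch [W [oW Wy fP fs]]; exists (U `&` h @^-1` W); split=> //.
  + exact: preim_open.
  + by move=> d [Ud Wd]; exact: fP.
  + move=> d s [Ud Wd].
    apply: (@smat_precomp _ _ _ _ _ _ (fun p : D * R^o => f p.1 p.2) (U `*` setT) (fun p : D' * R^o => (h p.1, p.2))).
    * exact: open_setXT.
    * by [].
    * apply: Cinfty_pair; last by apply: Cinfty_lin; exact: clin_snd.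
      apply: (@Cinfty_comp _ _ _ _ (U `*` setT) U fst h) => //; first exact: open_setXT.
        by move=> p [].
      by apply: Cinfty_lin; exact: clin_fst.
    * exact: fs.
- exact: open_pcod.
- by move=> s; rewrite addr0; have [] := chart_mapP c1.
- by apply/funext => s; rewrite pparE (ll_par0 local_lie_G).
- move=> z Uz; exists pcod; split=> //; [exact: open_pcod|exact: PeG_ppar|].
  move=> d s Ud; rewrite (_ : (fun p : V * R^o => _) = chart_par c \o (fun p : V * R^o => e0 + flat_fun p.1 p.2)); last first.
    by apply/funext => p; rewrite pparE.
  apply: (smat_par mA Ac (W := [set p : V * R^o | chart_cod c (e0 + flat_fun p.1 p.2)])) => //.
  + exact: open_shift (@ev_Cinfty R n).
  + exact: (Ud s).
  + apply: (@Cinfty_sub _ _ _ setT) => //; apply: Cinfty_add; first exact: openT.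
      exact: Cinfty_cst.
    exact: ev_Cinfty.
- move=> D f x [U [oU Ux fP fs]] fx.
  have [_ H] := smat_flat lA oU fP fs Ux.
  have [|W [oW Wx Wc CW]] := H pc Apc.
    rewrite fx; exists 0; first by move=> s /=; rewrite addr0; have [] := chart_mapP c1.
    by apply/funext => s /=; rewrite addr0 mul1g; have [_ ->] := chart_mapP c1.
  exists W; split=> // y Wy.
  exact: (chart_mapP (Wc y Wy)).
- by move=> z Uz; apply: chart_map_par => //; exact: (@flat_chart_inj _ _ _ _ lA Path).
Qed.

Let LG := local_lie_G.
Let LP := local_lie_P.

Lemma psm_cst (D : tvsType R) (g : R -> G) (x : D) : PeG A g -> psm (fun _ : D => g) x.
Proof.
move=> Pg; exists setT; split=> //; first exact: openT.
by move=> d s _; apply: smat_snd_curve; have [_ _] := (PeGP lA g).1 Pg; apply.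
Qed.

Lemma psm_PeG (D : tvsType R) (f : D -> R -> G) x : psm f x -> PeG A (f x).
Proof. by case=> U [_ Ux H _]; exact: H. Qed.

(** Evaluation at [s] is a homomorphism and is linear in the charts used, so it commutes with the
    mixed derivative of conjugation. *)
Lemma brk_pointwise (Y Z : V) s : local_brk ppar plg Y Z s = local_brk gpar glg (Y s) (Z s).
Proof.
have [W [oW W0 CW HW]] := lconj_near LP; have [Q [oQ Q0 CQ _]] := lconj_near LG.
have cev := @clin_ev R n s.
have E1 : local_brk ppar plg Y Z s = mix ((fun z : V => flat_fun z s) \o local_conj ppar plg) Y Z.
  by rewrite (mix_postlin Y Z hV hV hV hX oW W0 CW cev).
have cq : clin (fun p : V * V => (flat_fun p.1 s, flat_fun p.2 s)).
  apply: clin_pair; first exact: clin_comp (@clin_fst _ _ _) cev.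
  exact: clin_comp (@clin_snd _ _ _) cev.
have Cq : Cinfty setT (fun p : V * V => (flat_fun p.1 s, flat_fun p.2 s)) by exact: Cinfty_lin.
have hXX := hausdorff_prod hX hX.
have E2 : mix (local_conj gpar glg \o (fun p : V * V => (flat_fun p.1 s, flat_fun p.2 s))) Y Z = local_brk gpar glg (Y s) (Z s).
  rewrite (mix_comp Y Z hV hV hXX hX openT I Cq oQ Q0 CQ) (mix_lin Y Z hV hV hXX cq).
  rewrite !(Df_lin _ _ hXX cq) /=.
  exact: (etrans (congr2 +%R erefl (Df0 hX oQ (CQ 1%N) Q0)) (addr0 _)).
rewrite E1 -E2.
have oP : open (setT `&` (fun p : V * V => (flat_fun p.1 s, flat_fun p.2 s)) @^-1` Q) by apply: preim_open => //; exact: openT.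
apply: (@mix_near _ _ _ _ _ _ W (setT `&` (fun p : V * V => (flat_fun p.1 s, flat_fun p.2 s)) @^-1` Q)) => //.
- exact: (Cinfty_comp oW openT _ CW (Cinfty_lin setT cev)).
- by apply: (Cinfty_comp oP oQ _ (Cinfty_sub _ Cq) CQ) => // p [].
have U00 := ll_zero LP.
have nU : \forall p \near ((0 : V), (0 : V)), pcod p.1 /\ pcod p.2.
  exists (pcod, pcod); first by split; apply: open_nbhs_nbhs; split=> //; exact: open_pcod.
  by move=> p.
near=> p.
have Wp : W p by near: p; exact: open_nbhs_nbhs.
have [U1 U2] : pcod p.1 /\ pcod p.2 by near: p.
have [Ul El] := HW p Wp.
rewrite /= -(ll_lgK LG (Ul s : gcod _)) -pparE El.
by rewrite /local_conj /= -!pparE.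
Unshelve. all: by end_near. Qed.

(** Connects the bracket in the definition of semisimplicity, made of two successive derivatives in
    one real variable, with the mixed derivative used here. *)
Lemma lie_bracketE (Y Z : X) : lie_bracket c Y Z = local_brk gpar glg Y Z.
Proof.
have U00 := ll_zero LG.
have AdE g : @admissible R X G gsm g -> Ad c g Z = local_Ad gpar glg g Z.
  move=> sg; have [W [oW W0 CW _]] := lact_near LG sg.
  have H := Cinfty_hasD (v := Z) hX oW CW W0.
  have {}H : hasD (fun t : R^o => chart_map c (g * chart_par c (e0 + t *: Z)%R * g^-1)%g) 0 (1 : R^o) (local_Ad gpar glg g Z).
    apply: dnbhs0_eq_cvg H => h h0.
    rewrite /local_act /gpar /glg !add0r [h *: 1]mulr1 scale0r addr0.
    by rewrite opprB addrA subrK.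
  by have [_] := hasD_derivable H.
have sp : gsm (fun t : R^o => gpar (t *: Y)) 0.
  apply: (Sm_lin LG (L := fun t : R^o => t *: Y)); last by rewrite scale0r.
  split; first by move=> a x y; rewrite scalerDl scalerA.
  by move=> x; apply: cvgZ; [exact: cvg_id|exact: cvg_cst].
have := @hasD_AdG _ _ _ _ _ _ _ LG _ _ 0 (1 : R^o) Z sp.
rewrite /= scale0r (ll_par0 LG) => /(_ erefl) H.
have E : Df (glg \o (fun t : R^o => gpar (t *: Y))) (0, (1 : R^o)) = Y.
  have := hasD_Df hX (_ : hasD (glg \o (fun t : R^o => gpar (t *: Y))) 0 (1 : R^o) Y); apply.
  apply: (@hasD_near _ _ _ (fun t : R^o => t *: Y)).
    have cl : {for (0 : R^o), continuous (fun t : R^o => t *: Y)}.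
      by apply: cvgZ; [exact: cvg_id|exact: cvg_cst].
    have nb : nbhs ((0 : R^o) *: Y) gcod.
      by rewrite scale0r; apply: open_nbhs_nbhs; split=> //; exact: (ll_open LG).
    have nr : \forall t \near (0 : R^o), gcod (t *: Y) := cl _ nb.
    near=> t; apply/esym; apply: (ll_lgK LG); near: t; exact: nr.
  by apply: (@dnbhs0_eq_cvg _ _ _ (fun=> Y)) => [h h0|]; [rewrite add0r scale0r subr0 [h *: 1]mulr1 scalerA mulVf // scale1r|exact: cvg_cst].
rewrite E in H.
suff H2 : hasD (fun t : R^o => Ad c (chart_par c (e0 + t *: Y)) Z) 0 (1 : R^o) (local_brk gpar glg Y Z).
  by have [_] := hasD_derivable H2.
apply: hasD_near H.
have cl : {for (0 : R^o), continuous (fun t : R^o => t *: Y)}.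
  by apply: cvgZ; [exact: cvg_id|exact: cvg_cst].
have nb : nbhs ((0 : R^o) *: Y) gcod.
  by rewrite scale0r; apply: open_nbhs_nbhs; split=> //; exact: (ll_open LG).
have nr : \forall t \near (0 : R^o), gcod (t *: Y) := cl _ nb.
near=> t; rewrite AdE //.
apply: (admissible_par LG); near: t; exact: nr.
Unshelve. all: by end_near. Qed.

End PathGroup.

Lemma open_near (T : topologicalType) (W : set T) x : open W -> W x -> \forall y \near x, W y.
Proof. by move=> oW Wx; exact: open_nbhs_nbhs. Qed.

Lemma mix_add (R : realType) (E F K : tvsType R) (f g : E * F -> K) (W : set (E * F)%type) x y :
  hausdorff_space E -> hausdorff_space F -> hausdorff_space K ->
  open W -> W (0, 0) -> Cinfty W f -> Cinfty W g ->
  mix (fun p => f p + g p) x y = mix f x y + mix g x y.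
Proof.
move=> hE hF hK oW W0 Cf Cg; have hKK := hausdorff_prod hK hK.
have cs : clin (fun q : K * K => q.1 + q.2) by apply: clin_sum; [exact: clin_fst|exact: clin_snd].
have := mix_postlin x y hE hF hKK hK oW W0 (Cinfty_pair Cf Cg) cs.
by rewrite (mix_pair x y hE hF hK hK oW W0 Cf Cg).
Qed.

Lemma hasD_sum (R : realType) (E F : tvsType R) (f g : E -> F) x v a b : hausdorff_space F ->
  hasD f x v a -> hasD g x v b -> hasD (fun y => f y + g y) x v (a + b).
Proof.
move=> hF df dg.
have cs : clin (fun q : F * F => q.1 + q.2) by apply: clin_sum; [exact: clin_fst|exact: clin_snd].
have := hasD_comp hF openT (Cinfty_lin setT cs 1%N) (I : setT ((fun y => (f y, g y)) x)) (hasD_pair df dg).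
by rewrite (Df_lin _ _ hF cs).
Qed.

Lemma Df2_0 (R : realType) (E K : tvsType R) (f : E -> K) (W : set E) x v : hausdorff_space K ->
  open W -> W x -> Cinfty W f -> Df (Df f) ((x, v), (0, 0)) = 0.
Proof.
move=> hK oW Wx Cf; have WW : (W `*` setT) (x, v) by [].
have oWW : open (W `*` [set: E]) by exact: open_setXT.
exact: (Df0 hK oWW (Cinfty_Df hK oW Cf 1%N) WW).
Qed.

Lemma mix_fst (R : realType) (E F K : tvsType R) (f : E -> K) (W : set E) x (y : F) :
  hausdorff_space E -> hausdorff_space F -> hausdorff_space K ->
  open W -> W 0 -> Cinfty W f -> mix (fun p : E * F => f p.1) x y = 0.
Proof.
move=> hE hF hK oW W0 Cf.
have c1 : clin (fst : E * F -> E) by exact: clin_fst.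
have C1 : Cinfty setT (fst : E * F -> E) by exact: Cinfty_lin.
rewrite (mix_comp (q := fst) x y hE hF hE hK openT I C1 oW W0 Cf) (mix_lin x y hE hF hE c1).
rewrite !(Df_lin _ _ hE c1) /= (Df0 hK oW (Cf 1%N) W0) (Df_sym _ _ hK oW (Cf 2%N) W0).
by rewrite (Df2_0 _ hK oW W0 Cf) addr0.
Qed.

Lemma mix_snd (R : realType) (E F K : tvsType R) (f : F -> K) (W : set F) (x : E) y :
  hausdorff_space E -> hausdorff_space F -> hausdorff_space K ->
  open W -> W 0 -> Cinfty W f -> mix (fun p : E * F => f p.2) x y = 0.
Proof.
move=> hE hF hK oW W0 Cf.
have c1 : clin (snd : E * F -> F) by exact: clin_snd.
have C1 : Cinfty setT (snd : E * F -> F) by exact: Cinfty_lin.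
rewrite (mix_comp (q := snd) x y hE hF hF hK openT I C1 oW W0 Cf) (mix_lin x y hE hF hF c1).
rewrite !(Df_lin _ _ hF c1) /= (Df0 hK oW (Cf 1%N) W0).
by rewrite (Df2_0 _ hK oW W0 Cf) addr0.
Qed.

(** * Cocycles of a central extension *)

Section LocalExtension.
Context {R : realType}.
Variables (E : tvsType R) (H : groupType).
Variable Sm : forall D : tvsType R, (D -> H) -> D -> Prop.
Variables (U0 : set E) (par : E -> H) (lg : H -> E).
Variables (Ht : groupType) (SmT : forall D : tvsType R, (D -> Ht) -> D -> Prop).
Variables (ie : R -> Ht) (over : Ht -> H -> Prop).

Definition section_at (s : E -> Ht) (W : set E) :=
  [/\ open W, W 0, s 0 = 1%g & forall z, W z -> SmT s z /\ over (s z) (par z)].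

(* [over y a] says that [y] lies in the fibre of the extension over [a], and
   [ie t] is the image of [exp (i t)] in the centre. *)
Record local_ext : Prop := LocalExtension {
  xt_mul : forall (D : tvsType R) (f g : D -> Ht) x, SmT f x -> SmT g x -> SmT (fun y => f y * g y)%g x;
  xt_inv : forall (D : tvsType R) (f : D -> Ht) x, SmT f x -> SmT (fun y => (f y)^-1)%g x;
  xt_comp : forall (D D' : tvsType R) (f : D -> Ht) (U : set D') (h : D' -> D) y,
    open U -> U y -> Cinfty U h -> SmT f (h y) -> SmT (f \o h) y;
  xt_cst : forall (D : tvsType R) y (x : D), SmT (fun=> y) x;
  xt_ie : forall t : R^o, SmT (ie : R^o -> Ht) t;
  ov_mul : forall y z a b, over y a -> over z b -> over (y * z)%g (a * b)%g;
  ov_inv : forall y a, over y a -> over y^-1%g a^-1%g;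
  ov_lift : forall a, admissible E Sm a -> exists y, over y a;
  ov_fib : forall y z a, over y a -> over z a -> exists t, z = (y * ie t)%g;
  ov_ie : forall t, over (ie t) 1%g;
  ie_add : forall s t, ie (s + t) = (ie s * ie t)%g;
  ie_central : forall t y, (ie t * y = y * ie t)%g;
  ie_small : forall t, `|t| < pi -> ie t = 1%g -> t = 0;
  ie_const : forall th : R -> R, (forall r : R, exists v : R -> R,
    [/\ v r = 0, is_derive r (1 : R) v 0 & \forall h \near r, ie (th h) = ie (th r + v h)]) ->
    forall r t, ie (th r) = ie (th t);
  ov_log : forall (D : tvsType R) (L : D -> Ht) x, SmT L x -> (\forall d \near x, over (L d) 1%g) ->
    L x = 1%g -> exists (u : D -> R^o) W,
    [/\ open W, W x, Cinfty W u, u x = 0 & forall d, W d -> L d = ie (u d)];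
  ov_sect : exists s W, section_at s W
}.

Hypothesis LL : local_lie Sm U0 par lg.
Hypothesis XT : local_ext.
Let hE := ll_hausdorff LL.
Let hR : hausdorff_space R^o := @hausdorff_normed R R^o.
Let lmul := local_mul par lg.
Let lconj := local_conj par lg.
Let lact := local_act par lg.
Let AdG := local_Ad par lg.
Let brk := local_brk par lg.

Lemma ie0 : ie 0 = 1%g.
Proof. by apply: (mulgI (ie 0)); rewrite -(ie_add XT) addr0 mulg1. Qed.

Lemma ieN t : ie (- t) = (ie t)^-1%g.
Proof. by apply: (mulgI (ie t)); rewrite -(ie_add XT) subrr ie0 mulgV. Qed.

Lemma ieAC (x y : Ht) t : (x * ie t * y = x * y * ie t)%g.
Proof. by rewrite -!mulgA (ie_central XT). Qed.

Lemma conj_exponents (y s1 s2 s3 t1 t2 t3 : Ht) l1 l2 l3 m k :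
  (y * s1 * y^-1 = t1 * ie l1)%g -> (y * s2 * y^-1 = t2 * ie l2)%g ->
  (y * s3 * y^-1 = t3 * ie l3)%g -> (t1 * t2 * t1^-1 = t3 * ie m)%g ->
  (s1 * s2 * s1^-1 = s3 * ie k)%g -> (t3 * ie (m + l2) = t3 * ie (l3 + k))%g.
Proof.
move=> H1 H2 H3 Ht' Hs.
have K : (y * (s1 * s2 * s1^-1) * y^-1 = (y * s1 * y^-1) * (y * s2 * y^-1) * (y * s1 * y^-1)^-1)%g.
  by rewrite !invgM invgK !mulgA !mulgVK.
rewrite Hs mulgA ieAC H3 H1 H2 in K.
rewrite !(ie_add XT) !mulgA K -Ht' invgM (ieAC t1) mulgA mulgK mulgA.
by rewrite (ieAC (t1 * t2)%g).
Qed.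

(** [ie] is injective on small exponents only; continuity keeps the difference of [u] and [v] small
    near [x]. *)
Lemma ie_inj_near (D : tvsType R) (u v : D -> R^o) (x : D) : {for x, continuous u} ->
  {for x, continuous v} -> u x = v x -> (\forall d \near x, ie (u d) = ie (v d)) ->
  \forall d \near x, u d = v d.
Proof.
move=> cu cv uv uvn.
have c : (fun d => u d - v d) @ x --> (0 : R^o).
  have -> : 0 = u x - v x by rewrite uv subrr.
  exact: (@cvgB _ R^o).
have nb : nbhs (0 : R^o) [set t : R^o | `|t : R| < pi].
  by apply/nbhs_ballP; exists pi; [exact: pi_gt0|move=> t; rewrite /ball /= sub0r normrN].
have : \forall d \near x, `|u d - v d : R| < pi := c _ nb.
move=> nd; near=> d; apply/eqP; rewrite -subr_eq0; apply/eqP; apply: (ie_small XT).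
  by near: d; exact: nd.
rewrite (ie_add XT) ieN; have -> : ie (u d) = ie (v d) by near: d; exact: uvn.
by rewrite mulgV.
Unshelve. all: by end_near. Qed.

(** The common source of the exponents of the cocycles below: two lifts of one map into the base
    differ by a central factor, and [ov_log] takes its logarithm smoothly. *)
Lemma ie_diff (D : tvsType R) (f g : D -> Ht) (x : D) : SmT f x -> SmT g x -> f x = g x ->
  (\forall d \near x, exists2 a, over (f d) a & over (g d) a) ->
  exists (u : D -> R^o) W, [/\ open W, W x, Cinfty W u, u x = 0 &
    forall d, W d -> f d = (g d * ie (u d))%g].
Proof.
move=> sf sg fg ov.
have sL : SmT (fun d => (g d)^-1 * f d)%g x by apply: (xt_mul XT) => //; exact: (xt_inv XT).
have oL : \forall d \near x, over ((g d)^-1 * f d)%g 1%g.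
  apply: filterS ov => d [a fa ga]; rewrite -(mulVg a).
  by apply: (ov_mul XT) => //; exact: (ov_inv XT).
have L1 : ((g x)^-1 * f x)%g = 1%g by rewrite fg mulVg.
have [u [W [oW Wx Cu ux Wu]]] := ov_log XT sL oL L1.
by exists u, W; split=> // d Wd; rewrite -(Wu d Wd) mulgA mulgV mul1g.
Qed.

Section GivenSection.
Variables (s : E -> Ht) (W0 : set E).
Hypothesis hs : section_at s W0.
Let oW0 : open W0. Proof. by case: hs. Qed.
Let W00 : W0 0. Proof. by case: hs. Qed.
Let s0 : s 0 = 1%g. Proof. by case: hs. Qed.
Let sS z : W0 z -> SmT s z. Proof. by case: hs => _ _ _ h /h[]. Qed.
Let sO z : W0 z -> over (s z) (par z). Proof. by case: hs => _ _ _ h /h[]. Qed.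

Lemma SmT_section (D : tvsType R) (U : set D) (h : D -> E) y : open U -> U y -> Cinfty U h ->
  W0 (h y) -> SmT (fun d => s (h d)) y.
Proof. by move=> oU Uy Ch Wh; apply: (xt_comp XT oU Uy Ch); exact: sS. Qed.

Lemma SmT_section_fst : SmT (fun p : E * E => s p.1) (0, 0).
Proof. by apply: (@SmT_section _ setT) => //; [exact: openT|apply: Cinfty_lin; exact: clin_fst]. Qed.

Lemma SmT_section_snd : SmT (fun p : E * E => s p.2) (0, 0).
Proof. by apply: (@SmT_section _ setT) => //; [exact: openT|apply: Cinfty_lin; exact: clin_snd]. Qed.

Lemma near_W0 (D : tvsType R) (U : set D) (h : D -> E) y : open U -> U y -> Cinfty U h ->
  W0 (h y) -> \forall d \near y, W0 (h d).
Proof. by move=> oU Uy Ch Wh; apply: (Cinfty_cont Ch Uy); exact: open_near. Qed.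

Lemma near_W0_fst : \forall p \near ((0, 0) : E * E), W0 p.1.
Proof. by apply: (@near_W0 _ setT) => //; [exact: openT|apply: Cinfty_lin; exact: clin_fst]. Qed.

Lemma near_W0_snd : \forall p \near ((0, 0) : E * E), W0 p.2.
Proof. by apply: (@near_W0 _ setT) => //; [exact: openT|apply: Cinfty_lin; exact: clin_snd]. Qed.

Lemma lmul00 : lmul (0, 0) = 0.
Proof. exact: (lmul0r LL (ll_zero LL)). Qed.

Lemma mul_cocycle : exists (c : E * E -> R^o) W, [/\ open W, W (0, 0), Cinfty W c, c (0, 0) = 0 &
  forall p, W p -> (s p.1 * s p.2 = s (lmul p) * ie (c p))%g].
Proof.
have [W [oW Wx CW HW]] := lmul_near LL.
apply: (@ie_diff _ (fun p : E * E => s p.1 * s p.2)%g (fun p => s (lmul p))).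
- by apply: (xt_mul XT); [exact: SmT_section_fst|exact: SmT_section_snd].
- by apply: (SmT_section oW Wx CW); rewrite [X in W0 X]lmul00.
- by rewrite lmul00 /= s0 mulg1.
have nl : \forall p \near ((0, 0) : E * E), W0 (lmul p) by apply: (near_W0 oW Wx CW); rewrite [X in W0 X]lmul00.
near=> p; exists (par p.1 * par p.2)%g.
  apply: (ov_mul XT); apply: sO; near: p; [exact: near_W0_fst|exact: near_W0_snd].
have Wp : W p by near: p; exact: (open_near oW Wx).
by rewrite -(HW p Wp).2; apply: sO; near: p.
Unshelve. all: by end_near. Qed.

Lemma conj_cocycle : exists (k : E * E -> R^o) W, [/\ open W, W (0, 0), Cinfty W k, k (0, 0) = 0 &
  forall p, W p -> (s p.1 * s p.2 * (s p.1)^-1 = s (lconj p) * ie (k p))%g].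
Proof.
have [W [oW Wx CW HW]] := lconj_near LL.
have c0 : lconj (0, 0) = 0 by exact: (lconj0r LL).
apply: (@ie_diff _ (fun p : E * E => s p.1 * s p.2 * (s p.1)^-1)%g (fun p => s (lconj p))).
- apply: (xt_mul XT); last by apply: (xt_inv XT); exact: SmT_section_fst.
  by apply: (xt_mul XT); [exact: SmT_section_fst|exact: SmT_section_snd].
- by apply: (SmT_section oW Wx CW); rewrite [X in W0 X]c0.
- by rewrite c0 /= s0 mulg1 mulgV.
have nl : \forall p \near ((0, 0) : E * E), W0 (lconj p) by apply: (near_W0 oW Wx CW); rewrite [X in W0 X]c0.
near=> p; exists (par p.1 * par p.2 * (par p.1)^-1)%g.
  have W1 : W0 p.1 by near: p; exact: near_W0_fst.
  have W2 : W0 p.2 by near: p; exact: near_W0_snd.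
  apply: (ov_mul XT); last by apply: (ov_inv XT); exact: sO.
  by apply: (ov_mul XT); exact: sO.
have Wp : W p by near: p; exact: (open_near oW Wx).
by rewrite -(HW p Wp).2; apply: sO; near: p.
Unshelve. all: by end_near. Qed.

Lemma act_cocycle a y : admissible E Sm a -> over y a -> exists (k : E -> R^o) W,
  [/\ open W, W 0, Cinfty W k, k 0 = 0 & forall z, W z -> (y * s z * y^-1 = s (lact a z) * ie (k z))%g].
Proof.
move=> sa ya; have [W [oW Wx CW HW]] := lact_near LL sa.
have c0 : lact a 0 = 0 by exact: (lact0 LL).
apply: (@ie_diff _ (fun z => y * s z * y^-1)%g (fun z => s (lact a z))).
- apply: (xt_mul XT); last exact: (xt_cst XT).
  by apply: (xt_mul XT); [exact: (xt_cst XT)|exact: sS].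
- by apply: (SmT_section oW Wx CW); rewrite [X in W0 X]c0.
- by rewrite c0 s0 mulg1 mulgV.
have nl : \forall z \near (0 : E), W0 (lact a z) by apply: (near_W0 oW Wx CW); rewrite [X in W0 X]c0.
near=> z; exists (a * par z * a^-1)%g.
  have W1 : W0 z by near: z; exact: open_near.
  apply: (ov_mul XT); last exact: (ov_inv XT).
  by apply: (ov_mul XT) => //; exact: sO.
have Wz : W z by near: z; exact: (open_near oW Wx).
by rewrite -(HW z Wz).2; apply: sO; near: z.
Unshelve. all: by end_near. Qed.

(** Because [s 0 = 1], the exponent vanishes along both axes near the origin. *)
Lemma mul_cocycle_Df (c : E * E -> R^o) W v : open W -> W (0, 0) -> Cinfty W c -> c (0, 0) = 0 ->
  (forall p, W p -> (s p.1 * s p.2 = s (lmul p) * ie (c p))%g) -> Df c ((0, 0), v) = 0.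
Proof.
move=> oW W00' Cc c0 Hc; case: v => X Y.
have -> : (X, Y) = (X, 0) + (0, Y) :> E * E by rewrite -[RHS]/(X + 0, 0 + Y) addr0 add0r.
rewrite (DfD hR _ _ oW (Cc 1%N) W00').
have key (h : E -> E * E) Z : clin h -> (\forall z \near (0 : E), ie (c (h z)) = ie 0) -> Df c ((0, 0), h Z) = 0.
  move=> ch Hn; have h0 : h 0 = (0, 0) by exact: clin0 ch.
  have W0' : W (h 0) by rewrite h0.
  have dh := hasD_comp hR oW (Cc 1%N) W0' (@hasD_lin R _ _ h 0 Z ch).
  have cch : {for (0 : E), continuous (c \o h)}.
    apply: continuous_comp; first exact: clin_cont.
    by rewrite h0; exact: (Cinfty_cont Cc).
  have n0 : \forall z \near (0 : E), c (h z) = (fun=> 0) z.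
    apply: (@ie_inj_near E (c \o h) (fun=> 0)) => //=; [exact: cvg_cst|by rewrite h0 c0].
  have := hasD_Df hR (hasD_near n0 dh); rewrite (hasD_Df hR (@hasD_cst R _ _ _ _ _)) h0.
  exact: esym.
have cl1 : clin (fun x : E => (x, 0 : E)) by apply: clin_pair; [exact: clin_id|exact: clin_zero].
have cl2 : clin (fun x : E => (0 : E, x)) by apply: clin_pair; [exact: clin_zero|exact: clin_id].
rewrite (key _ X cl1) ?(key _ Y cl2) ?addr0 //.
- have c2 : {for (0 : E), continuous (fun x : E => (0 : E, x))} by exact: clin_cont.
  have nW : \forall z \near (0 : E), W (0, z) by apply: c2; exact: (open_near oW W00').
  near=> z; have Wz : W (0, z) by near: z.
  apply: (mulgI (s (lmul (0, z)))); rewrite -(Hc _ Wz) /= s0 mul1g ie0 mulg1 /lmul /local_mul /=.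
  have Uz : U0 z by near: z; apply: open_near; [exact: (ll_open LL)|exact: (ll_zero LL)].
  by rewrite (ll_par0 LL) mul1g (ll_lgK LL).
- have c1 : {for (0 : E), continuous (fun x : E => (x, 0 : E))} by exact: clin_cont.
  have nW : \forall z \near (0 : E), W (z, 0) by apply: c1; exact: (open_near oW W00').
  near=> z; have Wz : W (z, 0) by near: z.
  apply: (mulgI (s (lmul (z, 0)))); rewrite -(Hc _ Wz) /= s0 mulg1 ie0 mulg1 /lmul.
  have Uz : U0 z by near: z; apply: open_near; [exact: (ll_open LL)|exact: (ll_zero LL)].
  by rewrite (lmul0r LL).
Unshelve. all: by end_near. Qed.

(* Since [s x * s y = s (x y) * ie (c (x, y))], one has
   [c (x, y) = c (x y x^-1, x) + k (x, y)] near the origin. *)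
Lemma conj_cocycle_antisym (k : E * E -> R^o) W X Y : open W -> W (0, 0) -> Cinfty W k -> k (0, 0) = 0 ->
  (forall p, W p -> (s p.1 * s p.2 * (s p.1)^-1 = s (lconj p) * ie (k p))%g) ->
  mix k X Y = - mix k Y X.
Proof.
move=> oW Wx Ck0 k0 Hk; have [c [Q [oQ Qx Cc c0 Hc]]] := mul_cocycle.
have [P [oP Px CP HP]] := lconj_near LL.
have l00 : lconj (0, 0) = 0 by exact: (lconj0r LL).
pose q (p : E * E) := (lconj p, p.1).
have q00 : q (0, 0) = (0, 0) by rewrite /q l00.
have Cq : Cinfty P q by apply: Cinfty_pair => //; apply: Cinfty_lin; exact: clin_fst.
pose P' := (P `&` q @^-1` Q) `&` W.
have oP' : open P' by apply: openI => //; exact: preim_open.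
have P'x : P' (0, 0) by split=> //; split=> //; rewrite /preimage /= q00.
have Ccq : Cinfty P' (c \o q).
  apply: (Cinfty_comp oP' oQ _ _ Cc) => [p [[]]//|].
  by apply: Cinfty_sub Cq => p [[]].
have CkP : Cinfty P' k by apply: Cinfty_sub Ck0 => p [].
have [M [oM Mx CM HM]] := lmul_near LL.
have E1 : \forall p \near ((0, 0) : E * E), c p = c (q p) + k p.
  apply: (@ie_inj_near _ c (fun p => c (q p) + k p)).
  - exact: (Cinfty_cont Cc Qx).
  - have := Cinfty_cont (Cinfty_add oP' Ccq CkP) P'x; exact.
  - by rewrite q00 c0 k0 addr0.
  have nM : \forall p \near ((0, 0) : E * E), M (q p).
    by apply: (Cinfty_cont Cq Px); rewrite q00; exact: (open_near oM Mx).
  near=> p.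
  have Qp : Q p by near: p; exact: (open_near oQ Qx).
  have [[Pp Qqp] Wp] : P' p by near: p; exact: (open_near oP' P'x).
  have Mp : M p by near: p; exact: (open_near oM Mx).
  have Mq : M (q p) by near: p.
  have El : lmul (q p) = lmul p.
    by rewrite /lmul {1}/local_mul /= (HP p Pp).2 mulgVK.
  apply: (mulgI (s (lmul p))); rewrite -(Hc _ Qp) (ie_add XT) -{1}El.
  by rewrite mulgA -(Hc _ Qqp) -ieAC -[s (q p).1]/(s (lconj p)) -(Hk _ Wp) mulgVK.
have := @mix_near R _ _ _ c (fun p => c (q p) + k p) Q P' X Y hE hE hR oQ Qx Cc oP' P'x (Cinfty_add oP' Ccq CkP) E1.
rewrite (mix_add X Y hE hE hR oP' P'x Ccq CkP).
(* The first derivative of [c] at the origin is 0, so the bracket term of [mix_conj_swap] drops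
   out. *)
have -> : mix (c \o q) X Y = mix c Y X.
  have := mix_conj_swap LL X Y hR oQ Qx Cc; rewrite (mul_cocycle_Df _ oQ Qx Cc c0 Hc) addr0; exact.
move=> E2.
have := @mix_near R _ _ _ c (fun p => c (q p) + k p) Q P' Y X hE hE hR oQ Qx Cc oP' P'x (Cinfty_add oP' Ccq CkP) E1.
rewrite (mix_add Y X hE hE hR oP' P'x Ccq CkP).
have -> : mix (c \o q) Y X = mix c X Y.
  have := mix_conj_swap LL Y X hR oQ Qx Cc; rewrite (mul_cocycle_Df _ oQ Qx Cc c0 Hc) addr0; exact.
move: E2; move: (mix c X Y) (mix c Y X) (mix k X Y) (mix k Y X) => a b d e -> E3.
by apply/eqP; rewrite -addr_eq0; apply/eqP; apply: (addrI b); rewrite addr0 addrA -E3.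
Unshelve. all: by end_near. Qed.

(* Conjugate [s z * s w * (s z)^-1] by [y] in two ways. *)
Lemma act_conj_cocycle (k : E * E -> R^o) W a y (l : E -> R^o) Q X Y :
  open W -> W (0, 0) -> Cinfty W k -> k (0, 0) = 0 ->
  (forall p, W p -> (s p.1 * s p.2 * (s p.1)^-1 = s (lconj p) * ie (k p))%g) ->
  admissible E Sm a -> over y a ->
  open Q -> Q 0 -> Cinfty Q l -> l 0 = 0 ->
  (forall z, Q z -> (y * s z * y^-1 = s (lact a z) * ie (l z))%g) ->
  mix k (AdG a X) (AdG a Y) = Df l (0, brk X Y) + mix k X Y.
Proof.
move=> oW Wx Ckk k0 Hk sa ya oQ Q0 Cl l0 Hl.
have [P [oP Px CP HP]] := lconj_near LL.
have [N [oN N0 CN HN]] := lact_near LL sa.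
have l00 : lconj (0, 0) = 0 by exact: (lconj0r LL).
have a0 : lact a 0 = 0 by exact: (lact0 LL).
pose q (p : E * E) := (lact a p.1, lact a p.2).
have q00 : q (0, 0) = (0, 0) by rewrite /q /= a0.
have oNN : open (N `*` N) by exact: open_setX.
have Cq1 : Cinfty (N `*` N) (fun p : E * E => lact a p.1).
  by apply: (Cinfty_comp oNN oN _ _ CN) => [p []//|]; apply: Cinfty_lin; exact: clin_fst.
have Cq2 : Cinfty (N `*` N) (fun p : E * E => lact a p.2).
  by apply: (Cinfty_comp oNN oN _ _ CN) => [p []//|]; apply: Cinfty_lin; exact: clin_snd.
have Cq : Cinfty (N `*` N) q by exact: Cinfty_pair.
pose B := (N `*` N) `&` q @^-1` W.
have oB : open B by exact: preim_open.
have Bx : B (0, 0) by split=> //; rewrite /preimage /= q00.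
have Ckq : Cinfty B (k \o q) by apply: (Cinfty_comp oB oW _ _ Ckk) => [p []//|]; apply: Cinfty_sub Cq => p [].
pose B2 := P `&` lconj @^-1` Q.
have oB2 : open B2 by exact: preim_open.
have B2x : B2 (0, 0) by split=> //; rewrite /preimage /= l00.
have Cll : Cinfty B2 (l \o lconj) by apply: (Cinfty_comp oB2 oQ _ _ Cl) => [p []//|]; apply: Cinfty_sub CP => p [].
pose B3 : set (E * E) := setT `*` Q.
have oB3 : open B3 by apply: open_setX => //; exact: openT.
have B3x : B3 (0, 0) by [].
have Cls : Cinfty B3 (l \o snd) by apply: (Cinfty_comp oB3 oQ _ _ Cl) => [p []//|]; apply: Cinfty_lin; exact: clin_snd.
have oBB : open (B `&` B3) by exact: openI.
have oBW : open (B2 `&` W) by exact: openI.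
have C1 : Cinfty (B `&` B3) (k \o q) by apply: Cinfty_sub Ckq => p [].
have C2 : Cinfty (B `&` B3) (l \o snd) by apply: Cinfty_sub Cls => p [].
have C3 : Cinfty (B2 `&` W) (l \o lconj) by apply: Cinfty_sub Cll => p [].
have C4 : Cinfty (B2 `&` W) k by apply: Cinfty_sub Ckk => p [].
have E1 : \forall p \near ((0, 0) : E * E), (k \o q) p + (l \o snd) p = (l \o lconj) p + k p.
  apply: (@ie_inj_near _ (fun p => (k \o q) p + (l \o snd) p) (fun p => (l \o lconj) p + k p)).
  - exact: (Cinfty_cont (Cinfty_add oBB C1 C2)).
  - exact: (Cinfty_cont (Cinfty_add oBW C3 C4)).
  - by rewrite /= q00 l00 k0 l0.
  have nP : \forall p \near ((0, 0) : E * E), P (q p).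
    by apply: (Cinfty_cont Cq); [split|rewrite q00; exact: (open_near oP Px)].
  have nN : \forall p \near ((0, 0) : E * E), N (lconj p).
    by apply: (Cinfty_cont CP Px); rewrite [X in nbhs X]l00; exact: (open_near oN N0).
  near=> p.
  have [[[N1 N2] Wq] [_ Q2]] : (B `&` B3) p by near: p; apply: (open_near oBB); split.
  have [[Pp Qlp] Wp] : (B2 `&` W) p by near: p; apply: (open_near oBW); split.
  have Pq : P (q p) by near: p.
  have Nl : N (lconj p) by near: p.
  have Q1 : Q p.1.
    by near: p; apply: (clin_cont (@clin_fst R E E)); exact: (open_near oQ Q0).
  have El : lconj (q p) = lact a (lconj p).
    have -> : lact a (lconj p) = lg (a * (par p.1 * par p.2 * (par p.1)^-1) * a^-1)%g by rewrite -(HP p Pp).2.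
    have -> : lconj (q p) = lg ((a * par p.1 * a^-1) * (a * par p.2 * a^-1) * (a * par p.1 * a^-1)^-1)%g.
      by rewrite -(HN _ N1).2 -(HN _ N2).2.
    by rewrite !invgM invgK !mulgA !mulgVK.
  apply: (mulgI (s (lact a (lconj p)))).
  apply: (conj_exponents (Hl _ Q1) (Hl _ Q2) (Hl _ Qlp) _ (Hk _ Wp)).
  by rewrite -El -(Hk _ Wq).
have := @mix_near R _ _ _ _ _ _ _ X Y hE hE hR oBB (conj Bx B3x) (Cinfty_add oBB C1 C2) oBW (conj B2x Wx) (Cinfty_add oBW C3 C4) E1.
rewrite (mix_add X Y hE hE hR oBB (conj Bx B3x) C1 C2) (mix_add X Y hE hE hR oBW (conj B2x Wx) C3 C4).
have hEE := hausdorff_prod hE hE.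
have hasAd Z : hasD (lact a) 0 Z (AdG a Z) by exact: (Cinfty_hasD hE oN CN).
have dq X' Y' : Df q ((0, 0), (X', Y')) = (AdG a X', AdG a Y').
  have d1 : hasD (fun p : E * E => p.1) (0, 0) (X', Y') X' by exact: hasD_lin (@clin_fst R E E).
  have d2 : hasD (fun p : E * E => p.2) (0, 0) (X', Y') Y' by exact: hasD_lin (@clin_snd R E E).
  apply: (hasD_Df hEE); apply: hasD_pair.
    exact: (hasD_comp hE oN (CN 1%N) (N0 : N ((0, 0) : E * E).1) d1).
  exact: (hasD_comp hE oN (CN 1%N) (N0 : N ((0, 0) : E * E).2) d2).
have Ad0 : AdG a 0 = 0 by exact: clin0 (clin_AdG LL sa).
have mq : mix q X Y = (0, 0).
  rewrite /q (mix_pair X Y hE hE hE hE oNN (conj N0 N0) Cq1 Cq2).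
  by rewrite (mix_fst X Y hE hE hE oN N0 CN) (mix_snd X Y hE hE hE oN N0 CN).
have -> : mix (k \o q) X Y = mix k (AdG a X) (AdG a Y).
  have Wq0 : W (q (0, 0)) by rewrite q00.
  rewrite (mix_comp X Y hE hE hEE hR oNN (conj N0 N0) Cq oW Wq0 Ckk) !dq mq q00 Ad0.
  exact: (etrans (congr2 +%R erefl (Df0 hR oW (Ckk 1%N) Wx)) (addr0 _)).
have -> : mix (l \o snd) X Y = 0 by exact: (mix_snd X Y hE hE hR oQ Q0 Cl).
have -> : mix (l \o lconj) X Y = Df l (0, brk X Y).
  have Ql0 : Q (lconj (0, 0)) by rewrite l00.
  rewrite (mix_comp X Y hE hE hE hR oP Px CP oQ Ql0 Cl) (l00 : local_conj par lg (0, 0) = 0) (Df_lconjl LL X).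
  exact: (etrans (congr2 +%R (Df2_0 _ hR oQ Q0 Cl) erefl) (add0r _)).
by rewrite addr0.
Unshelve. all: by end_near. Qed.

Lemma AdG1 X : AdG 1%g X = X.
Proof.
rewrite /AdG /local_Ad (@Df_near _ _ _ _ id); first exact: (Df_lin _ _ hE (@clin_id R E)).
apply: (filterS _ (open_near (ll_open LL) (ll_zero LL))) => z Uz.
by rewrite /local_act mul1g invg1 mulg1 (ll_lgK LL).
Qed.

(** The derivative at [z = 0] of [act_conj_cocycle] for conjugation by [s z], whose exponent is
    [w |-> k (z, w)]. *)
Lemma conj_cocycle_lie (k : E * E -> R^o) W X Y Z :
  open W -> W (0, 0) -> Cinfty W k -> k (0, 0) = 0 ->
  (forall p, W p -> (s p.1 * s p.2 * (s p.1)^-1 = s (lconj p) * ie (k p))%g) ->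
  mix k (brk Z X) Y + mix k X (brk Z Y) = mix k Z (brk X Y).
Proof.
move=> oW Wx Ckk k0 Hk.
have sp := ll_par LL (ll_zero LL).
have dA T := @hasD_AdG _ _ _ _ _ _ _ LL _ par 0 Z T sp (ll_par0 LL).
have dB := hasD_bil hR (cbil_mix hR oW Wx Ckk) (dA X) (dA Y).
rewrite !(Df_lg_par LL) (ll_par0 LL) -/AdG !AdG1 in dB.
have c1 : clin (fun x : E => (x, 0 : E)) by apply: clin_pair; [exact: clin_id|exact: clin_zero].
have oS : open [set u : E | W (u, 0)].
  have := preim_open openT oW (Cinfty_lin setT c1); by rewrite setTI.
have CS := Cinfty_slice hR oW Ckk (brk X Y).
have dS := Cinfty_hasD (v := Z) hR oS CS (Wx : [set u : E | W (u, 0)] 0).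
rewrite -(mixE _ _ hE hE hR oW Wx Ckk) in dS.
have {}dS := hasD_sum hR dS (@hasD_cst R _ R^o (mix k X Y) 0 Z).
rewrite addr0 in dS.
apply: etrans (esym (hasD_Df hR dB)) _; apply: etrans _ (hasD_Df hR dS).
apply: Df_near.
(* Conjugation fixes [s 0 = 1]. This is the normalisation that [act_conj_cocycle] asks of its
   exponent. *)
have n0 : \forall z \near (0 : E), k (z, 0) = 0.
  have ck : {for (0 : E), continuous (fun z : E => k (z, 0))}.
    by apply: (@continuous_comp _ _ _ (fun z : E => (z, 0 : E)) k); [exact: clin_cont|exact: (Cinfty_cont Ckk)].
  apply: (@ie_inj_near E (fun z => k (z, 0)) (fun=> 0)) => //; first exact: cvg_cst.
  near=> z; have Wz : W (z, 0) by near: z; exact: (open_near oS).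
  apply: (mulgI (s (lconj (z, 0)))); rewrite -(Hk _ Wz) /= s0 mulg1 mulgV ie0 mulg1.
  by rewrite /lconj (lconj0r LL) s0.
near=> z.
have Uz : U0 z by near: z; exact: (open_near (ll_open LL) (ll_zero LL)).
have Wz0 : W0 z by near: z; exact: (open_near oW0 W00).
have Wz : W (z, 0) by near: z; exact: (open_near oS).
have c2 : Cinfty setT (fun w : E => (z, w)).
  by apply: Cinfty_pair; [exact: Cinfty_cst|apply: Cinfty_lin; exact: clin_id].
have oQ : open [set w : E | W (z, w)] by have := preim_open openT oW c2; rewrite setTI.
have Cl : Cinfty [set w : E | W (z, w)] (fun w => k (z, w)).
  by apply: (@Cinfty_comp _ _ _ _ _ W (fun w : E => (z, w)) k) => //; apply: Cinfty_sub c2.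
have kz0 : k (z, 0) = 0 by near: z; exact: n0.
have Hl w : [set w : E | W (z, w)] w -> (s z * s w * (s z)^-1 = s (lact (par z) w) * ie (k (z, w)))%g.
  by move=> Ww; have := Hk _ Ww.
have := act_conj_cocycle X Y oW Wx Ckk k0 Hk (admissible_par LL Uz) (sO Wz0) oQ Wz Cl kz0 Hl.
rewrite /= => ->; congr (_ + _).
have dz : hasD (fun u : E => (z, u)) 0 (brk X Y) (0, brk X Y).
  by apply: hasD_pair; [exact: hasD_cst|exact: hasD_lin (@clin_id R E)].
exact: hasD_Df (hasD_comp hR oW (Ckk 1%N) (Wz : W ((fun u : E => (z, u)) 0)) dz).
Unshelve. all: by end_near. Qed.

(** To first order conjugation carries the section to itself: its tangent space at the identity is a
    complement to the U(1)-direction stable under conjugation. This is what makes horizontality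
    compatible with products. *)
Definition invariant_section (s : E -> Ht) := forall a y, admissible E Sm a -> over y a ->
  exists (l : E -> R^o) Q, [/\ [/\ open Q, Q 0, Cinfty Q l & l 0 = 0], forall X, Df l (0, X) = 0 &
    forall z, Q z -> (y * s z * y^-1 = s (lact a z) * ie (l z))%g].

Hypothesis H2 : forall w : E * E -> R^o, cbil w ->
  (forall Y Z, w (Y, Z) = - w (Z, Y)) ->
  (forall Y Z W, w (brk Y Z, W) + w (brk Z W, Y) + w (brk W Y, Z) = 0) ->
  exists mu : E -> R^o, clin mu /\ forall Y Z, w (Y, Z) = mu (brk Y Z).
Hypothesis dense_brk : forall L : E -> R^o, clin L -> (forall Y Z, L (brk Y Z) = 0) -> forall Y, L Y = 0.

(* The Lie algebra cocycle [mix k] is of the form [mu [ , ]]. After twisting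
   [s] by [mu], the first-order defect of equivariance vanishes on brackets. *)
Lemma invariant_section_ex : exists s, section_at s W0 /\ invariant_section s.
Proof.
have [k [W [oW Wx Ckk k0 Hk]]] := conj_cocycle.
have bw := cbil_mix hR oW Wx Ckk.
have wC X Y := conj_cocycle_antisym X Y oW Wx Ckk k0 Hk.
have [mu [cmu muE]] : exists mu : E -> R^o, clin mu /\ forall Y Z, mix k Y Z = mu (brk Y Z).
  apply: (H2 bw) => [X Y|X Y Z] /=; first exact: wC.
  have := conj_cocycle_lie Y Z X oW Wx Ckk k0 Hk.
  have E1 := wC (brk Y Z) X.
  have hZX : brk Z X = - brk X Z := brkC LL Z X.
  have hN : mix k Y (- brk X Z) = - mix k Y (brk X Z) := clinN _ (cbil_clinr Y bw).
  have E2 : mix k (brk Z X) Y = mix k Y (brk X Z).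
    exact: (etrans (wC _ _) (etrans (congr1 -%R (etrans (congr1 (mix k Y) hZX) hN)) (opprK _))).
  have alg (a b d e f : R) : e = - d -> f = b -> a + b = d -> a + e + f = 0.
    by move=> -> -> <-; rewrite addrAC subrr.
  exact: (alg _ _ _ _ _ E1 E2).
exists (fun z => s z * ie (mu z))%g; split.
  split=> //; first by rewrite s0 (clin0 cmu) ie0 mulg1.
  move=> z Wz; split.
    apply: (xt_mul XT); first exact: sS.
    by apply: (xt_comp XT (U := setT)) => //; [exact: openT|exact: Cinfty_lin|exact: (xt_ie XT)].
  by rewrite -[par z]mulg1; apply: (ov_mul XT); [exact: sO|exact: (ov_ie XT)].
move=> a y sa ya; have [l [Q [oQ Q0 Cl l0 Hl]]] := act_cocycle sa ya.
have [N [oN N0 CN HN]] := lact_near LL sa.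
have oB : open (Q `&` N) by exact: openI.
have a0 : lact a 0 = 0 by exact: (lact0 LL).
exists (fun z => l z + (mu z - mu (lact a z))), (Q `&` N); split.
- split=> //; last by rewrite a0 l0 subrr addr0.
  apply: Cinfty_add => //; first by apply: Cinfty_sub Cl => z [].
  apply: Cinfty_add => //; first exact: Cinfty_lin.
  apply: Cinfty_opp => //; apply: (Cinfty_comp oB openT _ _ (Cinfty_lin setT cmu)) => //.
  by apply: Cinfty_sub CN => z [].
- have cA := clin_AdG LL sa.
  have dl X : hasD l 0 X (Df l (0, X)) by exact: (Cinfty_hasD hR oQ Cl).
  have dm X : hasD (fun z => mu z - mu (lact a z)) 0 X (mu X - mu (AdG a X)).
    apply: (hasD_sum hR); first exact: hasD_lin.
    have cm : clin (fun z => - mu z).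
      have := clin_scal (-1) cmu; rewrite (_ : (fun x => -1 *: mu x) = (fun z => - mu z)) //.
      by apply/funext => z; rewrite scaleN1r.
    have da : hasD (lact a) 0 X (AdG a X) by exact: (Cinfty_hasD hE oN CN).
    have := hasD_comp hR openT (Cinfty_lin setT cm 1%N) (I : setT (lact a 0)) da.
    by rewrite (Df_lin _ _ hR cm).
  have dd X := hasD_Df hR (hasD_sum hR (dl X) (dm X)).
  move=> X; rewrite dd; move: X; apply: dense_brk.
    have cl : clin (fun X => Df l (0, X)) by exact: (Df_clin hR oQ (Cl 1%N) Q0).
    apply: clin_sum => //; apply: clin_sum => //.
    have := clin_scal (-1) (clin_comp cA cmu); rewrite (_ : (fun x => -1 *: _) = (fun z => - mu (AdG a z))) //.
    by apply/funext => z; rewrite scaleN1r.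
  move=> X Y; have := act_conj_cocycle X Y oW Wx Ckk k0 Hk sa ya oQ Q0 Cl l0 Hl.
  have Eb : brk (AdG a X) (AdG a Y) = AdG a (brk X Y) := esym (AdG_brk LL X Y sa).
  rewrite !muE => E1; have alg (a1 b d : R) : a1 = b + d -> b + (d - a1) = 0 by move=> ->; rewrite addrA subrr.
  exact: alg (etrans (congr1 mu (esym Eb)) E1).
- move=> z [Qz _]; rewrite (mulgA y) (ieAC (y * s z)%g) (Hl z Qz) -!mulgA -!(ie_add XT); congr (_ * ie _)%g.
  by rewrite addrCA [mu (lact a z) + _]addrC subrK.
Qed.

End GivenSection.
End LocalExtension.

(** Since [f] vanishes for [x < 0], the integral may start at -1 and still have the value 0 at 0;
    then 0 is an interior point and the derivative there is two-sided. *)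
Lemma continuous_primitive (R : realType) (f : R -> R) : continuous f -> (forall x, x < 0 -> f x = 0) ->
  exists F : R^o -> R^o, F 0 = 0 /\ forall x : R^o, hasD F x (1 : R^o) (f x).
Proof.
move=> cf f0; pose F (x : R) : R := (\int[lebesgue_measure]_(t in [set` `[(-1)%R, x]]) (f t))%R.
have F0 x : x <= 0 -> F x = 0.
  move=> x0; rewrite /F /Rintegral (_ : (\int[_]_(t in _) _ = 0)%E) //.
  apply: integral0_eq => t /=; rewrite in_itv /= => /andP[_ tx].
  have := le_trans tx x0; rewrite le_eqVlt => /orP[/eqP->|/f0 ->//].
  have c0 : f t @[t --> 0^'-] --> f 0 by apply: cvg_at_left_filter; exact: cf.
  have c1 : f t @[t --> 0^'-] --> (0 : R).
    by apply: cvg_near_cst; near=> t'; rewrite f0 //; near: t'; exact: nbhs_left_lt.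
  by congr EFin; exact: (cvg_unique (@Rhausdorff R) c0 c1).
exists F; split=> [|x]; first exact: F0.
have [x0|x0] := ltP x 0.
  rewrite f0 //; apply: (@hasD_near _ _ _ (fun=> 0)); last exact: hasD_cst.
  near=> y; apply/esym/F0/ltW; near: y; exact: lt_nbhsl.
have xu : x < x + 1 by rewrite ltrDl.
have [||dF <-] := @continuous_FTC1_closed R f (-1) x (x + 1) xu _ _ (cf x).
- apply: continuous_compact_integrable; first exact: segment_compact.
  by apply: continuous_subspaceT => y; exact: cf.
- by rewrite (lt_le_trans _ x0) // ltrN10.
exact: derivable_hasD1.
Unshelve. all: by end_near. Qed.

Lemma hasD_le (R : realType) (F : R^o -> R^o) (f : R -> R) c : (forall x : R^o, hasD F x (1 : R^o) (f x)) ->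
  F 0 = 0 -> (forall x, 0 <= x <= 1 -> `|f x| <= c) -> `|F 1 : R| <= c.
Proof.
move=> dF F0 fc.
have idF x : is_derive (x : R) (1 : R) (F : R -> R) (f x).
  by have [d1 d2] := hasD_derivable (dF x); apply: DeriveDef => //; rewrite -d2 derive1E.
have [x /[!in_itv] /= /andP[x0 x1]] := @MVT R F f 0 1 ltr01 (fun x _ => idF x)
  (derivable_within_continuous (fun x _ => @ex_derive _ _ _ _ _ _ _ (idF x))).
by rewrite F0 !subr0 mulr1 => ->; apply: fc; rewrite !ltW.
Qed.

Lemma hasD_uniq (R : realType) (E F : tvsType R) (f : E -> F) x v a b : hausdorff_space F ->
  hasD f x v a -> hasD f x v b -> a = b.
Proof. by move=> hF da db; rewrite -(hasD_Df hF da) -(hasD_Df hF db). Qed.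

Lemma clin_opp (R : realType) (E F : tvsType R) (L : E -> F) : clin L -> clin (fun x => - L x).
Proof.
move=> cL; have := clin_scal (-1) cL; rewrite (_ : (fun x => -1 *: L x) = (fun x => - L x)) //.
by apply/funext => z; rewrite scaleN1r.
Qed.

Lemma hasD_opp (R : realType) (E F : tvsType R) (f : E -> F) x v a : hausdorff_space F ->
  hasD f x v a -> hasD (fun y => - f y) x v (- a).
Proof.
move=> hF df; have cN := clin_opp (@clin_id R F).
by have := hasD_comp hF openT (Cinfty_lin setT cN 1%N) (I : setT (f x)) df; rewrite (Df_lin _ _ hF cN).
Qed.

(** * Horizontal lifts along a contraction *)

Section Contraction.
Context {R : realType}.
Variables (E : tvsType R) (H : groupType).
Variable Sm : forall D : tvsType R, (D -> H) -> D -> Prop.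
Variables (U0 : set E) (par : E -> H) (lg : H -> E).
Variables (S : R -> H -> H) (Sv : R -> E -> E).
Local Notation adm := (admissible E Sm).

(** Endomorphisms joining the trivial one at [r = 0] to the identity at [r = 1]. In the chart they
    are constant for [r <= 4^-1], where [repar] has not yet started to move, and for [r >= 1]; hence
    [r] may range over the whole line. *)
Record contraction : Prop := Contraction {
  ct_mul : forall r a b, adm a -> adm b -> S r (a * b)%g = (S r a * S r b)%g;
  ct_sm : forall a (r : R^o), adm a -> Sm (fun r : R^o => S r a) r;
  ct_0 : forall a, adm a -> S 0 a = 1%g;
  ct_1 : forall a, adm a -> S 1 a = a;
  ct_dom : forall r z, U0 z -> U0 (Sv r z);
  ct_par : forall r z, U0 z -> S r (par z) = par (Sv r z);
  ct_lin : forall r, clin (Sv r);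
  ct_Cinfty : Cinfty setT (fun p : R^o * E => Sv p.1 p.2);
  ct_out0 : forall r z, r <= 4^-1 -> Sv r z = 0;
  ct_out1 : forall r z, 1 <= r -> Sv r z = z
}.
End Contraction.

Section HorizontalLifts.
Context {R : realType}.
Variables (E : tvsType R) (H : groupType).
Variable Sm : forall D : tvsType R, (D -> H) -> D -> Prop.
Variables (U0 : set E) (par : E -> H) (lg : H -> E).
Variables (Ht : groupType) (SmT : forall D : tvsType R, (D -> Ht) -> D -> Prop).
Variables (ie : R -> Ht) (over : Ht -> H -> Prop).
Hypothesis LL : local_lie Sm U0 par lg.
Hypothesis XT : local_ext Sm par SmT ie over.
Variables (S : R -> H -> H) (Sv : R -> E -> E).
Hypothesis CT : contraction Sm U0 par S Sv.
Variables (s : E -> Ht) (W0 : set E).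
Hypothesis hs : section_at par SmT over s W0.
Hypothesis hI : invariant_section Sm par lg ie over s.
Let hE := ll_hausdorff LL.
Let hR : hausdorff_space R^o := @hausdorff_normed R R^o.
Let lmul := local_mul par lg.
Let lact := local_act par lg.
Let oW0 : open W0. Proof. by case: hs. Qed.
Let W00 : W0 0. Proof. by case: hs. Qed.
Let s0 : s 0 = 1%g. Proof. by case: hs. Qed.
Let sS z : W0 z -> SmT s z. Proof. by case: hs => _ _ _ h /h[]. Qed.
Let sO z : W0 z -> over (s z) (par z). Proof. by case: hs => _ _ _ h /h[]. Qed.
Local Notation adm := (admissible E Sm).

(* Horizontal for the connection in which [r |-> s (lg (g r0^-1 * g r))] has
   zero velocity at [r0]. *)
Definition horizontal (y : R -> Ht) (g : R -> H) (r0 : R) := exists u : R^o -> R^o,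
  [/\ u r0 = 0, hasD u r0 (1 : R^o) 0 &
    \forall r \near (r0 : R^o), y r = (y r0 * s (lg ((g r0)^-1 * g r)) * ie (u r))%g].

Definition hlift (a : H) (y : R -> Ht) := [/\ y 0 = 1%g, forall r, over (y r) (S r a) &
  forall r, horizontal y (S^~ a) r].

Lemma adm_of_Sm (D : tvsType R) (f : D -> H) x : Sm f x -> adm (f x).
Proof.
move=> sf; apply: (ll_comp LL (f := f) (U := setT) (h := fun=> x)) => //; first exact: openT.
exact: Cinfty_cst.
Qed.

Lemma adm_cst (D : tvsType R) a (x : D) : adm a -> Sm (fun _ : D => a) x.
Proof. by move=> sa; exact: (Sm_cst LL _ sa). Qed.

Lemma adm_mul a b : adm a -> adm b -> adm (a * b)%g.
Proof. exact: (ll_mul LL). Qed.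

Lemma adm_inv a : adm a -> adm a^-1%g.
Proof. exact: (ll_inv LL). Qed.

Lemma adm_S r a : adm a -> adm (S r a).
Proof. by move=> sa; exact: (adm_of_Sm (ct_sm CT r sa)). Qed.

Lemma adm1 : adm 1%g.
Proof. by rewrite -(ll_par0 LL); exact: (admissible_par LL (ll_zero LL)). Qed.

Lemma ct_log a (r0 : R^o) : adm a -> exists W,
  [/\ open W, W r0, Cinfty W (fun r : R^o => lg ((S r0 a)^-1 * S r a)%g) &
    forall r, W r -> U0 (lg ((S r0 a)^-1 * S r a)%g) /\ par (lg ((S r0 a)^-1 * S r a)%g) = ((S r0 a)^-1 * S r a)%g].
Proof.
move=> sa; apply: (ll_lg LL (f := fun r : R^o => ((S r0 a)^-1 * S r a)%g)); last by rewrite mulVg.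
by apply: (ll_mul LL); [apply/adm_cst/adm_inv/adm_S|exact: (ct_sm CT)].
Qed.

(** The exponent [th] of the quotient of the lifts is chosen pointwise and may jump by periods;
    [ie_const] only asks that, near each point, its increments agree modulo periods with a function
    of derivative 0. *)
Lemma hlift_unique a y y' : adm a -> hlift a y -> hlift a y' -> y 1 = y' 1.
Proof.
move=> sa [y0 oy hy] [y0' oy' hy'].
have [th Hth] := choice (fun r => ov_fib XT (oy r) (oy' r)).
have E1 : ie (th 1) = ie (th 0).
  apply: (ie_const XT) => r.
  have [u [u0 du nu]] := hy r; have [u' [u0' du' nu']] := hy' r.
  exists (fun h => u' h - u h); split.
  - by rewrite u0 u0' subrr.
  - have dn : hasD (fun h => - u h) r (1 : R^o) 0.
      have cN : clin (fun z : R^o => - z).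
        have := clin_scal (-1) (@clin_id R R^o); rewrite (_ : (fun x => -1 *: x) = (fun z => - z)) //.
        by apply/funext => z; rewrite scaleN1r.
      have := hasD_comp hR openT (Cinfty_lin setT cN 1%N) (I : setT (u r)) du.
      by rewrite (Df_lin _ _ hR cN) oppr0.
    have := hasD_sum hR du' dn; rewrite addr0 => dd.
    by have [d1 d2] := hasD_derivable dd; apply: DeriveDef => //; rewrite -derive1E.
  near=> h.
  have Eh : y h = (y r * s (lg ((S r a)^-1 * S h a)) * ie (u h))%g by near: h; exact: nu.
  have Eh' : y' h = (y' r * s (lg ((S r a)^-1 * S h a)) * ie (u' h))%g by near: h; exact: nu'.
  move: Eh'; rewrite (Hth h) (Hth r) Eh (ieAC XT) => E2.
  rewrite !(ie_add XT) (ieN XT).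
  apply: (mulgI (y r * s (lg ((S r a)^-1 * S h a)))%g); apply: (mulIg (ie (u h))).
  by rewrite E2 !mulgA mulgVK (ieAC XT (y r)).
by rewrite (Hth 1) E1; move: (Hth 0); rewrite y0 y0' mul1g => <-; rewrite mulg1.
Unshelve. all: by end_near. Qed.

Lemma mul_exponents (y z t1 t2 t3 t4 : Ht) l c u v :
  (z^-1 * t1 * z = t3 * ie l)%g -> (t3 * t2 = t4 * ie c)%g ->
  (y * t1 * ie u * (z * t2 * ie v) = y * z * t4 * (ie c * (ie l * (ie u * ie v))))%g.
Proof.
move=> El Ec; have E1 : (t1 * z = z * t3 * ie l)%g by rewrite -mulgA -El !mulgA mulgV mul1g.
rewrite (ieAC XT (y * t1)%g) !mulgA -(mulgA y) E1 !mulgA (ieAC XT (y * z * t3)%g) -(mulgA (y * z)%g t3) Ec.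
by rewrite -!mulgA (ie_central XT v (ie u)).
Qed.

(** Bringing the product into the form of a lift costs two exponents. Moving [s (eta r')] past [z r]
    gives [l], whose differential vanishes by invariance of [s]; multiplying the two values of the
    section gives [c], whose differential vanishes at the origin. *)
Lemma hlift_mul a b y z : adm a -> adm b -> hlift a y -> hlift b z -> hlift (a * b)%g (fun r => y r * z r)%g.
Proof.
move=> sa sb [y0 oy hy] [z0 oz hz]; split.
- by rewrite y0 z0 mulg1.
- by move=> r; rewrite (ct_mul CT) //; exact: (ov_mul XT).
move=> r.
have [u [u0 du nu]] := hy r; have [v [v0 dv nv]] := hz r.
have [W [oW Wr CW HW]] := ct_log r sa; have [Q [oQ Qr CQ HQ]] := ct_log r sb.
set eta := (fun r' : R^o => lg ((S r a)^-1 * S r' a)%g) in CW HW.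
set zeta := (fun r' : R^o => lg ((S r b)^-1 * S r' b)%g) in CQ HQ.
have eta0 : eta r = 0 by rewrite /eta mulVg (lg1 LL).
have zeta0 : zeta r = 0 by rewrite /zeta mulVg (lg1 LL).
have sbi : adm (S r b)^-1%g by exact/adm_inv/adm_S.
have [l [P [[oP P0 Cl l0] Dl Hl]]] := hI sbi (ov_inv XT (oz r)).
have [N [oN N0 CN HN]] := lact_near LL sbi.
have [c [M [oM M0 Cc c0 Hc]]] := mul_cocycle LL XT hs.
have a0 : lact (S r b)^-1%g 0 = 0 by exact: (lact0 LL).
pose q (r' : R^o) : E * E := (lact (S r b)^-1%g (eta r'), zeta r').
have q0 : q r = (0, 0) by rewrite /q eta0 zeta0 a0.
have dq : exists v, hasD q r (1 : R^o) v.
  exists (Df (lact (S r b)^-1%g) (eta r, Df eta (r, (1 : R^o))), Df zeta (r, (1 : R^o))).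
  apply: hasD_pair; last exact: (Cinfty_hasD hE oQ CQ).
  apply: (hasD_comp hE oN (CN 1%N)); first by rewrite [X in N X]eta0.
  exact: (Cinfty_hasD hE oW CW).
have [w dqw] := dq.
exists (fun r' => c (q r') + (l (eta r') + (u r' + v r'))); split.
- by rewrite q0 c0 eta0 l0 u0 v0 !addr0.
- rewrite -[X in hasD _ _ _ X]addr0 -{2}[0]addr0 -{3}[0]addr0.
  apply: (hasD_sum hR).
    have := hasD_comp hR oM (Cc 1%N) (_ : M (q r)) dqw; rewrite q0 => /(_ M0).
    by rewrite (mul_cocycle_Df LL XT hs w oM M0 Cc c0 Hc).
  apply: (hasD_sum hR); last exact: (hasD_sum hR).
  have Pe : P (eta r) by rewrite eta0.
  have Hd := hasD_comp hR oP (Cl 1%N) Pe (Cinfty_hasD (v := 1 : R^o) hE oW CW Wr).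
  have Ez : Df l (eta r, Df eta (r, (1 : R^o))) = 0 by rewrite eta0 Dl.
  by rewrite Ez in Hd.
have ceta : {for r, continuous eta} by exact: (Cinfty_cont CW).
have czeta : {for r, continuous zeta} by exact: (Cinfty_cont CQ).
have nP : \forall r' \near (r : R^o), P (eta r').
  by apply: ceta; rewrite eta0; exact: (open_near oP P0).
have nN : \forall r' \near (r : R^o), N (eta r').
  by apply: ceta; rewrite eta0; exact: (open_near oN N0).
have cq : {for r, continuous q}.
  apply: cts_pair => //; apply: continuous_comp => //.
  by apply: (Cinfty_cont CN); rewrite eta0.
have nM : \forall r' \near (r : R^o), M (q r').
  by apply: cq; rewrite q0; exact: (open_near oM M0).
near=> r'.
have Wr' : W r' by near: r'; exact: (open_near oW Wr).
have Qr' : Q r' by near: r'; exact: (open_near oQ Qr).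
have Pr' : P (eta r') by near: r'.
have Nr' : N (eta r') by near: r'.
have Mr' : M (q r') by near: r'.
have Ey : y r' = (y r * s (eta r') * ie (u r'))%g by near: r'; exact: nu.
have Ez : z r' = (z r * s (zeta r') * ie (v r'))%g by near: r'; exact: nv.
have -> : lg ((S r (a * b))^-1 * S r' (a * b))%g = lmul (q r').
  rewrite /lmul /local_mul /= (HN _ Nr').2 (HW _ Wr').2 (HQ _ Qr').2 !(ct_mul CT) // invgM invgK.
  by rewrite !mulgA mulgK.
have := Hl _ Pr'; rewrite invgK => El; have := Hc _ Mr' => /= Ec.
rewrite Ey Ez !(ie_add XT); exact: mul_exponents El Ec.
Unshelve. all: by end_near. Qed.

Lemma hlift1 : hlift 1%g (fun=> 1%g).
Proof.
have S1 r : S r 1%g = 1%g.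
  by apply: (mulgI (S r 1%g)); rewrite mulg1 -(ct_mul CT r adm1 adm1) mulg1.
split=> // r; first by rewrite S1 -(ie0 XT); exact: (ov_ie XT).
exists (fun=> 0); split=> //; first exact: hasD_cst.
by near=> h; rewrite !S1 mulVg (lg1 LL) s0 (ie0 XT) !mulg1.
Unshelve. all: by end_near. Qed.

(** The quotient of [i] and [j] is central, hence insensitive to conjugation; so the differential of
    its exponent [u] is invariant under [Ad], and differentiating this in the group variable shows
    that it kills brackets. *)
Lemma ext_hom_unique (i j : H -> Ht) :
  (forall L : E -> R^o, clin L -> (forall Y Z, L (local_brk par lg Y Z) = 0) -> forall Y, L Y = 0) ->
  (forall a b, adm a -> adm b -> i (a * b)%g = (i a * i b)%g) ->
  (forall a b, adm a -> adm b -> j (a * b)%g = (j a * j b)%g) ->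
  (forall a, adm a -> over (i a) a) -> (forall a, adm a -> over (j a) a) ->
  SmT (fun z => i (par z)) 0 -> SmT (fun z => j (par z)) 0 ->
  forall a, adm a -> i a = j a.
Proof.
move=> dense iM jM oi oj si sj.
have i1 : i 1%g = 1%g by apply: (mulgI (i 1%g)); rewrite mulg1 -(iM _ _ adm1 adm1) mulg1.
have j1 : j 1%g = 1%g by apply: (mulgI (j 1%g)); rewrite mulg1 -(jM _ _ adm1 adm1) mulg1.
have oU := ll_open LL; have U00 := ll_zero LL.
have [u [W [oW Wz Cu u0 Hu]]] : exists (u : E -> R^o) W, [/\ open W, W 0, Cinfty W u, u 0 = 0 &
    forall z, W z -> i (par z) = (j (par z) * ie (u z))%g].
  apply: (ie_diff XT) => //; first by rewrite (ll_par0 LL) i1 j1.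
  near=> z; have Uz : U0 z by near: z; exact: (open_near oU U00).
  by exists (par z); [apply: oi|apply: oj]; exact: (admissible_par LL).
have cL : clin (fun X => Df u (0, X)) by exact: (Df_clin hR oW (Cu 1%N) Wz).
have inv a X : adm a -> Df u (0, local_Ad par lg a X) = Df u (0, X).
  move=> sa; have [N [oN N0 CN HN]] := lact_near LL sa.
  have a0 : lact a 0 = 0 by exact: (lact0 LL).
  have W0' : W (lact a 0) by rewrite a0.
  have da : hasD (lact a) 0 X (local_Ad par lg a X) by exact: (Cinfty_hasD hE oN CN).
  have := hasD_Df hR (hasD_comp hR oW (Cu 1%N) W0' da); rewrite a0 => <-.
  apply: Df_near.
  have ca : {for (0 : E), continuous (lact a)} by exact: (Cinfty_cont CN).
  have nW : \forall z \near (0 : E), W (lact a z) by apply: ca; rewrite a0; exact: (open_near oW Wz).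
  apply: (@ie_inj_near _ _ _ Sm par Ht SmT ie over XT E (fun z => u (lact a z)) u).
  - by apply: (@continuous_comp _ _ _ (lact a) u) => //; apply: (Cinfty_cont Cu).
  - exact: (Cinfty_cont Cu).
  - by rewrite a0.
  near=> z.
  have Wlz : W (lact a z) by near: z.
  have Wzz : W z by near: z; exact: (open_near oW Wz).
  have Nz : N z by near: z; exact: (open_near oN N0).
  have Uz : U0 z by near: z; exact: (open_near oU U00).
  have az := admissible_par LL Uz; have ai := adm_inv sa; have aaz := adm_mul sa az.
  have [t Ht'] := ov_fib XT (oj _ sa) (oi _ sa).
  have [t' Ht''] := ov_fib XT (oj _ ai) (oi _ ai).
  have tt : ie t' = (ie t)^-1%g.
    apply: (mulIg (ie t)); rewrite mulVg; apply: (mulgI (j a^-1%g * j a)%g).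
    rewrite mulg1 -{2}(jM _ _ ai sa) mulVg j1.
    by rewrite mulgA -(ieAC XT (j a^-1%g) (j a)) -Ht'' -mulgA -Ht' -(iM _ _ ai sa) mulVg i1.
  have := Hu _ Wlz; rewrite /lact (HN _ Nz).2.
  rewrite (iM _ _ aaz ai) (iM _ _ sa az) (jM _ _ aaz ai) (jM _ _ sa az) Ht' Ht'' (Hu _ Wzz) tt.
  rewrite (ieAC XT (j a)) !mulgA (ieAC XT (j a * j (par z) * ie (u z))%g) mulgK (ieAC XT (j a * j (par z))%g) => E1.
  by apply: (mulgI (j a * j (par z) * j a^-1)%g); rewrite -E1.
have L0 X Z : Df u (0, local_brk par lg Z X) = 0.
  have sp := ll_par LL U00.
  have d1 := @hasD_AdG _ _ _ _ _ _ _ LL _ par 0 Z X sp (ll_par0 LL).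
  rewrite (Df_lg_par LL) in d1.
  have d2 := hasD_comp hR openT (Cinfty_lin setT cL 1%N) (I : setT ((fun z => local_Ad par lg (par z) X) 0)) d1.
  rewrite (Df_lin _ _ hR cL) in d2.
  rewrite -(hasD_Df hR d2) -(hasD_Df hR (@hasD_cst R _ R^o (Df u (0, X)) 0 Z)); apply: Df_near.
  near=> z => /=; apply: inv; apply: (admissible_par LL); near: z; exact: (open_near oU U00).
have LX X : Df u (0, X) = 0 by move: X; apply: (dense _ cL) => Y Z; exact: L0.
move=> a sa.
have fib b : exists t, adm b -> i b = (j b * ie t)%g.
  case: (pselect (adm b)) => [sb|nb]; last by exists 0.
  by have [t Ht'] := ov_fib XT (oj _ sb) (oi _ sb); exists t.
have [th Hth] := choice fib.
suff E1 : ie (th (S 1 a)) = ie (th (S 0 a)).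
  have := Hth (S 1 a) (adm_S 1 sa); rewrite E1 (ct_1 CT sa) (ct_0 CT sa) => ->.
  by have := Hth 1%g adm1; rewrite i1 j1 mul1g => <-; rewrite mulg1.
apply: (ie_const XT (th := fun r => th (S r a))) => r.
have [Q [oQ Qr CQ HQ]] := ct_log r sa.
set eta := (fun r' : R^o => lg ((S r a)^-1 * S r' a)%g) in CQ HQ.
have eta0 : eta r = 0 by rewrite /eta mulVg (lg1 LL).
exists (fun h => u (eta h)); split; first by rewrite eta0.
- have We : W (eta r) by rewrite eta0.
  have Hd := hasD_comp hR oW (Cu 1%N) We (Cinfty_hasD (v := 1 : R^o) hE oQ CQ Qr).
  have Ez : Df u (eta r, Df eta (r, (1 : R^o))) = 0 by rewrite eta0 LX.
  rewrite Ez in Hd.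
  by have [d1 d2] := hasD_derivable Hd; apply: DeriveDef => //; rewrite -derive1E.
have ceta : {for (r : R^o), continuous eta} by exact: (Cinfty_cont CQ).
have nW : \forall h \near (r : R^o), W (eta h) by apply: ceta; rewrite eta0; exact: (open_near oW Wz).
near=> h.
have Wh : W (eta h) by near: h.
have Qh : Q h by near: h; exact: (open_near oQ Qr).
have [Ue Pe] := HQ _ Qh.
have Eh : S h a = (S r a * par (eta h))%g by rewrite Pe mulgA mulgV mul1g.
have sr := adm_S r sa; have sh := adm_S h sa; have se := admissible_par LL Ue.
apply: (mulgI (j (S h a))); rewrite -(Hth _ sh) {1}Eh {1}Eh (iM _ _ sr se) (jM _ _ sr se).
by rewrite (Hth _ sr) (Hu _ Wh) (ie_add XT) (ieAC XT (j (S r a))) !mulgA (ieAC XT (j (S r a) * j _)%g).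
Unshelve. all: by end_near. Qed.

(** [e] measures how the translate of the section by [s z] deviates from the section. The bound
    [pi / 4] is chosen because [exponent_rel] compares four exponents, whose total must stay below
    the [pi] of [ie_small]. *)
Lemma div_cocycle : exists (e : E * E -> R^o) W, [/\ open W, W (0, 0), Cinfty W e,
  Cinfty W (fun p => lg ((par p.1)^-1 * par p.2)%g) & forall p, W p ->
  [/\ [/\ U0 p.1, U0 p.2, W0 p.1 & W0 p.2], W0 (lg ((par p.1)^-1 * par p.2)%g),
   U0 (lg ((par p.1)^-1 * par p.2)%g) /\ par (lg ((par p.1)^-1 * par p.2)%g) = ((par p.1)^-1 * par p.2)%g,
   `|e p : R| < pi / 4 & (s p.1 * s (lg ((par p.1)^-1 * par p.2)) = s p.2 * ie (e p))%g]].
Proof.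
have oU := ll_open LL; have U00 := ll_zero LL.
have sn : Sm (fun p : E * E => (par p.1)^-1 * par p.2)%g (0, 0).
  apply: (ll_mul LL); last by apply: (Sm_lin LL) => //; exact: clin_snd.
  by apply: (ll_inv LL); apply: (Sm_lin LL) => //; exact: clin_fst.
have [N [oN Nx CN HN]] := ll_lg LL sn (mulVg (par 0)).
set n := (fun p : E * E => lg ((par p.1)^-1 * par p.2)%g) in CN HN.
have n0 : n (0, 0) = 0 by rewrite /n mulVg (lg1 LL).
have Wn : W0 (n (0, 0)) by rewrite n0.
have nW := near_W0 hs oN Nx CN Wn.
have [e [Q [oQ Qx Ce e0 He]]] : exists (e : E * E -> R^o) Q, [/\ open Q, Q (0, 0), Cinfty Q e, e (0, 0) = 0 &
    forall p, Q p -> (s p.1 * s (n p) = s p.2 * ie (e p))%g].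
  apply: (@ie_diff _ _ _ Sm par Ht SmT ie over XT (E * E)%type (fun p => s p.1 * s (n p))%g (fun p => s p.2)).
  - apply: (xt_mul XT); first exact: (SmT_section_fst XT hs).
    exact: (SmT_section XT hs oN Nx CN Wn).
  - exact: (SmT_section_snd XT hs).
  - by rewrite n0 /= s0 mulg1.
  near=> p; exists (par p.2); last by apply: sO; near: p; exact: (near_W0_snd hs).
  have Np : N p by near: p; exact: (open_near oN Nx).
  have -> : par p.2 = (par p.1 * par (n p))%g by rewrite (HN _ Np).2 mulgA mulgV mul1g.
  by apply: (ov_mul XT); apply: sO; near: p; [exact: (near_W0_fst hs)|exact: nW].
pose Pi := [set t : R^o | `|t : R| < pi / 4].
have p4 : 0 < pi / 4 :> R by rewrite divr_gt0 ?pi_gt0.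
have oPi : open Pi.
  rewrite (_ : Pi = ball (0 : R^o) (pi / 4)); first exact: ball_open.
  by apply/funext => t; rewrite /Pi /ball /= sub0r normrN.
have c1 : Cinfty setT (fun p : E * E => p.1) by apply: Cinfty_lin; exact: clin_fst.
have c2 : Cinfty setT (fun p : E * E => p.2) by apply: Cinfty_lin; exact: clin_snd.
have oUW : open (U0 `&` W0) by exact: openI.
pose W := (Q `&` e @^-1` Pi) `&` (N `&` n @^-1` W0) `&` ((setT `&` fst @^-1` (U0 `&` W0)) `&` (setT `&` snd @^-1` (U0 `&` W0))).
have oW : open W.
  apply: openI; first by apply: openI; exact: preim_open.
  by apply: openI; apply: preim_open => //; exact: openT.
exists e, W; split=> //.
- by split; [split; split=> //; rewrite /preimage /= ?e0 /Pi /= ?normr0|].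
- by apply: Cinfty_sub Ce => p [[[]]].
- by apply: Cinfty_sub CN => p [[_ []]].
- move=> p [[[Qp ep] [Np Wnp]] [[_ [U1 W1]] [_ [U2 W2]]]]; split=> //; first exact: HN.
  exact: He.
Unshelve. all: by end_near. Qed.

Let dS (r : R) (z : E) : E := Df (fun p : R^o * E => Sv p.1 p.2) ((r : R^o, z), (1 : R^o, 0)).

Lemma dS_hasD (r : R^o) z : hasD (fun r : R^o => Sv r z) r (1 : R^o) (dS r z).
Proof.
have dp : hasD (fun r : R^o => (r, z)) r (1 : R^o) (1 : R^o, 0).
  by apply: hasD_pair; [exact: hasD_lin (@clin_id R R^o)|exact: hasD_cst].
exact: (hasD_comp hE openT (ct_Cinfty CT 1%N) (I : setT ((fun r : R^o => (r, z)) r)) dp).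
Qed.

Lemma dSZ r a z : dS r (a *: z) = a *: dS r z.
Proof.
apply: (hasD_uniq hE (@dS_hasD r (a *: z))).
have cZ : clin (fun x : E => a *: x) by apply: clin_scal; exact: clin_id.
have := hasD_comp hE openT (Cinfty_lin setT cZ 1%N) (I : setT ((fun r : R^o => Sv r z) r)) (@dS_hasD r z).
rewrite (Df_lin _ _ hE cZ); apply: hasD_near; near=> t => /=.
by apply/esym; exact: (clinZ _ _ (ct_lin CT t)).
Unshelve. all: by end_near. Qed.

Lemma dS_out (r : R) z : r < 0 -> dS r z = 0.
Proof.
move=> r0; apply: (hasD_uniq hE (@dS_hasD r z)).
apply: (@hasD_near _ _ _ (fun=> 0)); last exact: hasD_cst.
near=> t; apply/esym/(ct_out0 CT); apply: (@le_trans _ _ 0); last by rewrite invr_ge0.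
by apply: ltW; near: t; exact: (lt_nbhsl r0).
Unshelve. all: by end_near. Qed.

Lemma Cinfty_dS : Cinfty setT (fun p : R^o * E => dS p.1 p.2).
Proof.
have CD := Cinfty_Df hE openT (ct_Cinfty CT).
apply: (@Cinfty_comp _ _ _ _ setT _ (fun p : R^o * E => ((p.1, p.2), (1 : R^o, 0 : E))) _ _ _ _ _ CD) => //.
- exact: openT.
- by apply: open_setXT; exact: openT.
apply: Cinfty_pair; last exact: Cinfty_cst.
by apply: Cinfty_pair; apply: Cinfty_lin; [exact: clin_fst|exact: clin_snd].
Qed.

Section GivenCocycle.
Variables (e : E * E -> R^o) (W : set (E * E)).
Hypotheses (oW : open W) (Wx : W (0, 0)) (Ce : Cinfty W e).
Let n (p : E * E) := lg ((par p.1)^-1 * par p.2)%g.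
Hypotheses (Cn : Cinfty W n) (HW : forall p, W p ->
  [/\ [/\ U0 p.1, U0 p.2, W0 p.1 & W0 p.2], W0 (n p),
   U0 (n p) /\ par (n p) = ((par p.1)^-1 * par p.2)%g,
   `|e p : R| < pi / 4 & (s p.1 * s (n p) = s p.2 * ie (e p))%g]).

Lemma small_e p t : W p -> `|t| < pi / 4 -> ie (e p) = ie t -> e p = t.
Proof.
move=> Wp tp E1; have [_ _ _ ep _] := HW Wp.
apply/eqP; rewrite -subr_eq0; apply/eqP; apply: (ie_small XT).
  rewrite (le_lt_trans (ler_normB _ _)) // (lt_trans (ltrD ep tp)) //.
  by have := pi_gt0 R => p0; lra.
by rewrite (ie_add XT) (ieN XT) E1 mulgV.
Qed.

Lemma e_diag z : W (z, z) -> e (z, z) = 0.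
Proof.
move=> Wz; apply: small_e => //; first by rewrite normr0 divr_gt0 ?pi_gt0.
have [_ _ _ _] := HW Wz; rewrite /n /= mulVg (lg1 LL) s0 mulg1 => E1.
by apply: (mulgI (s z)); rewrite -E1 (ie0 XT) mulg1.
Qed.

Lemma e_zero z : W (0, z) -> e (0, z) = 0.
Proof.
move=> Wz; apply: small_e => //; first by rewrite normr0 divr_gt0 ?pi_gt0.
have [[_ Uz _ _] _ _ _] := HW Wz; rewrite /n /= (ll_par0 LL) invg1 mul1g (ll_lgK LL) // s0 mul1g => E1.
by apply: (mulgI (s z)); rewrite -E1 (ie0 XT) mulg1.
Qed.

Let D z v := Df e ((z, z), (0, v)).

Lemma D_zero v : D 0 v = 0.
Proof.
have c0 : clin (fun z : E => (0 : E, z)) by apply: clin_pair; [exact: clin_zero|exact: clin_id].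
have := hasD_comp hR oW (Ce 1%N) (Wx : W ((fun z : E => (0 : E, z)) 0)) (@hasD_lin R _ _ _ 0 v c0).
move=> d1; apply: (hasD_uniq hR d1); apply: (@hasD_near _ _ _ (fun=> 0)); last exact: hasD_cst.
have cc : {for (0 : E), continuous (fun z : E => (0 : E, z))} by exact: clin_cont.
have nW : \forall z \near (0 : E), W (0, z) := cc _ (open_near oW Wx).
by apply: filterS nW => z Wz; apply/esym; exact: e_zero.
Qed.

Lemma D_lin z : W (z, z) -> clin (D z).
Proof.
move=> Wz; apply: (clin_comp (M := fun w => Df e ((z, z), w)) (L := fun v : E => (0 : E, v))).
  by apply: clin_pair; [exact: clin_zero|exact: clin_id].
exact: (Df_clin hR oW (Ce 1%N) Wz).
Qed.

Let Wd := [set z | W (z, z)].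

Lemma open_Wd : open Wd.
Proof.
have cd : clin (fun z : E => (z, z)) by apply: clin_pair; exact: clin_id.
by have := preim_open openT oW (Cinfty_lin setT cd); rewrite setTI.
Qed.

Lemma Cinfty_D : Cinfty (Wd `*` setT) (fun p : E * E => D p.1 p.2).
Proof.
have CD := Cinfty_Df hR oW Ce.
apply: (@Cinfty_comp _ _ _ _ (Wd `*` setT) _ (fun p : E * E => ((p.1, p.1), (0 : E, p.2))) _ _ _ _ _ CD) => //.
- by apply: open_setXT; exact: open_Wd.
- by apply: open_setXT.
apply: Cinfty_pair; apply: Cinfty_pair; try exact: Cinfty_cst.
- by apply: Cinfty_lin; exact: clin_fst.
- by apply: Cinfty_lin; exact: clin_fst.
- by apply: Cinfty_lin; exact: clin_snd.
Qed.

(** The whole contraction path of [z] stays where [e] is defined near the diagonal. *)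
Let good (z : E) := forall r, Wd (Sv r z).
Let vel (z : E) (r : R) : R := D (Sv r z) (dS r z).

Lemma good_W z : good z -> W (z, z).
Proof. by move=> /(_ 1); rewrite (ct_out1 CT). Qed.

Lemma out_unit (P : E -> Prop) z : (forall r, 0 <= r <= 1 -> P (Sv r z)) -> forall r, P (Sv r z).
Proof.
move=> H1 r; have [r0|r0] := lerP 0 r.
  have [r1|r1] := lerP r 1; first by apply: H1; rewrite r0.
  by rewrite (ct_out1 CT) ?ltW // -(ct_out1 CT z (lexx 1)); apply: H1; rewrite lexx ler01.
rewrite (ct_out0 CT); last by rewrite (le_trans (ltW r0)) // invr_ge0.
have E0 : Sv 0 z = 0 by apply: (ct_out0 CT); rewrite invr_ge0.
by rewrite -E0; apply: H1; rewrite lexx ler01.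
Qed.

Lemma good_near : \forall z \near (0 : E), good z.
Proof.
have Wd0 : Wd 0 by [].
have H1 : \forall z \near (0 : E), forall s0 : R, 0 <= s0 <= 1 -> Wd (Sv s0 z).
  apply: (@tube_lemma R _ (nbhs (0 : E)) (fun z r => Wd (Sv r z)) 0 1 _ _) => r _.
  have cS : {for ((r : R^o, 0 : E)), continuous (fun p : R^o * E => Sv p.1 p.2)} by exact: (Cinfty_cont (ct_Cinfty CT)).
  have S0 : Sv r 0 = 0 by exact: (clin0 (ct_lin CT r)).
  by have := cS _ (open_near open_Wd (_ : Wd (Sv r 0))); rewrite S0; apply.
by apply: filterS H1 => z Hz r; exact: (out_unit Hz).
Qed.

Lemma cts_vel (r : R^o) (z w : E) : Wd (Sv r z) ->
  {for (r, (z, w)), continuous (fun p : R^o * (E * E) => D (Sv p.1 p.2.1) (dS p.1 p.2.2))}.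
Proof.
move=> Wz.
apply: (@continuous_comp _ _ _ (fun p : R^o * (E * E) => (Sv p.1 p.2.1, dS p.1 p.2.2)) (fun p : E * E => D p.1 p.2)); last first.
  have WD : (Wd `*` [set: E]) (Sv r z, dS r w) by [].
  exact: (Cinfty_cont Cinfty_D WD).
have c1 : clin (fun p : R^o * (E * E) => (p.1, p.2.1)).
  apply: clin_pair; first exact: clin_fst.
  exact: (clin_comp (@clin_snd R _ _) (@clin_fst R _ _)).
have c2 : clin (fun p : R^o * (E * E) => (p.1, p.2.2)).
  apply: clin_pair; first exact: clin_fst.
  exact: (clin_comp (@clin_snd R _ _) (@clin_snd R _ _)).
apply: cts_pair.
- apply: (@continuous_comp _ _ _ (fun p : R^o * (E * E) => (p.1, p.2.1)) (fun p : R^o * E => Sv p.1 p.2)).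
    exact: clin_cont.
  exact: (Cinfty_cont (ct_Cinfty CT)).
- apply: (@continuous_comp _ _ _ (fun p : R^o * (E * E) => (p.1, p.2.2)) (fun p : R^o * E => dS p.1 p.2)).
    exact: clin_cont.
  exact: (Cinfty_cont Cinfty_dS).
Qed.

Lemma nbhs_small (eps : R) : 0 < eps -> nbhs (0 : R^o) [set t : R^o | `|t : R| < eps].
Proof. by move=> e0; apply/nbhs_ballP; exists eps => // t; rewrite /ball /= sub0r normrN. Qed.

(** [D] vanishes at 0, and compactness of [[0, 1]] makes the smallness uniform in [r]. The direction
    varies independently near [w0], in view of the rescaling in [exponent_curve]. *)
Lemma vel_small (w0 : E) eps : 0 < eps ->
  \forall q \near ((0, w0) : E * E), forall r, 0 <= r <= 1 -> `|D (Sv r q.1) (dS r q.2) : R| < eps.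
Proof.
move=> e0.
apply: (@tube_lemma R _ (nbhs ((0, w0) : E * E)) (fun q r => `|D (Sv r q.1) (dS r q.2) : R| < eps) 0 1 _ _) => r _.
have S0 : Sv r 0 = 0 by exact: (clin0 (ct_lin CT r)).
have Wr : Wd (Sv r 0) by rewrite S0.
have nb : nbhs (D (Sv r 0) (dS r w0)) [set t : R^o | `|t : R| < eps].
  by rewrite S0 D_zero; exact: nbhs_small.
exact: (@cts_vel r 0 w0 Wr _ nb).
Qed.

(** Inside the domain of the section, horizontality of [s (Sv r z) * ie (a r)] amounts to a scalar
    equation: the derivative of [a] is [vel z]. *)
Lemma small_lift z : good z -> exists a : R^o -> R^o,
  [/\ a 0 = 0, forall x : R^o, hasD a x (1 : R^o) (vel z x) &
    hlift (par z) (fun r => s (Sv r z) * ie (a r))%g].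
Proof.
move=> gz; have [[Uz _ _ _] _ _ _ _] := HW (good_W gz).
have cv : continuous (vel z).
  move=> r; apply: (@continuous_comp _ _ _ (fun r : R => ((r : R^o), (z, z))) (fun p : R^o * (E * E) => D (Sv p.1 p.2.1) (dS p.1 p.2.2))).
    by apply: cts_pair; [exact: cvg_id|exact: cvg_cst].
  exact: (cts_vel (gz r)).
have [a [a0 da]] : exists a : R^o -> R^o, a 0 = 0 /\ forall x : R^o, hasD a x (1 : R^o) (vel z x).
  by apply: (continuous_primitive cv) => r r0; rewrite /vel (dS_out _ r0) (clin0 (D_lin (gz r))).
exists a; split=> //; split.
- by rewrite a0 (ie0 XT) mulg1 (ct_out0 CT) ?invr_ge0 ?s0.
- move=> r; rewrite -[S r _]mulg1 (ct_par CT) //; apply: (ov_mul XT); last exact: (ov_ie XT).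
  by apply: sO; have [[]] := HW (gz r : W (_, _)).
move=> r; exists (fun h : R^o => (a h - a r) - e (Sv r z, Sv h z)); split.
- by rewrite subrr e_diag ?subrr //; exact: gz.
- have dp : hasD (fun h : R^o => (Sv r z, Sv h z)) r (1 : R^o) (0, dS r z).
    by apply: hasD_pair; [exact: hasD_cst|exact: dS_hasD].
  have de := hasD_comp hR oW (Ce 1%N) (gz r : W ((fun h : R^o => (Sv r z, Sv h z)) r)) dp.
  have := hasD_sum hR (hasD_sum hR (da r) (@hasD_cst R _ R^o (- a r) r (1 : R^o))) (hasD_opp hR de).
  by rewrite addr0 [X in hasD _ _ _ X](subrr (vel z r)).
have cS : {for (r : R^o), continuous (fun h : R^o => (Sv r z, Sv h z))}.
  apply: cts_pair; first exact: cvg_cst.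
  apply: (@continuous_comp _ _ _ (fun h : R^o => (h, z)) (fun p : R^o * E => Sv p.1 p.2)).
    by apply: cts_pair; [exact: cvg_id|exact: cvg_cst].
  exact: (Cinfty_cont (ct_Cinfty CT)).
have nW : \forall h \near (r : R^o), W (Sv r z, Sv h z) := cS _ (open_near oW (gz r)).
near=> h.
have Wh : W (Sv r z, Sv h z) by near: h.
have [_ _ _ _ /=] := HW Wh; rewrite /n /= !(ct_par CT) // => E1.
rewrite (ieAC XT (s (Sv r z))) E1 -!mulgA -!(ie_add XT); congr (_ * ie _)%g.
by rewrite addrCA addrC; ring.
Unshelve. all: by end_near. Qed.

Lemma good_near_comp (T : topologicalType) (f : T -> E) x : {for x, continuous f} -> f x = 0 ->
  \forall t \near x, good (f t).
Proof. by move=> cf fx; apply: cf; rewrite fx; exact: good_near. Qed.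

(* The set of [r] for which [S r a] has a lift is open and closed. *)
Theorem hlift_ex a : adm a -> exists y, hlift a y.
Proof.
move=> sa; pose T r := exists y, hlift (S r a) y.
(* Connectedness of the line enters through this indicator: it is locally constant, so it has
   derivative 0 everywhere. *)
pose F (r : R) : R := if `[< T r >] then 1 else 0.
(* A lift of [S r0 a] times a lift of the small element [par z] is a lift of [S r1 a]. *)
have step (r0 r1 : R) z : T r0 -> adm (S r0 a) -> good z -> S r1 a = (S r0 a * par z)%g -> T r1.
  move=> [y hy] s0a gz E1; have [b [_ _ hb]] := small_lift gz.
  have [[Uz _ _ _] _ _ _ _] := HW (good_W gz).
  rewrite /T E1; exists (fun r => y r * (s (Sv r z) * ie (b r)))%g.
  by apply: hlift_mul => //; exact: (admissible_par LL).
have loc (r : R) : \forall h \near (r : R^o), F h = F r.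
  have [Q [oQ Qr CQ HQ]] := ct_log r sa.
  have sp : Sm (fun h : R^o => (S h a)^-1 * S r a)%g r.
    apply: (ll_mul LL); first by apply: (ll_inv LL); exact: (ct_sm CT).
    by apply: adm_cst; exact: adm_S.
  have [P [oP Pr CP HP]] := ll_lg LL sp (mulVg (S r a)).
  have n1 : \forall h \near (r : R^o), good (lg ((S r a)^-1 * S h a)%g).
    apply: good_near_comp; last by rewrite mulVg (lg1 LL).
    exact: (Cinfty_cont CQ).
  have n2 : \forall h \near (r : R^o), good (lg ((S h a)^-1 * S r a)%g).
    apply: good_near_comp; last by rewrite mulVg (lg1 LL).
    exact: (Cinfty_cont CP).
  near=> h.
  have Qh : Q h by near: h; exact: (open_near oQ Qr).
  have Ph : P h by near: h; exact: (open_near oP Pr).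
  have g1 : good (lg ((S r a)^-1 * S h a)%g) by near: h.
  have g2 : good (lg ((S h a)^-1 * S r a)%g) by near: h.
  rewrite /F; have -> // : T h = T r.
  apply/propext; split=> Th.
  - apply: (step _ _ _ Th (adm_S h sa) g2).
    by rewrite [par _](HP _ Ph).2 mulgA mulgV mul1g.
  - apply: (step _ _ _ Th (adm_S r sa) g1).
    by rewrite (HQ _ Qh).2 mulgA mulgV mul1g.
have dF (r : R) : is_derive r (1 : R) F 0.
  have Hd : hasD (F : R^o -> R^o) r (1 : R^o) 0.
    apply: (@hasD_near _ _ _ (fun=> F r)); last exact: hasD_cst.
    by apply: filterS (loc r) => h ->.
  by have [d1 d2] := hasD_derivable Hd; apply: DeriveDef => //; rewrite -derive1E.
have := @is_derive_0_is_cst R F 1 0 dF; rewrite /F.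
have T0 : T 0 by exists (fun=> 1%g); rewrite (ct_0 CT sa); exact: hlift1.
rewrite (asboolT T0); case: asboolP => [T1 _|_ /eqP]; last by rewrite eq_sym oner_eq0.
by move: T1; rewrite /T (ct_1 CT sa).
Unshelve. all: by end_near. Qed.

Definition lift_end (a : H) : Ht := xget 1%g [set x | exists2 y, hlift a y & x = y 1].

Lemma lift_endE a y : adm a -> hlift a y -> lift_end a = y 1.
Proof.
move=> sa hy; rewrite /lift_end; case: xgetP => [x _ [z hz ->]|/(_ (y 1)) []]; last by exists y.
exact: hlift_unique hz hy.
Qed.

Lemma lift_end_mul a b : adm a -> adm b -> lift_end (a * b)%g = (lift_end a * lift_end b)%g.
Proof.
move=> sa sb; have [y hy] := hlift_ex sa; have [z hz] := hlift_ex sb.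
by rewrite (lift_endE sa hy) (lift_endE sb hz) (lift_endE (adm_mul sa sb) (hlift_mul sa sb hy hz)).
Qed.

Lemma lift_end_over a : adm a -> over (lift_end a) a.
Proof.
move=> sa; have [y hy] := hlift_ex sa; rewrite (lift_endE sa hy).
by have [_ /(_ 1) + _] := hy; rewrite (ct_1 CT sa).
Qed.

(** The exponent [u] comes from a primitive of [vel z], but this bound and the homomorphism property
    are all that its smoothness will require. *)
Lemma lift_end_par : exists u : E -> R^o, forall z, good z ->
  lift_end (par z) = (s z * ie (u z))%g /\
  forall c : R, (forall r : R, 0 <= r <= 1 -> `|vel z r| <= c) -> `|u z : R| <= c.
Proof.
have H1 (z : E) : exists t : R^o, good z -> lift_end (par z) = (s z * ie t)%g /\
  forall c : R, (forall r : R, 0 <= r <= 1 -> `|vel z r| <= c) -> `|t : R| <= c; last first.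
  by have [u Hu] := choice H1; exists u.
case: (pselect (good z)) => [gz|ng]; last by exists 0.
have [a [a0 da ha]] := small_lift gz; have [[Uz _ _ _] _ _ _ _] := HW (good_W gz).
exists (a 1) => _; split=> [|c vc].
  by rewrite (lift_endE (admissible_par LL Uz) ha) (ct_out1 CT).
exact: (hasD_le da a0 vc).
Qed.

Section Exponent.
Variable u : E -> R^o.
Hypothesis Hu : forall z, good z -> lift_end (par z) = (s z * ie (u z))%g /\
  forall c : R, (forall r : R, 0 <= r <= 1 -> `|vel z r| <= c) -> `|u z : R| <= c.

Lemma exponent_small eps : 0 < eps -> \forall z \near (0 : E), `|u z : R| < eps.
Proof.
move=> e0; have e2 : 0 < eps / 2 by rewrite divr_gt0.
have cd : {for (0 : E), continuous (fun z : E => (z, z))} by apply: cts_pair; exact: cvg_id.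
have nv : \forall z \near (0 : E), forall r, 0 <= r <= 1 -> `|vel z r| < eps / 2 := cd _ (vel_small 0 e2).
near=> z.
have gz : good z by near: z; exact: good_near.
have vz : forall r, 0 <= r <= 1 -> `|vel z r| < eps / 2 by near: z; exact: nv.
apply: (@le_lt_trans _ _ (eps / 2)); last by rewrite ltr_pdivrMr // ltr_pMr // ltr1n.
by apply: (Hu gz).2 => r r01; exact: ltW (vz r r01).
Unshelve. all: by end_near. Qed.

(** [D] and [dS] are homogeneous in the direction, so dividing by [h] leaves velocities in the
    direction [h^-1 *: eta h], which converges; [vel_small] applies. Thus [u] has derivative 0 along
    every such curve through the origin. *)
Lemma exponent_curve (eta : R^o -> E) w : eta 0 = 0 -> {for 0, continuous eta} ->
  hasD eta 0 (1 : R^o) w -> h^-1 *: (u (eta h) : R^o) @[h --> (0 : R)^'] --> (0 : R^o).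
Proof.
move=> eta0 ceta deta.
have dq : (fun h : R => h^-1 *: eta h) @ (0 : R)^' --> w.
  apply: (dnbhs0_eq_cvg _ deta) => h h0.
  by rewrite add0r [h *: 1]mulr1 eta0 subr0.
have c1 : (fun h : R => eta h) @ (0 : R)^' --> (0 : E).
  by rewrite -eta0; apply: cvg_trans ceta => //; apply: cvg_app; exact: cvg_within.
have cp : (fun h : R => (eta h, h^-1 *: eta h)) @ (0 : R)^' --> ((0, w) : E * E) by exact: cvg_pair.
apply/cvgr0Pnorm_lt => eps e0; have e2 : 0 < eps / 2 by rewrite divr_gt0.
have nv : \forall h \near (0 : R)^', forall r, 0 <= r <= 1 -> `|D (Sv r (eta h)) (dS r (h^-1 *: eta h)) : R| < eps / 2.
  exact: (cp _ (vel_small w e2)).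
have ng : \forall h \near (0 : R)^', good (eta h) := c1 _ good_near.
near=> h.
have h0 : h != 0 by near: h; exact: dnbhs0_neq.
have gh : good (eta h) by near: h; exact: ng.
have vh : forall r, 0 <= r <= 1 -> `|D (Sv r (eta h)) (dS r (h^-1 *: eta h)) : R| < eps / 2 by near: h; exact: nv.
have uh : `|u (eta h) : R| <= `|h| * (eps / 2).
  apply: (Hu gh).2 => r r01; rewrite /vel.
  have -> : dS r (eta h) = h *: dS r (h^-1 *: eta h) by rewrite -dSZ scalerA divff // scale1r.
  rewrite (clinZ _ _ (D_lin (gh r))) [X in `|X|]/(h * _) normrM ler_wpM2l //.
  exact: ltW (vh r r01).
rewrite [X in `|X|]/(h^-1 * _) normrM normfV ltr_pdivrMl ?normr_gt0 //.
rewrite (le_lt_trans uh) // ltr_pM2l ?normr_gt0 //.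
by rewrite ltr_pdivrMr // ltr_pMr // ltr1n.
Unshelve. all: by end_near. Qed.

Let B := interior [set z | good z /\ `|u z : R| < pi / 4].

Let oB : open B. Proof. exact: open_interior. Qed.

Let p4 : 0 < pi / 4 :> R. Proof. by rewrite divr_gt0 ?pi_gt0. Qed.

Let B0 : B 0.
Proof.
near=> z; split; near: z; [exact: good_near|exact: exponent_small].
Unshelve. all: by end_near. Qed.

Let BP z : B z -> good z /\ `|u z : R| < pi / 4.
Proof. by move=> Bz; exact: (nbhs_singleton Bz). Qed.

(** The homomorphism property for the factorization of [par z'] into [par z] and [par (n (z, z'))],
    read in the centre; smallness of all four exponents excludes a discrepancy by a period. *)
Lemma exponent_rel z z' : B z -> B z' -> W (z, z') -> B (n (z, z')) -> u z' = (u z + u (n (z, z'))) + e (z, z').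
Proof.
move=> /BP[gz uz] /BP[gz' uz'] Wz /BP[gn un].
have [[/= Uz Uz' _ _] _ [Un Pn] ez /= E1] := HW Wz.
have sz := admissible_par LL Uz; have sn := admissible_par LL Un.
have := (Hu gz').1; have -> : par z' = (par z * par (n (z, z')))%g by rewrite Pn /= mulgA mulgV mul1g.
rewrite (lift_end_mul sz sn) (Hu gz).1 (Hu gn).1 mulgA (ieAC XT (s z)) E1 -!mulgA -!(ie_add XT) => /mulgI E2.
apply/eqP; rewrite -subr_eq0; apply/eqP; apply: (ie_small XT).
  move: (uz) (uz') (un) (ez); rewrite !ltr_norml => /andP[? ?] /andP[? ?] /andP[? ?] /andP[? ?].
  by have := pi_gt0 R => ?; apply/andP; split; lra.
by rewrite (ie_add XT) (ieN XT) -E2 -(ieN XT) -(ie_add XT) (_ : _ + _ = 0) ?(ie0 XT) //; ring.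
Qed.

Let n_diag z : n (z, z) = 0. Proof. by rewrite /n /= mulVg (lg1 LL). Qed.

Lemma exponent_near z : B z -> \forall z' \near z, u z' = (u z + u (n (z, z'))) + e (z, z').
Proof.
move=> Bz; have Wz := good_W (BP Bz).1.
have cz : {for z, continuous (fun z' : E => (z, z'))} by apply: cts_pair; [exact: cvg_cst|exact: cvg_id].
have nW : \forall z' \near z, W (z, z') := cz _ (open_near oW Wz).
have cn : {for z, continuous (fun z' : E => n (z, z'))}.
  by apply: (@continuous_comp _ _ _ (fun z' : E => (z, z')) n) => //; exact: (Cinfty_cont Cn).
have nB : \forall z' \near z, B (n (z, z')) by apply: cn; rewrite n_diag; exact: (open_near oB B0).
near=> z'; apply: exponent_rel => //; near: z'; [exact: (open_near oB Bz)|exact: nW|exact: nB].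
Unshelve. all: by end_near. Qed.

Lemma exponent_cont z : B z -> {for z, continuous u}.
Proof.
move=> Bz; have Wz := good_W (BP Bz).1.
have cz : {for z, continuous (fun z' : E => (z, z'))} by apply: cts_pair; [exact: cvg_cst|exact: cvg_id].
have cn : {for z, continuous (fun z' : E => n (z, z'))}.
  by apply: (@continuous_comp _ _ _ (fun z' : E => (z, z')) n) => //; exact: (Cinfty_cont Cn).
have ce : {for z, continuous (fun z' : E => e (z, z'))}.
  by apply: (@continuous_comp _ _ _ (fun z' : E => (z, z')) e) => //; exact: (Cinfty_cont Ce).
have cu : (fun z' => u (n (z, z'))) @ z --> (0 : R^o).
  apply/cvgr0Pnorm_lt => eps e0.
  have nb : nbhs (n (z, z)) [set x | `|u x : R| < eps] by rewrite n_diag; exact: exponent_small.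
  exact: (cn _ nb).
have cs : (fun z' => (u z + u (n (z, z'))) + e (z, z')) @ z --> u z.
  rewrite -[X in _ --> X]addr0 -(e_diag Wz) -[in X in _ --> X + _](addr0 (u z)).
  by apply: tvs_cvgD => //; apply: tvs_cvgD => //; exact: cvg_cst.
apply: cvg_trans cs; apply: near_eq_cvg.
by apply: filterS (exponent_near Bz) => z' ->.
Qed.

(** Apply [exponent_near] to [z + h *: w]: the contribution of [n] has derivative 0 by
    [exponent_curve], which leaves the derivative of [e]. *)
Lemma exponent_hasD z w : B z -> hasD u z w (D z w).
Proof.
move=> Bz; have Wz := good_W (BP Bz).1.
have dl : hasD (fun h : R^o => (z, z + h *: w)) 0 (1 : R^o) (0, w).
  apply: hasD_pair; first exact: hasD_cst.
  have cl : clin (fun h : R^o => h *: w).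
    split; first by move=> a x y; rewrite scalerDl scalerA.
    by move=> x; apply: tvs_cvgZ; [exact: cvg_id|exact: cvg_cst].
  have := hasD_sum hE (@hasD_cst R R^o _ z 0 (1 : R^o)) (@hasD_lin R _ _ _ 0 (1 : R^o) cl).
  by rewrite add0r scale1r.
have l0 : (z, z + (0 : R^o) *: w) = (z, z) by rewrite scale0r addr0.
have cl : {for 0, continuous (fun h : R^o => (z, z + h *: w))}.
  apply: cts_pair; first exact: cvg_cst.
  by apply: tvs_cvgD; [exact: cvg_cst|apply: tvs_cvgZ; [exact: cvg_id|exact: cvg_cst]].
have Wl : W ((fun h : R^o => (z, z + h *: w)) 0) by rewrite l0.
have de := hasD_comp hR oW (Ce 1%N) Wl dl; rewrite l0 in de.
have dn := hasD_comp hE oW (Cn 1%N) Wl dl.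
have cn : {for 0, continuous (fun h : R^o => n (z, z + h *: w))}.
  apply: (@continuous_comp _ _ _ (fun h : R^o => (z, z + h *: w)) n) => //.
  exact: (Cinfty_cont Cn).
have n0 : n (z, z + (0 : R^o) *: w) = 0 by rewrite l0 n_diag.
have du := exponent_curve n0 cn dn.
rewrite -[D z w]add0r /hasD.
have nz : \forall h \near (0 : R)^', u (z + h *: w) = (u z + u (n (z, z + h *: w))) + e (z, z + h *: w).
  exact: (@cvg_dnbhs_line R E z w _ (exponent_near Bz)).
have de' : (fun h : R => h^-1 *: e (z, z + h *: w)) @ (0 : R)^' --> D z w.
  apply: (dnbhs0_eq_cvg _ de) => h h0 /=.
  by rewrite add0r [h *: 1]mulr1 scale0r addr0 (e_diag Wz) subr0.
apply: cvg_trans (tvs_cvgD du de'); apply: near_eq_cvg.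
by apply: filterS nz => h ->; rewrite -scalerDr -(addrA (u z)) (addrC (u z)) addrK.
Qed.

(** The derivative of [u] is [D], already known to be smooth, so no differentiation under an
    integral is needed. *)
Lemma Cinfty_exponent : Cinfty B u.
Proof.
have cu z : B z -> {for z, continuous u} by exact: exponent_cont.
case=> [|k]; first by split.
apply/CkSE; split=> //; exists (fun p => D p.1 p.2); split; first by move=> z w Bz; exact: exponent_hasD.
apply: Ck_sub (Cinfty_D k) => p [Bp _]; split=> //; exact: (good_W (BP Bp).1).
Qed.

Lemma SmT_lift_end a : adm a -> exists2 f : E -> Ht, SmT f 0 & \forall z \near (0 : E), lift_end (a * par z)%g = f z.
Proof.
move=> sa; exists (fun z => lift_end a * s z * ie (u z))%g.
  apply: (xt_mul XT); last first.
    by apply: (xt_comp XT (U := B)) => //; [exact: Cinfty_exponent|exact: (xt_ie XT)].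
  by apply: (xt_mul XT); [exact: (xt_cst XT)|exact: sS].
near=> z; have gz : good z by near: z; exact: good_near.
have [[Uz _ _ _] _ _ _ _] := HW (good_W gz).
by rewrite (lift_end_mul sa (admissible_par LL Uz)) (Hu gz).1 mulgA.
Unshelve. all: by end_near. Qed.

End Exponent.
End GivenCocycle.

Theorem factorization_ex : exists i : H -> Ht,
  [/\ forall a b, adm a -> adm b -> i (a * b)%g = (i a * i b)%g, forall a, adm a -> over (i a) a &
    forall a, adm a -> exists2 f : E -> Ht, SmT f 0 & \forall z \near (0 : E), i (a * par z)%g = f z].
Proof.
have [e [W [oW Wx Ce Cn HW]]] := div_cocycle.

have [u Hu] := lift_end_par oW Ce HW.
exists lift_end; split.
- exact: (lift_end_mul oW Wx Ce HW).
- exact: (lift_end_over oW Wx Ce HW).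
- exact: (SmT_lift_end oW Wx Ce Cn HW Hu).
Qed.

End HorizontalLifts.

(** * Contraction of the path group by reparametrisation *)

Section Reparametrisation.
Context {R : realType}.

(* For [r] from [0] to [1], first the constant [0] is deformed into a map that
   is locally constant near the endpoints of [[0, pi]], then the latter into
   the identity. *)
Definition repar (r t : R) : R := (step1 (2 * r) - step1 r) * (pi * step1 t) + step1 r * t.

Lemma pi_ge1 : 1 <= pi :> R.
Proof. by rewrite (le_trans _ (pi_ge2 R)) // ler1n. Qed.

Lemma repar_le0 r t : t <= 0 -> repar r t <= 0.
Proof.
move=> t0; rewrite /repar (@step1_le0 _ t) ?mulr0 ?add0r; last by rewrite (le_trans t0) // invr_ge0.
by rewrite mulr_ge0_le0 // step1_ge0.
Qed.

Lemma repar0 t r : r <= 4^-1 -> repar r t = 0.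
Proof.
move=> r0; have a : step1 (2 * r) = 0 by apply: step1_le0; lra.
have b : step1 r = 0 by apply: step1_le0; lra.
by rewrite /repar a b subrr !mul0r addr0.
Qed.

Lemma repar1 r t : 1 <= r -> repar r t = t.
Proof.
move=> r1; have a : step1 (2 * r) = 1 by apply: step1_ge1; lra.
by rewrite /repar a (step1_ge1 r1) subrr mul0r add0r mul1r.
Qed.

(** For [r <= 2^-1] the map [repar r] is itself constant beyond [pi]; for larger [r] its values
    there are at least [pi], where [g] is constant. *)
Lemma repar_gepi r t T (g : R -> T) : wraps Path g -> pi <= t -> g (repar r t) = g (repar r pi).
Proof.
move=> wg pt; have p1 := pi_ge1; rewrite /repar.
rewrite (@step1_ge1 _ t) ?(le_trans p1) // (@step1_ge1 _ pi) // mulr1.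
have [r0|r0] := lerP r 2^-1; first by rewrite (step1_le0 r0) !mul0r.
rewrite (@step1_ge1 _ (2 * r)); last by lra.
rewrite [X in g X = _](_ : _ = pi + step1 r * (t - pi)); last by ring.
rewrite [X in _ = g X](_ : _ = pi); last by ring.
by rewrite (wraps_path_gepi wg) // lerDl mulr_ge0 ?step1_ge0 // subr_ge0.
Qed.

Lemma wraps_repar T (g : R -> T) r : wraps Path g -> wraps Path (g \o repar r).
Proof.
move=> wg; apply: wraps_pathI => t t0 /=; last exact: repar_gepi.
by rewrite !(wraps_path_le0 wg) // repar_le0.
Qed.

Lemma Cinfty_repar : Cinfty setT (fun p : R^o * R^o => repar p.1 p.2 : R^o).
Proof.
have cf (f : R -> R) : smf f -> Cinfty setT (fun p : R^o * R^o => f p.1 : R^o).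
  move=> sf; apply: (@Cinfty_comp _ _ _ _ setT setT (fun p : R^o * R^o => p.1)) => //; try exact: openT.
  by apply: Cinfty_lin; exact: clin_fst.
have cs (f : R -> R) : smf f -> Cinfty setT (fun p : R^o * R^o => f p.2 : R^o).
  move=> sf; apply: (@Cinfty_comp _ _ _ _ setT setT (fun p : R^o * R^o => p.2)) => //; try exact: openT.
  by apply: Cinfty_lin; exact: clin_snd.
have s1 := @smf_step1 R.
apply: Cinfty_add; first exact: openT.
- apply: (@Cinfty_scale R _ R^o (fun p : R^o * R^o => step1 (2 * p.1) - step1 p.1)).
    by apply: (cf (fun r => step1 (2 * r) - step1 r)); apply: smfD; [exact: smf_comp s1 (smfZ _ (@smf_id R))|exact: smfN].
  by apply: (cs (fun t => pi * step1 t)); exact: smfZ.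
- apply: (@Cinfty_scale R _ R^o (fun p : R^o * R^o => step1 p.1)); first exact: cf.
  by apply: Cinfty_lin; exact: clin_snd.
Qed.

Variable n : nat.
Local Notation V := (flat_vect R Path n).

Fact vrepar_subproof r (z : V) : {W : V | forall t, W t = z (repar r t)}.
Proof.
exists (mk_flat Path (fun t => z (repar r t))) => t; rewrite mk_pathE //.
- exact: (wraps_repar r (flat_wraps z)).
- by rewrite path_le0 // repar_le0.
- apply: (@Cinfty_comp _ _ _ _ setT setT (fun t : R^o => (r : R^o, t)) (fun p : R^o * R^o => z (repar p.1 p.2))); try exact: openT; first by [].
    by apply: Cinfty_pair; [exact: Cinfty_cst|apply: Cinfty_lin; exact: clin_id].
  by apply: Cinfty_ev; [exact: Cinfty_cst|exact: Cinfty_repar].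
Qed.
Definition vrepar r z : V := sval (vrepar_subproof r z).
Lemma vreparE r z t : vrepar r z t = z (repar r t).
Proof. exact: (svalP (vrepar_subproof r z)). Qed.

Lemma Cinfty_vrepar : Cinfty setT (fun p : R^o * V => vrepar p.1 p.2).
Proof.
apply: (@exp_law _ _ _ _ _ (fun q : (R^o * V) * R^o => flat_fun q.1.2 (repar q.1.1 q.2))).
- exact: openT.
- apply: (@Cinfty_sub _ _ _ setT) => //; apply: Cinfty_ev.
    by apply: Cinfty_lin; exact: (clin_comp (@clin_fst R _ _) (@clin_snd R _ _)).
  apply: (@Cinfty_comp _ _ _ _ setT setT (fun q : (R^o * V) * R^o => (q.1.1, q.2)) (fun p : R^o * R^o => repar p.1 p.2 : R^o)); try exact: openT; first by [].
    apply: Cinfty_pair; apply: Cinfty_lin; last exact: clin_snd.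
    exact: (clin_comp (@clin_fst R _ _) (@clin_fst R _ _)).
  exact: Cinfty_repar.
- by move=> p t _; rewrite vreparE.
Qed.

Lemma clin_vrepar r : clin (vrepar r).
Proof.
split=> [a x y|x]; first by apply: flat_ext => t; rewrite !vreparE -[RHS]/(a *: flat_fun (vrepar r x) t + flat_fun (vrepar r y) t) !vreparE.
have C : Cinfty setT (@vrepar r).
  apply: (@Cinfty_comp _ _ _ _ setT setT (fun z : V => (r : R^o, z)) (fun p : R^o * V => vrepar p.1 p.2)) => //; try exact: openT.
    by apply: Cinfty_pair; [exact: Cinfty_cst|apply: Cinfty_lin; exact: clin_id].
  exact: Cinfty_vrepar.
exact: (Cinfty_cont C).
Qed.

End Reparametrisation.

Section PathContraction.
Context {R : realType} {n : nat} {G : groupType}.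
Variable A : atlas 'rV[R]_n G.
Hypothesis lA : lie_group A.
Variable c : chart 'rV[R]_n G.
Hypotheses (Ac : A c) (c1 : chart_dom c 1%g).
Local Notation V := (flat_vect R Path n).

Lemma adm_PeG (a : R -> G) : admissible V (@psm R n G A) a <-> PeG A a.
Proof. by split=> [|H]; [exact: psm_PeG|exact: psm_cst]. Qed.

Lemma contraction_path : contraction (@psm R n G A) (pcod c) (ppar c) (fun r a => a \o repar r) (@vrepar R n).
Proof.
have sm2 (a : R -> G) (p : R^o * R^o) : PeG A a -> smat A (fun p : R^o * R^o => a (repar p.1 p.2)) p.
  move=> /(PeGP lA)[_ _ sa].
  apply: (@smat_precomp _ _ _ _ _ _ (a : R^o -> G) setT (fun p : R^o * R^o => repar p.1 p.2 : R^o)) => //.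
    exact: openT.
  exact: Cinfty_repar.
split.
- by [].
- move=> a r /adm_PeG Pa; exists setT; split=> //; first exact: openT; last by move=> d s _; exact: sm2.
  move=> d _; apply/(PeGP lA); have [wa a0 _] := (PeGP lA a).1 Pa; split.
  + exact: wraps_repar.
  + by rewrite /= (wraps_path_le0 wa) // repar_le0.
  + by move=> s; apply: (smat_slice (K := fun p : R^o * R^o => a (repar p.1 p.2))); exact: sm2.
- move=> a /adm_PeG /(PeGP lA)[_ a0 _]; apply/funext => t /=.
  by rewrite repar0 ?a0 // invr_ge0.
- by move=> a _; apply/funext => t /=; rewrite repar1.
- by move=> r z Uz s; rewrite vreparE; exact: (Uz (repar r s)).
- by move=> r z Uz; apply/funext => s; rewrite /= !pparE vreparE.
- exact: clin_vrepar.
- exact: Cinfty_vrepar.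
- by move=> r z r0; apply: flat_ext => t; rewrite vreparE repar0 // path_le0.
- by move=> r z r1; apply: flat_ext => t; rewrite vreparE repar1.
Qed.

End PathContraction.

(** * The circle and the fusion extension *)

Section CircleGroup.
Context {R : realType}.

Lemma expiD (s t : R) : expi (s + t) = (expi s * expi t)%g.
Proof. by apply: val_inj; rewrite /= cosD sinD; congr (_ +i* _)%C; rewrite addrC. Qed.

Lemma expi0 : expi (0 : R) = 1%g.
Proof. by apply: val_inj; rewrite /= cos0 sin0. Qed.

Lemma expi_eq1 (t : R) : `|t| < 2 * pi -> expi t = 1%g -> t = 0.
Proof.
move=> tp /(congr1 (fun z : circle R => complex.Re (circle_val z))) /= ct.
(* The half-angle formula turns a cosine equal to 1 into a zero of the sine at [t / 2], and [t / 2]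
   lies strictly between [- pi] and [pi]. *)
have s0 : sin (t / 2) = 0.
  apply/eqP; rewrite -sqrf_eq0 sin2cos2.
  have := cos_mulr2n (t / 2); rewrite -[t / 2 *+ 2]mulr_natr divfK // ct => E1.
  by apply/eqP; move: E1; rewrite mulr2n; lra.
move: tp; rewrite ltr_norml => /andP[t1 t2].
have [t0|t0|//] := ltgtP t 0.
- have : 0 < sin (- (t / 2)) by apply: sin_gt0_pi; apply/andP; split; lra.
  by rewrite sinN s0 oppr0 ltxx.
- have : 0 < sin (t / 2) by apply: sin_gt0_pi; apply/andP; split; lra.
  by rewrite s0 ltxx.
Qed.

Lemma expi_surj (z : circle R) : exists t, z = expi t.
Proof.
case: z => -[a b] zn; have ab : a ^+ 2 + b ^+ 2 = 1.
  move: zn; rewrite normc_def /= => /eqP/(congr1 (@complex.Re R)) /= E1.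
  have := sqr_sqrtr (addr_ge0 (sqr_ge0 a) (sqr_ge0 b)); rewrite E1 => <-.
  by rewrite expr1n.
have a1 : -1 <= a <= 1.
  rewrite -ler_norml -(ler_pXn2r (n := 2)) ?nnegrE // expr1n real_normK ?num_real //.
  by have := sqr_ge0 b; lra.
have ca : cos (acos a) = a by apply: acosK; rewrite in_itv.
have sa : sin (acos a) = `|b|.
  by rewrite sin_acos // (_ : 1 - a ^+ 2 = b ^+ 2) ?sqrtr_sqr //; lra.
have [b0|b0] := lerP 0 b.
- exists (acos a); apply: val_inj; rewrite /= ca sa ger0_norm //.
- exists (- acos a); apply: val_inj; rewrite /= cosN sinN ca sa ltr0_norm // opprK //.
Qed.

Lemma circle_chart_inj (t : R) : {in chart_cod (circle_chart t) &, injective (chart_par (circle_chart t))}.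
Proof.
move=> u v; rewrite !inE /= => /andP[u1 u2] /andP[v1 v2] E1.
apply/eqP; rewrite -subr_eq0; apply/eqP; apply: expi_eq1.
  by rewrite ltr_norml; apply/andP; split; lra.
have -> : u - v = (t + u) + - (t + v) by ring.
rewrite expiD E1 -expiD subrr; exact: expi0.
Qed.

Lemma circle_atlas_inj : atlas_inj (@circle_atlas R).
Proof. by move=> _ [t _ <-]; exact: circle_chart_inj. Qed.

Lemma smat_expi (t : R^o) : smat (@circle_atlas R) (expi : R^o -> circle R) t.
Proof.
split.
  exists (circle_chart t); split; first by exists t.
  by exists (0 : R^o); rewrite /= ?addr0 // oppr_lt0 pi_gt0.
move=> _ [t1 _ <-] [u /= /andP[u1 u2] ut].
pose h (t' : R^o) : R^o := u + (t' - t).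
have Ch : Cinfty setT h.
  rewrite (_ : h = fun t' => t' + (u - t)); last by apply/funext => t'; rewrite /h; ring.
  by have := @smf_affine R 1 (u - t); under eq_fun do rewrite mul1r.
pose W := setT `&` h @^-1` [set v : R^o | - pi < v < pi].
have oI : open [set v : R^o | - pi < v < pi].
  rewrite (_ : [set v : R^o | - pi < v < pi] = ball (0 : R^o) pi); first exact: ball_open.
  by apply/funext => v; apply/propext; rewrite /ball /= sub0r normrN ltr_norml.
have oW : open W by apply: preim_open => //; exact: openT.
have E1 t' : expi (t1 + h t') = expi t'.
  have -> : t1 + h t' = (t1 + u) + (t' - t) by rewrite /h; ring.
  by rewrite expiD ut -expiD; congr expi; ring.
exists W; split=> //.
- by split=> //; rewrite /preimage /h /= subrr addr0 u1 u2.
- by move=> v [_ hv]; exists (h v) => //=; exact: E1.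
- apply: (@Cinfty_ext _ _ _ _ h) => //; last by apply: Cinfty_sub Ch.
  move=> v [_ hv]; apply/esym; apply: chart_map_eq => //; first exact: circle_chart_inj.
  exact: E1.
Qed.

(** [th] itself may be discontinuous, but its cosine and its sine have derivative 0. *)
Lemma expi_const (th : R -> R) : (forall r : R, exists v : R -> R,
    [/\ v r = 0, is_derive r (1 : R) v 0 & \forall h \near r, expi (th h) = expi (th r + v h)]) ->
  forall r t, expi (th r) = expi (th t).
Proof.
move=> H1 r t.
have key (f : R -> R) (f' : R -> R) : (forall x, is_derive x (1 : R) f (f' x)) ->
    (forall x y, expi x = expi y -> f x = f y) -> f (th r) = f (th t).
  move=> df fE; apply: (@is_derive_0_is_cst R (f \o th) r t) => x.
  have [v [v0 dv nv]] := H1 x.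
  have dv' : is_derive x (1 : R) (fun h => th x + v h) 0.
      by have := is_deriveD (is_derive_cst (th x) x (1 : R)) dv; rewrite addr0.
  have df' : is_derive (th x + v x) (1 : R) f (f' (th x + v x)) by exact: df.
  have dc : is_derive x (1 : R) (f \o (fun h => th x + v h)) 0.
    by have := @is_derive1_comp R f (fun h => th x + v h) x _ _ df' dv'; rewrite mulr0.
  apply: (near_eq_is_derive _ dc).
  by apply: filterS nv => h /fE /= ->.
apply: val_inj; rewrite /=.
congr (_ +i* _)%C.
- apply: (key cos (fun x => - sin x)) => x y.
  by move/(congr1 (fun z : circle R => complex.Re (circle_val z))).
- apply: (key sin cos) => x y.
  by move/(congr1 (fun z : circle R => complex.Im (circle_val z))).
Qed.

End CircleGroup.

Section FusionExtension.
Context {R : realType} {n : nat} {G : groupType}.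
Variable A : atlas 'rV[R]_n G.
Hypothesis lA : lie_group A.
Variables (E : tvsType R) (OGt : groupType) (At : atlas E OGt).
Variables (iota : circle R -> OGt) (p : OGt -> (R -> G)).
Hypothesis ext : central_extension (OmegaG A) (flat_atlas A Loop) At iota p.
Variable c : chart 'rV[R]_n G.
Hypotheses (Ac : A c) (c1 : chart_dom c 1%g).
Local Notation V := (flat_vect R Path n).
Let LP := local_lie_P lA Ac c1.
Let lAt := ext_lie_group ext.
Let mAt := lie_manifold lAt.

Definition fiber_exp (t : R) : OGt := iota (expi t).
(** The pull-back of the extension along [a |-> cup a a] is not formed as a group; only the relation
    between its elements and the paths is kept. *)
Definition fiber_over (y : OGt) (a : R -> G) : Prop := p y = cup a a.

Lemma cup_mul (a b : R -> G) : cup (a * b)%g (a * b)%g = (cup a a * cup b b)%g.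
Proof. by apply/funext => t; rewrite /cup [RHS]/(_ * _)%g /=; case: ifP. Qed.

Lemma cup1 : cup (1%g : R -> G) 1%g = 1%g.
Proof. by apply/funext => t; rewrite /cup; case: ifP. Qed.

Lemma projM y z : p (y * z)%g = (p y * p z)%g.
Proof. by have [_ H] := ext_proj_hom ext; exact: H. Qed.

Lemma proj1 : p 1%g = 1%g.
Proof. by apply: (mulgI (p 1%g)); rewrite mulg1 -projM mulg1. Qed.

Lemma projV y : p y^-1%g = (p y)^-1%g.
Proof. by apply: (mulgI (p y)); rewrite mulgV -projM mulgV proj1. Qed.

Lemma iotaM z w : iota (z * w)%g = (iota z * iota w)%g.
Proof. by have [_ H] := ext_iota_hom ext; exact: H. Qed.

Lemma iota1 : iota 1%g = 1%g.
Proof. by apply: (mulgI (iota 1%g)); rewrite mulg1 -iotaM mulg1. Qed.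

Lemma psm_cup (D : tvsType R) (f : D -> R -> G) x : psm A f x ->
  smat (flat_atlas A Loop) (fun d => cup (f d) (f d)) x.
Proof. by case=> U [oU Ux fP fs]; exact: (smat_cup_loop lA oU fP fs Ux). Qed.

(** The logarithm is the circle component of the trivialisation [Psi], read in a chart of the
    circle. Subtracting its value at [x] normalises it, and the constant factor [Phi (1, 1)]
    cancels. *)
Lemma fiber_log (D : tvsType R) (L : D -> OGt) x : smat At L x ->
  (\forall d \near x, fiber_over (L d) 1%g) -> L x = 1%g ->
  exists (u : D -> R^o) W, [/\ open W, W x, Cinfty W u, u x = 0 & forall d, W d -> L d = fiber_exp (u d)].
Proof.
move=> sL oL Lx.
have S1 : OmegaG A (1%g : R -> G).
  by rewrite -(ext_proj_surj ext) /=; exists 1%g => //; exact: proj1.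
have [U [Phi [Psi [[U1 _ _] [[_ sPsi _ PP] [pPhi Phie]]]]]] := ext_bundle ext S1.
have Ux : (p @^-1` U) (L x) by rewrite /preimage /= Lx proj1.
have [c0 [e [Ac0 [c' [_ [_ [t1 _ <-] ->]]] c0x [Wc [oWc Wcx Wcc Wce CWc]]]]] := sPsi (L x) Ux.
have [_ H] := sL; have [W [oW Wx Wc0 CW]] := H c0 Ac0 c0x.
pose d' := circle_chart t1.
pose g := chart_map (prod_chart c' d') \o Psi \o chart_par c0.
pose u (d : D) : R^o := (g (chart_map c0 (L d))).2.
pose W1 := W `&` (chart_map c0 \o L) @^-1` Wc.
have oW1 : open W1 by exact: preim_open.
have W1x : W1 x by [].
have Cu : Cinfty W1 u.
  have Cg : Cinfty W1 (fun d => g (chart_map c0 (L d))).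
    apply: (@Cinfty_comp _ _ _ _ W1 Wc (chart_map c0 \o L) g) => //; first by move=> d [].
    by apply: Cinfty_sub CW => d [].
  apply: (@Cinfty_comp _ _ _ _ W1 setT (fun d => g (chart_map c0 (L d))) snd) => //; first exact: openT.
  by apply: Cinfty_lin; exact: clin_snd.
have wE d : W1 d -> (Psi (L d)).2 = expi (t1 + u d).
  move=> [Wd Wcd].
  have -> // : Psi (L d) = chart_par (prod_chart c' d') (g (chart_map c0 (L d))).
  apply: etrans _ (esym (chart_mapP (Wce _ Wcd)).2).
  by congr Psi; exact: (esym (chart_mapP (Wc0 _ Wd)).2).
have [Q [oQ Qx] HQ] : exists2 Q : set D, open_nbhs x Q & Q `<=` (fun d => fiber_over (L d) 1%g).
  by have : nbhs x [set d | fiber_over (L d) 1%g] := oL; rewrite nbhsE.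
have LE d : W1 d -> Q d -> L d = (Phi (1%g, 1%g) * iota (expi (t1 + u d)))%g.
  move=> Wd Od; have pd : p (L d) = 1%g by rewrite (HQ _ Od) cup1.
  have Upd : U (p (L d)) by rewrite pd.
  have [UPsi PL] := PP (L d) Upd; have := wE _ Wd.
  case: (Psi (L d)) UPsi PL => a w /= Ua PL wE'.
  have a1 : a = 1%g by rewrite -(pPhi a w Ua) PL pd.
  by rewrite -PL a1 wE' -Phie // mul1g.
exists (fun d => u d - u x), (W1 `&` Q); split=> //.
- exact: openI.
- by apply: Cinfty_add; [exact: openI|by apply: Cinfty_sub Cu => d []|exact: Cinfty_cst].
- exact: subrr.
- move=> d [Wd Od]; have := LE _ W1x Qx; rewrite Lx => Ex.
  apply: (mulgI (Phi (1%g, 1%g) * iota (expi (t1 + u x)))%g); rewrite -{1}Ex mul1g (LE _ Wd Od).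
  by rewrite -mulgA /fiber_exp -iotaM -expiD; congr (_ * iota (expi _))%g; ring.
Qed.

(** The unit section of the trivialisation, pulled back along the doubling of paths to loops and
    divided by its value at the identity, so that it starts at [1]. *)
Lemma fiber_section : exists s W, section_at (ppar c) (fun D => @smat R D E OGt At) fiber_over s W.
Proof.
have S1 : OmegaG A (1%g : R -> G).
  by rewrite -(ext_proj_surj ext) /=; exists 1%g => //; exact: proj1.
have [U [Phi [Psi [[U1 _ oU] [[sPhi _ _ _] [pPhi Phie]]]]]] := ext_bundle ext S1.
have par0 : ppar c 0 = 1%g := ll_par0 LP.
have U00 : pcod c 0 := ll_zero LP.
have oU0 : open (pcod c) := ll_open LP.
pose cupz (z : V) := cup (ppar c z) (ppar c z).
have sc z : pcod c z -> smat (flat_atlas A Loop) cupz z.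
  by move=> Uz; apply: psm_cup; exact: (ll_par LP Uz).
have iB := @flat_chart_inj _ _ _ _ lA Loop.
have sPhiz z : pcod c z -> U (cupz z) -> smat At (fun z => Phi (cupz z, 1%g)) z.
  move=> Uz Ucz.
  apply: (@smat_comp R E OGt At mAt _ _ _ _ (U `*` setT) (fun z => (cupz z, 1%g)) Phi z _ sPhi) => //.
  apply: smat_pair => //; [exact: circle_atlas_inj|exact: sc|].
  split; last by move=> c' _ c'1; exists setT; split=> //; [exact: openT|exact: Cinfty_cst].
  exists (circle_chart 0); split; first by exists 0.
  by exists 0; rewrite /= ?addr0 ?expi0 // oppr_lt0 pi_gt0.
have nU : \forall z \near (0 : V), U (cupz z).
  have [[c' [Ac' c'x]] H] := sc 0 U00.
  have [W [oW W0 Wc CW]] := H c' Ac' c'x.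
  have [cx ccx] := chart_mapP c'x.
  have oU' : manifold_open (flat_atlas A Loop) U by [].
  have Uc : U (chart_par c' (chart_map c' (cupz 0))) by rewrite ccx /cupz par0 cup1.
  have nb := oU' _ _ Ac' cx Uc.
  have nU' := (Cinfty_cont CW W0) _ nb.
  near=> z; have Wz : W z by near: z; exact: (open_near oW W0).
  rewrite -(chart_mapP (Wc z Wz)).2; near: z; exact: nU'.
exists (fun z => Phi (cupz z, 1%g) * (Phi (1%g, 1%g))^-1)%g, (interior [set z | pcod c z /\ U (cupz z)]); split.
- exact: open_interior.
- near=> z; split; near: z; [exact: (open_near oU0 U00)|exact: nU].
- by rewrite /cupz par0 cup1 mulgV.
move=> z /nbhs_singleton[Uz Ucz]; split.
  by apply: (smat_mul lAt); [exact: sPhiz|exact: smat_cst].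
by rewrite /fiber_over projM projV !pPhi // invg1 mulg1.
Unshelve. all: by end_near. Qed.

Lemma local_ext_fusion : local_ext (@psm R n G A) (ppar c) (fun D => @smat R D E OGt At) fiber_exp fiber_over.
Proof.
have e1 t : fiber_exp t = 1%g -> expi t = 1%g by rewrite -iota1 => /(ext_iota_inj ext).
split.
- by move=> D f g x; exact: (smat_mul lAt).
- by move=> D f x; exact: (smat_inv lAt).
- by move=> D D' f U h y; exact: smat_precomp.
- by move=> D y x; exact: (smat_cst mAt).
- move=> t; have [si _] := ext_iota_hom ext.
  exact: (@smat_comp R E OGt At mAt _ _ _ _ setT expi iota t (smat_expi t) si I).
- by move=> y z a b ya zb; rewrite /fiber_over projM ya zb cup_mul.
- move=> y a ya; rewrite /fiber_over projV ya; apply: (mulgI (cup a a)).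
  by rewrite mulgV -cup_mul mulgV cup1.
- move=> a /(adm_PeG lA) Pa.
  have Oa : OmegaG A (cup a a).
    apply: (@cup_OmegaG R n G A lA R^o setT (fun=> a) openT (fun _ _ => Pa) _ 0 I) => d s _.
    by apply: smat_snd_curve; have [_ _] := (PeGP lA a).1 Pa; apply.
  by move: Oa; rewrite -(ext_proj_surj ext) => -[y _ ya]; exists y.
- move=> y z a ya za.
  have /(ext_exact ext)[w _ wE] : p (y^-1 * z)%g = 1%g by rewrite projM projV ya za mulVg.
  have [t wt] := expi_surj w; exists t.
  by rewrite /fiber_exp -wt wE mulgA mulgV mul1g.
- by move=> t; rewrite /fiber_over cup1; apply/(ext_exact ext); exists (expi t).
- by move=> s t; rewrite /fiber_exp expiD iotaM.
- by move=> t y; exact: (ext_central ext).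
- move=> t tp /e1; apply: expi_eq1; apply: (lt_le_trans tp).
  by have := pi_gt0 R; lra.
- move=> th H1 r t; congr iota; apply: expi_const => r'.
  have [v [v0 dv nv]] := H1 r'; exists v; split=> //.
  by apply: filterS nv => h; exact: (ext_iota_inj ext).
- exact: fiber_log.
- exact: fiber_section.
Qed.

Section Semisimple.
Hypothesis ss : semisimple A.
Local Notation X := 'rV[R]_n.
Let LG := local_lie_G lA Ac c1.
Let br : X -> X -> X := local_brk (gpar c) (glg c).
Let bbr : cbil (fun q : X * X => br q.1 q.2) := cbil_brk LG.

Lemma casimir_bracket : exists f : 'I_n -> X,
  (forall (B : X -> X -> R) x,
     (forall a y1 y2 z, B (a *: y1 + y2) z = a * B y1 z + B y2 z) ->
     (forall a y1 y2 z, B z (a *: y1 + y2) = a * B z y1 + B z y2) ->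
     \sum_i (B (br x (delta_mx 0 i)) (f i) + B (delta_mx 0 i) (br x (f i))) = 0) /\
  forall y, \sum_i br (delta_mx 0 i) (br (f i) y) = y.
Proof.
apply: casimir.
- by move=> x y z; exact: (clinD x y (cbil_clinl z bbr)).
- by move=> a x z; exact: (clinZ a x (cbil_clinl z bbr)).
- by move=> x y; exact: (brkC LG).
- by move=> x y z; exact: (brk_jacobi LG).
- move=> J H1 H2; apply: (ss Ac c1) => x y; rewrite (lie_bracketE lA Ac c1) => *; [exact: H1|exact: H2].
Qed.

Lemma vbr_brk Y Z : vbr bbr Y Z = local_brk (ppar c) (plg c) Y Z.
Proof. by apply: flat_ext => t; rewrite vbrE (brk_pointwise lA Ac c1). Qed.

Lemma path_brackets_dense (L : V -> R^o) : clin L -> (forall Y Z, L (local_brk (ppar c) (plg c) Y Z) = 0) ->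
  forall Y, L Y = 0.
Proof.
move=> cL L0; have [f [fi fE]] := casimir_bracket.
by apply: (brackets_dense (bbr := bbr) fE cL) => Y Z; rewrite vbr_brk.
Qed.

Lemma path_second_cohomology (w : V * V -> R^o) : cbil w ->
  (forall Y Z, w (Y, Z) = - w (Z, Y)) ->
  (forall Y Z W, w (local_brk (ppar c) (plg c) Y Z, W) + w (local_brk (ppar c) (plg c) Z W, Y) +
    w (local_brk (ppar c) (plg c) W Y, Z) = 0) ->
  exists mu : V -> R^o, clin mu /\ forall Y Z, w (Y, Z) = mu (local_brk (ppar c) (plg c) Y Z).
Proof.
move=> bw wC cocycle; have [f [fi fE]] := casimir_bracket.
have [|mu [cmu muE]] := second_cohomology (bbr := bbr) (brkC LG) (brk_jacobi LG) fi fE bw wC.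
  by move=> Y Z W; rewrite !vbr_brk; exact: cocycle.
by exists mu; split=> // Y Z; rewrite muE vbr_brk.
Qed.

Lemma fusion_factorization_unique i j : fusion_factorization A At p i -> fusion_factorization A At p j ->
  forall g, PeG A g -> i g = j g.
Proof.
have sm k : fusion_factorization A At p k -> smat At (fun z => k (ppar c z)) 0.
  move=> [[sk _] _ _]; have [U [oU U00 fP fs]] := ll_par LP (ll_zero LP).
  apply: (@smat_comp R E OGt At mAt _ _ _ _ (PeG A) (ppar c) k 0 _ sk); last exact: fP.
  exact: (smat_flat lA oU fP fs U00).
move=> hi hj g /(adm_PeG lA) ag.
have [[_ iM] _ iO] := hi; have [[_ jM] _ jO] := hj.
apply: (ext_hom_unique LP local_ext_fusion (contraction_path lA c) path_brackets_dense _ _ _ _ (sm i hi) (sm j hj) ag).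
- by move=> a b /(adm_PeG lA) Pa /(adm_PeG lA) Pb; exact: iM.
- by move=> a b /(adm_PeG lA) Pa /(adm_PeG lA) Pb; exact: jM.
- by move=> a /(adm_PeG lA) Pa; exact: iO.
- by move=> a /(adm_PeG lA) Pa; exact: jO.
Qed.

Lemma fusion_factorization_ex : exists i, fusion_factorization A At p i.
Proof.
have [s0 [W0 hs0]] := fiber_section.
have [s [hs hI]] := invariant_section_ex LP local_ext_fusion hs0 path_second_cohomology path_brackets_dense.
have [i [iM iO iS]] := factorization_ex LP local_ext_fusion (contraction_path lA c) hs hI.
exists i; split.
- split; last by move=> x y /(adm_PeG lA) Px /(adm_PeG lA) Py; exact: iM.
  move=> g Pg; have [f sf nf] := iS g ((adm_PeG lA g).2 Pg).
  have {sf nf}sg : smat At (fun z => i (g * ppar c z)%g) 0.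
    by apply: smat_near sf; apply: filterS nf => z ->.
  have g0 : (g * ppar c 0)%g = g by rewrite (ll_par0 LP) mulg1.
  have [d [Ad dg]] := manifold_cov mAt (i g).
  have [_ H] := sg; have [|W [oW W0' Wd CW]] := H d Ad; first by rewrite g0.
  have oU0 : open (pcod c) := ll_open LP; have U00 : pcod c 0 := ll_zero LP.
  (* The chart of [flat_atlas] centred at [g] is the chart at the identity translated by [g], so
     smoothness of [i] at [g] is smoothness of [z |-> i (g * ppar c z)] at 0. *)
  pose e := flat_chart Path g c.
  have ge z : chart_par e z = (g * ppar c z)%g by apply/funext => t; rewrite /= -[RHS]/(g t * ppar c z t)%g pparE.
  have e0 : chart_map e g = 0.
    apply: chart_map_eq => //; last by rewrite ge g0.
    by apply: (@flat_chart_inj _ _ _ _ lA Path); exists g, c.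
  exists e, d; split=> //.
  + by exists g, c.
  + by exists 0 => //; rewrite ge g0.
  rewrite /smooth_in_charts e0; exists (pcod c `&` W); split=> //.
  + exact: openI.
  + by move=> z [_ Wz]; rewrite ge; exact: Wd.
  + have -> : chart_map d \o i \o chart_par e = chart_map d \o (fun z => i (g * ppar c z)%g).
      by apply/funext => z; rewrite /comp ge.
    by apply: Cinfty_sub CW => z [].
- move=> g Pg; exists g, g; split=> //; exact: (iO g ((adm_PeG lA g).2 Pg)).
- by move=> g Pg; exact: (iO g ((adm_PeG lA g).2 Pg)).
Qed.

End Semisimple.
End FusionExtension.

Theorem theorem1p4 (R : realType) (n : nat) (G : groupType)
    (A : atlas 'rV[R]_n G) (G_lie : lie_group A)
    (G_connected : connected (@setT (manifold_top A)))
    (E : tvsType R) (OGt : groupType) (At : atlas E OGt)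
    (iota : circle R -> OGt) (p : OGt -> (R -> G))
    (OGt_ext : central_extension (OmegaG A) (flat_atlas A Loop) At iota p)
    (G_semisimple : semisimple A) :
  (forall i j : (R -> G) -> OGt,
     fusion_factorization A At p i -> fusion_factorization A At p j ->
     forall g : R -> G, PeG A g -> i g = j g) /\
  (@simply_connected R (manifold_top A) ->
     exists i : (R -> G) -> OGt, fusion_factorization A At p i).
Proof.
have [c [Ac c1]] := manifold_cov (lie_manifold G_lie) 1%g.
split=> [i j|_].
  exact: (fusion_factorization_unique G_lie OGt_ext Ac c1 G_semisimple).
exact: (fusion_factorization_ex G_lie OGt_ext Ac c1 G_semisimple).
Qed.
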